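(* Suppose Assumption (A1) of the context holds. The centralized problem (finding a centralized open-loop Nash equilibrium, see context) has a centralized open-loop Nash equilibrium $(u_1^*(\cdot),\dots,u_N^*(\cdot))$ if and only if, for every $i=1,\dots,N$, $\mathcal J_i(u_i(\cdot),u_{-i}(\cdot))$ is convex in $u_i$, and the system of forward-backward stochastic differential equations ($i=1,\dots,N$, $j\neq i$) $$ \left\{\begin{aligned} dx_i^*=&\big(Ax_i^*+Bu_i^*+Ex^{*(N)}+f\big)dt+\big(Cx_i^*+Du_i^*+Fx^{*(N)}+g\big)dW_i+\big(\widetilde Cx_i^*+\widetilde Du_i^*+\widetilde Fx^{*(N)}+\widetilde g\big)dW_0,\\ dp_i^i=&-\Big(A^\top p_i^i+C^\top q_{ii}^i+\widetilde C^\top q_{i0}^i+E^\top p^{i(N)}+F^\top q^{i(N)}+\widetilde F^\top q_0^{i(N)}\\ &\qquad+\big(I_n-\tfrac{\Gamma_1}{N}\big)^\top Q\big(x_i^*-\Gamma_1x^{*(N)}-\eta_1\big)\Big)dt+\sum_{k=1}^Nq_{ik}^i\,dW_k+q_{i0}^i\,dW_0,\\ dp_j^i=&-\Big(A^\top p_j^i+C^\top q_{jj}^i+\widetilde C^\top q_{j0}^i+E^\top p^{i(N)}+F^\top q^{i(N)}+\widetilde F^\top q_0^{i(N)}\\ &\qquad-\tfrac{\Gamma_1^\top}{N}Q\big(x_i^*-\Gamma_1x^{*(N)}-\eta_1\big)\Big)dt+\sum_{k=1}^Nq_{jk}^i\,dW_k+q_{j0}^i\,dW_0,\\ x_i^*(0)=&\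 \xi_i,\qquad p_i^i(T)=\big(I_n-\tfrac{\Gamma_0}{N}\big)^\top G\big(x_i^*(T)-\Gamma_0x^{*(N)}(T)-\eta_0\big),\\ p_j^i(T)=&-\Gamma_0^\top\tfrac{G}{N}\big(x_i^*(T)-\Gamma_0x^{*(N)}(T)-\eta_0\big), \end{aligned}\right. $$ where $x^{*(N)}=\frac1N\sum_{k=1}^Nx_k^*$, $p^{i(N)}=\frac1N\sum_{k=1}^Np_k^i$, $q^{i(N)}=\frac1N\sum_{k=1}^Nq_{kk}^i$, $q_0^{i(N)}=\frac1N\sum_{k=1}^Nq_{k0}^i$, admits an adapted solution with all of $x_i^*(\cdot),p_j^i(\cdot),q_{jk}^i(\cdot),q_{j0}^i(\cdot)$ ($1\le i,j,k\le N$) in $L^2_{\mathcal F_t}(0,T;\mathbb R^n)$, satisfying the stationarity condition $$B^\top p_i^i+D^\top q_{ii}^i+\widetilde D^\top q_{i0}^i+Ru_i^*-R\eta_2=0,\qquad i=1,\dots,N.$$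
   Context: Setting. $T>0$ is fixed, $(\Omega,\mathcal F,\mathbb P)$ is a complete probability space carrying a standard $(N+1)$-dimensional Brownian motion $(W_0,W_1,\dots,W_N)$ (each $W_k$ scalar) and random initial states $\xi_1,\dots,\xi_N$ in $\mathbb R^n$. Filtrations (augmented by null sets): $\mathcal F_t=\sigma\{\xi_i,W_0(s),W_i(s):0\le s\le t,1\le i\le N\}$ and $\mathcal F_t^0=\sigma\{W_0(s):0\le s\le t\}$. $L^2_{\mathcal H_t}(0,T;\mathbb R^m)$ denotes $\mathcal H_t$-adapted $\mathbb R^m$-valued processes $h$ with $\mathbb E\int_0^T|h|^2dt<\infty$. $\mathcal S^n$ is the set of symmetric $n\times n$ matrices and $\|x\|_Q^2=\langle Qx,x\rangle$. The time argument is often suppressed. States: for $i=1,\dots,N$, $x_i$ ($\mathbb R^n$-valued) solves $$dx_i=(Ax_i+Bu_i+Ex^{(N)}+f)dt+(Cx_i+Du_i+Fx^{(N)}+g)dW_i+(\widetilde Cx_i+\widetilde Du_i+\widetilde Fx^{(N)}+\widetilde g)dW_0,\quad x_i(0)=\xi_i,$$ with $x^{(N)}=\frac1N\sum_{i=1}^Nx_i$. Cost of agent $i$ ($u_{-i}$ denotes the controls of all agents other than $i$): $$\mathcal J_i(u_i,u_{-i})=\tfrac12\mathbb E\Big[\int_0^T\big(\|x_i-\Gamma_1x^{(N)}-\eta_1\|_Q^2+\|u_i-\eta_2\|_R^2\big)dt+\|x_i(T)-\Gamma_0x^{(N)}(T)-\eta_0\|_G^2\Big].$$ Assumption (A1):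 (i) $A,C,\widetilde C,E,F,\widetilde F\in L^\infty(0,T;\mathbb R^{n\times n})$, $B,D,\widetilde D\in L^\infty(0,T;\mathbb R^{n\times k})$ are deterministic; $f,g,\widetilde g\in L^2_{\mathcal F_t^0}(0,T;\mathbb R^n)$. (ii) $Q\in L^\infty(0,T;\mathcal S^n)$, $R\in L^\infty(0,T;\mathcal S^k)$ ($R$ possibly indefinite), $\Gamma_1\in L^\infty(0,T;\mathbb R^{n\times n})$ are deterministic, $\eta_1\in L^2_{\mathcal F_t^0}(0,T;\mathbb R^n)$, $\eta_2\in L^2_{\mathcal F_t^0}(0,T;\mathbb R^k)$, $G\in\mathcal S^n$, $\Gamma_0\in\mathbb R^{n\times n}$, $\eta_0\in L^2(\Omega,\mathcal F_T^0;\mathbb R^n)$, and $Q(\cdot)\ge0$, $G\ge0$. (iii) $\xi_1,\dots,\xi_N$ are i.i.d. with finite second moment and independent of the Brownian motions. Centralized problem: the admissible controls of agent $i$ are $\mathcal U_i^c=L^2_{\mathcal F_t}(0,T;\mathbb R^k)$. A centralized open-loop Nash equilibrium is $(u_1^*,\dots,u_N^* )$ with $u_i^*\in\mathcal U_i^c$ and $\mathcal J_i(u_i^*,u_{-i}^* )=\inf_{u_i\in\mathcal U_i^c}\mathcal J_i(u_i,u_{-i}^* )$ for all $1\le i\le N$. *)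

(* Defs.v *)
From HB Require Import structures.
From mathcomp Require Import all_boot all_order all_algebra.
From mathcomp Require Import all_classical all_reals all_analysis.
Set Implicit Arguments.
Unset Strict Implicit.
Unset Printing Implicit Defensive.
Import Order.TTheory GRing.Theory Num.Theory.
Import numFieldNormedType.Exports.
Local Open Scope classical_set_scope.
Local Open Scope ring_scope.

(* This file uses MathComp-Analysis.  The library has no Brownian motion, Ito  *)
(* integral or SDE; they are defined below.  Processes are total in time, but *)
(* only their values on [0, T] matter.                                        *)

Section linear_algebra.
Context {R : realType}.

Definition dot m (u v : 'cV[R]_m) : R := (u^T *m v) 0 0.

Definition wnormsq m (Q : 'M[R]_m) (x : 'cV[R]_m) : R := dot (Q *m x) x.

Definition normsq m (x : 'cV[R]_m) : R := dot x x.

Definition symmx m (Q : 'M[R]_m) : Prop := Q^T = Q.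

Definition psdmx m (Q : 'M[R]_m) : Prop := forall v : 'cV[R]_m, 0 <= wnormsq Q v.

Definition borel_cV m : set_system 'cV[R]_m :=
  <<s [set C | exists (j : 'I_m) (B : set R),
         measurable B /\ C = [set v : 'cV[R]_m | B (v j 0)]] >>.

End linear_algebra.

Definition process (R : realType) (Omega : Type) (m : nat) : Type :=
  R -> Omega -> 'cV[R]_m.

Section probability_notions.
Context {R : realType} {d : measure_display} {Omega : measurableType d}.
Variable P : probability Omega R.

Definition sigma_rv (X : Omega -> R) : set_system Omega :=
  preimage_set_system setT X measurable.

Definition sigma_rvec m (X : Omega -> 'cV[R]_m) : set_system Omega :=
  [set A | exists2 C, borel_cV C & A = X @^-1` C].

Definition rvec_measurable (G : set_system Omega) m (X : Omega -> 'cV[R]_m) :=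
  sigma_rvec X `<=` G.

(* Mutual independence of a finite family of sigma-algebras; the product rule *)
(* for subfamilies is the case where some of the A i are the full space.      *)
Definition mutually_independent (I : finType) (G : I -> set_system Omega) :=
  forall A : I -> set Omega, (forall i, G i (A i)) ->
    P (\bigcap_(i in [set: I]) A i) = (\prod_(i : I) fine (P (A i)))%:E.

Definition independent2 (G H : set_system Omega) :=
  forall A B, G A -> H B -> P (A `&` B) = (P A * P B)%E.

Variable T : R.

Definition bm_past (I : Type) (W : I -> R -> Omega -> R) (t : R) :
    set_system Omega :=
  <<s [set A | exists (k : I) (s : R), 0 <= s <= t /\ sigma_rv (W k s) A] >>.

(* The family in the last clause consists of the past up to time s and of the *)
(* sigma-algebras of the increments W_k(t) - W_k(s), one for each k.          *)
Definition brownian_motion (I : finType) (W : I -> R -> Omega -> R) : Prop :=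
  [/\ forall k t, 0 <= t <= T -> measurable_fun setT (W k t),
      forall k, \forall w \ae P, W k 0 w = 0,
      forall k, \forall w \ae P, {within `[0, T], continuous (W k ^~ w)},
      forall k s t, 0 <= s -> s < t -> t <= T ->
        forall B : set R, measurable B ->
          P ((fun w => W k t w - W k s w) @^-1` B)
          = normal_prob 0 (Num.sqrt (t - s)) B &
      forall s t, 0 <= s -> s < t -> t <= T ->
        mutually_independent (fun o : option I =>
          if o is Some k then sigma_rv (fun w => W k t w - W k s w)
          else bm_past W s) ].

Definition time_space_measurable m (h : process R Omega m) : Prop :=
  forall j : 'I_m, measurable_fun ((`[0, T]%classic : set R) `*` [set: Omega])
    (fun z : R * Omega => h z.1 z.2 j 0).

Definition adapted (F : R -> set_system Omega) m (h : process R Omega m) : Prop :=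
  forall t, 0 <= t <= T -> rvec_measurable (F t) (h t).

Definition mean_time_normsq m (h : process R Omega m) : \bar R :=
  (\int[P]_w \int[lebesgue_measure]_(t in `[0%R, T]) (normsq (h t w))%:E)%E.

Definition L2 (F : R -> set_system Omega) m (h : process R Omega m) : Prop :=
  [/\ time_space_measurable h, adapted F h & (mean_time_normsq h < +oo)%E].

Definition L2_rv (G : set_system Omega) m (X : Omega -> 'cV[R]_m) : Prop :=
  rvec_measurable G X /\ (\int[P]_w (normsq (X w))%:E < +oo)%E.

Definition Linfty m1 m2 (M : R -> 'M[R]_(m1, m2)) : Prop :=
  (forall i j, measurable_fun `[0, T] (fun t => M t i j)) /\
  exists c : R, \forall t \ae lebesgue_measure,
    t \in `[0, T] -> forall i j, `|M t i j| <= c.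

Record simple_process (m : nat) := SimpleProcess {
  sp_size : nat;
  sp_lo : 'I_sp_size -> R;
  sp_hi : 'I_sp_size -> R;
  sp_val : 'I_sp_size -> Omega -> 'cV[R]_m }.

Definition simple_adapted (F : R -> set_system Omega) m
    (H : simple_process m) : Prop :=
  forall i : 'I_(sp_size H),
    [/\ 0 <= sp_lo i, sp_lo i <= sp_hi i, sp_hi i <= T,
        rvec_measurable (F (sp_lo i)) (sp_val i) &
        exists c : R, forall w, normsq (sp_val i w) <= c].

Definition simple_eval m (H : simple_process m) : process R Omega m :=
  fun t w => \sum_(i < sp_size H)
    (\1_(`]sp_lo i, sp_hi i]%classic : set R) t : R) *: sp_val i w.

Definition simple_integral (B : R -> Omega -> R) m (H : simple_process m) :
    process R Omega m :=
  fun t w => \sum_(i < sp_size H)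
    (B (Num.min t (sp_hi i)) w - B (Num.min t (sp_lo i)) w) *: sp_val i w.

(* For each t in [0, T], Y t is (a version of) the integral of h over [0, t]  *)
(* against the scalar Brownian motion B: the L^2 limit of the integrals of    *)
(* simple adapted processes converging to h in L^2(dt x P).                   *)
Definition is_ito_integral (F : R -> set_system Omega) (B : R -> Omega -> R)
    m (h Y : process R Omega m) : Prop :=
  [/\ L2 F h,
      forall t, 0 <= t <= T -> rvec_measurable measurable (Y t) &
      exists H : nat -> simple_process m,
        [/\ forall l, simple_adapted F (H l),
            (fun l => mean_time_normsq
               (fun t w => simple_eval (H l) t w - h t w)) @ \oo --> 0%E &
            forall t, 0 <= t <= T ->
              (fun l => \int[P]_w
                 (normsq (simple_integral B (H l) t w - Y t w))%:E)%E
                @ \oo --> 0%E]].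

(* d X = b dt + \sum_k s_k dW_k on [0, T], with X continuous. *)
Definition ito_equation (F : R -> set_system Omega)
    (I : finType) (W : I -> R -> Omega -> R)
    m (X b : process R Omega m) (s : I -> process R Omega m) : Prop :=
  [/\ L2 F b,
      \forall w \ae P, forall j : 'I_m,
        {within `[0, T], continuous (fun t => X t w j 0)} &
      exists Y : I -> process R Omega m,
        (forall k, is_ito_integral F (W k) (s k) (Y k)) /\
        forall t, 0 <= t <= T -> \forall w \ae P,
          X t w = X 0 w
            + \col_j (\int[lebesgue_measure]_(r in `[0, t]) b r w j 0)
            + \sum_(k : I) Y k t w].

End probability_notions.

(* The fields ending in w are the tilded coefficients, those of W_0; lq_Rr is *)
(* the control weight.                                                        *)
Record lq_data (R : realType) (d : measure_display) (Omega : measurableType d)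
    (n k : nat) := LQData {
  lq_A : R -> 'M[R]_n;
  lq_C : R -> 'M[R]_n;
  lq_Cw : R -> 'M[R]_n;
  lq_E : R -> 'M[R]_n;
  lq_F : R -> 'M[R]_n;
  lq_Fw : R -> 'M[R]_n;
  lq_B : R -> 'M[R]_(n, k);
  lq_D : R -> 'M[R]_(n, k);
  lq_Dw : R -> 'M[R]_(n, k);
  lq_f : R -> Omega -> 'cV[R]_n;
  lq_g : R -> Omega -> 'cV[R]_n;
  lq_gw : R -> Omega -> 'cV[R]_n;
  lq_Q : R -> 'M[R]_n;
  lq_Rr : R -> 'M[R]_k;
  lq_Gamma1 : R -> 'M[R]_n;
  lq_eta1 : R -> Omega -> 'cV[R]_n;
  lq_eta2 : R -> Omega -> 'cV[R]_k;
  lq_G : 'M[R]_n;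
  lq_Gamma0 : 'M[R]_n;
  lq_eta0 : Omega -> 'cV[R]_n }.

Section game.
Context {R : realType} {d : measure_display} {Omega : measurableType d}.
Variables (P : probability Omega R) (T : R) (N n k : nat).

(* W ord0 is the common noise W_0, W (agent i) the individual noise W_i. *)
Definition agent (i : 'I_N) : 'I_N.+1 := lift ord0 i.

Variables (W : 'I_N.+1 -> R -> Omega -> R) (xi : 'I_N -> Omega -> 'cV[R]_n).

Definition filtration (t : R) : set_system Omega :=
  <<s [set S | (exists i, sigma_rvec (xi i) S)
            \/ (exists (l : 'I_N.+1) (s : R), 0 <= s <= t /\ sigma_rv (W l s) S)
            \/ P.-negligible S] >>.

Definition filtration0 (t : R) : set_system Omega :=
  <<s [set S | (exists s : R, 0 <= s <= t /\ sigma_rv (W ord0 s) S)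
            \/ P.-negligible S] >>.

Variable L : lq_data R Omega n k.

Definition avg m (y : 'I_N -> process R Omega m) : process R Omega m :=
  fun t w => N%:R^-1 *: \sum_(j < N) y j t w.

Definition assumption_A1_i : Prop :=
  [/\ [/\ Linfty T (lq_A L), Linfty T (lq_C L) & Linfty T (lq_Cw L)],
      [/\ Linfty T (lq_E L), Linfty T (lq_F L) & Linfty T (lq_Fw L)],
      [/\ Linfty T (lq_B L), Linfty T (lq_D L) & Linfty T (lq_Dw L)] &
      [/\ L2 P T filtration0 (lq_f L), L2 P T filtration0 (lq_g L)
        & L2 P T filtration0 (lq_gw L)]].

Definition assumption_A1_ii : Prop :=
  [/\ [/\ Linfty T (lq_Q L), Linfty T (lq_Rr L) & Linfty T (lq_Gamma1 L)],
      \forall t \ae lebesgue_measure, t \in `[0, T] ->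
        [/\ symmx (lq_Q L t), psdmx (lq_Q L t) & symmx (lq_Rr L t)],
      symmx (lq_G L) /\ psdmx (lq_G L),
      L2 P T filtration0 (lq_eta1 L) /\ L2 P T filtration0 (lq_eta2 L) &
      L2_rv P (filtration0 T) (lq_eta0 L)].

Definition assumption_A1_iii : Prop :=
  [/\ forall i, L2_rv P measurable (xi i),
      mutually_independent P (fun i => sigma_rvec (xi i)),
      forall i j S, borel_cV S -> P (xi i @^-1` S) = P (xi j @^-1` S) &
      independent2 P
        <<s [set S | exists i, sigma_rvec (xi i) S] >> (bm_past W T)].

Definition assumption_A1 : Prop :=
  [/\ assumption_A1_i, assumption_A1_ii & assumption_A1_iii].

Definition admissible : set (process R Omega k) := [set u | L2 P T filtration u].

Definition state_drift (u : 'I_N -> process R Omega k) (x : 'I_N -> process R Omega n)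
    (i : 'I_N) : process R Omega n :=
  fun t w =>
    lq_A L t *m x i t w + lq_B L t *m u i t w + lq_E L t *m avg x t w
    + lq_f L t w.

Definition state_diffusion (u : 'I_N -> process R Omega k) (x : 'I_N -> process R Omega n)
    (i : 'I_N) (l : 'I_N.+1) : process R Omega n :=
  fun t w =>
    if l == ord0 then
      lq_Cw L t *m x i t w + lq_Dw L t *m u i t w + lq_Fw L t *m avg x t w
      + lq_gw L t w
    else if l == agent i then
      lq_C L t *m x i t w + lq_D L t *m u i t w + lq_F L t *m avg x t w
      + lq_g L t w
    else 0.

Definition is_state (u : 'I_N -> process R Omega k) (x : 'I_N -> process R Omega n) : Prop :=
  forall i,
    [/\ L2 P T filtration (x i),
        \forall w \ae P, x i 0 w = xi i w &
        ito_equation P T filtration W (x i)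
          (state_drift u x i) (state_diffusion u x i)].

(* The state equation determines x up to indistinguishability, which does not *)
(* affect the costs; the default value of xget is used only if there is no    *)
(* solution.                                                                  *)
Definition state_of (u : 'I_N -> process R Omega k) : 'I_N -> process R Omega n :=
  xget (fun _ _ _ => 0) (is_state u).

Definition tracking_error (x : 'I_N -> process R Omega n) (i : 'I_N) : process R Omega n :=
  fun t w => x i t w - lq_Gamma1 L t *m avg x t w - lq_eta1 L t w.

Definition terminal_error (x : 'I_N -> process R Omega n) (i : 'I_N) :
    Omega -> 'cV[R]_n :=
  fun w => x i T w - lq_Gamma0 L *m avg x T w - lq_eta0 L w.

Definition cost (i : 'I_N) (u : 'I_N -> process R Omega k) : R :=
  let x := state_of u in
  2^-1 * \int[P]_w
    ((\int[lebesgue_measure]_(t in `[0, T])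
        (wnormsq (lq_Q L t) (tracking_error x i t w)
         + wnormsq (lq_Rr L t) (u i t w - lq_eta2 L t w)))
     + wnormsq (lq_G L) (terminal_error x i w)).

(* The profile (v, u_{-i}). *)
Definition deviate (u : 'I_N -> process R Omega k) (i : 'I_N) (v : process R Omega k) :
    'I_N -> process R Omega k :=
  fun j => if j == i then v else u j.

Definition nash_equilibrium (u : 'I_N -> process R Omega k) : Prop :=
  (forall i, admissible (u i)) /\
  forall i, (cost i u)%:E
    = ereal_inf [set (cost i (deviate u i v))%:E | v in admissible].

Definition convex_cost (i : 'I_N) : Prop :=
  forall u : 'I_N -> process R Omega k, (forall j, admissible (u j)) ->
  forall v1 v2 : process R Omega k, admissible v1 -> admissible v2 ->
  forall a : R, 0 <= a <= 1 ->
    cost i (deviate u i (fun t w => a *: v1 t w + (1 - a) *: v2 t w))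
    <= a * cost i (deviate u i v1) + (1 - a) * cost i (deviate u i v2).

(* In p, the first index is the superscript i of p_j^i and the second the     *)
(* subscript j; q i j (agent l) is q_{jl}^i and q i j ord0 is q_{j0}^i.       *)
Section adjoint.
Variables (x : 'I_N -> process R Omega n) (p : 'I_N -> 'I_N -> process R Omega n)
  (q : 'I_N -> 'I_N -> 'I_N.+1 -> process R Omega n).

(* (I_n - Gamma / N)^T for j = i and - Gamma^T / N for j <> i. *)
Definition error_weight (Gamma : 'M[R]_n) (i j : 'I_N) : 'M[R]_n :=
  if j == i then (1%:M - N%:R^-1 *: Gamma)^T else - (N%:R^-1 *: Gamma^T).

Definition adjoint_drift (i j : 'I_N) : process R Omega n :=
  fun t w =>
    - ((lq_A L t)^T *m p i j t w
       + (lq_C L t)^T *m q i j (agent j) t w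
       + (lq_Cw L t)^T *m q i j ord0 t w
       + (lq_E L t)^T *m avg (p i) t w
       + (lq_F L t)^T *m avg (fun l => q i l (agent l)) t w
       + (lq_Fw L t)^T *m avg (fun l => q i l ord0) t w
       + error_weight (lq_Gamma1 L t) i j *m (lq_Q L t *m tracking_error x i t w)).

Definition is_adjoint : Prop :=
  forall i j,
    [/\ L2 P T filtration (p i j),
        forall l, L2 P T filtration (q i j l),
        ito_equation P T filtration W (p i j) (adjoint_drift i j) (q i j) &
        \forall w \ae P, p i j T w
          = error_weight (lq_Gamma0 L) i j *m (lq_G L *m terminal_error x i w)].

Definition stationary (u : 'I_N -> process R Omega k) : Prop :=
  forall i, \forall z \ae (lebesgue_measure \x P)%E, z.1 \in `[0, T] ->
    (lq_B L z.1)^T *m p i i z.1 z.2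
    + (lq_D L z.1)^T *m q i i (agent i) z.1 z.2
    + (lq_Dw L z.1)^T *m q i i ord0 z.1 z.2
    + lq_Rr L z.1 *m u i z.1 z.2 - lq_Rr L z.1 *m lq_eta2 L z.1 z.2 = 0.

End adjoint.

End game.

(* Main.v *)
(** The state is affine in the controls, so along a deviation of agent i the cost
is J(u + a v) = J(u) + a L(v) + a^2 K(v), with L linear and K quadratic in v and
K independent of u. Hence J is minimal at u iff L = 0 and K >= 0, and K >= 0 is
convexity. The product formula, applied to the adjoint and to the variation of
the state, gives L(v) = E int <stationarity expression, v> dt, so L = 0 is the
stationarity condition.

States and adjoints exist by Picard iteration in L^2 norms with an exponential
weight in time; for the backward equation this needs the martingale
representation theorem. A variable Z orthogonal to the variables known at time
0 and to all simple stochastic integrals is shown to vanish: for f of class C^{1,1}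
and V bounded and known at time a, E[Z V f(W_b)] = E[Z V u(W_a)] where
u(x) = E f(x + W_b - W_a). Indeed on each piece of a subdivision of [a, b] one
subtracts a first order term, to which Z is orthogonal; the remainders are
martingale differences whose variances are of second order in the mesh.

The product formula E[X_T Y_T] = E[X_0 Y_0] + ... only uses the Ito isometry and
Fubini's theorem, by splitting both processes into a drift and a martingale. *)
From HB Require Import structures.
From mathcomp Require Import all_boot all_order all_algebra.
From mathcomp Require Import all_classical all_reals all_analysis.
From mathcomp Require Import measurable_realfun ring lra.
Require Import Defs.
Set Implicit Arguments.
Unset Strict Implicit.
Unset Printing Implicit Defensive.
Import Order.TTheory GRing.Theory Num.Theory.
Import numFieldNormedType.Exports.
Local Open Scope classical_set_scope.
Local Open Scope ring_scope.

Local Notation meas_fun := (measurable_fun setT).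

(** Conditioning is expressed as orthogonality to the variables known at a given time, and processes
    are only jointly measurable and adapted. This shapes two steps. Simple integrands are shown to
    be dense by projecting in L^2 and proving that an adapted process orthogonal to all of them
    vanishes; for this F_t has to be generated, up to null sets, by countably many events observed
    strictly before t, so that one null set of times serves all of them. The same events, with bumps
    in place of indicators, are the test variables in the martingale representation.

    All analysis is done on scalar functions rather than on equivalence classes, an upper limit
    being the choice of a limit. Vectors and matrices return only in the translation of the game,
    which gives one linear-quadratic problem per agent, each on the joint state of all agents.
    Coefficients are bounded only almost everywhere in time, so they are first replaced by versions
    that are bounded everywhere. *)

Lemma indic_le1 {R : realType} {U : Type} (A : set U) x : `|\1_A x : R| <= 1.
Proof. by rewrite indicE; case: (_ \in _); rewrite ?normr1 ?normr0. Qed.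

(** * Square-integrable functions: inner product, norm, equality almost everywhere *)

Section square_integrable.
Context {d} {X : measurableType d} {R : realType} (mu : {measure set X -> \bar R}).
Implicit Types f g h : X -> R.

Definition integ f := mu.-integrable setT (EFin \o f).

Definition sq f := meas_fun f /\ integ (fun x => f x ^+ 2).

Lemma integ_le f g : meas_fun f -> integ g ->
 (forall x, `|f x| <= g x) -> integ f.
Proof.
move=> mf ig fg; apply: le_integrable ig => //; first exact/measurable_EFinP.
by move=> x _ /=; rewrite lee_fin (le_trans (fg x))// ler_norm.
Qed.

Lemma integ_meas f : integ f -> meas_fun f.
Proof. by move=> /measurable_int/measurable_EFinP. Qed.

Lemma integD f g : integ f -> integ g -> integ (fun x => f x + g x).
Proof. by move=> fi gi; apply: (integrableD measurableT fi gi). Qed.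

Lemma integZ a f : integ f -> integ (fun x => a * f x).
Proof. by move=> fi; apply: (integrableZl measurableT a fi). Qed.

Lemma integB f g : integ f -> integ g -> integ (fun x => f x - g x).
Proof. by move=> fi gi; apply: (integrableB measurableT fi gi). Qed.

Lemma integ0 : integ (fun=> 0).
Proof. exact: integrable0. Qed.

Lemma integ_sum (I : Type) (s : seq I) (p : pred I) (F : I -> X -> R) :
 (forall i, integ (F i)) -> integ (fun x => \sum_(i <- s | p i) F i x).
Proof.
move=> iF; elim: s => [|i s IH].
 by rewrite (_ : (fun _ => _) = fun=> 0) ?integ0//; apply/funext => x; rewrite big_nil.
rewrite (_ : (fun _ => _) = fun x => (if p i then F i x else 0) +
 \sum_(j <- s | p j) F j x).
 by apply: integD => //; case: (p i) => //; exact: integ0.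
by apply/funext => x; rewrite big_cons; case: (p i); rewrite ?add0r.
Qed.

Lemma Rint_sum (I : Type) (s : seq I) (p : pred I) (F : I -> X -> R) :
 (forall i, integ (F i)) -> \int[mu]_x (\sum_(i <- s | p i) F i x) =
 \sum_(i <- s | p i) \int[mu]_x F i x.
Proof.
move=> iF; elim: s => [|i s IH].
 under eq_Rintegral do rewrite big_nil.
 by rewrite big_nil Rintegral_cst// mul0r.
rewrite big_cons -IH; case: ifP => pi; last first.
 by apply: eq_Rintegral => x _; rewrite big_cons pi.
under eq_Rintegral do rewrite big_cons pi.
by rewrite RintegralD//; [exact: iF|exact: integ_sum].
Qed.

Lemma sq_meas f : sq f -> meas_fun f. Proof. by case. Qed.

Lemma norm_mul_le (a b : R) : `|a * b| <= a ^+ 2 + b ^+ 2.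
Proof.
rewrite normrM -(real_normK (num_real a)) -(real_normK (num_real b)).
set x := `|a|; set y := `|b|.
have := sqr_ge0 (x - y); have := sqr_ge0 x; have := sqr_ge0 y; nra.
Qed.

Lemma integ_le1M g f : meas_fun g -> (forall x, `|g x| <= 1) -> integ f ->
 integ (fun x => g x * f x).
Proof.
move=> mg g1 fi; apply: (@integ_le _ (fun x => `|f x|)).
- exact: measurable_funM (integ_meas fi).
- by rewrite /integ; have := integrable_norm fi; congr (_.-integrable _ _).
- by move=> x; rewrite normrM ler_piMl.
Qed.

Lemma sq_mul f g : sq f -> sq g -> integ (fun x => f x * g x).
Proof.
move=> [mf if_] [mg ig].
apply: (integ_le _ (integD if_ ig)); first exact: measurable_funM.
by move=> x; exact: norm_mul_le.
Qed.

Lemma sq_le f g : meas_fun f -> sq g -> (forall x, `|f x| <= `|g x|) -> sq f.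
Proof.
move=> mf [mg ig] fg; split => //.
apply: (integ_le _ ig); first exact: measurable_funX.
move=> x; rewrite normrX -[g x ^+ 2]real_normK ?num_real//.
by rewrite ler_pXn2r// nnegrE.
Qed.

Lemma sqZ a f : sq f -> sq (fun x => a * f x).
Proof.
move=> [mf fi]; split; first exact: measurable_funM.
by under [fun x => _]eq_fun do rewrite exprMn; exact: integZ.
Qed.

Lemma sqN f : sq f -> sq (- f).
Proof.
move=> /(sqZ (-1)); congr sq; apply/funext => x.
by rewrite mulN1r.
Qed.

Lemma sqD f g : sq f -> sq g -> sq (f + g).
Proof.
move=> sf sg; have [mf fi] := sf; have [mg gi] := sg.
split; first exact: measurable_funD.
apply: (integ_le _ (integZ 2 (integD fi gi))).
 by apply: measurable_funX; exact: measurable_funD.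
move=> x; rewrite ger0_norm ?sqr_ge0//=.
rewrite (_ : (f + g) x = f x + g x)//.
have := sqr_ge0 (f x - g x); nra.
Qed.

Lemma sqB f g : sq f -> sq g -> sq (f - g).
Proof. by move=> sf sg; apply: sqD => //; exact: sqN. Qed.

Lemma sq0 : sq 0.
Proof.
split; first exact: measurable_cst.
rewrite (_ : (fun _ => _) = fun=> 0) ?integ0//.
by apply/funext => x; rewrite expr0n.
Qed.

Lemma sq_sum (I : Type) (s : seq I) (p : pred I) (F : I -> X -> R) :
 (forall i, p i -> sq (F i)) -> sq (\sum_(i <- s | p i) F i).
Proof. by move=> sF; elim/big_rec: _ => [|i f pi sf]; [exact: sq0|apply: sqD => //; exact: sF]. Qed.

Lemma sq_bddM c f g : meas_fun g -> (forall x, `|g x| <= c) -> sq f ->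
 sq (fun x => g x * f x).
Proof.
move=> mg gc sf; have c0 x : `|g x| <= `|c| by rewrite (le_trans (gc x))// ler_norm.
apply: (sq_le _ (sqZ c sf)); first by apply: measurable_funM => //; exact: sq_meas.
by move=> x; rewrite !normrM ler_wpM2r.
Qed.

(** The real-valued integral is total and meaningless off the integrable functions, which is why
    linearity carries [sq] hypotheses below. *)
Definition ip f g := \int[mu]_x (f x * g x).

Definition nrm f := Num.sqrt (ip f f).

Lemma ipC f g : ip f g = ip g f.
Proof. by apply: eq_Rintegral => x _; rewrite mulrC. Qed.

Lemma ipDl f g h : sq f -> sq g -> sq h -> ip (f + g) h = ip f h + ip g h.
Proof.
move=> sf sg sh; rewrite /ip -RintegralD//; [|exact: sq_mul|exact: sq_mul].
by apply: eq_Rintegral => x _; rewrite -mulrDl.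
Qed.

Lemma ipDr f g h : sq f -> sq g -> sq h -> ip h (f + g) = ip h f + ip h g.
Proof. by move=> sf sg sh; rewrite ipC ipDl// ![ip h _]ipC. Qed.

Lemma ipZl a f g : sq f -> sq g -> ip (fun x => a * f x) g = a * ip f g.
Proof.
move=> sf sg; rewrite /ip -RintegralZl//; last exact: sq_mul.
by apply: eq_Rintegral => x _; rewrite mulrA.
Qed.

Lemma ipZr a f g : sq f -> sq g -> ip g (fun x => a * f x) = a * ip g f.
Proof. by move=> sf sg; rewrite ipC ipZl// ipC. Qed.

Lemma ipNl f g : sq f -> sq g -> ip (- f) g = - ip f g.
Proof.
move=> sf sg; rewrite -[RHS]mulN1r -ipZl//; apply: eq_Rintegral => x _.
by rewrite mulN1r.
Qed.

Lemma ipBl f g h : sq f -> sq g -> sq h -> ip (f - g) h = ip f h - ip g h.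
Proof. by move=> sf sg sh; rewrite ipDl ?ipNl//; exact: sqN. Qed.

Lemma ipBr f g h : sq f -> sq g -> sq h -> ip h (f - g) = ip h f - ip h g.
Proof. by move=> sf sg sh; rewrite ipC ipBl// ![ip h _]ipC. Qed.

Lemma ip0l f : ip 0 f = 0.
Proof. by rewrite /ip; under eq_Rintegral do rewrite mul0r; rewrite Rintegral_cst// mul0r. Qed.

Lemma ip0r f : ip f 0 = 0. Proof. by rewrite ipC ip0l. Qed.

Lemma ip_suml (I : Type) (s : seq I) (p : pred I) (F : I -> X -> R) g :
 sq g -> (forall i, p i -> sq (F i)) ->
 ip (\sum_(i <- s | p i) F i) g = \sum_(i <- s | p i) ip (F i) g.
Proof.
move=> sg sF; elim: s => [|i s IH]; first by rewrite !big_nil ip0l.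
rewrite !big_cons; case: ifP => // pi; rewrite ipDl ?IH//; first exact: sF.
exact: sq_sum.
Qed.

Lemma ip_sumr (I : Type) (s : seq I) (p : pred I) (F : I -> X -> R) g :
 sq g -> (forall i, p i -> sq (F i)) ->
 ip g (\sum_(i <- s | p i) F i) = \sum_(i <- s | p i) ip g (F i).
Proof.
by move=> sg sF; rewrite ipC ip_suml//; apply: eq_bigr => i _; rewrite ipC.
Qed.

Lemma ip_ge0 f : 0 <= ip f f.
Proof. by apply: Rintegral_ge0 => x _; rewrite -expr2 sqr_ge0. Qed.

Lemma nrm_ge0 f : 0 <= nrm f. Proof. exact: sqrtr_ge0. Qed.

Lemma sqr_nrm f : nrm f ^+ 2 = ip f f.
Proof. by rewrite sqr_sqrtr// ip_ge0. Qed.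

Lemma nrm0 : nrm 0 = 0. Proof. by rewrite /nrm ip0l sqrtr0. Qed.

Lemma ip_CS f g : sq f -> sq g -> `|ip f g| <= nrm f * nrm g.
Proof.
move=> sf sg.
have key t : 0 <= ip f f - 2 * t * ip f g + t ^+ 2 * ip g g.
 have sh := sqB sf (sqZ t sg).
 have := ip_ge0 (f - (fun x => t * g x)).
 have stg := sqZ t sg.
 rewrite ipBl// !ipBr// !ipZl// !ipZr// (ipC g f).
 by congr (0 <= _); ring.
rewrite -[leLHS]ger0_norm// -[leRHS]ger0_norm ?mulr_ge0 ?nrm_ge0//.
rewrite -ler_sqr ?nnegrE ?normr_ge0// !real_normK ?num_real//.
rewrite exprMn !sqr_nrm.
have := ip_ge0 f; have := ip_ge0 g.
have [g0|g0 gp fp] := eqVneq (ip g g) 0.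
 move=> _ fp; rewrite g0 mulr0.
 have [->|fg0] := eqVneq (ip f g) 0; first by rewrite expr0n.
 (* When g has norm 0 the quadratic of [key] is affine in t, and at this t it takes the value -1. *)
 have := key ((ip f f + 1) / (2 * ip f g)).
 rewrite g0 mulr0 addr0.
 rewrite (_ : 2 * _ * _ = ip f f + 1); last by field.
 by rewrite opprD addNKr ler0N1.
have := key (ip f g / ip g g).
have gp' : 0 < ip g g by rewrite lt_def g0.
rewrite (_ : _ + _ = (ip f f * ip g g - ip f g ^+ 2) / ip g g); last by field.
by rewrite pmulr_lge0 ?invr_gt0// subr_ge0.
Qed.

Lemma nrmZ a f : sq f -> nrm (fun x => a * f x) = `|a| * nrm f.
Proof.
move=> sf; rewrite /nrm ipZl//; last exact: sqZ.
by rewrite ipZr// mulrA sqrtrM -?expr2 ?sqr_ge0// sqrtr_sqr.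
Qed.

Lemma nrmN f : nrm (- f) = nrm f.
Proof. by congr Num.sqrt; apply: eq_Rintegral => x _; rewrite mulrNN. Qed.

Lemma nrmD f g : sq f -> sq g -> nrm (f + g) <= nrm f + nrm g.
Proof.
move=> sf sg; rewrite -ler_sqr ?nnegrE ?addr_ge0 ?nrm_ge0//.
have sfg := sqD sf sg.
rewrite sqr_nrm ipDl// !ipDr// (ipC g f) sqrrD !sqr_nrm.
have := ler_norm (ip f g); have := ip_CS sf sg.
set a := nrm f; set b := nrm g; set c := ip f g; nra.
Qed.

Lemma nrmBC f g : nrm (f - g) = nrm (g - f).
Proof. by rewrite -nrmN opprB. Qed.

Lemma nrm_tri g f h : sq f -> sq g -> sq h -> nrm (f - h) <= nrm (f - g) + nrm (g - h).
Proof. by move=> sf sg sh; rewrite -(subrKA g) nrmD//; exact: sqB. Qed.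

Lemma nrm_sum (I : Type) (s : seq I) (p : pred I) (F : I -> X -> R) :
 (forall i, p i -> sq (F i)) ->
 nrm (\sum_(i <- s | p i) F i) <= \sum_(i <- s | p i) nrm (F i).
Proof.
move=> sF; elim: s => [|i s IH]; first by rewrite !big_nil nrm0.
rewrite !big_cons; case: ifP => // pi; apply: (le_trans (nrmD _ _)).
- exact: sF.
- exact: sq_sum.
- by rewrite lerD2l.
Qed.

Lemma ae_eq_refl f : {ae mu, forall x, f x = f x}.
Proof. exact: aeW. Qed.

Lemma integ_ae f g : integ f -> meas_fun g ->
 {ae mu, forall x, f x = g x} -> integ g.
Proof.
move=> /integrableP[mf fi] mg fg; apply/integrableP; split; first exact/measurable_EFinP.
rewrite (le_lt_trans _ fi)// le_eqVlt; apply/orP; left; apply/eqP.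
apply: ae_eq_integral => //; [|by apply: measurableT_comp|].
 by apply: measurableT_comp => //; exact/measurable_EFinP.
by apply: filterS fg => x /= -> _.
Qed.

Lemma Rint_ae f g : meas_fun f -> meas_fun g ->
 {ae mu, forall x, f x = g x} -> \int[mu]_x f x = \int[mu]_x g x.
Proof.
move=> mf mg fg; congr fine; apply: ae_eq_integral => //; try exact/measurable_EFinP.
by apply: filterS fg => x /= -> _.
Qed.

Lemma sq_ae f g : sq f -> meas_fun g ->
 {ae mu, forall x, f x = g x} -> sq g.
Proof.
move=> [mf fi] mg fg; split=> //; apply: (integ_ae fi); first exact: measurable_funX.
by apply: filterS fg => x ->.
Qed.

Lemma ip_ae f f' g : meas_fun f -> meas_fun f' ->
 meas_fun g ->
 {ae mu, forall x, f x = f' x} -> ip f g = ip f' g.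
Proof.
move=> mf mf' mg ff'; apply: Rint_ae; try exact: measurable_funM.
by apply: filterS ff' => x ->.
Qed.

Lemma nrm_ae f g : meas_fun f -> meas_fun g ->
 {ae mu, forall x, f x = g x} -> nrm f = nrm g.
Proof.
move=> mf mg fg; congr Num.sqrt.
by rewrite (ip_ae mf mg mf fg) ipC (ip_ae mf mg mg fg).
Qed.

Lemma ip0_ae f : sq f -> ip f f = 0 -> {ae mu, forall x, f x = 0}.
Proof.
move=> [mf fi] f0.
have : (\int[mu]_x `|((f x) ^+ 2)%:E| = 0)%E.
 under eq_integral do rewrite /= ger0_norm ?sqr_ge0//.
 rewrite -[LHS]fineK; last exact: integrable_fin_num.
 by congr EFin; rewrite -[RHS]f0; apply: eq_Rintegral => x _; rewrite expr2.
move/ae_eq_integral_abs => /(_ measurableT) [|N [mN N0 Nf]].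
 by apply/measurable_EFinP; exact: measurable_funX.
exists N; split => // x /= fx; apply: Nf => /= /(_ I)[] /eqP.
by rewrite sqrf_eq0 => /eqP.
Qed.

Lemma nrm0_ae f : sq f -> nrm f = 0 -> {ae mu, forall x, f x = 0}.
Proof. by move=> sf f0; apply: ip0_ae => //; rewrite -sqr_nrm f0 expr0n. Qed.

Lemma nrm0_ae_eq f g : sq f -> sq g -> nrm (f - g) = 0 -> {ae mu, forall x, f x = g x}.
Proof.
move=> sf sg /(nrm0_ae (sqB sf sg)); apply: filterS => x /eqP.
by rewrite subr_eq0 => /eqP.
Qed.

End square_integrable.

Lemma Rint_bound {d} {X : measurableType d} {R : realType} (P : probability X R)
 (phi : X -> R) c : integ P phi -> (forall w, `|phi w| <= c) -> `|\int[P]_w phi w| <= c.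
Proof.
move=> ip bp; apply: (le_trans (le_normr_Rintegral _ _)) => //.
rewrite -[leRHS]mulr1 -[X in _ <= _ * X](_ : fine (P setT) = 1); last by rewrite probability_setT.
rewrite -[leRHS](@Rintegral_cst _ _ _ P setT)//.
apply: le_Rintegral => //; first exact: (integrable_norm ip).
exact: finite_measure_integrable_cst.
Qed.

(** * Pointwise limits, completeness of L^2, orthogonal projection *)

Section limits.
Context {R : realType}.

(** The upper limit is a total and measurable choice of the pointwise limit. It is computed at each
    point separately, so it commutes with sections in time and preserves adaptedness. *)
Definition flim {X : Type} (f : nat -> X -> R) (x : X) : R :=
 fine (limn_esup (fun n => (f n x)%:E)).

Lemma flim_cvg {X : Type} (f : nat -> X -> R) x l :
 f ^~ x @ \oo --> l -> flim f x = l.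
Proof.
move=> fl; rewrite /flim.
have /cvg_limn_einf_sup[_ ->//] : (fun n => (f n x)%:E) @ \oo --> l%:E.
by apply: cvg_EFin; first exact: nearW.
Qed.

Lemma measurable_flim d (X : measurableType d) (f : nat -> X -> R) :
 (forall n, meas_fun (f n)) -> meas_fun (flim f).
Proof.
move=> mf; apply: (@measurableT_comp _ _ _ _ _ _ (@fine R)) => //.
by apply: measurable_fun_limn_esup => n; exact/measurable_EFinP.
Qed.

Lemma sum_half_le (a b : nat) : \sum_(a <= k < b) (2^-1 : R) ^+ k <= 2 * 2^-1 ^+ a.
Proof.
suff key c : \sum_(a <= k < a + c) (2^-1 : R) ^+ k = 2 * 2^-1 ^+ a - 2 * 2^-1 ^+ (a + c).
 have [ba|ab] := leqP b a; first by rewrite big_geq// mulr_ge0// exprn_ge0// invr_ge0.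
 by rewrite -(subnKC (ltnW ab)) key gerBl mulr_ge0// exprn_ge0// invr_ge0.
elim: c => [|c IH]; first by rewrite addn0 big_geq// subrr.
rewrite addnS big_nat_recr/= ?leq_addr// IH exprS.
by set t := _ ^+ (a + c); set u := _ ^+ a; field.
Qed.

End limits.

Section completeness.
Context {d} {X : measurableType d} {R : realType} (mu : {measure set X -> \bar R}).
Implicit Types f g h : X -> R.
Notation sq := (sq mu).
Notation nrm := (nrm mu).
Notation ip := (ip mu).

Lemma sq_fin f : meas_fun f -> (\int[mu]_x (f x ^+ 2)%:E < +oo)%E -> sq f.
Proof.
move=> mf fi; split => //; apply/integrableP; split.
 by apply/measurable_EFinP; exact: measurable_funX.
by under eq_integral do rewrite /= ger0_norm ?sqr_ge0//.
Qed.

Lemma integral_sqr f : sq f -> (\int[mu]_x (f x ^+ 2)%:E)%E = (nrm f ^+ 2)%:E.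
Proof.
move=> [mf fi]; rewrite sqr_nrm -[LHS]fineK; last exact: integrable_fin_num.
by congr EFin; apply: eq_Rintegral => x _; rewrite expr2.
Qed.

(** Fatou's lemma for the squares. Norm bounds and square integrability pass in this way to limits
    that exist only almost everywhere. *)
Lemma nrm_fatou (g : nat -> X -> R) f c : 0 <= c -> (forall n, sq (g n)) ->
 meas_fun f -> {ae mu, forall x, g ^~ x @ \oo --> f x} ->
 (forall n, nrm (g n) <= c) -> sq f /\ nrm f <= c.
Proof.
move=> c0 sg mf gf gc.
have mg n : meas_fun (fun x => (g n x ^+ 2)%:E).
 by apply/measurable_EFinP; apply: measurable_funX; exact: sq_meas.
have fc : (\int[mu]_x (f x ^+ 2)%:E <= (c ^+ 2)%:E)%E.
 rewrite (@ge0_ae_eq_integral _ _ _ mu setT _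
  (fun x => limn_einf (fun n => (g n x ^+ 2)%:E)))//; last first.
 - apply: filterS gf => x gx _; apply/esym.
  have /cvg_limn_einf_sup[-> _]// : (fun n => (g n x ^+ 2)%:E) @ \oo --> (f x ^+ 2)%:E.
  by apply: cvg_EFin; [exact: nearW|rewrite expr2; exact: cvgM].
 - move=> x _; rewrite limn_einf_lim; apply: lime_ge; first exact: is_cvg_einfs.
  by apply: nearW => n; apply: le_ereal_inf_tmp => _ [k _ <-]; rewrite lee_fin sqr_ge0.
 - by move=> x _; rewrite lee_fin sqr_ge0.
 - by apply: measurableT_comp => //; apply: measurable_fun_limn_esup => n; apply: measurableT_comp.
 - by apply/measurable_EFinP; exact: measurable_funX.
 apply: (le_trans (fatou mu measurableT mg _)); first by move=> *; rewrite lee_fin sqr_ge0.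
 rewrite limn_einf_lim; apply: lime_le; first exact: is_cvg_einfs.
 apply: nearW => n; apply: (@le_trans _ _ (\int[mu]_x (g n x ^+ 2)%:E)%E).
  by apply: ereal_inf_lbound; exists n => /=.
 by rewrite integral_sqr// lee_fin ler_pXn2r// nnegrE ?nrm_ge0.
have sf : sq f by apply: sq_fin => //; rewrite (le_lt_trans fc)// ltry.
split => //; move: fc; rewrite integral_sqr// lee_fin ler_pXn2r// nnegrE nrm_ge0//.
Qed.

(** With a summable rate and a finite measure the whole sequence converges almost everywhere,
    without passing to a subsequence. *)
Definition fast (f : nat -> X -> R) :=
 (forall n, sq (f n)) /\ (forall n, nrm (f n.+1 - f n) <= 2^-1 ^+ n).

Hypothesis mu_fin : (mu setT < +oo)%E.

Lemma fast_ae_cvg (f : nat -> X -> R) : fast f -> {ae mu, forall x, cvgn (f ^~ x)}.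
Proof.
move=> [sf ff].
pose D n x : R := `|f n.+1 x - f n x|.
have sd n : sq (f n.+1 - f n) by exact: sqB.
have mD n : meas_fun (fun x => (D n x)%:E).
 apply/measurable_EFinP; apply: measurableT_comp => //.
 by apply: measurable_funB; exact: (sq_meas (sf _)).
have DI n : (\int[mu]_x (D n x)%:E <= ((2^-1 ^+ n) * (fine (mu setT) + 1))%:E)%E.
 set a : R := 2^-1 ^+ n; have a0 : 0 < a by rewrite exprn_gt0// invr_gt0.
 have mE : meas_fun (fun x => (a + a^-1 * (f n.+1 - f n) x ^+ 2)%:E).
  apply/measurable_EFinP; apply: measurable_funD => //; apply: measurable_funM => //.
  by apply: measurable_funX; exact: (sq_meas (sd n)).
 (* The L^1 norm is bounded through the pointwise inequality |y| <= a + y^2 / a with a = 2^-n. *)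
 apply: (@le_trans _ _ (\int[mu]_x (a + a^-1 * (f n.+1 - f n) x ^+ 2)%:E)%E).
  apply: ge0_le_integral => //.
  - by move=> x _; rewrite lee_fin normr_ge0.
  - move=> x _; rewrite lee_fin /D.
   rewrite -[_ - _]/((f n.+1 - f n) x); set y := (_ - _) x.
   rewrite -(real_normK (num_real y)); set z := `|y|.
   rewrite -(ler_pM2l a0) mulrDr mulrA mulfV ?gt_eqF// mul1r.
   have := sqr_ge0 (a - z); have := sqr_ge0 a; have := sqr_ge0 z; nra.
 under eq_integral do rewrite EFinD EFinM.
 rewrite ge0_integralD//; last first.
 - apply/measurable_EFinP; apply: measurable_funM => //.
  by apply: measurable_funX; exact: (sq_meas (sd n)).
 - by move=> x _; rewrite lee_fin mulr_ge0 ?sqr_ge0// invr_ge0 ltW.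
 - by move=> x _; rewrite lee_fin ltW.
 rewrite integral_cst// ge0_integralZl//; last first.
 - by rewrite lee_fin invr_ge0 ltW.
 - by move=> x _; rewrite lee_fin sqr_ge0.
 - by apply/measurable_EFinP; apply: measurable_funX; exact: (sq_meas (sd n)).
 rewrite integral_sqr// -[X in (_ * X + _)%E]fineK ?ge0_fin_numE//.
 rewrite -!EFinM -EFinD lee_fin mulrDr mulr1 lerD2l.
 rewrite ler_pdivrMl// -expr2 ler_pXn2r// ?nnegrE ?nrm_ge0//; exact: ltW.
pose G x := (\sum_(n <oo) (D n x)%:E)%E.
have GI : (\int[mu]_x G x < +oo)%E.
 rewrite integral_nneseries//; last by move=> *; rewrite lee_fin normr_ge0.
 apply: (@le_lt_trans _ _ (\sum_(n <oo) ((2^-1 ^+ n) * (fine (mu setT) + 1))%:E)%E).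
  by apply: lee_nneseries => // n _ _; apply: integral_ge0 => x _; rewrite lee_fin normr_ge0.
 have M0 : 0 <= fine (mu setT) + 1 by rewrite addr_ge0// fine_ge0.
 apply: (@le_lt_trans _ _ (2 * (fine (mu setT) + 1))%:E); last exact: ltry.
 apply: lime_le.
  by apply: is_cvg_nneseries => n _ _; rewrite lee_fin mulr_ge0// exprn_ge0// invr_ge0.
 apply: nearW => n; rewrite sumEFin lee_fin -mulr_suml ler_wpM2r//.
 by have := @sum_half_le R 0 n; rewrite expr0 mulr1.
have GInt : mu.-integrable setT G.
 apply/integrableP; split.
  apply: (@ge0_emeasurable_sum _ _ _ setT (fun k x => (D k x)%:E) predT) => //.
  by move=> k x _ _; rewrite lee_fin normr_ge0.
 rewrite (eq_integral G)// => x _; rewrite gee0_abs//.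
 by apply: nneseries_ge0 => *; rewrite lee_fin normr_ge0.
have := integrable_ae measurableT GInt.
apply: filterS => x /(_ I) Gx.
have bnd n : \sum_(0 <= k < n) D k x <= fine (G x).
 rewrite -lee_fin fineK// -sumEFin /G.
 by apply: nneseries_lim_ge => k _ _; rewrite lee_fin normr_ge0.
have cs : cvgn (series (fun k => f k.+1 x - f k x)).
 apply: normed_cvg; apply: nondecreasing_is_cvgn.
  by apply/nondecreasing_seqP => n; rewrite /= !seriesEnat/= big_nat_recr//= lerDl.
 by exists (fine (G x)) => _ [n _ <-]; rewrite /= seriesEnat/=; exact: bnd.
have : cvgn (fun n => series (fun k => f k.+1 x - f k x) n + f 0%N x).
 by apply: is_cvgD => //; exact: is_cvg_cst.
rewrite (_ : (fun n => _) = f ^~ x)//.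
by apply/funext => n; rewrite seriesEnat/= telescope_sumr// subrK.
Qed.

Lemma fast_tail (f : nat -> X -> R) n m : fast f -> nrm (f n - f (n + m)%N) <= 2 * 2^-1 ^+ n.
Proof.
move=> [sf ff]; rewrite nrmBC.
rewrite -(@telescope_sumr _ n (n + m) f) ?leq_addr//.
apply: (le_trans (nrm_sum _ _)) => [i _|]; first exact: sqB.
by apply: le_trans (sum_half_le _ _) ; apply: ler_sum => i _.
Qed.

Lemma fast_limit (f : nat -> X -> R) (s : X -> R) : fast f -> meas_fun s ->
 {ae mu, forall x, f ^~ x @ \oo --> s x} ->
 sq s /\ forall n, nrm (f n - s) <= 2 * 2^-1 ^+ n.
Proof.
move=> Ff ms fs; have [sf _] := Ff.
have key n : sq (f n - s) /\ nrm (f n - s) <= 2 * 2^-1 ^+ n.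
 apply: (@nrm_fatou (fun m => f n - f (n + m)%N)).
 - by rewrite mulr_ge0// exprn_ge0// invr_ge0.
 - by move=> m; exact: sqB.
 - by apply: measurable_funB => //; exact: (sq_meas (sf n)).
 - apply: filterS fs => x fx; apply: cvgB; first exact: cvg_cst.
  move: fx; rewrite -(cvg_shiftn n).
  by under eq_fun do rewrite addnC.
 - by move=> m; exact: fast_tail.
split; last by move=> n; case: (key n).
have [s0 _] := key 0%N.
by have := sqB (sf 0%N) s0; rewrite subKr.
Qed.

Lemma fast_flim (f : nat -> X -> R) : fast f ->
 [/\ sq (flim f), forall n, nrm (f n - flim f) <= 2 * 2^-1 ^+ n &
   {ae mu, forall x, f ^~ x @ \oo --> flim f x}].
Proof.
move=> ff; have fl : {ae mu, forall x, f ^~ x @ \oo --> flim f x}.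
 apply: filterS (fast_ae_cvg ff) => x /cvg_ex[l fl].
 by rewrite (flim_cvg fl).
have [|sl ll] := fast_limit ff _ fl; last by split.
by apply: measurable_flim => n; have [sf _] := ff; exact: (sq_meas (sf n)).
Qed.

Lemma half_small (e : R) : 0 < e -> exists n, (2^-1 : R) ^+ n < e.
Proof.
move=> e0; have /cvgrPdist_lt/(_ _ e0)[n _ /(_ n)/=] :
 (fun n => (2^-1 : R) ^+ n) @ \oo --> 0.
 by apply: cvg_expr; rewrite ger0_norm ?invr_ge0// invf_lt1// ltr1n.
by rewrite leqnn sub0r normrN ger0_norm ?exprn_ge0 ?invr_ge0// => /(_ isT); exists n.
Qed.

(** A sequence in [S] whose squared distance to f is within 4^-n / 4 of the infimum is [fast] by the
    parallelogram law. [S] need not be closed, so the projection is the limit of this sequence and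
    not an element of [S]. *)
Lemma projection (S : (X -> R) -> Prop) f :
 S 0 -> (forall g h, S g -> S h -> S (g + h)) ->
 (forall a g, S g -> S (fun x => a * g x)) ->
 (forall g, S g -> sq g) -> sq f ->
 exists s, [/\ forall n, S (s n), fast s & forall v, S v -> ip (f - flim s) v = 0].
Proof.
move=> S0 SD SZ Ssq sf.
pose E : set R := [set ip (f - v) (f - v) | v in S].
have E0 : E !=set0 by exists (ip (f - 0) (f - 0)), 0.
have El : lbound E 0 by move=> _ [v _ <-]; exact: ip_ge0.
have hE : has_inf E by split => //; exists 0.
pose D := inf E.
have D0 : 0 <= D by apply: lb_le_inf.
have Dle v : S v -> D <= ip (f - v) (f - v).
 by move=> Sv; apply: ge_inf; [exists 0|exists v].
have SB g h : S g -> S h -> S (g - h).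
 move=> Sg Sh; apply: SD => //; move: (SZ (-1) _ Sh); congr S.
 by apply/funext => x; rewrite mulN1r.
have ex n : exists v, S v /\ ip (f - v) (f - v) < D + (2^-1 ^+ n) ^+ 2 / 4.
 have e0 : 0 < ((2^-1 : R) ^+ n) ^+ 2 / 4 by rewrite divr_gt0// exprn_gt0// exprn_gt0.
 have [_ [v Sv <-] ?] := inf_adherent e0 hE.
 by exists v.
have [s sP] := choice ex.
have sS n : S (s n) by case: (sP n).
have fs : fast s.
 split=> [n|n]; first exact/Ssq/sS.
 rewrite -ler_sqr ?nnegrE ?nrm_ge0 ?exprn_ge0 ?invr_ge0//.
 pose m : X -> R := fun x => 2^-1 * (s n.+1 + s n) x.
 have Sm : S m by apply: SZ; exact: SD.
 have par : nrm (s n.+1 - s n) ^+ 2 = 2 * ip (f - s n) (f - s n)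
   + 2 * ip (f - s n.+1) (f - s n.+1) - 4 * ip (f - m) (f - m).
  have s1 := Ssq _ (sS n); have s2 := Ssq _ (sS n.+1); have s3 := Ssq _ Sm.
  rewrite sqr_nrm !ipBl//; try exact: sqB.
  rewrite !ipBr// /m !ipZl//; try exact: sqD; try exact: sqZ; try (apply: sqZ; exact: sqD).
  rewrite !ipZr//; try exact: sqD.
  rewrite !ipDl//; try exact: sqD.
  rewrite !ipDr// (ipC mu f (s n)) (ipC mu f (s n.+1)) (ipC mu (s n) (s n.+1)).
  by field.
 rewrite par.
 have := Dle _ Sm; have [_] := sP n; have [_] := sP n.+1.
 rewrite (exprS _ n); set t := _ ^+ n; have := sqr_ge0 t; rewrite exprMn; nra.
exists s; split => // v Sv.
have [sl ll _] := fast_flim fs.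
set g := f - flim s.
have sg : sq g by exact: sqB.
have gD : nrm g <= Num.sqrt D.
 apply/ler_addgt0Pr => e e0.
 have [n ne] := @half_small (e / 4) ltac:(by rewrite divr_gt0).
 rewrite (le_trans (nrm_tri sf (Ssq _ (sS n)) sl))//.
 have h1 : nrm (f - s n) <= Num.sqrt D + 2^-1 ^+ n / 2.
  rewrite -ler_sqr ?nnegrE ?nrm_ge0 ?addr_ge0 ?sqrtr_ge0 ?divr_ge0 ?exprn_ge0 ?invr_ge0//.
  rewrite sqr_nrm; have [_ /ltW] := sP n; move/le_trans; apply.
  rewrite sqrrD sqr_sqrtr//.
  have : 0 <= Num.sqrt D * ((2^-1 : R) ^+ n / 2).
   by rewrite mulr_ge0 ?sqrtr_ge0 ?divr_ge0 ?exprn_ge0 ?invr_ge0.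
  set a := Num.sqrt D * _; rewrite expr_div_n; set b := (_ ^+ n) ^+ 2; lra.
 have := ll n; lra.
(* [flim s] may lie outside [S]. The comparison is made with s_n + t v, which lies in [S], up to an
   error that tends to 0. *)
have gt t : nrm g <= nrm (g - (fun x => t * v x)).
 have sv := SZ t _ Sv; set tv := fun x => t * v x.
 rewrite (le_trans gD)//; apply/ler_addgt0Pr => e e0.
 have [n ne] := @half_small (e / 4) ltac:(by rewrite divr_gt0).
 have h1 : Num.sqrt D <= nrm (f - (s n + tv)).
  by rewrite -[leRHS]sqrtr_sqr in RHS || idtac; rewrite ler_wsqrtr// Dle//; exact: SD.
 rewrite (le_trans h1)//.
 have -> : f - (s n + tv) = (g - tv) + (flim s - s n).
  by rewrite /g opprD !addrA; apply/funext => x; rewrite /tv !fctE/=; ring.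
 apply: (le_trans (nrmD _ _)); first by apply: sqB => //; exact: Ssq.
  by apply: sqB => //; exact/Ssq.
 rewrite lerD2l nrmBC; have := ll n; lra.
clear gD; clearbody g.
apply/eqP; rewrite -normr_eq0; apply/eqP.
have sv := Ssq _ Sv.
(* A quadratic in t without constant term that is nowhere negative has no linear term. The case
   where v has norm 0 is treated apart. *)
have key t : 0 <= t ^+ 2 * ip v v - 2 * t * ip g v.
 have := gt t; rewrite -ler_sqr ?nnegrE ?nrm_ge0// !sqr_nrm.
 rewrite ipBl ?ipBr ?ipZl ?ipZr//; try exact: sqZ; try (by apply: sqB => //; exact: sqZ).
 rewrite (ipC mu v g); set a := ip g g; set b := ip g v; set c := ip v v; lra.
have := ip_ge0 mu v; rewrite le_eqVlt => /predU1P[v0|v0].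
 have := key (ip g v); rewrite -v0 mulr0 sub0r -mulrA -expr2 => k.
 have : ip g v ^+ 2 <= 0 by lra.
 by rewrite -[ip g v ^+ 2]real_normK ?num_real// => k2; apply/eqP;
   rewrite -sqrf_eq0 eq_le k2 sqr_ge0.
have := key (ip g v / ip v v).
rewrite (_ : _ - _ = - (ip g v ^+ 2 / ip v v)); last by field; rewrite gt_eqF.
rewrite oppr_ge0 pmulr_lle0 ?invr_gt0// => k.
by apply/eqP; rewrite normr_eq0 -sqrf_eq0 eq_le k sqr_ge0.
Qed.

End completeness.

(** * Measurability for sub-sigma-algebras, and vanishing of orthogonal variables *)

Section sub_sigma_algebra.
Context {R : realType} {Omega : pointedType}.
Implicit Types (G : set_system Omega) (X Y : Omega -> R).

(** Passing through [g_sigma_algebraType] makes the general measurability lemmas available for every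
    member of a filtration on the same space. *)
Definition mF G X := @measurable_fun _ _ (g_sigma_algebraType G) R setT X.

Lemma mFP G X : sigma_algebra setT G ->
 mF G X <-> (forall B, measurable B -> G (X @^-1` B)).
Proof.
move=> sG; split => [mX B mB|GX _ B mB].
 have := mX measurableT B mB; rewrite setTI.
 by rewrite /measurable/= (sigma_algebra_id sG).
by rewrite setTI; apply: sub_sigma_algebra; exact: GX.
Qed.

Lemma mF_sub G G' X : sigma_algebra setT G' -> G `<=` G' -> mF G X -> mF G' X.
Proof.
move=> sG' GG' mX _ B mB; have := mX measurableT B mB.
exact: sub_sigma_algebra2.
Qed.

Lemma mF_cst G c : mF G (fun=> c).
Proof. exact: measurable_cst. Qed.

Lemma mFD G X Y : mF G X -> mF G Y -> mF G (fun w => X w + Y w).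
Proof. exact: measurable_funD. Qed.

Lemma mFB G X Y : mF G X -> mF G Y -> mF G (fun w => X w - Y w).
Proof. exact: measurable_funB. Qed.

Lemma mFM G X Y : mF G X -> mF G Y -> mF G (fun w => X w * Y w).
Proof. exact: measurable_funM. Qed.

Lemma mFN G X : mF G X -> mF G (fun w => - X w).
Proof. by move=> mX; apply: measurableT_comp. Qed.

Lemma mF_comp G X (f : R -> R) : meas_fun f -> mF G X -> mF G (fun w => f (X w)).
Proof. by move=> mf mX; apply: (measurableT_comp mf mX). Qed.

Lemma mF_sum G (I : Type) (s : seq I) (p : pred I) (X : I -> Omega -> R) :
 (forall i, p i -> mF G (X i)) -> mF G (fun w => \sum_(i <- s | p i) X i w).
Proof.
move=> mX; elim: s => [|i s IH].
 rewrite (_ : (fun _ => _) = fun=> 0); first exact: mF_cst.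
 by apply/funext => w; rewrite big_nil.
case pi : (p i); last first.
 by rewrite (_ : (fun _ => _) = (fun w => \sum_(j <- s | p j) X j w))//;
   apply/funext => w; rewrite big_cons pi.
rewrite (_ : (fun _ => _) = (fun w => X i w + \sum_(j <- s | p j) X j w)).
 by apply: mFD => //; exact: mX.
by apply/funext => w; rewrite big_cons pi.
Qed.

Lemma mF_flim G (X : nat -> Omega -> R) : (forall n, mF G (X n)) -> mF G (flim X).
Proof. exact: (@measurable_flim R _ (g_sigma_algebraType G)). Qed.

Lemma mF_indic G A : G A -> mF G (\1_A : Omega -> R).
Proof.
move=> GA; have mA : @measurable _ (g_sigma_algebraType G) A by exact: sub_sigma_algebra.
exact: (@measurable_indic _ (g_sigma_algebraType G) R setT A mA).
Qed.

End sub_sigma_algebra.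

Lemma P_fin {R : realType} {d : measure_display} {Omega : measurableType d}
 (P : probability Omega R) : (P setT < +oo)%E.
Proof. by rewrite probability_setT ltry. Qed.

Section measure.
Context {R : realType} {d} {Omega : measurableType d} (P : {measure set Omega -> \bar R}).
Implicit Types (G : set_system Omega) (X Y Z : Omega -> R).

Lemma sigma_measurable : sigma_algebra setT (@measurable _ Omega).
Proof. by split => [|A mA|F mF]; [exact: measurable0|exact: measurableD|exact: bigcupT_measurable]. Qed.

Lemma mF_meas G X : G `<=` measurable -> mF G X -> meas_fun X.
Proof.
move=> Gm mX _ B mB; have := mX measurableT B mB.
by apply: (@smallest_sub _ _ G); [exact: sigma_measurable|].
Qed.

Lemma mF_ae G X Y : sigma_algebra setT G -> (forall A, P.-negligible A -> G A) ->
 mF G X -> {ae P, forall w, X w = Y w} -> mF G Y.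
Proof.
move=> sG Gnull /(mFP _ sG) mX XY; apply/(mFP _ sG) => B mB.
pose N := [set w | ~ X w = Y w].
have -> : Y @^-1` B = (X @^-1` B `\` N) `|` (Y @^-1` B `&` N).
 apply/seteqP; split => w /=.
  move=> YB; have [XYw|XYw] := pselect (X w = Y w); last by right.
  by left; split; [rewrite /= XYw|apply].
 by case=> [[XB /contrapT <-]//|[]].
have [G0 GC GU] := sG.
have GT : G setT by have := GC _ G0; rewrite setD0.
have GUU A B' : G A -> G B' -> G (A `|` B').
 move=> GA GB; rewrite -bigcup2E; apply: GU => -[|[|k]]//=.
have GD A B' : G A -> G B' -> G (A `\` B').
 move=> GA GB; rewrite (_ : _ `\` _ = setT `\` ((setT `\` A) `|` B')).
  by apply: (GC); apply: GUU => //; exact: GC.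
 by rewrite !setTD setCU setCK setDE.
apply: GUU.
 by apply: GD; [exact: mX|exact: Gnull].
by apply: Gnull; apply: negligibleS XY => w [].
Qed.

Lemma mF_limit G (X : nat -> Omega -> R) Y : sigma_algebra setT G ->
 (forall A, P.-negligible A -> G A) -> (forall n, mF G (X n)) ->
 {ae P, forall w, X ^~ w @ \oo --> Y w} -> mF G Y.
Proof.
move=> sG Gnull mX XY; apply: (mF_ae sG Gnull (mF_flim mX)).
by apply: filterS XY => w; exact: flim_cvg.
Qed.

Lemma Rint_indic Z A : measurable A -> \int[P]_(w in A) Z w = \int[P]_w (\1_A w * Z w).
Proof.
move=> mA; rewrite Rintegral_mkcond; apply: eq_Rintegral => w _.
rewrite patchE indicE; case: (w \in A); by rewrite ?mul1r ?mul0r.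
Qed.

(** The sets on which Z integrates to 0 form a Dynkin class; the integral over the whole space gives
    stability under complement. *)
Lemma pi_lambda_orth (C : set_system Omega) Z : setI_closed C -> C `<=` measurable ->
 integ P Z -> \int[P]_w Z w = 0 -> (forall A, C A -> \int[P]_(w in A) Z w = 0) ->
 forall A, <<s C >> A -> \int[P]_(w in A) Z w = 0.
Proof.
move=> CI Cm iZ ZT ZC.
pose H : set_system Omega := [set A | measurable A /\ \int[P]_(w in A) Z w = 0].
have iZA A : measurable A -> P.-integrable A (EFin \o Z).
 by move=> mA; apply: integrableS iZ.
have dH : dynkin H.
 split; first by split.
 - move=> A [mA ZA]; split; first exact: measurableC.
  have := ZT; rewrite -(setUv A) Rintegral_setU//.
  + by rewrite ZA add0r.
  + exact: measurableC.
  + by rewrite setUv.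
  + by apply/disj_setPS; rewrite setICr.
 - move=> F tF HF; split; first by apply: bigcupT_measurable => n; case: (HF n).
  rewrite /Rintegral integral_bigcup//; last 2 first.
  + by move=> n; case: (HF n).
  + by apply: iZA; apply: bigcupT_measurable => n; case: (HF n).
  rewrite eseries0// => n _ _; have [mFn] := HF n.
  move=> ZF; rewrite -[LHS]fineK ?[fine _]ZF//.
  by apply: integrable_fin_num => //; exact: iZA.
have : <<s C >> `<=` H.
 apply: (lambda_system_subset CI).
 - exact/dynkin_lambda_system.
 - by move=> A CA; split; [exact: Cm|exact: ZC].
 - by [].
by move=> CH A /CH[].
Qed.

(** Z is tested on the event where it is nonnegative and on its complement, which together give a
    zero L^1 norm. *)
Lemma orth_zero G Z : sigma_algebra setT G -> G `<=` measurable -> mF G Z ->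
 integ P Z -> (forall A, G A -> \int[P]_(w in A) Z w = 0) ->
 {ae P, forall w, Z w = 0}.
Proof.
move=> sG Gm mZ iZ Z0.
have mZ' := mF_meas Gm mZ.
pose A := [set w | 0 <= Z w].
have GA : G A.
 have /(mFP _ sG) h := mZ; have := h `[0, +oo[%classic (measurable_itv _).
 by congr G; apply/seteqP; split => w /=; rewrite in_itv/= ?andbT.
have GAC : G (~` A) by case: sG => _ GC _; rewrite -setTD; exact: GC.
have mA := Gm _ GA; have mAC := Gm _ GAC.
have h1 : \int[P]_w `|Z w| = 0.
 rewrite -[setT](setUv A) Rintegral_setU//; last 2 first.
 - rewrite setUv; apply: integrable_norm iZ.
 - by apply/disj_setPS; rewrite setICr.
 rewrite (@eq_Rintegral _ _ _ _ A Z); last by move=> w /[!inE] wA; rewrite ger0_norm.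
 rewrite (@eq_Rintegral _ _ _ _ (~` A) (fun w => -1 * Z w)); last first.
  move=> w /[!inE] /negP; rewrite -ltNge => wA; rewrite ltr0_norm// mulN1r//.
 rewrite RintegralZl//; last by apply: integrableS iZ.
 by rewrite !Z0// mulr0 addr0.
have h2 : (\int[P]_w `|(EFin \o Z) w| = 0)%E.
 rewrite -[RHS]/(0%:E) -h1 /Rintegral fineK//.
 by apply: integrable_fin_num => //; apply: integrable_norm iZ.
have [|N [mN N0 Nf]] := (ae_eq_integral_abs P measurableT (f := EFin \o Z) _).1 h2.
 exact/measurable_EFinP.
by exists N; split => // w /= Zw; apply: Nf => /= /(_ I)[].
Qed.

(** The sets that agree with one of [<<s C >>] up to a null set form a sigma-algebra, so only
    generators have to be checked. This removes the null sets from the augmented filtration. *)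
Lemma gen_mod_null (C S : set_system Omega) :
 (forall A, S A -> exists2 A', <<s C >> A' & P.-negligible (A `+` A')) ->
 forall A, <<s S >> A -> exists2 A', <<s C >> A' & P.-negligible (A `+` A').
Proof.
move=> SC; have [C0 CC CU] := smallest_sigma_algebra setT C.
apply: smallest_sub => //; split.
- exists set0 => //; apply: negligibleS (negligible_set0 P) => w.
 by rewrite /setY /= => -[[]|[]].
- move=> A [A' CA' nA]; exists (setT `\` A'); first exact: CC.
 apply: negligibleS nA => w; rewrite /setY /= => -[[[_ h] h2]|[[_ h] h2]].
  by right; split => //; apply: contrapT => nA; apply: h2.
 by left; split => //; apply: contrapT => nA; apply: h2.
- move=> F FP.
 have /choice[f fP] : forall n, exists A', <<s C >> A' /\ P.-negligible (F n `+` A').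
  by move=> n; have [A' ? ?] := FP n; exists A'.
 exists (\bigcup_n f n); first by apply: CU => n; case: (fP n).
 apply: (@negligibleS _ _ _ P (\bigcup_n (F n `+` f n))).
  move=> w; rewrite /setY /= => -[[[n _ Fw] h]|[[n _ fw] h]]; exists n => //.
   by left; split => // fw; apply: h; exists n.
  by right; split => // Fw; apply: h; exists n.
 by apply: negligible_bigcup => n; case: (fP n).
Qed.

Lemma Rint_setY Z A B : measurable A -> measurable B -> integ P Z ->
 P.-negligible (A `+` B) -> \int[P]_(w in A) Z w = \int[P]_(w in B) Z w.
Proof.
move=> mA mB iZ nAB; rewrite (Rint_indic Z mA) (Rint_indic Z mB).
have mZ := integ_meas iZ.
apply: Rint_ae; try by apply: measurable_funM => //; exact: measurable_indic.
apply: negligibleS nAB => w /= h; apply: contrapT => nw; apply: h.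
rewrite !indicE; have [Aw|Aw] := pselect (A w); have [Bw|Bw] := pselect (B w).
- by rewrite !mem_set.
- by exfalso; apply: nw; left.
- by exfalso; apply: nw; right.
- by rewrite !memNset.
Qed.

End measure.

(** * Independence, and change of measure by a density *)

Section independence.
Context {R : realType} {d} {Omega : measurableType d} (P : probability Omega R).

Section pair.
Variables (X Y : Omega -> R) (mX : meas_fun X) (mY : meas_fun Y).
Hypothesis ind : forall A B : set R, measurable A -> measurable B ->
 P (X @^-1` A `&` Y @^-1` B) = (P (X @^-1` A) * P (Y @^-1` B))%E.
Hypotheses (iX : integ P X) (iY : integ P Y).

(** Independence identifies the law of (X, Y) with the product of the two laws, by uniqueness on
    rectangles; Fubini's theorem for the function x y then gives both claims. *)
Lemma indep_mul : integ P (fun w => X w * Y w) /\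
 \int[P]_w (X w * Y w) = (\int[P]_w X w) * (\int[P]_w Y w).
Proof.
pose mXf : {mfun Omega >-> R} := mfun_Sub (mem_set mX).
pose mYf : {mfun Omega >-> R} := mfun_Sub (mem_set mY).
pose PX := distribution P mXf; pose PY := distribution P mYf.
pose XY w := (X w, Y w).
have mXY : meas_fun XY by exact: measurable_fun_pair.
pose m' := pushforward P XY.
have mE : forall Z, measurable Z -> (PX \x PY)%E Z = m' Z.
 by apply: product_measure_unique => A B mA mB; exact: ind.
pose f (z : R * R) := z.1 * z.2.
have mf : meas_fun f by apply: measurable_funM.
have EX : (\int[PX]_x (`|x|)%:E = \int[P]_w (`|X w|)%:E)%E.
 rewrite ge0_integral_pushforward//=.
 by apply/measurable_EFinP; exact: normr_measurable.
have EY : (\int[PY]_x (`|x|)%:E = \int[P]_w (`|Y w|)%:E)%E.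
 rewrite ge0_integral_pushforward//=.
 by apply/measurable_EFinP; exact: normr_measurable.
have FX : (\int[P]_w (`|X w|)%:E < +oo)%E by case/integrableP: iX.
have FY : (\int[P]_w (`|Y w|)%:E < +oo)%E by case/integrableP: iY.
have if_ : (PX \x PY)%E.-integrable setT (EFin \o f).
 apply/(integrable12ltyP PX PY); first exact/measurable_EFinP.
 rewrite (_ : (fun _ => _) = fun x => (`|x|%:E * \int[PY]_y `|y|%:E)%E); last first.
  apply/funext => x; rewrite -ge0_integralZl//; last first.
   by apply/measurable_EFinP; exact: normr_measurable.
  by apply: eq_integral => y _; rewrite /= normrM EFinM.
 rewrite ge0_integralZr//; last 2 first.
 - by apply/measurable_EFinP; exact: normr_measurable.
 - exact: integral_ge0.
 rewrite EX EY.
 rewrite -[X in (X * _)%E]fineK ?ge0_fin_numE//; last exact: integral_ge0.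
 rewrite -[X in (_ * X)%E]fineK ?ge0_fin_numE//; last exact: integral_ge0.
 by rewrite -EFinM ltry.
have iXY : integ P (fun w => X w * Y w).
 apply/integrableP; split.
  by apply/measurable_EFinP; exact: measurable_funM.
 case/integrableP: if_ => _; apply: le_lt_trans.
 have -> : (\int[PX \x PY]_z `|(EFin \o f) z| = \int[m']_z `|(EFin \o f) z|)%E.
  by apply: eq_measure_integral => A mA _; exact: mE.
 rewrite ge0_integral_pushforward//=.
 by do 2 apply: measurableT_comp => //.
split => //; apply: EFin_inj.
have fX : (\int[P]_w (X w)%:E = (\int[P]_w X w)%:E)%E.
 by rewrite /Rintegral fineK//; exact: integrable_fin_num.
have fY : (\int[P]_w (Y w)%:E = (\int[P]_w Y w)%:E)%E.
 by rewrite /Rintegral fineK//; exact: integrable_fin_num.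
transitivity (\int[PX \x PY]_z (f z)%:E)%E.
 have -> : (\int[PX \x PY]_z (f z)%:E = \int[m']_z (f z)%:E)%E.
  by apply: eq_measure_integral => A mA _; exact: mE.
 rewrite integral_pushforward//; last exact/measurable_EFinP.
 by rewrite /Rintegral fineK//; exact: integrable_fin_num.
rewrite -integral12_prod_meas1//.
transitivity (\int[PX]_x (x%:E * (\int[P]_w Y w)%:E))%E.
 apply: eq_integral => x _; rewrite -fY.
 have -> : (\int[P]_w (Y w)%:E = \int[PY]_y y%:E)%E.
  by rewrite integral_pushforward//; exact/measurable_EFinP.
 rewrite -integralZl//.
 by apply: integrable_pushforward => //; exact/measurable_EFinP.
rewrite integralZr//; last first.
 by apply: integrable_pushforward => //; exact/measurable_EFinP.
rewrite EFinM -fX; congr (_ * _)%E.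
by rewrite integral_pushforward//; exact/measurable_EFinP.
Qed.

End pair.

End independence.

Section density.
Context {d} {X : measurableType d} {R : realType} (m m' : {measure set X -> \bar R}) (p : X -> R)
 (mp : meas_fun p) (p0 : forall x, 0 <= p x).
Hypothesis m'E : forall A, measurable A -> m' A = (\int[m]_(x in A) (p x)%:E)%E.

Import HBNNSimple.

Let integral_density_nnsfun (f : {nnsfun X >-> R}) :
 (\int[m']_x (f x)%:E = \int[m]_x ((f x)%:E * (p x)%:E))%E.
Proof.
under [LHS]eq_integral do rewrite fimfunE -fsumEFin//.
rewrite [LHS]ge0_integral_fsum//; last 2 first.
 - by move=> r; exact/measurable_EFinP/measurableT_comp.
 - by move=> n x _; rewrite EFinM nnfun_muleindic_ge0.
under [RHS]eq_integral.
 move=> x xD; rewrite fimfunE -fsumEFin// ge0_mule_fsuml; last first.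
  by move=> r; rewrite EFinM nnfun_muleindic_ge0.
 over.
rewrite [RHS]ge0_integral_fsum//; last 2 first.
 - move=> r; apply: emeasurable_funM; last exact/measurable_EFinP.
  by apply/measurable_EFinP; do 2 apply/measurableT_comp => //.
 - move=> n x _; apply: mule_ge0; last by rewrite lee_fin.
  by rewrite EFinM nnfun_muleindic_ge0.
apply: eq_fsbigr => r _.
have mr : measurable (f @^-1` [set r]) by [].
have e1 : (\int[m]_x ((\1_(f @^-1` [set r]) x)%:E * (p x)%:E) = m' (f @^-1` [set r]))%E.
 rewrite m'E// [RHS]integral_mkcond; apply: eq_integral => x _.
 by rewrite patchE indicE; case: ifP => _; rewrite ?mul1e ?mul0e.
have [r0|r0] := leP 0 r; last first.
 by rewrite preimage_nnfun0// !integral0_eq// => x _; rewrite indicE in_set0 mulr0 ?mul0e.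
transitivity (r%:E * m' (f @^-1` [set r]))%E.
 rewrite integralZl_indic_nnsfun//= integral_indic//= setIT//.
rewrite -e1 -ge0_integralZl//; last 2 first.
 - apply: emeasurable_funM; last exact/measurable_EFinP.
  by apply/measurable_EFinP; exact: measurable_indic.
 - by move=> x _; rewrite mule_ge0// lee_fin.
by apply: eq_integral => x _; rewrite EFinM muleA.
Qed.

(** Monotone limits of the identity for simple functions. It serves for the normal law and for
    Lebesgue measure on [0, T], whose density is an indicator. *)
Lemma ge0_integral_density (f : X -> \bar R) : meas_fun f ->
 (forall x, 0 <= f x)%E -> (\int[m']_x f x = \int[m]_x (f x * (p x)%:E))%E.
Proof.
move=> mf f0; pose f_ := nnsfun_approx measurableT mf.
transitivity (lim (\int[m']_x (f_ n x)%:E @[n --> \oo])%E).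
 rewrite -monotone_convergence//=.
 - apply: eq_integral => ? /[!inE] xD; apply/esym/cvg_lim => //=.
  exact: cvg_nnsfun_approx.
 - by move=> n; exact/measurable_EFinP/measurable_funTS.
 - by move=> n ? _; rewrite lee_fin.
 - by move=> ? _ ? ? mn; rewrite lee_fin; exact/lefP/nd_nnsfun_approx.
rewrite [RHS](_ : _ = lim (\int[m]_x ((f_ n x)%:E * (p x)%:E) @[n --> \oo])%E); last first.
 rewrite -monotone_convergence//=.
 - apply: eq_integral => x /[!inE] xD; apply/esym/cvg_lim => //.
  by apply: cvgeZr => //; exact: cvg_nnsfun_approx.
 - move=> n; apply: emeasurable_funM; last exact/measurable_EFinP.
  exact/measurable_EFinP/measurable_funTS.
 - by move=> n ? _; rewrite mule_ge0// lee_fin.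
 - move=> ? _ ? ? mn; rewrite lee_wpmul2r ?lee_fin//.
  exact/lefP/nd_nnsfun_approx.
by congr (lim (_ @ \oo)); apply/funext => n; exact: integral_density_nnsfun.
Qed.

End density.

(** * Moments of a centred normal variable *)

Section gaussian_moments.
Context {R : realType} {d} {Omega : measurableType d} (P : probability Omega R)
 (X : Omega -> R) (s : R) (mX : meas_fun X) (s0 : 0 < s)
 (lawX : forall B : set R, measurable B -> P (X @^-1` B) = normal_prob 0 s B).

Lemma gauss_E (f : R -> R) : meas_fun f -> (forall x, 0 <= f x) ->
 (\int[P]_w (f (X w))%:E = \int[lebesgue_measure]_x (f x * normal_pdf 0 s x)%:E)%E.
Proof.
move=> mf f0.
have mX' : meas_fun (X : Omega -> measurableTypeR R) by exact: mX.
have mf' : measurable_fun [set: measurableTypeR R] (fun x => (f x)%:E).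
 exact/measurable_EFinP.
have f0' : {in [set: measurableTypeR R], forall x, 0 <= (f x)%:E}%E.
 by move=> x _; rewrite lee_fin.
apply: etrans (esym (ge0_integral_pushforward mX' P measurableT mf' f0')) _.
under [RHS]eq_integral do rewrite EFinM.
apply: ge0_integral_density => //.
- exact: measurable_normal_pdf.
- by move=> x; rewrite normal_pdf_ge0.
Qed.

Let tilt_exponent (c r y : R) : r != 0 -> c != 0 ->
 - ((c ^+ 2 - 1) / (2 * r ^+ 2)) * y + - y / (r ^+ 2 *+ 2) = - y / ((r / c) ^+ 2 *+ 2).
Proof.
move=> r0 d0; rewrite expr_div_n -(mulr_natr (r ^+ 2)) -(mulr_natr (_ / _)).
have : r ^+ 2 != 0 by rewrite expf_neq0.
have : c ^+ 2 != 0 by rewrite expf_neq0.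
move: (r ^+ 2) (c ^+ 2) => a b b0 a0; field.
by rewrite a0 b0.
Qed.

(** The density of deviation s times this exponential is 1/c times the density of deviation s/c. The
    variance and the fourth moment are both derived from this Laplace transform of X^2. *)
Lemma gauss_tilt c : 0 < c ->
 (\int[P]_w (expR (- ((c ^+ 2 - 1) / (2 * s ^+ 2)) * X w ^+ 2))%:E = (c^-1)%:E)%E.
Proof.
move=> c0; have sc0 : 0 < s / c by rewrite divr_gt0.
rewrite (gauss_E (f := fun x => expR (- ((c ^+ 2 - 1) / (2 * s ^+ 2)) * x ^+ 2))); last 2 first.
- by apply: measurableT_comp => //; apply: measurable_funM => //; exact: measurable_funX.
- by move=> x; exact: expR_ge0.
transitivity (\int[lebesgue_measure]_x ((c^-1)%:E * (normal_pdf 0 (s / c) x)%:E))%E; last first.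
 rewrite ge0_integralZl//; last 3 first.
 - by apply/measurable_EFinP; exact: measurable_normal_pdf.
 - by move=> x _; rewrite lee_fin normal_pdf_ge0.
 - by rewrite lee_fin invr_ge0 ltW.
 by rewrite integral_normal_pdf mule1.
apply: eq_integral => x _; rewrite -EFinM; congr EFin.
rewrite !normal_pdfE ?gt_eqF// mulrCA.
have pk : normal_peak s = c^-1 * normal_peak (s / c).
 have sqE t : 0 < t -> Num.sqrt (t ^+ 2 * pi *+ 2) = t * Num.sqrt (pi *+ 2) :> R.
  by move=> t0; rewrite -mulrnAr sqrtrM ?sqr_ge0// sqrtr_sqr gtr0_norm.
 rewrite /normal_peak !sqE//.
 have : Num.sqrt (pi *+ 2) != 0 :> R by rewrite sqrtr_eq0 -ltNge pmulrn_lgt0// pi_gt0.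
 move=> pi0; by field; rewrite pi0 !gt_eqF.
rewrite [in LHS]pk -!mulrA; congr (_ * (_ * _)).
rewrite /normal_fun -expRD; congr expR.
by rewrite !subr0; apply: tilt_exponent; rewrite gt_eqF.
Qed.

Let mE a : meas_fun (fun w => expR (a * X w ^+ 2)).
Proof.
by apply: measurableT_comp => //; apply: measurable_funM => //; exact: measurable_funX.
Qed.

Let iE c : 0 < c -> integ P (fun w => expR (- ((c ^+ 2 - 1) / (2 * s ^+ 2)) * X w ^+ 2)).
Proof.
move=> c0; apply/integrableP; split; first exact/measurable_EFinP.
under eq_integral do rewrite /= ger0_norm ?expR_ge0//.
by rewrite gauss_tilt// ltry.
Qed.

Let RE c : 0 < c -> \int[P]_w expR (- ((c ^+ 2 - 1) / (2 * s ^+ 2)) * X w ^+ 2) = c^-1.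
Proof. by move=> c0; rewrite /Rintegral gauss_tilt. Qed.

(** A difference quotient at 0 of the Laplace transform of X^2; it bounds the second moment from
    below and tends to s^2 as c tends to 1. *)
Let tilt_diff c : 1 < c ->
 \int[P]_w (((c ^+ 2 - 1) / (2 * s ^+ 2))^-1 *
   (1 - expR (- ((c ^+ 2 - 1) / (2 * s ^+ 2)) * X w ^+ 2))) = 2 * s ^+ 2 / (c * (c + 1)).
Proof.
move=> c1; have c0 : 0 < c by exact: lt_trans c1.
have i1 : integ P (fun=> 1).
 exact: finite_measure_integrable_cst.
rewrite RintegralZl//; last exact: (integB i1 (iE c0)).
rewrite RintegralB//; last exact: iE.
rewrite RE// (_ : \int[P]_w 1 = 1); last by rewrite Rintegral_cst//= mul1r probability_setT.
have c1' : c ^+ 2 - 1 != 0.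
 by rewrite subr_eq0 gt_eqF// -[ltLHS](expr1n _ 2) ltr_pXn2r ?nnegrE ?ltW.
have c2 : c + 1 != 0 by rewrite gt_eqF// addr_gt0.
by field; rewrite c1' c2 !gt_eqF.
Qed.

(** Square integrability is not known yet, so the upper bound comes from Fatou's lemma along damped
    versions of X, as c decreases to 1. *)
Lemma gauss_nrm : sq P X /\ nrm P X <= s.
Proof.
pose h n : R := 2^-1 ^+ n.
have h0 n : 0 < h n by rewrite exprn_gt0// invr_gt0.
pose c n := 1 + h n.
have c1 n : 1 < c n by rewrite ltrDl.
have c0 n : 0 < c n by exact: lt_trans (c1 n).
pose a n := (c n ^+ 2 - 1) / (2 * s ^+ 2).
have a0 n : 0 < a n.
 by rewrite divr_gt0 ?mulr_gt0 ?exprn_gt0// subr_gt0 -[ltLHS](expr1n _ 2) ltr_pXn2r ?nnegrE ?ltW.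
(* Half of the exponent is used, so that the square is X^2 exp(-a X^2), which is at most (1 - exp(-a
   X^2)) / a. *)
pose g n w := X w * expR (- a n / 2 * X w ^+ 2).
have g2 n w : g n w ^+ 2 = X w ^+ 2 * expR (- a n * X w ^+ 2).
 rewrite exprMn; congr (_ * _); rewrite expr2 -expRD; congr expR; by field.
have gle n w : g n w ^+ 2 <= (a n)^-1 * (1 - expR (- a n * X w ^+ 2)).
 rewrite g2 ler_pdivlMl// mulrA; set y := a n * X w ^+ 2.
 rewrite mulNr -/y; have y0 : 0 <= y by rewrite mulr_ge0 ?sqr_ge0// ltW.
 have := expR_ge1Dx y; rewrite -(ler_pM2l (expR_gt0 (- y))) -expRD addNr expR0; lra.
have mg n : meas_fun (g n) by exact: measurable_funM.
have iR n : integ P (fun w => (a n)^-1 * (1 - expR (- a n * X w ^+ 2))).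
 apply: integZ; apply: integB; last exact: iE.
 exact: finite_measure_integrable_cst.
have sg n : sq P (g n).
 split => //; apply: (integ_le _ (iR n)); first exact: measurable_funX.
 by move=> w; rewrite ger0_norm ?sqr_ge0.
apply: (@nrm_fatou _ _ _ P g X s (ltW s0) sg mX).
- apply: aeW => w; rewrite -[X w]mulr1.
 apply: cvgM; first exact: cvg_cst.
 rewrite -[X in _ --> X](expR0).
 apply: continuous_cvg; first exact: continuous_expR.
 rewrite -[X in _ --> X](_ : - (((1 + 0) ^+ 2 - 1) / (2 * s ^+ 2)) / 2 * X w ^+ 2 = 0); last first.
  by rewrite addr0 expr1n subrr !mul0r oppr0 !mul0r.
 apply: cvgMl; apply: cvgMl; apply: cvgN; apply: cvgMl.
 apply: cvgB; last exact: cvg_cst.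
 rewrite expr2; under eq_fun do rewrite expr2.
 have hc : (fun n => 1 + h n) @ \oo --> (1 + 0 : R).
  apply: cvgD; first exact: cvg_cst.
  by apply: cvg_expr; rewrite ger0_norm ?invr_ge0// invf_lt1// ltr1n.
 exact: cvgM.
- move=> n; rewrite -ler_sqr ?nnegrE ?nrm_ge0 ?(ltW s0)// sqr_nrm.
 apply: (@le_trans _ _ (2 * s ^+ 2 / (c n * (c n + 1)))).
  rewrite -tilt_diff//; apply: le_Rintegral => //; first exact: sq_mul.
   exact: iR.
  by move=> w _; rewrite -expr2; exact: gle.
 rewrite ler_pdivrMr ?mulr_gt0 ?addr_gt0//.
 have := c1 n; have := sqr_ge0 s; set x := c n; set y := s ^+ 2 => y0 x1.
 have : 2 <= x * (x + 1) by nra.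
 nra.
Qed.

Lemma gauss_sq : sq P X.
Proof. by case: gauss_nrm. Qed.

(** The upper bound is [gauss_nrm]; the lower one follows from 1 - exp(-y) <= y in the difference
    quotient. *)
Lemma gauss_var : \int[P]_w X w ^+ 2 = s ^+ 2.
Proof.
have [_ iX] := gauss_sq.
have up c : 1 < c -> 2 * s ^+ 2 / (c * (c + 1)) <= \int[P]_w X w ^+ 2.
 move=> c1; have c0 : 0 < c by exact: lt_trans c1.
 rewrite -tilt_diff//; apply: le_Rintegral => //.
  apply: integZ; apply: integB; last exact: iE.
  exact: finite_measure_integrable_cst.
 move=> w _; set a := _ / _.
 have a0 : 0 < a.
  by rewrite divr_gt0 ?mulr_gt0 ?exprn_gt0// subr_gt0 -[ltLHS](expr1n _ 2) ltr_pXn2r ?nnegrE ?ltW.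
 rewrite ler_pdivrMl// mulNr.
 have := expR_ge1Dx (- (a * X w ^+ 2)); lra.
apply/eqP; rewrite eq_le; apply/andP; split.
 have [_ nX] := gauss_nrm.
 rewrite (_ : \int[P]_w _ = nrm P X ^+ 2); last first.
  by rewrite sqr_nrm; apply: eq_Rintegral => w _; rewrite expr2.
 by rewrite ler_pXn2r// nnegrE ?nrm_ge0// ltW.
set V := \int[P]_w _; have V0 : 0 <= V by apply: Rintegral_ge0 => w _; exact: sqr_ge0.
(* Here c = 1 + h, and c (c + 1) = 2 + 3 h + h^2 is at most 2 + 4 h when h <= 1. *)
have key h : 0 < h -> h <= 1 -> s ^+ 2 <= V + 2 * h * V.
 move=> h0 h1; have := up (1 + h) ltac:(by rewrite ltrDl).
 rewrite ler_pdivrMr; last by rewrite mulr_gt0 ?addr_gt0.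
 rewrite -/V; have := mulr_ge0 V0 (mulr_ge0 (ltW h0) (_ : 0 <= 1 - h)).
 by rewrite subr_ge0 => /(_ h1); nra.
apply/ler_addgt0Pr => e e0.
have V1 : 0 < 2 * V + 1 by rewrite ltr_wpDl// mulr_ge0.
have h0 : 0 < Num.min 1 (e / (2 * V + 1)) by rewrite lt_min ltr01 divr_gt0.
apply: (le_trans (key _ h0 _)); first by rewrite ge_min lexx.
rewrite lerD2l mulrAC; have : Num.min 1 (e / (2 * V + 1)) <= e / (2 * V + 1).
 by rewrite ge_min lexx orbT.
rewrite ler_pdivlMr// => h; apply: le_trans h; rewrite mulrC ler_pM2l//; lra.
Qed.

Lemma gauss_X4 : integ P (fun w => X w ^+ 4) /\ \int[P]_w X w ^+ 4 <= 128 * s ^+ 4.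
Proof.
(* For c < 1 the exponential grows. With c = 3/4 its exponent is 7/32 t for t = (X / s)^2, and its
   value, at least (1 + 7/64 t)^2, dominates t^2 / 96. Then 96 / c = 128. *)
have c0 : 0 < 3 / 4 :> R by rewrite divr_gt0.
have le4 w : X w ^+ 4 <= 96 * s ^+ 4 * expR (- (((3/4) ^+ 2 - 1) / (2 * s ^+ 2)) * X w ^+ 2).
 set e := - _ * _; set y := X w ^+ 2.
 have -> : X w ^+ 4 = y ^+ 2 by rewrite -exprM.
 have -> : e = 7 / 32 * (y / s ^+ 2) by rewrite /e -/y; field; rewrite gt_eqF.
 set t := y / s ^+ 2.
 have -> : y = t * s ^+ 2 by rewrite divfK// expf_neq0// gt_eqF.
 have t0 : 0 <= t by rewrite divr_ge0 ?sqr_ge0.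
 rewrite (_ : _ ^+ 2 = t ^+ 2 * s ^+ 4); last by ring.
 rewrite [leRHS]mulrAC ler_pM2r ?exprn_gt0//.
 have -> : 7 / 32 * t = 7 / 64 * t + 7 / 64 * t by field.
 rewrite expRD.
 have := expR_ge1Dx (7 / 64 * t); set x := expR _ => hx.
 have : (1 + 7 / 64 * t) * (1 + 7 / 64 * t) <= x * x by apply: ler_pM => //; lra.
 nra.
have iR := integZ (96 * s ^+ 4) (iE c0).
have i4 : integ P (fun w => X w ^+ 4).
 apply: (integ_le _ iR); first exact: measurable_funX.
 by move=> w; rewrite ger0_norm// exprn_even_ge0.
split => //; apply: (@le_trans _ _ (96 * s ^+ 4 * (3 / 4)^-1)).
 rewrite -RE// -RintegralZl//; last exact: iE.
 exact: le_Rintegral.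
have := exprn_gt0 4 s0; rewrite invf_div; lra.
Qed.

(** The density is even, so the positive and negative parts of X have the same integral. *)
Lemma gauss_mean : \int[P]_w X w = 0.
Proof.
have iX : integ P X.
 have [_ i2] := gauss_sq; have i1 : integ P (fun=> 1) by exact: finite_measure_integrable_cst.
 apply: (integ_le mX (integD i1 i2)) => w.
 by rewrite -[X w ^+ 2]real_normK ?num_real//; have := sqr_ge0 (`|X w| - 1); nra.
have mpos : meas_fun (fun x : R => Num.max x 0).
 exact: measurable_maxr.
have mneg : meas_fun (fun x : R => Num.max (- x) 0).
 by apply: measurable_maxr => //; exact: measurableT_comp.
have sym : (\int[P]_w (Num.max (X w) 0)%:E = \int[P]_w (Num.max (- X w) 0)%:E)%E.
 rewrite (gauss_E (f := fun x => Num.max x 0)) //; last by move=> x; rewrite le_max lexx orbT.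
 rewrite (gauss_E (f := fun x => Num.max (- x) 0)) //; last by move=> x; rewrite le_max lexx orbT.
 pose f (x : R) := (Num.max x 0 * normal_pdf 0 s x)%:E.
 have mN : meas_fun (-%R : measurableTypeR R -> measurableTypeR R) by [].
 have mf' : measurable_fun [set: measurableTypeR R] f.
  by apply/measurable_EFinP; apply: measurable_funM => //; exact: measurable_normal_pdf.
 have f0' : {in [set: measurableTypeR R], forall x, 0 <= f x}%E.
  by move=> x _; rewrite lee_fin mulr_ge0 ?normal_pdf_ge0// le_max lexx orbT.
 have h := ge0_integral_pushforward mN lebesgue_measure measurableT mf' f0'.
 transitivity (\int[lebesgue_measure]_x (f \o -%R) x)%E; last first.
  apply: eq_integral => x _; rewrite /f /=; congr (_ * _)%:E.
  by rewrite !normal_pdfE ?gt_eqF// /normal_fun !subr0 sqrrN.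
 rewrite -[RHS]h.
 by apply: eq_measure_integral => A mA _; rewrite -[LHS](lebesgue_measureN mA).
rewrite (@eq_Rintegral _ _ _ _ setT (fun w => Num.max (X w) 0 - Num.max (- X w) 0)); last first.
 move=> w _; have [x0|x0] := leP 0 (X w).
  by rewrite max_r ?oppr_le0// subr0.
 by rewrite max_l ?oppr_ge0 ?(ltW x0)// sub0r opprK.
rewrite RintegralB//; last 2 first.
- apply: integ_le (integrable_norm iX) _.
  exact: measurable_maxr.
 move=> w; rewrite ger0_norm ?le_max ?lexx ?orbT//.
 by rewrite ge_max ler_norm normr_ge0.
- apply: integ_le (integrable_norm iX) _.
  by apply: measurable_maxr => //; exact: measurableT_comp.
 move=> w; rewrite ger0_norm ?le_max ?lexx ?orbT//.
 by rewrite ge_max /= -normrN ler_norm normr_ge0.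
by rewrite /Rintegral sym subrr.
Qed.

End gaussian_moments.

Lemma within_seq {R : realType} (D : set R) (f : R -> R) (s : R) (r : nat -> R) :
 {within D, continuous f} -> D s -> (forall m, D (r m)) -> r @ \oo --> s ->
 (fun m => f (r m)) @ \oo --> f s.
Proof.
move=> /subspace_continuousP cf Ds Dr rs U nU.
have [m0 _ h] := rs _ (cf s Ds U nU).
by exists m0 => // m m0m; exact: (h m m0m (Dr m)).
Qed.

Section measurability.
Context {R : realType} {d} {Omega : measurableType d} (P : probability Omega R).

Lemma sigma_algebraT (G : set_system Omega) : sigma_algebra setT G -> G setT.
Proof. by move=> [G0 GC _]; have := GC _ G0; rewrite setD0. Qed.

Lemma sigma_algebraI (G : set_system Omega) A B : sigma_algebra setT G ->
 G A -> G B -> G (A `&` B).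
Proof.
move=> sG GA GB; rewrite -(sigma_algebra_id sG).
by apply: (@measurableI _ (g_sigma_algebraType G)); exact: sub_sigma_algebra.
Qed.

(** Rational thresholds suffice; this is what makes the generating events of the filtration
    countable. *)
Lemma mF_rat (G : set_system Omega) (X : Omega -> R) : sigma_algebra setT G ->
 (forall q : rat, G [set w | ratr q < X w]) -> mF G X.
Proof.
move=> sG GX; rewrite /mF; apply: (measurability _ (RGenOInfty.measurableE R)) => _ [_ [c ->] <-].
rewrite setTI; apply: sub_sigma_algebra.
rewrite (_ : _ @^-1` _ = \bigcup_n (if unpickle n is Some q then
  (if c < ratr q then [set w | ratr q < X w] else set0) else set0)).
 case: sG => G0 _ GU; apply: GU => n; case: unpickle => // q.
 by case: ifP.
apply/seteqP; split => w /=; rewrite in_itv/= andbT.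
 move=> /rat_in_itvoo[q]; rewrite in_itv/= => /andP[cq qX].
 by exists (pickle q); [by []|rewrite pickleK cq; exact: qX].
case=> n _; case: unpickle => // q; case: ifP => // cq /= qX.
exact: lt_trans qX.
Qed.

Lemma P_setY (A B : set Omega) : measurable A -> measurable B ->
 P.-negligible (A `+` B) -> P A = P B.
Proof.
have half C D : measurable C -> measurable D -> P.-negligible (C `+` D) -> (P C <= P D)%E.
 move=> mC mD [M [mM M0 CD]].
 apply: (@le_trans _ _ (P (D `|` M))).
  apply: le_measure; rewrite ?inE//; first exact: measurableU.
  move=> w Cw; have [Dw|Dw] := pselect (D w); [by left|right].
  by apply: CD; left.
 by apply: (le_trans (measureU2 _ mD mM)); rewrite (_ : _ M = 0%E) ?adde0.
move=> mA mB nAB; apply/eqP; rewrite eq_le !half//.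
by rewrite setYC.
Qed.

Lemma dynkin_indep (C : set_system Omega) (A : set Omega) : measurable A ->
 setI_closed C -> C `<=` measurable ->
 (forall D, C D -> P (A `&` D) = (P A * P D)%E) ->
 forall D, <<s C >> D -> P (A `&` D) = (P A * P D)%E.
Proof.
move=> mA CI Cm CP.
pose H : set_system Omega := [set D | measurable D /\ P (A `&` D) = (P A * P D)%E].
have fP B : measurable B -> P B \is a fin_num by move=> mB; exact: fin_num_measure.
have dH : dynkin H.
 split.
 - by split => //; rewrite setIT probability_setT mule1.
 - move=> D [mD PD]; split; first exact: measurableC.
  have mAD : measurable (A `&` D) by exact: measurableI.
  have h : P A = (P (A `&` D) + P (A `&` ~` D))%E.
   rewrite -measureU//; first by rewrite -setIUr setUv setIT.
    by apply: measurableI => //; exact: measurableC.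
   by rewrite setIACA setICr setI0.
  have h2 : (1 = P D + P (~` D))%E.
   rewrite -(probability_setT P) -(setUv D) measureU//; first exact: measurableC.
   by rewrite setICr.
  have /fP f1 := mA; have /fP f2 := mD.
  have /fP f3 : measurable (A `&` ~` D) by apply: measurableI => //; exact: measurableC.
  have /fP f4 : measurable (~` D) by exact: measurableC.
  rewrite PD in h; move: h h2.
  rewrite -(fineK f1) -(fineK f2) -(fineK f3) -(fineK f4) -!EFinM -!EFinD.
  move=> [h] [h2]; congr EFin.
  have -> : fine (P (~` D)) = 1 - fine (P D) by rewrite h2 addrC addKr.
  by rewrite mulrBr mulr1; lra.
 - move=> F tF HF.
  have mFn n : measurable (F n) by case: (HF n).
  split; first exact: bigcupT_measurable.
  rewrite setI_bigcupr !measure_bigcup//; last 2 first.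
  + by move=> n _; exact: measurableI.
  + exact: trivIset_setIl.
  rewrite -(fineK (fP _ mA)) -nneseriesZl; last by move=> n _; rewrite ?measure_ge0.
  by apply: eq_eseriesr => n _; rewrite (fineK (fP _ mA)); case: (HF n).
have CH : <<s C >> `<=` H.
 apply: (lambda_system_subset CI).
 - exact/dynkin_lambda_system.
 - by move=> D CD; split; [exact: Cm|exact: CP].
 - by [].
by move=> D /CH[].
Qed.

End measurability.

(** * The filtration and its countably many generating events *)

Section brownian_filtration.
Context {R : realType} {d} {Omega : measurableType d} (P : probability Omega R) (T : R)
 (I : finType) (W : I -> R -> Omega -> R) (F : R -> set_system Omega) (E0 : nat -> set Omega).

(** An initial event, or the event that W_k exceeds c at time r with r and c rational. Finite
    sequences of atoms form a countable type, so properties that hold almost everywhere for each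
    sequence hold for all of them outside one null set. *)
Definition atom : Type := (nat + I * rat * rat)%type.

Definition atom_set (a : atom) : set Omega :=
 match a with
 | inl n => E0 n
 | inr (k, r, c) => [set w | ratr c < W k (ratr r) w]
 end.

Definition atom_before (t : R) (a : atom) : bool :=
 match a with inl _ => true | inr (_, r, _) => 0 <= (ratr r : R) < t end.

Definition cylinder (s : seq atom) : set Omega :=
 foldr (fun a A => atom_set a `&` A) setT s.

Definition cylinders (t : R) : set_system Omega :=
 [set A | exists s, all (atom_before t) s /\ A = cylinder s].

(* bf_gen: up to null sets, F t is generated by countably many events that are *)
(* observed strictly before t or at time 0.                                    *)
Record brownian_filtration : Prop := BrownianFiltration {
 bf_T : 0 < T;
 bf_sigma : forall t, sigma_algebra setT (F t);
 bf_meas : forall t, t <= T -> F t `<=` measurable;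
 bf_mono : forall s t, s <= t -> F s `<=` F t;
 bf_null : forall t A, P.-negligible A -> F t A;
 bf_W : forall k t, 0 <= t <= T -> mF (F t) (W k t);
 bf_ind : forall s t, 0 <= s -> s < t -> t <= T ->
  forall A (B : I -> set R), F s A -> (forall k, measurable (B k)) ->
  P (A `&` \bigcap_(k in [set: I]) ((fun w => W k t w - W k s w) @^-1` B k)) =
  (P A * (\prod_k fine (P ((fun w => W k t w - W k s w) @^-1` B k)))%:E)%E;
 bf_law : forall k s t, 0 <= s -> s < t -> t <= T ->
  forall B : set R, measurable B ->
   P ((fun w => W k t w - W k s w) @^-1` B) = normal_prob 0 (Num.sqrt (t - s)) B;
 bf_cont : forall k, {ae P, forall w, {within `[0, T], continuous (W k ^~ w)}};
 bf_W0 : forall k, {ae P, forall w, W k 0 w = 0};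
 bf_E0 : forall n, F 0 (E0 n);
 bf_gen : forall t, 0 < t -> t <= T -> forall A, F t A ->
  exists2 A', <<s cylinders t >> A' & P.-negligible (A `+` A') }.

Lemma cylinder_cat s1 s2 : cylinder (s1 ++ s2) = cylinder s1 `&` cylinder s2.
Proof. by elim: s1 => [|a s1 IH]/=; rewrite ?setTI// IH setIA. Qed.

Lemma cylinders_setI t : setI_closed (cylinders t).
Proof.
move=> _ _ [s1 [h1 ->]] [s2 [h2 ->]]; exists (s1 ++ s2).
by rewrite all_cat h1 h2 cylinder_cat.
Qed.

End brownian_filtration.

Section game_filtration.
Context {R : realType} {d} {Omega : measurableType d}
 (P : probability Omega R) (T : R) (N n : nat)
 (W : 'I_N.+1 -> R -> Omega -> R) (xi : 'I_N -> Omega -> 'cV[R]_n) (T0 : 0 < T)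
 (P_complete : measure_is_complete P) (BW : brownian_motion P T W)
 (xi_meas : forall i, rvec_measurable measurable (xi i)).
Hypothesis xi_ind : independent2 P
 <<s [set S | exists i, sigma_rvec (xi i) S] >> (bm_past W T).

Notation F := (filtration P W xi).

Definition init_event (m : nat) : set Omega :=
 if @unpickle ('I_N * 'I_n * rat)%type m is Some (i, j, c)
 then [set w | ratr c < xi i w j 0] else setT.

Lemma neg_meas A : P.-negligible A -> measurable A.
Proof. exact: P_complete. Qed.

Let W_meas k t : 0 <= t <= T -> meas_fun (W k t).
Proof. by case: BW => h _ _ _ _; exact: h. Qed.

Lemma filtration_sigma t : sigma_algebra setT (F t).
Proof. exact: smallest_sigma_algebra. Qed.

Lemma filtration_meas t : t <= T -> F t `<=` measurable.
Proof.
move=> tT; apply: smallest_sub; first exact: sigma_measurable.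
move=> S [[i]|[[l [s [/andP[s0 st] [B mB <-]]]]|]].
- exact: xi_meas.
- rewrite setTI -[_ @^-1` _]setTI; apply: W_meas => //.
 by rewrite s0 (le_trans st).
- exact: neg_meas.
Qed.

Lemma filtration_mono s t : s <= t -> F s `<=` F t.
Proof.
move=> st; apply: sub_sigma_algebra2 => S [|[|]]; [by left| |by right; right].
move=> [l [r [/andP[r0 rs] ?]]]; right; left; exists l, r.
by rewrite r0 (le_trans rs).
Qed.

Lemma filtration_null t A : P.-negligible A -> F t A.
Proof. by move=> nA; apply: sub_sigma_algebra; right; right. Qed.

Lemma filtration_W k t : 0 <= t <= T -> mF (F t) (W k t).
Proof.
move=> /andP[t0 tT]; apply/mFP; first exact: filtration_sigma.
move=> B mB; apply: sub_sigma_algebra; right; left; exists k, t.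
by rewrite t0 lexx; split => //; exists B; rewrite ?setTI.
Qed.

Let incr k s t := fun w => W k t w - W k s w.

Let incr_past k s t (B : set R) r : 0 <= s -> s <= t -> t <= r -> measurable B ->
 bm_past W r (incr k s t @^-1` B).
Proof.
move=> s0 st tr mB.
have sB : sigma_algebra setT (bm_past W r) by exact: smallest_sigma_algebra.
have h q : 0 <= q -> q <= r -> mF (bm_past W r) (W k q).
 move=> q0 qr; apply/mFP => // C mC; apply: sub_sigma_algebra; exists k, q.
 by rewrite q0 qr; split => //; exists C; rewrite ?setTI.
have /mFP : mF (bm_past W r) (incr k s t).
 by apply: mFB; apply: h => //; [exact: le_trans st|exact: le_trans tr].
by apply.
Qed.

Let incr_meas k s t (B : set R) : 0 <= s -> s <= t -> t <= T -> measurable B ->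
 measurable (incr k s t @^-1` B).
Proof.
move=> s0 st tT mB; rewrite -[_ @^-1` _]setTI.
apply: measurable_funB => //; apply: W_meas; rewrite ?s0 ?(le_trans st)//.
by rewrite (le_trans s0).
Qed.

(** Up to null sets F_s is generated by the intersections of an event of the initial states with an
    event of the past of W. For such an intersection the product rule combines the independence of
    the initial states from W with that of the increments from the past, and Dynkin's theorem
    extends it. *)
Lemma filtration_ind s t : 0 <= s -> s < t -> t <= T ->
 forall A (B : 'I_N.+1 -> set R), F s A -> (forall k, measurable (B k)) ->
 P (A `&` \bigcap_(k in [set: 'I_N.+1]) ((fun w => W k t w - W k s w) @^-1` B k)) =
 (P A * (\prod_k fine (P ((fun w => W k t w - W k s w) @^-1` B k)))%:E)%E.
Proof.
move=> s0 st tT A B FA mB.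
have [_ _ _ _ ind] := BW.
set D := \bigcap_(k in _) _.
have mD : measurable D.
 by apply: fin_bigcap_measurable => // k _; exact: incr_meas (ltW st) tT (mB k).
have sP : bm_past W s `<=` measurable.
 apply: smallest_sub; first exact: sigma_measurable.
 move=> S [k [r [/andP[r0 rs] [C mC <-]]]]; apply: W_meas => //.
 by rewrite r0 (le_trans rs)// (le_trans (ltW st)).
have sX : <<s [set S | exists i, sigma_rvec (xi i) S] >> `<=` measurable.
 apply: smallest_sub; first exact: sigma_measurable.
 by move=> S [i]; exact: xi_meas.
have bT : sigma_algebra setT (bm_past W T) by exact: smallest_sigma_algebra.
have bs : sigma_algebra setT (bm_past W s) by exact: smallest_sigma_algebra.
have bx : sigma_algebra setT <<s [set S | exists i, sigma_rvec (xi i) S] >>.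
 exact: smallest_sigma_algebra.
have sub : bm_past W s `<=` bm_past W T.
 apply: sub_sigma_algebra2 => S [k [r [/andP[r0 rs] h]]]; exists k, r.
 by rewrite r0 (le_trans rs)// (le_trans (ltW st)).
have key A2 : bm_past W s A2 -> P (A2 `&` D) =
  (P A2 * (\prod_k fine (P (incr k s t @^-1` B k)))%:E)%E.
 move=> bA2; pose E (o : option 'I_N.+1) :=
  if o is Some k then incr k s t @^-1` B k else A2.
 have hE : forall o, (if o is Some k then sigma_rv (fun w => W k t w - W k s w) else bm_past W s) (E o).
  by case => [k|] //=; exists (B k); rewrite ?setTI.
 have := ind s t s0 st tT E hE.
 rewrite (_ : \bigcap_(o in _) _ = A2 `&` D); last first.
  apply/seteqP; split => w /=.
   by move=> h; split; [exact: (h None)|move=> k _; exact: (h (Some k))].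
  by move=> [h1 h2] [k|] _ //; exact: h2.
 rewrite (bigD1 None)//= (reindex_omap (@Some _) id)/=; last by case.
 move=> ->; rewrite EFinM fineK; last by apply: fin_num_measure; exact: sP.
 by congr (_ * (_)%:E)%E; apply: eq_big => // k; rewrite eqxx.
have PD : P D = (\prod_k fine (P (incr k s t @^-1` B k)))%:E.
 have := key setT (sigma_algebraT bs).
 by rewrite setTI probability_setT mul1e.
rewrite -PD.
pose C : set_system Omega := [set A | exists A1 A2,
 [/\ <<s [set S | exists i, sigma_rvec (xi i) S] >> A1, bm_past W s A2 & A = A1 `&` A2]].
have Cm : C `<=` measurable.
 by move=> _ [A1 [A2 [h1 h2 ->]]]; apply: measurableI; [exact: sX|exact: sP].
have CI : setI_closed C.
 move=> _ _ [A1 [A2 [h1 h2 ->]]] [B1 [B2 [g1 g2 ->]]].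
 exists (A1 `&` B1), (A2 `&` B2); split.
 - exact: (sigma_algebraI bx).
 - exact: (sigma_algebraI bs).
 - by rewrite setIACA.
have bD : bm_past W T D.
 rewrite -(sigma_algebra_id bT).
 apply: (@fin_bigcap_measurable _ (g_sigma_algebraType (bm_past W T))) => // k _.
 by apply: sub_sigma_algebra; apply: incr_past => //; exact: ltW.
have Cind A' : <<s C >> A' -> P (D `&` A') = (P D * P A')%E.
 apply: dynkin_indep => // _ [A1 [A2 [h1 h2 ->]]].
 rewrite setIC -setIA (xi_ind h1 (sigma_algebraI bT (sub _ h2) bD)).
 by rewrite key// -PD (xi_ind h1 (sub _ h2)) muleA muleC.
have [A' CA' nA] : exists2 A', <<s C >> A' & P.-negligible (A `+` A').
 move: A FA; apply: gen_mod_null => S [hS|[[l [r [rs hS]]]|nS]].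
 - exists S; last by rewrite setYK; exact: negligible_set0.
  apply: sub_sigma_algebra; exists S, setT; rewrite setIT; split => //.
   exact: sub_sigma_algebra.
  exact: sigma_algebraT.
 - exists S; last by rewrite setYK; exact: negligible_set0.
  apply: sub_sigma_algebra; exists setT, S; rewrite setTI; split => //.
   exact: sigma_algebraT.
  by apply: sub_sigma_algebra; exists l, r.
 - exists set0; last by rewrite setY0.
  by have [] := smallest_sigma_algebra setT C.
have mA : measurable A by apply: (filtration_meas (t := s)) FA; rewrite (le_trans (ltW st)).
have mA' : measurable A' by apply: (@smallest_sub _ _ C _ sigma_measurable Cm).
rewrite (P_setY mA mA' nA) (P_setY (B := A' `&` D)); last 3 first.
- exact: measurableI.
- exact: measurableI.
- by apply: negligibleS nA; rewrite -setIYl => w [].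
by rewrite setIC Cind// muleC.
Qed.

Let rat_between (a b : R) : a < b -> exists q : rat, a < ratr q < b.
Proof. by move=> /rat_in_itvoo[q]; rewrite in_itv/=; exists q. Qed.

Let near_rat t s m : 0 < t -> t <= T -> 0 <= s -> s <= t ->
 exists q : rat, [/\ 0 <= (ratr q : R), ratr q < t & `|ratr q - s| < 2^-1 ^+ m].
Proof.
move=> t0 tT s0 st; have e0 : 0 < (2^-1 : R) ^+ m by rewrite exprn_gt0// invr_gt0.
move: e0; set e := 2^-1 ^+ m => e0.
have [st'|ts] := ltP s t.
 have [|q /andP[h1]] := @rat_between s (Num.min t (s + e)).
  by rewrite lt_min st' ltrDl.
 rewrite lt_min => /andP[h2 h3]; exists q; split => //.
  by rewrite (le_trans s0)// ltW.
 by rewrite gtr0_norm ?subr_gt0//; lra.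
have -> : s = t by apply/eqP; rewrite eq_le st.
have [|q /andP[]] := @rat_between (Num.max 0 (t - e)) t.
 by rewrite gt_max t0 gtrBl.
rewrite gt_max => /andP[h1 h2] h3; exists q; split => //; first exact: ltW.
by rewrite ltr0_norm ?subr_lt0//; lra.
Qed.

Notation cyl := (cylinders W init_event).

Let cyl_sigma t : sigma_algebra setT <<s cyl t >>.
Proof. exact: smallest_sigma_algebra. Qed.

Let cyl_atom t a : atom_before t a -> <<s cyl t >> (atom_set W init_event a).
Proof.
move=> ha; apply: sub_sigma_algebra; exists [:: a].
by rewrite /= ha setIT.
Qed.

Let cyl_xi t i (j : 'I_n) : mF <<s cyl t >> (fun w => xi i w j 0).
Proof.
apply: mF_rat => // q; have := @cyl_atom t (inl (pickle (i, j, q))) isT.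
by rewrite /= /init_event pickleK.
Qed.

Let cyl_W t l (r : rat) : 0 <= (ratr r : R) -> ratr r < t ->
 mF <<s cyl t >> (W l (ratr r)).
Proof.
move=> r0 rt; apply: mF_rat => // q; have := @cyl_atom t (inr (l, r, q)).
by rewrite /= r0 rt; apply.
Qed.

(** By continuity of the paths W_l(s), even for s = t, is almost surely the limit of W_l at rational
    times strictly before t. Events of the initial states are expressed by rational thresholds, and
    null sets are absorbed in the symmetric difference. *)
Lemma filtration_gen t : 0 < t -> t <= T -> forall A, F t A ->
 exists2 A', <<s cyl t >> A' & P.-negligible (A `+` A').
Proof.
move=> t0 tT; apply: gen_mod_null => S [[i [C bC ->]]|[[l [s [/andP[s0 st] [B mB <-]]]]|nS]].
- exists (xi i @^-1` C); last by rewrite setYK; exact: negligible_set0.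
 move: C bC; apply: smallest_sub.
  split; first by rewrite preimage_set0; case: (cyl_sigma t).
  + move=> A hA; rewrite setTD preimage_setC -setTD.
   by case: (cyl_sigma t) => _ h _; exact: h.
  + move=> G hG; rewrite preimage_bigcup.
   by case: (cyl_sigma t) => _ _ h; exact: h.
 move=> _ [j [B [mB ->]]].
 by have /(mFP _ (@cyl_sigma t))/(_ B mB) := @cyl_xi t i j.
- rewrite setTI.
 have /choice[r rP] : forall m, exists q : rat,
   [/\ 0 <= (ratr q : R), ratr q < t & `|ratr q - s| < 2^-1 ^+ m].
  by move=> m; exact: near_rat.
 pose X := flim (fun m => W l (ratr (r m))).
 have mX : mF <<s cyl t >> X.
  by apply: mF_flim => m; have [? ? _] := rP m; exact: cyl_W.
 exists (X @^-1` B); first by move/(mFP _ (@cyl_sigma t)) : mX; apply.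
 have [_ _ cW _ _] := BW.
 have XW : {ae P, forall w, X w = W l s w}.
  apply: filterS (cW l) => w cw; apply: flim_cvg.
  have sT : s \in `[0, T] by rewrite in_itv/= s0 (le_trans st).
  apply: (within_seq cw sT).
   move=> m; have [h1 h2 _] := rP m.
   by rewrite /= in_itv/= h1 (le_trans (ltW h2)).
  apply/cvgrPdist_lt => e e0.
  have [m0 hm] := half_small e0; exists m0 => // m /= m0m.
  have [_ _ h] := rP m; rewrite distrC (lt_trans h)//.
  by apply: le_lt_trans hm; rewrite ler_wiXn2l ?invr_ge0// invf_le1// ler1n.
 apply: negligibleS XW => w; rewrite /setY /= => -[[h1 h2]|[h1 h2]] e.
  by apply: h2; rewrite e.
 by apply: h2; rewrite -e.
- exists set0; last by rewrite setY0.
 by case: (cyl_sigma t).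
Qed.

Lemma game_brownian_filtration : brownian_filtration P T W F init_event.
Proof.
have [_ W0 cW lW _] := BW.
split => //.
- exact: filtration_sigma.
- exact: filtration_meas.
- exact: filtration_mono.
- exact: filtration_null.
- exact: filtration_W.
- exact: filtration_ind.
- move=> m; rewrite /init_event; case: unpickle => [[[i j] c]|]; last first.
  exact: (sigma_algebraT (filtration_sigma 0)).
 apply: sub_sigma_algebra; left; exists i.
 exists [set v | ratr c < v j 0] => //; apply: sub_sigma_algebra.
 exists j, `]ratr c, +oo[%classic; split; first exact: measurable_itv.
 by apply/seteqP; split => v /=; rewrite in_itv/= andbT.
- exact: filtration_gen.
Qed.

End game_filtration.

(** * Lebesgue measure on [0, T] and its product with P *)

Section time_measure.
Context {R : realType} (T : R).

Lemma lebesgue_T_fin : (@lebesgue_measure R `[0%R, T]%classic < +oo)%E.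
Proof. by rewrite lebesgue_measure_itv/=; case: ifP => _; rewrite ?ltry// -EFinB ltry. Qed.

(** A finite measure on the whole line that ignores times outside [0, T]. Processes can thus be
    total functions, and no domain of integration has to be carried along. *)
Definition lamT : set (measurableTypeR R) -> \bar R :=
 @mfrestr _ (measurableTypeR R) R `[0, T]%classic lebesgue_measure
  (measurable_itv `[0, T]) lebesgue_T_fin.

HB.instance Definition _ := FiniteMeasure.on lamT.

Lemma lamTE (A : set (measurableTypeR R)) :
 lamT A = lebesgue_measure (A `&` `[0, T]%classic).
Proof. by []. Qed.

Lemma ge0_integral_lamT (f : measurableTypeR R -> \bar R) : meas_fun f ->
 (forall x, 0 <= f x)%E ->
 (\int[lamT]_t f t = \int[lebesgue_measure]_(t in `[0%R, T]) f t)%E.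
Proof.
move=> mf f0.
rewrite (@ge0_integral_density _ _ _ lebesgue_measure _ (\1_(`[0, T]%classic)))//.
- rewrite [RHS]integral_mkcond; apply: eq_integral => t _.
 by rewrite patchE indicE; case: ifP => _; rewrite ?mule1 ?mule0.
- move=> A mA; rewrite -[LHS]/(lamT A) lamTE integral_indic//; first by rewrite setIC.
Qed.

Lemma ae_lamT (Q : R -> Prop) : {ae lamT, forall t, Q t} <->
 {ae @lebesgue_measure R, forall t, t \in `[0, T] -> Q t}.
Proof.
split => [[N [mN N0 NQ]]|[N [mN N0 NQ]]].
 exists (N `&` `[0, T]%classic); split => //; first exact: measurableI.
 move=> t /= h; split.
  by apply: NQ => /= q; apply: h.
 by apply: contrapT => ht; apply: h => ht'; exfalso; apply: ht.
exists (N `|` ~` `[0, T]%classic); split.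
- by apply: measurableU => //; apply: measurableC; exact: measurable_itv.
- rewrite lamTE setIUl setICl setU0; apply/eqP; rewrite -measure_le0 -N0.
 by apply: le_measure; rewrite ?inE//; exact: measurableI.
- move=> t /= h; have [tT|tT] := pselect (t \in `[0, T]); [left|right] => //.
 by apply: NQ => /= q; apply: h; exact: q.
Qed.

Lemma lamT_neq r : {ae lamT, forall t, t != r}.
Proof.
have m1 : measurable ([set r] : set (measurableTypeR R)).
 by rewrite -set_itv1; exact: measurable_itv.
exists [set r]; split => //.
 rewrite lamTE; apply/eqP; rewrite -measure_le0 -[leRHS](lebesgue_measure_set1 r).
 by apply: le_measure; rewrite ?inE//; apply: measurableI => //; apply: measurable_itv.
by move=> t /= /negP; rewrite negbK => /eqP.
Qed.

Lemma lamT_in : {ae lamT, forall t, 0 <= t <= T}.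
Proof. by apply/ae_lamT; apply: aeW => t; rewrite in_itv. Qed.

Lemma lamT_fin : (lamT setT < +oo)%E.
Proof. by rewrite lamTE setTI lebesgue_T_fin. Qed.

End time_measure.

Section product_time.
Context {R : realType} {d} {Omega : measurableType d} (P : probability Omega R) (T : R).

Notation TO := (measurableTypeR R * Omega)%type.

Definition muT : set TO -> \bar R := (lamT T \x P)%E.

HB.instance Definition _ := Measure.on muT.

Lemma muT_fin : (muT setT < +oo)%E.
Proof.
by rewrite /muT -setXTT product_measure1E//= probability_setT mule1 lamT_fin.
Qed.

Lemma muT_integrable12 (f : TO -> R) : meas_fun f ->
 integ muT f <-> (\int[lamT T]_t \int[P]_w `|f (t, w)|%:E < +oo)%E.
Proof.
move=> mf; rewrite (_ : integ muT f = (lamT T \x P)%E.-integrable setT (EFin \o f))//.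
by apply: integrable12ltyP; exact/measurable_EFinP.
Qed.

Lemma fubini_tw (f : TO -> R) : integ muT f ->
 [/\ {ae lamT T, forall t, integ P (fun w => f (t, w))},
   integ (lamT T) (fun t => \int[P]_w f (t, w)) &
   \int[muT]_z f z = \int[lamT T]_t (\int[P]_w f (t, w))].
Proof.
move=> intf; have if' : (lamT T \x P)%E.-integrable setT (EFin \o f) by [].
have h1 := ae_integrable1 if'.
have h2 := integrable_fubini_F if'.
have h3 := integral12_prod_meas1 if'.
have e t : integ P (fun w => f (t, w)) ->
  fubini_F P (EFin \o f) t = (\int[P]_w f (t, w))%:E.
 by move=> it; rewrite /fubini_F /Rintegral fineK//; exact: integrable_fin_num.
have mG : meas_fun (fun t => \int[P]_w f (t, w)).
 apply: (@measurableT_comp _ _ _ _ _ _ (@fine R)) => //.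
 exact: (measurable_int (lamT T) h2).
have aee : {ae lamT T, forall t, fine (fubini_F P (EFin \o f) t) = \int[P]_w f (t, w)}.
 by apply: filterS h1 => t it; rewrite e.
have iG : integ (lamT T) (fun t => \int[P]_w f (t, w)).
 apply/integrableP; split; first exact/measurable_EFinP.
 have /integrableP[_] := h2; apply: le_lt_trans.
 rewrite le_eqVlt; apply/orP; left; apply/eqP; apply: ae_eq_integral => //.
 - by apply: measurableT_comp => //; exact/measurable_EFinP.
 - by apply: measurableT_comp => //; exact: (measurable_int (lamT T) h2).
 - by apply: filterS h1 => t it _; rewrite /= e.
split => //.
rewrite /Rintegral; congr fine; rewrite -[LHS]h3.
apply: ae_eq_integral => //.
- exact: (measurable_int (lamT T) h2).
- exact/measurable_EFinP.
- by apply: filterS h1 => t it _; rewrite e.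
Qed.

Lemma fubini_wt (f : TO -> R) : integ muT f ->
 [/\ {ae P, forall w, integ (lamT T) (fun t => f (t, w))},
   integ P (fun w => \int[lamT T]_t f (t, w)) &
   \int[muT]_z f z = \int[P]_w (\int[lamT T]_t f (t, w))].
Proof.
move=> intf; have if' : (lamT T \x P)%E.-integrable setT (EFin \o f) by [].
have h1 := ae_integrable2 if'.
have mf : meas_fun (EFin \o f) := measurable_int _ if'.
have h2 : P.-integrable setT (fubini_G (lamT T) (EFin \o f)).
 apply/integrableP; split; first exact: (measurable_fubini_G if').
 apply: le_lt_trans ((integrable21ltyP (lamT T) P mf).1 if').
 apply: ge0_le_integral => //.
 - by apply: measurableT_comp => //; exact: (measurable_fubini_G if').
 - apply: (measurable_fun_fubini_tonelli_G (abse \o (EFin \o f))).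
   exact: measurableT_comp.
  by move=> z; exact: abse_ge0.
 - move=> w _; apply: le_abse_integral => //.
  by apply: (measurableT_comp mf); exact: measurable_pair2.
have h3 := integral21_prod_meas1 if'.
have e w : integ (lamT T) (fun t => f (t, w)) ->
  fubini_G (lamT T) (EFin \o f) w = (\int[lamT T]_t f (t, w))%:E.
 by move=> it; rewrite /fubini_G /Rintegral fineK//; exact: integrable_fin_num.
have mG : meas_fun (fun w => \int[lamT T]_t f (t, w)).
 apply: (@measurableT_comp _ _ _ _ _ _ (@fine R)) => //.
 exact: (measurable_int P h2).
have iG : integ P (fun w => \int[lamT T]_t f (t, w)).
 apply/integrableP; split; first exact/measurable_EFinP.
 have /integrableP[_] := h2; apply: le_lt_trans.
 rewrite le_eqVlt; apply/orP; left; apply/eqP; apply: ae_eq_integral => //.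
 - by apply: measurableT_comp => //; exact/measurable_EFinP.
 - by apply: measurableT_comp => //; exact: (measurable_int P h2).
 - by apply: filterS h1 => t it _; rewrite /= e.
split => //.
rewrite /Rintegral; congr fine; rewrite -[LHS]h3.
apply: ae_eq_integral => //.
- exact: (measurable_int P h2).
- exact/measurable_EFinP.
- by apply: filterS h1 => t it _; rewrite e.
Qed.

Lemma measurable_section (f : TO -> R) t : meas_fun f ->
 meas_fun (fun w => f (t, w)).
Proof. by move=> mf; apply: (measurableT_comp mf); exact: measurable_pair1. Qed.

Lemma measurable_path (f : TO -> R) w : meas_fun f ->
 meas_fun (fun t => f (t, w)).
Proof. by move=> mf; apply: (measurableT_comp mf); exact: measurable_pair2. Qed.

Lemma sq_section (f : TO -> R) : sq muT f ->
 {ae lamT T, forall t, sq P (fun w => f (t, w))}.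
Proof.
move=> [mf /fubini_tw[h _ _]]; apply: filterS h => t ht; split => //.
exact: measurable_section.
Qed.

Lemma sq_path (f : TO -> R) : sq muT f ->
 {ae P, forall w, sq (lamT T) (fun t => f (t, w))}.
Proof.
move=> [mf /fubini_wt[h _ _]]; apply: filterS h => w hw; split => //.
exact: measurable_path.
Qed.

Lemma ip_muT (f g : TO -> R) : sq muT f -> sq muT g ->
 ip muT f g = \int[lamT T]_t ip P (fun w => f (t, w)) (fun w => g (t, w)).
Proof. by move=> sf sg; have [_ _] := fubini_tw (sq_mul sf sg). Qed.

Lemma sq_tensor (u : measurableTypeR R -> R) (X : Omega -> R) :
 sq (lamT T) u -> sq P X -> sq muT (fun z => u z.1 * X z.2).
Proof.
move=> [mu iu] [mX iX]; have mf : meas_fun (fun z : TO => u z.1 * X z.2).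
 by apply: measurable_funM; exact: measurableT_comp.
split => //; apply/muT_integrable12; first exact: measurable_funX.
rewrite (_ : (fun _ => _) = fun t => ((u t ^+ 2)%:E * \int[P]_w (X w ^+ 2)%:E)%E).
 rewrite ge0_integralZr//; last 3 first.
 - by apply/measurable_EFinP; exact: measurable_funX.
 - by move=> t _; rewrite lee_fin sqr_ge0.
 - by apply: integral_ge0 => w _; rewrite lee_fin sqr_ge0.
 have fu := integrable_fin_num measurableT iu.
 have fX := integrable_fin_num measurableT iX.
 by rewrite -(fineK fu) -(fineK fX) -EFinM ltry.
apply/funext => t; rewrite -ge0_integralZl//.
- by apply: eq_integral => w _; rewrite ger0_norm ?sqr_ge0// exprMn EFinM.
- by apply/measurable_EFinP; exact: measurable_funX.
- by move=> w _; rewrite lee_fin sqr_ge0.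
- by rewrite lee_fin sqr_ge0.
Qed.

Lemma ip_tensor (u u' : measurableTypeR R -> R) (X X' : Omega -> R) :
 sq (lamT T) u -> sq P X -> sq (lamT T) u' -> sq P X' ->
 ip muT (fun z => u z.1 * X z.2) (fun z => u' z.1 * X' z.2) =
 ip (lamT T) u u' * ip P X X'.
Proof.
move=> su sX su' sX'; rewrite ip_muT; try exact: sq_tensor.
rewrite -RintegralZr//; last exact: sq_mul.
apply: eq_Rintegral => t _; rewrite /ip /= -RintegralZl//; last exact: sq_mul.
by apply: eq_Rintegral => w _; rewrite mulrACA.
Qed.

Lemma sq_bdd d' (X : measurableType d') (m : {measure set X -> \bar R}) (f : X -> R) c :
 (m setT < +oo)%E -> meas_fun f -> (forall x, `|f x| <= c) -> sq m f.
Proof.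
move=> m_fin mf fc.
have s1 : sq m (fun=> 1).
 split; first exact: measurable_cst.
 apply/integrableP; split; first by apply/measurable_EFinP; exact: measurable_cst.
 by under eq_integral do rewrite expr1n /= normr1; rewrite integral_cst// mul1e.
apply: (sq_le mf (sqZ c s1)) => x; rewrite mulr1 (le_trans (fc x))// ler_norm//.
Qed.

Lemma sq_indic_itv a b : sq (lamT T) (\1_(`]a, b]%classic) : measurableTypeR R -> R).
Proof.
apply: (@sq_bdd _ _ _ _ 1); first exact: lamT_fin.
 exact: measurable_indic.
exact: indic_le1.
Qed.

Lemma ip_indic_itv a b a' b' : 0 <= a' -> b' <= T -> a <= a' ->
 ip (lamT T) (\1_(`]a, b]%classic)) (\1_(`]a', b']%classic)) =
 Num.max 0 (Num.min b b' - a').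
Proof.
move=> a'0 b'T aa'.
transitivity (\int[lamT T]_t (\1_(`]a', (Num.min b b')]%classic) t : R)).
 apply: eq_Rintegral.
 move=> t _; rewrite !indicE -natrM mulnb; congr (nat_of_bool _)%:R.
 apply/idP/idP; rewrite !inE/= !in_itv/= le_min; last first.
  move=> /and3P[h1 h2 h3]; apply/andP.
  by split; rewrite inE/= in_itv/= ?h1 ?h2 ?h3 ?(le_lt_trans aa').
 by move=> /andP[]; rewrite !inE/= !in_itv/= => /andP[_ ->] /andP[-> ->].
transitivity (fine (lamT T `]a', (Num.min b b')]%classic)).
 by rewrite /Rintegral integral_indic// setIT.
rewrite lamTE.
rewrite (_ : _ `&` _ = `]a', (Num.min b b')]%classic); last first.
 apply/seteqP; split => t /=; first by case.
 rewrite !in_itv/= le_min => /and3P[h1 h2 h3]; split => //.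
  by rewrite h1 h2.
 by rewrite (le_trans a'0 (ltW h1)) (le_trans h3).
rewrite lebesgue_measure_itv/= lte_fin; case: ltP => h.
 by rewrite /= max_r// subr_ge0 ltW.
by rewrite /= max_l// subr_le0.
Qed.

End product_time.

(** * Simple integrands and the Ito isometry *)

Section simple_processes.
Context {R : realType} {d} {Omega : measurableType d}
 (P : probability Omega R) (T : R) (I : finType) (W : I -> R -> Omega -> R)
 (F : R -> set_system Omega) (E0 : nat -> set Omega) (BF : brownian_filtration P T W F E0).

Notation TO := (measurableTypeR R * Omega)%type.
Notation muT := (muT P T).
Notation incr k s t := (fun w => W k t w - W k s w).

Let T0 : 0 < T := bf_T BF.
Let Fs t : sigma_algebra setT (F t) := bf_sigma BF t.

Lemma mF_mono s t (X : Omega -> R) : s <= t -> mF (F s) X -> mF (F t) X.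
Proof. by move=> st; apply: mF_sub => //; exact: (bf_mono BF). Qed.

Lemma mF_meas_le t (X : Omega -> R) : t <= T -> mF (F t) X -> meas_fun X.
Proof. by move=> tT; apply: mF_meas; exact: (bf_meas BF). Qed.

Lemma W_meas k t : 0 <= t <= T -> meas_fun (W k t).
Proof. by move=> tT; apply: (mF_meas_le (t := t)); [case/andP: tT|exact: (bf_W BF)]. Qed.

Lemma incr_meas k s t : 0 <= s -> s <= t -> t <= T -> meas_fun (incr k s t).
Proof.
move=> s0 st tT; apply: measurable_funB; apply: W_meas.
 by rewrite (le_trans s0 st) tT.
by rewrite s0 (le_trans st).
Qed.

Definition incr_events (s t : R) : set_system Omega :=
 [set D | exists B : I -> set R, (forall k, measurable (B k)) /\
   D = \bigcap_(k in [set: I]) (incr k s t) @^-1` B k].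

Definition incr_sigma s t := <<s incr_events s t >>.

Lemma incr_sigma_mF k s t : mF (incr_sigma s t) (incr k s t).
Proof.
apply/mFP; first exact: smallest_sigma_algebra.
move=> B mB; apply: sub_sigma_algebra.
exists (fun l => if l == k then B else setT); split; first by move=> l; case: ifP.
apply/seteqP; split => w /=.
 by move=> Bw l _ /=; case: eqP => // ->.
by move=> h; have := h k Logic.I; rewrite /= eqxx.
Qed.

Lemma incr_indep_sigma s t A D : 0 <= s -> s < t -> t <= T ->
 F s A -> incr_sigma s t D -> P (A `&` D) = (P A * P D)%E.
Proof.
move=> s0 st tT FA; apply: dynkin_indep.
- by apply: (bf_meas BF) FA; rewrite (le_trans (ltW st)).
- move=> _ _ [B [mB ->]] [C [mC ->]]; exists (fun k => B k `&` C k); split.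
  by move=> k; exact: measurableI.
 by rewrite -bigcapI; apply: eq_bigcapr => k _; rewrite preimage_setI.
- move=> _ [B [mB ->]]; apply: fin_bigcap_measurable => // k _.
 by rewrite -[_ @^-1` _]setTI; apply: incr_meas => //; exact: ltW.
- move=> _ [B [mB ->]]; rewrite (bf_ind BF)//; congr (_ * _)%E.
 have := bf_ind BF s0 st tT (sigma_algebraT (Fs s)) mB.
 by rewrite setTI probability_setT mul1e.
Qed.

Lemma incr_sigma_meas s t : 0 <= s -> s <= t -> t <= T -> incr_sigma s t `<=` measurable.
Proof.
move=> s0 st tT; apply: smallest_sub; first exact: sigma_measurable.
move=> _ [B [mB ->]]; apply: fin_bigcap_measurable => // k _.
by rewrite -[_ @^-1` _]setTI; apply: incr_meas.
Qed.

Lemma incr_indep s t X Y : 0 <= s -> s < t -> t <= T -> mF (F s) X ->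
 mF (incr_sigma s t) Y -> integ P X -> integ P Y ->
 integ P (fun w => X w * Y w) /\
 \int[P]_w (X w * Y w) = (\int[P]_w X w) * (\int[P]_w Y w).
Proof.
move=> s0 st tT mX mY iX iY; have sT := le_trans (ltW st) tT.
apply: indep_mul => //; [exact: (integ_meas iX)|exact: (integ_meas iY)|].
move=> A B mA mB; apply: (incr_indep_sigma s0 st tT).
 by move/(mFP _ (Fs s)): mX; apply.
by move/mFP: mY; apply => //; exact: smallest_sigma_algebra.
Qed.

Let sqrt_pos s t : s < t -> 0 < Num.sqrt (t - s) :> R.
Proof. by move=> st; rewrite sqrtr_gt0 subr_gt0. Qed.

Lemma sq_integ X : sq P X -> integ P X.
Proof.
move=> sX; have := sq_mul sX (sq_bdd (c := 1) (P_fin P) (measurable_cst (1 : R)) _).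
move=> h; have {h} := h (fun x => _).
rewrite /integ; under [X in EFin \o X]eq_fun do rewrite mulr1; apply.
by move=> x; rewrite normr1.
Qed.

Lemma incr_sq k s t : 0 <= s -> s <= t -> t <= T -> sq P (incr k s t).
Proof.
move=> s0; rewrite le_eqVlt => /predU1P[<- _|st tT].
 rewrite (_ : (fun _ => _) = 0); first exact: sq0.
 by apply/funext => w; rewrite subrr.
apply: (gauss_sq (incr_meas k s0 (ltW st) tT) (sqrt_pos st)).
exact: (bf_law BF).
Qed.

Lemma incr_mean k s t : 0 <= s -> s <= t -> t <= T -> \int[P]_w (incr k s t) w = 0.
Proof.
move=> s0; rewrite le_eqVlt => /predU1P[<- _|st tT].
 by under eq_Rintegral do rewrite subrr; rewrite Rintegral_cst// mul0r.
apply: (gauss_mean (incr_meas k s0 (ltW st) tT) (sqrt_pos st)).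
exact: (bf_law BF).
Qed.

Lemma incr_var k s t : 0 <= s -> s <= t -> t <= T -> \int[P]_w (incr k s t) w ^+ 2 = t - s.
Proof.
move=> s0; rewrite le_eqVlt => /predU1P[<- _|st tT].
 under eq_Rintegral do rewrite subrr expr0n.
 by rewrite Rintegral_cst// mul0r subrr.
rewrite (gauss_var (incr_meas k s0 (ltW st) tT) (sqrt_pos st)).
 by rewrite sqr_sqrtr// subr_ge0 ltW.
exact: (bf_law BF).
Qed.

Lemma incr_X4 k s t : 0 <= s -> s < t -> t <= T ->
 integ P (fun w => (incr k s t) w ^+ 4) /\
 \int[P]_w (incr k s t) w ^+ 4 <= 128 * (t - s) ^+ 2.
Proof.
move=> s0 st tT; have [h1 h2] := gauss_X4 (incr_meas k s0 (ltW st) tT) (sqrt_pos st) (bf_law BF k s0 st tT).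
split => //; apply: le_trans h2 _.
by rewrite (_ : 4 = 2 * 2)%N// exprM sqr_sqrtr// subr_ge0 ltW.
Qed.

Lemma incr_prod_mean k l s t : k != l -> 0 <= s -> s <= t -> t <= T ->
 \int[P]_w (incr k s t w * incr l s t w) = 0.
Proof.
move=> kl s0; rewrite le_eqVlt => /predU1P[<- _|st tT].
 by under eq_Rintegral do rewrite subrr mul0r; rewrite Rintegral_cst// mul0r.
have st' := ltW st.
have [|||||_ ->] := @indep_mul _ _ _ P (incr k s t) (incr l s t).
- exact: incr_meas.
- exact: incr_meas.
- move=> A B mA mB.
 have hB := bf_ind BF s0 st tT (sigma_algebraT (Fs s)).
 have key (C : I -> set R) : (forall j, measurable (C j)) ->
   P (\bigcap_(j in [set: I]) (incr j s t) @^-1` C j) =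
   (\prod_j fine (P ((incr j s t) @^-1` C j)))%:E.
  by move=> mC; have := hB C mC; rewrite setTI probability_setT mul1e.
 pose C j := if j == k then A else if j == l then B else setT.
 have mC j : measurable (C j) by rewrite /C; case: ifP => // _; case: ifP.
 have := key C mC.
 rewrite (_ : \bigcap_(j in _) _ = incr k s t @^-1` A `&` incr l s t @^-1` B); last first.
  apply/seteqP; split => w /=.
   move=> h; split; first by have := h k Logic.I; rewrite /C eqxx.
   by have := h l Logic.I; rewrite /C eqxx eq_sym (negbTE kl).
  by move=> [h1 h2] j _; rewrite /C /=; case: eqP => [->//|_]; case: eqP => [->|].
 move=> ->; rewrite (bigD1 k)//= (bigD1 l)/=; last by rewrite eq_sym.
 rewrite big1 => [|j /andP[jk jl]]; last first.
  by rewrite /C (negbTE jk) (negbTE jl) preimage_setT probability_setT.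
 rewrite mulr1 /C !eqxx eq_sym (negbTE kl) EFinM !fineK//.
  by apply: fin_num_measure; rewrite -[_ @^-1` _]setTI; exact: incr_meas.
 by apply: fin_num_measure; rewrite -[_ @^-1` _]setTI; exact: incr_meas.
- by apply: sq_integ; exact: incr_sq.
- by apply: sq_integ; exact: incr_sq.
by rewrite !incr_mean// mulr0.
Qed.

Lemma past_incr k s t X : 0 <= s -> s <= t -> t <= T -> mF (F s) X -> sq P X ->
 sq P (fun w => X w * incr k s t w) /\ ip P X (incr k s t) = 0.
Proof.
move=> s0; rewrite le_eqVlt => /predU1P[<- _ mX sX|st tT mX sX].
 split.
  rewrite (_ : (fun _ => _) = 0); first exact: sq0.
  by apply/funext => w; rewrite subrr mulr0.
 by rewrite (_ : (fun w => W k s w - W k s w) = 0) ?ip0r//; apply/funext => w; rewrite subrr.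
have mI := @incr_sigma_mF k s t.
have sI := incr_sq k s0 (ltW st) tT.
split; last first.
 have [_ e] := incr_indep s0 st tT mX mI (sq_integ sX) (sq_integ sI).
 by rewrite /ip e (incr_mean k s0 (ltW st) tT) mulr0.
split; first by apply: measurable_funM; [exact: sq_meas sX|exact: sq_meas sI].
have mI2 : mF (incr_sigma s t) (fun w => incr k s t w ^+ 2).
 by apply: (@mF_comp _ _ _ _ (fun x => x ^+ 2) _ mI); exact: measurable_funX.
have mX2 : mF (F s) (fun w => X w ^+ 2).
 by apply: (@mF_comp _ _ _ _ (fun x => x ^+ 2) _ mX); exact: measurable_funX.
have [h _] := incr_indep s0 st tT mX2 mI2 (proj2 sX) (proj2 sI).
by rewrite /integ; under [X in EFin \o X]eq_fun do rewrite exprMn.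
Qed.

Lemma past_incr2 k l s t X c : 0 <= s -> s <= t -> t <= T -> mF (F s) X ->
 (forall w, `|X w| <= c) ->
 \int[P]_w (X w * (incr k s t w * incr l s t w)) = (k == l)%:R * (t - s) * \int[P]_w X w.
Proof.
move=> s0; rewrite le_eqVlt => /predU1P[<- _ mX Xc|st tT mX Xc].
 under eq_Rintegral do rewrite !subrr !mulr0.
 by rewrite Rintegral_cst// mul0r subrr mulr0 mul0r.
have sT := le_trans (ltW st) tT.
have iX : integ P X by apply/sq_integ/(sq_bdd (P_fin P) _ Xc); exact: mF_meas_le mX.
have mI : mF (incr_sigma s t) (fun w => incr k s t w * incr l s t w).
 by apply: mFM; exact: incr_sigma_mF.
have iI : integ P (fun w => incr k s t w * incr l s t w).
 by apply: sq_mul; apply: incr_sq => //; exact: ltW.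
have [_ ->] := incr_indep s0 st tT mX mI iX iI.
rewrite mulrC; congr (_ * _); have [->|kl] := eqVneq k l.
 rewrite mul1r -(incr_var l s0 (ltW st) tT).
 by apply: eq_Rintegral => w _; rewrite expr2.
by rewrite (incr_prod_mean kl s0 (ltW st) tT) mul0r.
Qed.

(** The integrand is related to its integrals against every W_k, instead of the integral being a
    function of the integrand: one function may have several representations. Sums are then
    concatenations, and no common refinement of partitions is formed. *)
Inductive simple : (TO -> R) -> (I -> R -> Omega -> R) -> Prop :=
| simple_nil : simple 0 (fun _ _ => 0)
| simple_cons (a b : R) (Z : Omega -> R) H J : 0 <= a -> a <= b -> b <= T ->
  mF (F a) Z -> (exists c, forall w, `|Z w| <= c) -> simple H J ->
  simple ((fun z => \1_(`]a, b]%classic) z.1 * Z z.2) + H)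
   (fun k t => (fun w => (W k (Num.min t b) w - W k (Num.min t a) w) * Z w) + J k t).

Definition elem a b (Z : Omega -> R) : TO -> R := fun z => \1_(`]a, b]%classic) z.1 * Z z.2.

Definition elemJ a b (Z : Omega -> R) k t : Omega -> R :=
 fun w => (W k (Num.min t b) w - W k (Num.min t a) w) * Z w.

Lemma simple_elem a b Z : 0 <= a -> a <= b -> b <= T -> mF (F a) Z ->
 (exists c, forall w, `|Z w| <= c) -> simple (elem a b Z) (elemJ a b Z).
Proof.
move=> a0 ab bT mZ Zc; have := simple_cons a0 ab bT mZ Zc simple_nil.
by congr simple; [rewrite addr0|apply/eq2_fun => k t; rewrite addr0].
Qed.

Lemma simple_add H J H' J' : simple H J -> simple H' J' ->
 simple (H + H') (fun k t => J k t + J' k t).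
Proof.
move=> sH sH'; elim: sH => [|a b Z {}H {}J a0 ab bT mZ Zc sH IH].
 move: sH'; congr simple; first by rewrite add0r.
 by apply/eq2_fun => k t; rewrite add0r.
have := simple_cons a0 ab bT mZ Zc IH.
by congr simple; [rewrite addrA|apply/eq2_fun => k t; rewrite addrA].
Qed.

Lemma simple_sum (K : Type) (r : seq K) (p : pred K) (H : K -> TO -> R) J :
 (forall i, p i -> simple (H i) (J i)) ->
 simple (\sum_(i <- r | p i) H i) (fun k t => \sum_(i <- r | p i) J i k t).
Proof.
move=> sH; elim: r => [|i r IH].
 move: simple_nil; congr simple; first by rewrite big_nil.
 by apply/eq2_fun => k t; rewrite big_nil.
case pi : (p i); last first.
 move: IH; congr simple; first by rewrite big_cons pi.
 by apply/eq2_fun => k t; rewrite big_cons pi.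
have := simple_add (sH _ pi) IH; congr simple; first by rewrite big_cons pi.
by apply/eq2_fun => k t; rewrite big_cons pi.
Qed.

Lemma simple_scale c H J : simple H J ->
 simple (fun z => c * H z) (fun k t => fun w => c * J k t w).
Proof.
elim => [|a b Z {}H {}J a0 ab bT mZ [e Ze] sH IH].
 move: simple_nil; congr simple; first by apply/funext => z; rewrite mulr0.
 by apply/eq2_fun => k t; apply/funext => w; rewrite mulr0.
have cZ : exists e', forall w, `|c * Z w| <= e'.
 by exists (`|c| * e) => w; rewrite normrM ler_wpM2l.
have := simple_cons a0 ab bT (mFM (mF_cst c) mZ) cZ IH.
congr simple; first by apply/funext => z; rewrite !fctE/= mulrDr mulrCA.
by apply/eq2_fun => k t; apply/funext => w; rewrite !fctE/= mulrDr mulrCA.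
Qed.

(** Cutting the integrand at s stops the integral at s, which reduces the isometry at time s to the
    isometry at T. *)
Lemma simple_stop s H J : 0 <= s <= T -> simple H J ->
 simple (fun z => \1_(`[0, s]%classic) z.1 * H z) (fun k t => J k (Num.min t s)).
Proof.
move=> /andP[s0 sT]; elim => [|a b Z {}H {}J a0 ab bT mZ Zc sH IH].
 by move: simple_nil; congr simple; apply/funext => z; rewrite mulr0.
have [as_|sa] := leP a s.
 have h2 : a <= Num.min b s by rewrite le_min ab.
 have h3 : Num.min b s <= T by rewrite ge_min bT.
 have := simple_cons a0 h2 h3 mZ Zc IH; congr simple.
  apply/funext => z; rewrite !fctE/= mulrDr; congr (_ + _).
  rewrite mulrA; congr (_ * _).
  rewrite !indicE -natrM mulnb; congr (nat_of_bool _)%:R.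
  apply/idP/andP; rewrite !inE/= !in_itv/= le_min.
   by move=> /and3P[az -> ->]; rewrite az (le_trans a0 (ltW az)).
  by move=> [/andP[_ ->] /andP[-> ->]].
 apply/eq2_fun => k t; apply/funext => w; rewrite !fctE/=.
 by rewrite (minC b) minA -(minA t s a) (min_r as_).
move: IH; congr simple.
 apply/funext => z; rewrite !fctE/= mulrDr -[LHS]add0r; congr (_ + _).
 rewrite mulrA -[LHS](mul0r (Z z.2)); congr (_ * _).
 rewrite !indicE -natrM mulnb; case: andP => //.
 rewrite !inE/= !in_itv/= => -[/andP[_ zs] /andP[az _]].
 by have := lt_le_trans az zs; rewrite ltNge (ltW sa).
apply/eq2_fun => k t; apply/funext => w; rewrite !fctE/=.
by rewrite -!minA (min_l (ltW sa)) (min_l (le_trans (ltW sa) ab)) subrr mul0r add0r.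
Qed.

Lemma elemJ_sq a b Z k t : 0 <= a -> a <= b -> b <= T -> mF (F a) Z ->
 (exists c, forall w, `|Z w| <= c) -> 0 <= t -> t <= T ->
 sq P (elemJ a b Z k t) /\ mF (F t) (elemJ a b Z k t).
Proof.
move=> a0 ab bT mZ [c Zc] t0 tT; rewrite /elemJ.
have [ta|/ltW at_] := leP t a.
 rewrite (min_l (le_trans ta ab)).
 rewrite (_ : (fun _ => _) = 0); first by split; [exact: sq0|exact: mF_cst].
 by apply/funext => w; rewrite subrr mul0r.
have h1 : a <= Num.min t b by rewrite le_min at_.
have h2 : Num.min t b <= T by rewrite ge_min tT.
have mZ' := mF_meas_le (le_trans ab bT) mZ.
have [h _] := past_incr k a0 h1 h2 mZ (sq_bdd (P_fin P) mZ' Zc).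
split; first by under eq_fun do rewrite mulrC.
apply: mFM; last exact: mF_mono mZ.
apply: mFB; apply: (mF_mono _ (bf_W BF _ _)).
- by rewrite ge_min lexx.
- by rewrite (le_trans a0).
- by [].
- by rewrite a0 (le_trans at_).
Qed.

Lemma simple_J H J k t : simple H J -> 0 <= t -> t <= T ->
 sq P (J k t) /\ mF (F t) (J k t).
Proof.
move=> sH t0 tT; elim: sH => [|a b Z {}H {}J a0 ab bT mZ Zc sH [IH1 IH2]].
 by split; [exact: sq0|exact: mF_cst].
have [h1 h2] := elemJ_sq k a0 ab bT mZ Zc t0 tT.
by split; [exact: sqD|exact: mFD].
Qed.

Lemma elem_sq a b Z : a <= T -> mF (F a) Z -> (exists c, forall w, `|Z w| <= c) ->
 sq muT (elem a b Z).
Proof.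
move=> aT mZ [c Zc]; apply: sq_tensor; first exact: sq_indic_itv.
by apply: (sq_bdd (P_fin P) _ Zc); exact: mF_meas_le mZ.
Qed.

Lemma simple_sq H J : simple H J -> sq muT H.
Proof.
elim => [|a b Z {}H {}J a0 ab bT mZ Zc sH IH]; first exact: sq0.
by apply: sqD => //; apply: elem_sq => //; exact: le_trans bT.
Qed.

Lemma simple_mF H J t : simple H J -> 0 <= t -> t <= T -> mF (F t) (fun w => H (t, w)).
Proof.
move=> sH t0 tT; elim: sH => [|a b Z {}H {}J a0 ab bT mZ Zc sH IH]; first exact: mF_cst.
apply: mFD => //=; have [ta|/ltW at_] := leP t a.
 rewrite (_ : (fun _ => _) = 0); first exact: mF_cst.
 apply/funext => w; rewrite indicE memNset ?mul0r//= in_itv/= => /andP[].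
 by rewrite ltNge ta.
by apply: mFM; [exact: mF_cst|exact: mF_mono mZ].
Qed.

Let past_incr3_le k l s c b X e : 0 <= s -> s <= c -> c <= b -> b <= T -> mF (F s) X ->
 (forall w, `|X w| <= e) ->
 \int[P]_w (X w * (incr k s c w * incr l s b w)) = (k == l)%:R * (c - s) * \int[P]_w X w.
Proof.
move=> s0 sc cb bT mX Xe; have sb := le_trans sc cb; have cT := le_trans cb bT.
have mXm := mF_meas_le (le_trans sb bT) mX.
have sX : sq P X by exact: sq_bdd (P_fin P) mXm Xe.
have c0 := le_trans s0 sc.
rewrite -(past_incr2 k l s0 sc cT mX Xe).
have [sI _] := past_incr k s0 sc cT mX sX.
have mI : mF (F c) (fun w => X w * incr k s c w).
 apply: mFM; first exact: mF_mono mX.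
 apply: mFB; first by apply: (bf_W BF); rewrite c0.
 by apply: (mF_mono sc); apply: (bf_W BF); rewrite s0 (le_trans sc).
have [_ h] := past_incr l c0 cb bT mI sI.
have i1 : integ P (fun w => X w * (incr k s c w * incr l s c w)).
 rewrite (_ : (fun _ => _) = fun w => (X w * incr k s c w) * incr l s c w).
  by apply: sq_mul => //; exact: incr_sq.
 by apply/funext => w; rewrite mulrA.
have i2 : integ P (fun w => (X w * incr k s c w) * incr l c b w).
 by apply: sq_mul => //; exact: incr_sq.
rewrite -[RHS]addr0 -h /ip -RintegralD//.
by apply: eq_Rintegral => w _; ring.
Qed.

Lemma past_incr3 k l s c b X e : 0 <= s -> s <= c -> s <= b -> c <= T -> b <= T ->
 mF (F s) X -> (forall w, `|X w| <= e) ->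
 \int[P]_w (X w * (incr k s c w * incr l s b w)) =
 (k == l)%:R * (Num.min c b - s) * \int[P]_w X w.
Proof.
move=> s0 sc sb cT bT mX Xe; have [cb|/ltW bc] := leP c b.
 exact: (past_incr3_le _ _ _ _ _ _ mX Xe).
rewrite eq_sym -(past_incr3_le l k s0 sb bc cT mX Xe).
by apply: eq_Rintegral => w _; ring.
Qed.

(** Say a <= a'. The part of the first increment before a' is known at a', hence orthogonal to the
    second increment. The part after a' starts together with the second increment, and [past_incr3]
    computes the product from the length of the overlap. *)
Lemma elem_iso a b Z k a' b' Z' l : 0 <= a -> a <= b -> b <= T -> mF (F a) Z ->
 (exists c, forall w, `|Z w| <= c) ->
 0 <= a' -> a' <= b' -> b' <= T -> mF (F a') Z' ->
 (exists c, forall w, `|Z' w| <= c) ->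
 ip P (elemJ a b Z k T) (elemJ a' b' Z' l T) =
 (k == l)%:R * ip muT (elem a b Z) (elem a' b' Z').
Proof.
wlog aa' : a b Z k a' b' Z' l / a <= a'.
 move=> hw a0 ab bT mZ Zc a'0 ab' bT' mZ' Zc'; have [aa'|/ltW aa'] := leP a a'.
  exact: hw.
 by rewrite ipC (ipC muT) eq_sym; exact: hw.
move=> a0 ab bT mZ Zc a'0 ab' bT' mZ' Zc'.
have aT := le_trans ab bT; have aT' := le_trans ab' bT'.
have [c hc] := Zc; have [c' hc'] := Zc'.
have sZ : sq P Z by apply: (sq_bdd (P_fin P) _ hc); exact: mF_meas_le mZ.
have sZ' : sq P Z' by apply: (sq_bdd (P_fin P) _ hc'); exact: mF_meas_le mZ'.
rewrite ip_tensor//; try exact: sq_indic_itv.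
rewrite ip_indic_itv//.
(* The first increment runs from a to min(b, a') and then from a' to m; one of the two pieces is
   trivial. *)
set m := Num.max b a'.
have mT : m <= T by rewrite ge_max bT.
have am : a' <= m by rewrite le_max lexx orbT.
have lenE : Num.max 0 (Num.min b b' - a') = Num.min m b' - a'.
 rewrite /m; have [ba|/ltW ba] := leP b a'.
  rewrite (min_l ab') subrr max_l// subr_le0 ge_min ba//.
 by rewrite max_r// subr_ge0 le_min ba.
have h1 : a <= Num.min b a' by rewrite le_min ab.
have h2 : Num.min b a' <= T by rewrite ge_min bT.
have [sI _] := past_incr k a0 h1 h2 mZ sZ.
have mI : mF (F a') (fun w => Z' w * (Z w * incr k a (Num.min b a') w)).
 apply: mFM => //; apply: mFM; first exact: mF_mono mZ.
 apply: mFB; apply: (mF_mono _ (bf_W BF _ _)).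
 - by rewrite ge_min lexx orbT.
 - by rewrite (le_trans a0).
 - by [].
 - by rewrite a0.
have sI' : sq P (fun w => Z' w * (Z w * incr k a (Num.min b a') w)).
 by apply: (sq_bddM (c := c')) => //; exact: mF_meas_le mZ'.
have [_ z1] := past_incr l a'0 ab' bT' mI sI'.
have mY : mF (F a') (fun w => Z w * Z' w) by apply: mFM => //; exact: mF_mono mZ.
have Yc w : `|Z w * Z' w| <= c * c' by rewrite normrM ler_pM.
have z2 := past_incr3 k l a'0 am ab' mT bT' mY Yc.
rewrite lenE mulrA [X in _ * X](_ : _ = \int[P]_w (Z w * Z' w))// -z2 -[RHS]add0r -z1.
rewrite /ip -RintegralD//; last 2 first.
- by apply: sq_mul => //; exact: incr_sq.
- rewrite (_ : (fun _ => _) = fun w => (Z' w * (Z w * incr k a' m w)) * incr l a' b' w).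
  apply: sq_mul; last exact: incr_sq.
  apply: (sq_bddM (c := c')) => //; first exact: mF_meas_le mZ'.
  by have [] := past_incr k a'0 am mT (mF_mono aa' mZ) sZ.
 by apply/funext => w; ring.
apply: eq_Rintegral => w _; rewrite /elemJ !(min_r bT) !(min_r bT') !(min_r aT) !(min_r aT').
have -> : W k b w - W k a w = incr k a (Num.min b a') w + incr k a' m w.
 by rewrite /m; have [ba|/ltW ba] := leP b a'; ring.
ring.
Qed.

Lemma simple_iso H J H' J' k l : simple H J -> simple H' J' ->
 ip P (J k T) (J' l T) = (k == l)%:R * ip muT H H'.
Proof.
have T0' := ltW T0.
move=> sH sH'; elim: sH => [|a b Z {}H {}J a0 ab bT mZ Zc sH IH].
 by rewrite !ip0l mulr0.
have aT := le_trans ab bT.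
have [s1 _] := elemJ_sq k a0 ab bT mZ Zc T0' (lexx T).
have [s2 _] := simple_J k sH T0' (lexx T).
have [s3 _] := simple_J l sH' T0' (lexx T).
have s4 := elem_sq b aT mZ Zc; have s5 := simple_sq sH; have s6 := simple_sq sH'.
rewrite ipDl// (ipDl s4 s5 s6) mulrDr IH; congr (_ + _).
clear IH s2 s5; elim: sH' s3 s6 => [|a' b' Z' {}H' {}J' a'0 ab' bT' mZ' Zc' sH' IH] _ _.
 by rewrite !ip0r mulr0.
have aT' := le_trans ab' bT'.
have [s1' _] := elemJ_sq l a'0 ab' bT' mZ' Zc' T0' (lexx T).
have [s2' _] := simple_J l sH' T0' (lexx T).
have s4' := elem_sq b' aT' mZ' Zc'; have s5' := simple_sq sH'.
rewrite ipDr// (ipDr s4' s5' s4) mulrDr IH//; congr (_ + _).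
exact: elem_iso.
Qed.

End simple_processes.

(** * Almost everywhere statements over countable families *)

Section ae_monotone.
Context {R : realType} {d} {X : measurableType d} (mu : {measure set X -> \bar R}).
Implicit Types A B C D : X -> Prop.

Lemma ae_imp A B : {ae mu, forall x, A x} -> (forall x, A x -> B x) ->
 {ae mu, forall x, B x}.
Proof. by move=> hA AB; apply: filterS hA. Qed.

Lemma ae_imp2 A B C : {ae mu, forall x, A x} -> {ae mu, forall x, B x} ->
 (forall x, A x -> B x -> C x) -> {ae mu, forall x, C x}.
Proof. by move=> hA hB AB; apply: filterS2 hA hB. Qed.

Lemma ae_imp3 A B C D : {ae mu, forall x, A x} -> {ae mu, forall x, B x} ->
 {ae mu, forall x, C x} -> (forall x, A x -> B x -> C x -> D x) ->
 {ae mu, forall x, D x}.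
Proof. by move=> hA hB hC AB; apply: filterS3 hA hB hC. Qed.

End ae_monotone.

Lemma ae_count {R : realType} {d} {X : measurableType d} (mu : {measure set X -> \bar R})
 (K : countType) (Q : K -> X -> Prop) :
 (forall k, {ae mu, forall x, Q k x}) -> {ae mu, forall x, forall k, Q k x}.
Proof.
move=> hQ; have : {ae mu, forall x, forall n, if @unpickle K n is Some k then Q k x else True}.
 by apply: ae_foralln => n; case: unpickle => [k|]; [exact: hQ|exact: aeW].
by apply: filterS => x h k; have := h (pickle k); rewrite pickleK.
Qed.

Lemma ae_fin {R : realType} {d} {X : measurableType d} (mu : {measure set X -> \bar R})
 (K : finType) (Q : K -> X -> Prop) :
 (forall k, {ae mu, forall x, Q k x}) -> {ae mu, forall x, forall k, Q k x}.
Proof. exact: ae_count. Qed.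

(** * Density of simple integrands among adapted processes *)

Section density.
Context {R : realType} {d} {Omega : measurableType d}
 (P : probability Omega R) (T : R) (I : finType) (W : I -> R -> Omega -> R)
 (F : R -> set_system Omega) (E0 : nat -> set Omega) (BF : brownian_filtration P T W F E0).

Notation TO := (measurableTypeR R * Omega)%type.
Notation muT := (muT P T).
Notation lamT := (lamT T).
Notation simple := (simple T W F).

Let T0 : 0 < T := bf_T BF.
Let Fs t : sigma_algebra setT (F t) := bf_sigma BF t.

(** Adaptedness is required at every time of [0, T], square integrability only for the product
    measure, so that a single section in time may fail to be square integrable. *)
Definition L2p (h : TO -> R) :=
 sq muT h /\ forall t, 0 <= t <= T -> mF (F t) (fun w => h (t, w)).

Lemma L2p_sq h : L2p h -> sq muT h. Proof. by case. Qed.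

Lemma L2p0 : L2p 0.
Proof. by split; [exact: sq0|move=> t _; exact: mF_cst]. Qed.

Lemma L2pD h g : L2p h -> L2p g -> L2p (h + g).
Proof. by move=> [sh ah] [sg ag]; split; [exact: sqD|move=> t tT; apply: mFD; [exact: ah|exact: ag]]. Qed.

Lemma L2pZ c h : L2p h -> L2p (fun z => c * h z).
Proof. by move=> [sh ah]; split; [exact: sqZ|move=> t tT; apply: mFM; [exact: mF_cst|exact: ah]]. Qed.

Lemma L2pN h : L2p h -> L2p (- h).
Proof. by move=> [sh ah]; split; [exact: sqN|move=> t tT; apply: mFN; exact: ah]. Qed.

Lemma L2pB h g : L2p h -> L2p g -> L2p (h - g).
Proof. by move=> Lh Lg; apply: L2pD => //; exact: L2pN. Qed.

Lemma L2p_sum (K : Type) (r : seq K) (p : pred K) (h : K -> TO -> R) :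
 (forall i, p i -> L2p (h i)) -> L2p (\sum_(i <- r | p i) h i).
Proof.
by move=> Lh; elim/big_rec: _ => [|i f pi Lf]; [exact: L2p0|apply: L2pD => //; exact: Lh].
Qed.

Lemma simple_L2p H J : simple H J -> L2p H.
Proof.
move=> sH; split; first exact: (simple_sq BF sH).
by move=> t /andP[t0 tT]; exact: (simple_mF BF sH).
Qed.

Lemma L2p_flim h : (forall n, L2p (h n)) -> fast muT h -> L2p (flim h).
Proof.
move=> Lh fh; have [sf _ _] := fast_flim (muT_fin P T) fh; split => // t tT.
by apply: (@mF_flim _ _ _ (fun n w => h n (t, w))) => n; have [_] := Lh n; exact.
Qed.

Lemma atom_before_F t (a : atom I) : 0 <= t -> t <= T -> atom_before t a ->
 F t (atom_set W E0 a).
Proof.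
move=> t0 tT; case: a => [n|[[k r] c]] /=.
 by move=> _; apply: (bf_mono BF t0); exact: (bf_E0 BF).
move=> /andP[r0 rt].
have rT : 0 <= (ratr r : R) <= T by rewrite r0 (le_trans (ltW rt)).
apply: (bf_mono BF (ltW rt)).
have /(mFP _ (Fs _)) := bf_W BF k rT; move/(_ `]ratr c, +oo[%classic (measurable_itv _)).
by congr F; apply/seteqP; split => w /=; rewrite in_itv/= andbT.
Qed.

Lemma cylinder_F t s : 0 <= t -> t <= T -> all (atom_before t) s -> F t (cylinder W E0 s).
Proof.
move=> t0 tT; elim: s => [_|a s IH /= /andP[ha hs]]; first exact: (sigma_algebraT (Fs t)).
by apply: sigma_algebraI => //; [exact: atom_before_F|exact: IH].
Qed.

Lemma cylinders_meas t : 0 <= t -> t <= T -> <<s cylinders W E0 t >> `<=` measurable.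
Proof.
move=> t0 tT; apply: smallest_sub; first exact: sigma_measurable.
by move=> _ [s [hs ->]]; apply: (bf_meas BF tT); exact: cylinder_F.
Qed.

(** [atom_before] is strict and the sequence is finite, which leaves room for a rational time. *)
Lemma all_before_rat t (s : seq (atom I)) : 0 < t -> all (atom_before t) s ->
 exists q : rat, [/\ 0 <= (ratr q : R), (ratr q : R) < t & all (atom_before (ratr q : R)) s].
Proof.
move=> t0; elim: s => [_|a s IH /= /andP[ha /IH[q [q0 qt hq]]]].
 have /rat_in_itvoo[q] : 0 < t by [].
 by rewrite in_itv/= => /andP[q0 qt]; exists q; split => //; exact: ltW.
case: a ha => [n|[[k r] c]] /= ha; first by exists q.
move: ha => /andP[r0 rt].
have /rat_in_itvoo[q'] : Num.max (ratr r : R) (ratr q) < t by rewrite gt_max rt.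
rewrite in_itv/= gt_max => /andP[/andP[rq' qq'] q't]; exists q'; split => //.
 by rewrite (le_trans q0)// ltW.
rewrite r0 rq'/=; apply: sub_all hq => -[n|[[l r'] c']]//= /andP[-> h]/=.
exact: lt_trans qq'.
Qed.

Lemma cylinders_orth t Z : 0 < t -> t <= T -> mF (F t) Z -> integ P Z ->
 (forall s, all (atom_before t) s -> \int[P]_(w in cylinder W E0 s) Z w = 0) ->
 {ae P, forall w, Z w = 0}.
Proof.
move=> t0 tT mZ iZ Z0; apply: (orth_zero (Fs t) (bf_meas BF tT)) => // A FA.
have [A' cA' nA] := bf_gen BF t0 tT FA.
rewrite (Rint_setY _ _ iZ nA).
- apply: (pi_lambda_orth (C := cylinders W E0 t)) => //.
 + exact: cylinders_setI.
 + by move=> B cB; apply: (cylinders_meas (ltW t0) tT); exact: sub_sigma_algebra.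
 + by have := Z0 [::] isT.
 + by move=> _ [s [hs ->]]; exact: Z0.
- exact: (bf_meas BF tT).
- exact: (cylinders_meas (ltW t0) tT).
Qed.

(** The indicator of C times that of an interval after a is a simple integrand. Hence the function
    of t that integrates g(t) over C has zero integral on every interval after a, and vanishes
    almost everywhere there. *)
Let orth_after g C a : 0 <= a -> a <= T -> sq muT g -> F a C ->
 (forall H J, simple H J -> ip muT g H = 0) ->
 {ae lamT, forall t, a < t -> \int[P]_(w in C) g (t, w) = 0}.
Proof.
move=> a0 aT sg FC g0.
have mC := bf_meas BF aT FC.
have mg := sq_meas sg.
pose f (z : TO) := \1_C z.2 * g z.
have sf : sq muT f.
 apply: (sq_bddM (c := 1) _ _ sg).
  by apply: measurableT_comp => //; exact: measurable_indic.
 by move=> z; exact: indic_le1.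
have s1 : sq muT (fun=> 1).
 apply: (@sq_bdd _ _ _ _ 1) => //; [exact: muT_fin|by move=> x; rewrite normr1].
have int_f : integ muT f.
 have := sq_mul sf s1; rewrite /integ.
 by under [X in EFin \o X]eq_fun do rewrite mulr1.
have [fsec iphi _] := fubini_tw int_f.
pose phi t := \int[P]_w f (t, w).
pose Z (t : measurableTypeR R) := \1_(`]a, T]%classic) t * phi t.
have mI : meas_fun (\1_(`]a, T]%classic) : measurableTypeR R -> R).
 exact: measurable_indic.
have iZ : integ lamT Z.
 have mphi := integ_meas iphi.
 apply: (integ_le _ (integrable_norm iphi)); first exact: measurable_funM.
 move=> t; rewrite /Z normrM indicE /=; case: (_ \in _); rewrite ?normr1 ?mul1r//.
 by rewrite normr0 mul0r.
have Z_itv x y : \int[lamT]_(t in `]x, y]%classic) Z t = 0.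
 rewrite Rint_indic//.
 set x' := Num.max x a; set y' := Num.min y T.
 have e t : \1_(`]x, y]%classic) t * Z t = \1_(`]x', y']%classic) t * phi t.
  rewrite /Z mulrA; congr (_ * _); rewrite !indicE -natrM mulnb; congr (nat_of_bool _)%:R.
  apply/andP/idP; rewrite !inE/= !in_itv/= gt_max le_min.
   by move=> [/andP[-> ->] /andP[-> ->]].
  by move=> /andP[/andP[-> ->] /andP[-> ->]].
 under eq_Rintegral do rewrite e.
 have [xy|yx] := leP x' y'; last first.
  rewrite (@eq_Rintegral _ _ _ _ setT (fun=> 0)) ?Rintegral_cst ?mul0r// => t _.
  rewrite indicE memNset ?mul0r//= in_itv/= => /andP[h1 h2].
  by have := lt_le_trans h1 h2; rewrite ltNge (ltW yx).
 have x'0 : 0 <= x' by rewrite le_max a0 orbT.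
 have y'T : y' <= T by rewrite ge_min lexx orbT.
 have mC' : mF (F x') (\1_C : Omega -> R).
  apply: (mF_mono BF (s := a)); first by rewrite le_max lexx orbT.
  exact: mF_indic.
 have Cb : exists c, forall w, `|\1_C w : R| <= c.
  by exists 1; exact: indic_le1.
 have sE := simple_elem W x'0 xy y'T mC' Cb.
 have sqE := simple_sq BF sE.
 have := g0 _ _ sE; rewrite ip_muT// => h; rewrite -[RHS]h.
 have [_ iE _] := fubini_tw (sq_mul sg sqE).
 apply: Rint_ae.
 - apply: measurable_funM; last exact: (integ_meas iphi).
  exact: measurable_indic.
 - exact: (integ_meas iE).
 - apply: filterS fsec => t it; rewrite /ip /elem /= -RintegralZl//.
  by apply: eq_Rintegral => w _; rewrite /f /=; ring.
have Z0 : {ae lamT, forall t, Z t = 0}.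
 apply: (orth_zero (G := @measurable _ (measurableTypeR R))) => //.
 - exact: sigma_measurable.
 - apply/mFP; first exact: sigma_measurable.
  by move=> B mB; have := integ_meas iZ measurableT mB; rewrite setTI.
 - suff h : forall A, <<s (@ocitv R : set_system (measurableTypeR R)) >> A ->
    \int[lamT]_(t in A) Z t = 0 by exact: h.
  apply: pi_lambda_orth => //.
  + exact: ocitvI.
  + by move=> _ [[x y] _ <-]; exact: measurable_itv.
  + rewrite -[RHS](Z_itv a T) [RHS]Rint_indic//; apply: eq_Rintegral => t _.
   by rewrite /Z mulrA !indicE -natrM mulnb andbb.
  + by move=> _ [[x y] _ <-]; exact: Z_itv.
apply: (ae_imp2 (lamT_in T) Z0) => t /andP[_ tT] Zt at_.
move: Zt; rewrite /Z indicE mem_set ?mul1r/= ?in_itv/= ?at_//.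
by rewrite /phi /f /= -Rint_indic.
Qed.

(** [orth_after] gives a null set of times for each rational q and each cylinder observed before q.
    There are countably many such pairs, so for almost every t the section g(t) integrates to 0 over
    every cylinder observed before t, and these generate F_t up to null sets. *)
Lemma orth_simple_zero g : L2p g ->
 (forall H J, simple H J -> ip muT g H = 0) -> nrm muT g = 0.
Proof.
move=> [sg ag] g0.
have h1 : {ae lamT, forall t, forall qs : rat * seq (atom I),
  0 <= (ratr qs.1 : R) -> (ratr qs.1 : R) <= T -> all (atom_before (ratr qs.1 : R)) qs.2 ->
  (ratr qs.1 : R) < t -> \int[P]_(w in cylinder W E0 qs.2) g (t, w) = 0}.
 apply: ae_count => -[q s] /=.
 have [q0|q0] := leP 0 (ratr q : R); last first.
  exact: aeW.
 have [qT|qT] := leP (ratr q : R) T; last first.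
  by apply: aeW => t _.
 have [hs|hs] := boolP (all (atom_before (ratr q : R)) s); last by apply: aeW.
 have h0 := orth_after q0 qT sg (cylinder_F q0 qT hs) g0.
 by apply: (ae_imp h0) => t h _ _ _; exact: h.
have h2 := sq_section sg.
have h4 : {ae lamT, forall t, ip P (fun w => g (t, w)) (fun w => g (t, w)) = 0}.
 have h12 := ae_imp2 h1 h2 (fun t a b => conj a b).
 (* Time 0 is discarded as a null set, since [bf_gen] speaks of t > 0 only. *)
 apply: (ae_imp3 (lamT_in T) h12 (lamT_neq T 0)) => t /andP[t0 tT] [ht st] tn0.
 have tp : 0 < t by rewrite lt_def tn0.
 have mt : mF (F t) (fun w => g (t, w)) by apply: ag; rewrite t0.
 have z : {ae P, forall w, g (t, w) = 0}.
  apply: (cylinders_orth tp tT mt (sq_integ st)) => s hs.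
  have [q [q0 qt hq]] := all_before_rat tp hs.
  exact: (ht (q, s) q0 (le_trans (ltW qt) tT) hq qt).
 rewrite -[RHS](ip0l P (fun w => g (t, w))).
 have mgt := sq_meas st.
 by apply: ip_ae => //; exact: measurable_cst.
rewrite /nrm ip_muT// (_ : Rintegral _ _ _ = 0) ?sqrtr0//.
have [_ ig _] := fubini_tw (sq_mul sg sg).
rewrite (@Rint_ae _ _ _ lamT _ (fun=> 0))//; first by rewrite Rintegral_cst// mul0r.
exact: (integ_meas ig).
Qed.

(** The difference between h and its projection is adapted, because [flim] preserves adaptedness,
    and orthogonal to all simple integrands; it therefore has norm 0. *)
Lemma simple_dense h e : L2p h -> 0 < e ->
 exists H J, simple H J /\ nrm muT (H - h) < e.
Proof.
move=> Lh e0; have [sh _] := Lh.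
have [||||s [Ss fs orth]] := @projection _ _ _ muT (muT_fin P T)
  (fun H => exists J, simple H J) h _ _ _ _ sh.
- by exists (fun _ _ => 0); exact: simple_nil.
- by move=> H H' [J sJ] [J' sJ']; exists (fun k t => J k t + J' k t); exact: simple_add.
- by move=> c H [J sJ]; exists (fun k t => fun w => c * J k t w); exact: simple_scale.
- by move=> H [J sJ]; exact: (simple_sq BF sJ).
have [sl ll _] := fast_flim (muT_fin P T) fs.
have Ll : L2p (flim s) by apply: L2p_flim => // n; have [J sJ] := Ss n; exact: simple_L2p sJ.
have z : nrm muT (h - flim s) = 0.
 apply: orth_simple_zero; first exact: L2pB.
 by move=> H J sJ; apply: orth; exists J.
have [n hn] := @half_small R (e / 2) ltac:(by rewrite divr_gt0).
have [J sJ] := Ss n; exists (s n), J; split => //.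
have [sn _] := fs.
apply: (le_lt_trans (nrm_tri (sn n) sl sh)).
rewrite (nrmBC _ (flim s) h) z addr0 (le_lt_trans (ll n))//; lra.
Qed.

End density.

(** * Mean square convergence and the Ito integral *)

Section limits_of_products.
Context {d} {X : measurableType d} {R : realType} (mu : {measure set X -> \bar R}).
Implicit Types f g h : X -> R.

Definition tendsto (fn : nat -> X -> R) f :=
 [/\ forall n, sq mu (fn n), sq mu f & (fun n => nrm mu (fn n - f)) @ \oo --> (0 : R)].

Lemma half_cvg : (fun n => (2^-1 : R) ^+ n) @ \oo --> (0 : R).
Proof. by apply: cvg_expr; rewrite ger0_norm ?invr_ge0// invf_lt1// ltr1n. Qed.

Lemma tendstoP fn f c : (forall n, sq mu (fn n)) -> sq mu f ->
 (forall n, nrm mu (fn n - f) <= c * 2^-1 ^+ n) -> tendsto fn f.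
Proof.
move=> sn sf h; split => //.
apply: (@squeeze_cvgr _ _ _ _ (fun=> 0) (fun n => c * 2^-1 ^+ n)).
- by near=> n; rewrite nrm_ge0 h.
- exact: cvg_cst.
- by rewrite -[X in _ --> X](mulr0 c); apply: cvgMr; exact: half_cvg.
Unshelve. all: by end_near. Qed.

Lemma tendsto_nrm fn f : tendsto fn f -> (fun n => nrm mu (fn n)) @ \oo --> nrm mu f.
Proof.
move=> [sn sf h]; apply/cvgrPdist_le => e e0.
move/cvgrPdist_le : h => /(_ _ e0); apply: filterS => n; rewrite sub0r normrN ger0_norm ?nrm_ge0//.
move=> hn; apply: (le_trans _ hn).
have e1 : f = (f - fn n) + fn n by rewrite subrK.
have e2 : fn n = (fn n - f) + f by rewrite subrK.
have h1 : nrm mu f <= nrm mu (fn n - f) + nrm mu (fn n).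
 by rewrite {1}e1 (nrmBC _ (fn n) f); apply: nrmD => //; apply: sqB.
have h2 : nrm mu (fn n) <= nrm mu (fn n - f) + nrm mu f.
 by rewrite {1}e2; apply: nrmD => //; apply: sqB.
by rewrite ler_norml; apply/andP; split; lra.
Qed.

Lemma tendsto_ip fn f gn g : tendsto fn f -> tendsto gn g ->
 (fun n => ip mu (fn n) (gn n)) @ \oo --> ip mu f g.
Proof.
move=> tf tg; have [sn sf h] := tf; have [sn' sg h'] := tg.
have e n : ip mu (fn n) (gn n) - ip mu f g =
  ip mu (fn n - f) (gn n) + ip mu f (gn n - g).
 by rewrite ipBl// ipBr// addrA subrK.
apply/subr_cvg0.
rewrite (_ : (fun n => _ - _) = (fun n => ip mu (fn n - f) (gn n) + ip mu f (gn n - g))); last first.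
 by apply/funext => n; exact: e.
rewrite -[X in _ --> X](addr0 (0:R)); apply: cvgD.
 apply: norm_cvg0; apply: (@squeeze_cvgr _ _ _ _ (fun=> 0)
  (fun n => nrm mu (fn n - f) * nrm mu (gn n))).
 - by near=> n; rewrite normr_ge0 ip_CS//; apply: sqB.
 - exact: cvg_cst.
 - by rewrite -[X in _ --> X](mul0r (nrm mu g)); apply: cvgM => //; exact: tendsto_nrm.
apply: norm_cvg0; apply: (@squeeze_cvgr _ _ _ _ (fun=> 0)
 (fun n => nrm mu f * nrm mu (gn n - g))).
- by near=> n; rewrite normr_ge0 ip_CS//; apply: sqB.
- exact: cvg_cst.
- by rewrite -[X in _ --> X](mulr0 (nrm mu f)); apply: cvgMr.
Unshelve. all: by end_near. Qed.

Lemma tendstoD fn f gn g : tendsto fn f -> tendsto gn g ->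
 tendsto (fun n => fn n + gn n) (f + g).
Proof.
move=> [sn sf h] [sn' sg h']; split; [by move=> n; exact: sqD|exact: sqD|].
apply: (@squeeze_cvgr _ _ _ _ (fun=> 0) (fun n => nrm mu (fn n - f) + nrm mu (gn n - g))).
- near=> n; rewrite nrm_ge0 /= (_ : _ - _ = (fn n - f) + (gn n - g)).
  by apply: nrmD; apply: sqB.
 by rewrite opprD !addrA; congr (_ + _); rewrite -!addrA; congr (_ + _); rewrite addrC.
- exact: cvg_cst.
- by rewrite -[X in _ --> X](addr0 (0:R)); apply: cvgD.
Unshelve. all: by end_near. Qed.

Lemma tendsto_cst f : sq mu f -> tendsto (fun=> f) f.
Proof.
move=> sf; split => //; rewrite (_ : (fun=> _) = (fun=> 0)); first exact: cvg_cst.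
by apply/funext => n; rewrite subrr nrm0.
Qed.

Lemma tendstoZ c fn f : tendsto fn f -> tendsto (fun n x => c * fn n x) (fun x => c * f x).
Proof.
move=> [sn sf h]; split; [by move=> n; exact: sqZ|exact: sqZ|].
rewrite -[X in _ --> X](mulr0 `|c|).
rewrite (_ : (fun n => _) = (fun n => `|c| * nrm mu (fn n - f))); first exact: cvgMr.
apply/funext => n; rewrite -nrmZ; last exact: sqB.
by congr nrm; apply/funext => x; rewrite !fctE mulrBr.
Qed.

End limits_of_products.

Section ito_relation.
Context {R : realType} {d} {Omega : measurableType d}
 (P : probability Omega R) (T : R) (I : finType) (W : I -> R -> Omega -> R)
 (F : R -> set_system Omega) (E0 : nat -> set Omega) (BF : brownian_filtration P T W F E0).

Notation TO := (measurableTypeR R * Omega)%type.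
Notation muT := (muT P T).
Notation lamT := (lamT T).
Notation simple := (simple T W F).
Notation L2p := (L2p P T F).

Let T0 : 0 < T := bf_T BF.
Let Fs t : sigma_algebra setT (F t) := bf_sigma BF t.

Definition cut (t : R) (h : TO -> R) : TO -> R := fun z => \1_(`[0, t]%classic) z.1 * h z.

Lemma measurable_cut_indic t : meas_fun (fun z : TO => \1_(`[0, t]%classic : set R) z.1 : R).
Proof.
apply: (measurableT_comp (f := (\1_(`[0, t]%classic) : measurableTypeR R -> R)) (g := fst)) => //.
Qed.

Lemma sq_cut t h : sq muT h -> sq muT (cut t h).
Proof. by apply: sq_bddM; [exact: measurable_cut_indic|exact: indic_le1]. Qed.

Lemma cut_norm t h z : `|cut t h z| <= `|h z|.
Proof. by rewrite normrM ler_piMl// indic_le1. Qed.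

Lemma cutD t h g : cut t (h + g) = cut t h + cut t g.
Proof. by apply/funext => z; rewrite /cut !fctE mulrDr. Qed.

Lemma cutB t h g : cut t (h - g) = cut t h - cut t g.
Proof. by apply/funext => z; rewrite /cut !fctE mulrBr. Qed.

Lemma nrm_cut t h : sq muT h -> nrm muT (cut t h) <= nrm muT h.
Proof.
move=> sh; rewrite ler_wsqrtr// /ip.
have s1 := sq_cut t sh; apply: le_Rintegral => //.
- exact: (sq_mul s1 s1).
- exact: (sq_mul sh sh).
move=> z _; rewrite -!expr2 -[leLHS]real_normK ?num_real// -[leRHS]real_normK ?num_real//.
by rewrite ler_sqr ?nnegrE// cut_norm.
Qed.

Lemma L2p_cut t h : L2p h -> L2p (cut t h).
Proof.
move=> [sh ah]; split; first exact: sq_cut.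
move=> s hs; have := mFM (@mF_cst R Omega (F s) (\1_(`[0, t]%classic : set R) s : R)) (ah s hs).
exact.
Qed.

Lemma tendsto_cut t hn h : tendsto muT hn h -> tendsto muT (fun n => cut t (hn n)) (cut t h).
Proof.
move=> [sn sh c]; split; [by move=> n; exact: sq_cut|exact: sq_cut|].
apply: (@squeeze_cvgr _ _ _ _ (fun=> 0) (fun n => nrm muT (hn n - h))) => //.
- by near=> n; rewrite nrm_ge0 -cutB nrm_cut//; apply: sqB.
- exact: cvg_cst.
Unshelve. all: by end_near. Qed.

Lemma cutT_ae h : {ae muT, forall z, cut T h z = h z}.
Proof.
have : {ae muT, forall z : TO, 0 <= z.1 <= T}.
 have [A [mA A0 AE]] := lamT_in T.
 exists (A `*` setT); split; first exact: measurableX.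
  rewrite (_ : muT _ = (lamT \x P)%E (A `*` setT))// product_measure1E//.
  by rewrite [X in (X * _)%E](_ : _ = 0%E) ?mul0e.
 by move=> z zA; split => //; apply: AE.
move=> hz; apply: (ae_imp hz) => z h1.
by rewrite /cut indicE mem_set ?mul1r//= in_itv.
Qed.

Lemma simple_J_iso H J H' J' k l t : simple H J -> simple H' J' -> 0 <= t <= T ->
 ip P (J k t) (J' l t) = (k == l)%:R * ip muT (cut t H) (cut t H').
Proof.
move=> sH sH' tT; have := simple_iso BF k l (simple_stop tT sH) (simple_stop tT sH').
by rewrite min_r//; case/andP: tT.
Qed.

Lemma simple_contr H J k t : simple H J -> 0 <= t <= T -> nrm P (J k t) <= nrm muT H.
Proof.
move=> sH tT; apply: le_trans (nrm_cut t (simple_sq BF sH)).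
by rewrite ler_wsqrtr// (simple_J_iso k k sH sH tT) eqxx mul1r.
Qed.

Lemma simple_opp H J : simple H J -> simple (- H) (fun k t => - J k t).
Proof.
move=> /(simple_scale (-1)); congr simple; first by apply/funext => z; rewrite mulN1r.
by apply/eq2_fun => k t; apply/funext => w; rewrite mulN1r.
Qed.

Lemma simple_sub H J H' J' : simple H J -> simple H' J' ->
 simple (H - H') (fun k t => J k t - J' k t).
Proof. by move=> sH sH'; apply: simple_add => //; exact: simple_opp. Qed.

Lemma simple_J0 H J k : simple H J -> J k 0 = 0.
Proof.
elim => [//|a b Z {}H {}J a0 ab bT mZ Zc sH ->].
by apply/funext => w; rewrite !fctE !min_l ?(le_trans a0)// subrr mul0r addr0.
Qed.

Lemma simple_past H J k s t V : simple H J -> 0 <= s -> s <= t -> t <= T ->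
 mF (F s) V -> sq P V -> ip P V (J k t - J k s) = 0.
Proof.
move=> sH s0 st tT mV sV; elim: sH => [|a b Z {}H {}J a0 ab bT mZ [c Zc] sH IH].
 by rewrite subrr ip0r.
have t0 := le_trans s0 st; have sT := le_trans st tT.
have sJ u : 0 <= u -> u <= T -> sq P (J k u) by move=> u0 uT; have [] := simple_J BF k sH u0 uT.
have mZ' := mF_meas_le BF (le_trans ab bT) mZ.
have key : sq P (elemJ W a b Z k t - elemJ W a b Z k s) /\
  ip P V (elemJ W a b Z k t - elemJ W a b Z k s) = 0.
 have [bs|sb] := leP b s.
  rewrite (_ : _ - _ = 0) ?ip0r; first by split => //; exact: sq0.
  apply/funext => w; rewrite /elemJ !fctE (min_r (le_trans bs st)) (min_r bs).
  by rewrite (min_r (le_trans ab (le_trans bs st))) (min_r (le_trans ab bs)) subrr.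
 have [ta|at_] := leP t a.
  rewrite (_ : _ - _ = 0) ?ip0r; first by split => //; exact: sq0.
  apply/funext => w; rewrite /elemJ !fctE (min_l (le_trans ta ab)) (min_l ta).
  by rewrite (min_l (le_trans st (le_trans ta ab))) (min_l (le_trans st ta)) !subrr.
 (* The increment that matters starts at max(a, s), where both Z and V are known. *)
 pose u := Num.max a s.
 have E : elemJ W a b Z k t - elemJ W a b Z k s =
   fun w => Z w * (W k (Num.min t b) w - W k u w).
  apply/funext => w; rewrite /elemJ !fctE (min_r (ltW at_)) (min_l (ltW sb)) /u.
  have [sa|as_] := leP s a.
   by rewrite subrr mul0r subr0 mulrC.
  by rewrite -mulrBl mulrC; congr (_ * _); lra.
 have u0 : 0 <= u by rewrite /u le_max a0.
 have ut : u <= Num.min t b by rewrite /u ge_max !le_min (ltW at_) ab st (ltW sb).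
 have mtT : Num.min t b <= T by rewrite ge_min tT.
 have mZu : mF (F u) Z by apply: (mF_mono BF _ mZ); rewrite /u le_max lexx.
 have mVu : mF (F u) V by apply: (mF_mono BF _ mV); rewrite /u le_max lexx orbT.
 have sVZ : sq P (fun w => Z w * V w) by apply: sq_bddM sV.
 have [_ e] := past_incr BF k u0 ut mtT (mFM mZu mVu) sVZ.
 have [s1 _] := past_incr BF k u0 ut mtT mZu (sq_bdd (P_fin P) mZ' Zc).
 rewrite E; split; first by [].
 by rewrite -[RHS]e /ip; congr Rintegral; apply/funext => w; rewrite mulrA (mulrC (V w)).
rewrite (_ : _ - _ = (elemJ W a b Z k t - elemJ W a b Z k s) + (J k t - J k s)).
 by case: key => k1 k2; rewrite ipDr// ?k2 ?IH ?addr0//; apply: sqB; exact: sJ.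
by apply/funext => w; rewrite /elemJ !fctE; ring.
Qed.

(* The Ito integral of h, characterized by the Ito isometry against simple integrands. *)
Definition ito (k : I) (h : TO -> R) (Y : R -> Omega -> R) :=
 [/\ L2p h, forall t, 0 <= t <= T -> sq P (Y t) /\ mF (F t) (Y t) &
   forall H J, simple H J -> forall t, 0 <= t <= T ->
    nrm P (J k t - Y t) <= nrm muT (H - h)].

(** The approximating integrand may depend on t and on the precision: by the isometry for simple
    integrands one good approximation controls all the others. *)
Lemma ito_crit k h Y : L2p h ->
 (forall t, 0 <= t <= T -> sq P (Y t) /\ mF (F t) (Y t)) ->
 (forall t e, 0 <= t <= T -> 0 < e -> exists H J,
  [/\ simple H J, nrm muT (H - h) <= e & nrm P (J k t - Y t) <= e]) ->
 ito k h Y.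
Proof.
move=> Lh HY h1; split => // H J sH t tT; apply/ler_addgt0Pr => e e0.
have [H' [J' [sH' n1 n2]]] := h1 t (e / 2) tT ltac:(by rewrite divr_gt0).
have [t0 tT'] := andP tT.
have [s1 _] := simple_J BF k sH t0 tT'.
have [s2 _] := simple_J BF k sH' t0 tT'.
have [s3 _] := HY t tT.
apply: (le_trans (nrm_tri s1 s2 s3)).
have h2 := simple_contr k (simple_sub sH sH') tT.
have h3 := nrm_tri (simple_sq BF sH) (L2p_sq Lh) (simple_sq BF sH').
rewrite (nrmBC _ h H') in h3; lra.
Qed.

(** Halving makes consecutive distances at most 4^-n. With deviations of size 2^-n the maximal
    inequality then yields exceptional events of probability at most 4^-n, which is summable. *)
Lemma simple_seq h : L2p h -> exists H J, forall n,
 simple (H n) (J n) /\ nrm muT (H n - h) <= 4^-1 ^+ n / 2.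
Proof.
move=> Lh.
have /choice[H /choice[J hJ]] : forall n, exists H J, simple H J /\ nrm muT (H - h) <= 4^-1 ^+ n / 2.
 move=> n; have [|H [J [sH hn]]] := @simple_dense _ _ _ _ _ _ _ _ _ BF h (4^-1 ^+ n / 2) Lh.
  by rewrite divr_gt0// exprn_gt0// invr_gt0.
 by exists H, J; split => //; exact: ltW.
by exists H, J.
Qed.

Lemma quarter_le n : (4^-1 : R) ^+ n / 2 <= 2^-1 ^+ n.
Proof.
have h : (4^-1 : R) ^+ n <= 2^-1 ^+ n.
 by apply: lerXn2r; rewrite ?nnegrE ?invr_ge0// lef_pV2 ?posrE// ler_nat.
have h0 : 0 <= (4^-1 : R) ^+ n by rewrite exprn_ge0// invr_ge0.
lra.
Qed.

Lemma ito_seq k h Y : ito k h Y -> exists H J,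
 [/\ forall n, simple (H n) (J n), tendsto muT H h &
   forall t, 0 <= t <= T -> tendsto P (fun n => J n k t) (Y t)].
Proof.
move=> [Lh HY hY]; have [H [J hJ]] := simple_seq Lh.
exists H, J; split; first by move=> n; case: (hJ n).
 apply: (@tendstoP _ _ _ _ _ _ 1); [by move=> n; exact: (simple_sq BF (hJ n).1)|exact: L2p_sq Lh|].
 by move=> n; rewrite mul1r; apply: le_trans (quarter_le n); case: (hJ n).
move=> t tT; have [t0 tT'] := andP tT; have [sY _] := HY t tT.
apply: (@tendstoP _ _ _ _ _ _ 1) => //; first by move=> n; have [] := simple_J BF k (hJ n).1 t0 tT'.
move=> n; rewrite mul1r; apply: le_trans (quarter_le n).
by have [sn hn] := hJ n; apply: le_trans hn; apply: hY.
Qed.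

Lemma ito_iso k l h g Y Z t : ito k h Y -> ito l g Z -> 0 <= t <= T ->
 ip P (Y t) (Z t) = (k == l)%:R * ip muT (cut t h) (cut t g).
Proof.
move=> iY iZ tT; have [H [J [sH tH tJ]]] := ito_seq iY; have [H' [J' [sH' tH' tJ']]] := ito_seq iZ.
have h1 := tendsto_ip (tJ t tT) (tJ' t tT).
have h2 := tendsto_ip (tendsto_cut t tH) (tendsto_cut t tH').
have h3 : (fun n => ip P (J n k t) (J' n l t)) @ \oo --> (k == l)%:R * ip muT (cut t h) (cut t g).
 rewrite (_ : (fun n => _) = (fun n => (k == l)%:R * ip muT (cut t (H n)) (cut t (H' n)))).
  exact: cvgMr.
 by apply/funext => n; rewrite (simple_J_iso k l (sH n) (sH' n) tT).
exact: (cvg_unique _ h1 h3).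
Qed.

Lemma ito_past k h Y s t V : ito k h Y -> 0 <= s -> s <= t -> t <= T ->
 mF (F s) V -> sq P V -> ip P V (Y t - Y s) = 0.
Proof.
move=> iY s0 st tT mV sV; have [H [J [sH tH tJ]]] := ito_seq iY.
have t1 : 0 <= t <= T by rewrite tT (le_trans s0).
have t2 : 0 <= s <= T by rewrite s0 (le_trans st).
have h0 := tendstoZ (-1) (tJ s t2).
have e1 X : (fun w : Omega => -1 * X w) = - X :> (Omega -> R).
 by apply/funext => w; rewrite mulN1r.
have h1 := tendsto_ip (tendsto_cst sV) (tendstoD (tJ t t1) h0).
have h2 : (fun n => ip P V (J n k t + (fun w => -1 * J n k s w))) @ \oo --> (0 : R).
 rewrite (_ : (fun n => _) = (fun=> 0)); first exact: cvg_cst.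
 by apply/funext => n; rewrite e1 (simple_past k (sH n)).
by rewrite e1 in h1; exact: (cvg_unique _ h1 h2).
Qed.

Lemma tendsto_small d' (X : measurableType d') (mu : {measure set X -> \bar R})
 (fn : nat -> X -> R) f e : tendsto mu fn f -> 0 < e -> \forall n \near \oo, nrm mu (fn n - f) <= e.
Proof.
move=> [_ _ /cvgrPdist_le h] e0; have := h _ e0; apply: filterS => n.
by rewrite sub0r normrN ger0_norm// nrm_ge0.
Qed.

Lemma ito_critS k h Y (H : nat -> TO -> R) J : L2p h ->
 (forall t, 0 <= t <= T -> mF (F t) (Y t)) -> (forall n, simple (H n) (J n)) ->
 tendsto muT H h -> (forall t, 0 <= t <= T -> tendsto P (fun n => J n k t) (Y t)) ->
 ito k h Y.
Proof.
move=> Lh mY sH tH tJ; apply: ito_crit => // t.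
 by move=> tT; split; [have [] := tJ t tT|exact: mY].
move=> e tT e0; have h1 := tendsto_small tH e0; have h2 := tendsto_small (tJ t tT) e0.
near \oo => n; exists (H n), (J n); split => //; first by near: n.
by near: n.
Unshelve. all: by end_near. Qed.

Lemma itoD k h g Y Z : ito k h Y -> ito k g Z -> ito k (h + g) (fun t => Y t + Z t).
Proof.
move=> iY iZ; have [H [J [sH tH tJ]]] := ito_seq iY; have [H' [J' [sH' tH' tJ']]] := ito_seq iZ.
have [Lh hY _] := iY; have [Lg hZ _] := iZ.
apply: (@ito_critS _ _ _ (fun n => H n + H' n) (fun n k t => J n k t + J' n k t)).
- exact: L2pD.
- by move=> t tT; apply: mFD; [have [] := hY t tT|have [] := hZ t tT].
- by move=> n; exact: simple_add.
- exact: tendstoD.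
- by move=> t tT; apply: tendstoD; [exact: tJ|exact: tJ'].
Qed.

Lemma itoZ c k h Y : ito k h Y -> ito k (fun z => c * h z) (fun t => fun w => c * Y t w).
Proof.
move=> iY; have [H [J [sH tH tJ]]] := ito_seq iY; have [Lh hY _] := iY.
apply: (@ito_critS _ _ _ (fun n z => c * H n z) (fun n k t => fun w => c * J n k t w)).
- exact: L2pZ.
- by move=> t tT; apply: mFM; [exact: mF_cst|have [] := hY t tT].
- by move=> n; exact: simple_scale.
- exact: tendstoZ.
- by move=> t tT; apply: tendstoZ; exact: tJ.
Qed.

Lemma ito_ae k h h' Y : ito k h Y -> L2p h' -> {ae muT, forall z, h z = h' z} -> ito k h' Y.
Proof.
move=> [Lh hY iY] Lh' e; split => // H J sH t tT.
apply: (le_trans (iY _ _ sH t tT)); rewrite le_eqVlt; apply/orP; left; apply/eqP.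
have sH' := simple_sq BF sH.
apply: nrm_ae; [exact: sq_meas (sqB sH' (L2p_sq Lh))|exact: sq_meas (sqB sH' (L2p_sq Lh'))|].
by apply: (ae_imp e) => z ez; rewrite !fctE ez.
Qed.

End ito_relation.

(** * Continuity on an interval and dyadic grids *)

Section real_sequences.
Context {R : realType}.

Lemma half_ge0 n : 0 <= (2^-1 : R) ^+ n.
Proof. by rewrite exprn_ge0// invr_ge0. Qed.

Lemma half_gt0 n : 0 < (2^-1 : R) ^+ n.
Proof. by rewrite exprn_gt0// invr_gt0. Qed.

Lemma fast_cvg (u : nat -> R) n0 : (forall n, (n0 <= n)%N -> `|u n.+1 - u n| <= 2^-1 ^+ n) ->
 exists l, u @ \oo --> l /\ forall n, (n0 <= n)%N -> `|u n - l| <= 2 * 2^-1 ^+ n.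
Proof.
move=> h.
have tail n m : (n0 <= n)%N -> `|u n - u (n + m)%N| <= 2 * 2^-1 ^+ n.
 move=> hn; rewrite distrC -(@telescope_sumr _ n (n + m) u) ?leq_addr//.
 apply: (le_trans (ler_norm_sum _ _ _)); apply: le_trans (sum_half_le n (n + m)).
 rewrite big_seq [leRHS]big_seq; apply: ler_sum => i; rewrite mem_index_iota => /andP[ni _].
 exact: (h _ (leq_trans hn ni)).
have cs : cvgn (series (fun k => u (k + n0).+1 - u (k + n0)%N)).
 apply: normed_cvg; apply: nondecreasing_is_cvgn.
  by apply/nondecreasing_seqP => n; rewrite /= !seriesEnat/= big_nat_recr//= lerDl.
 exists (2 * 2^-1 ^+ n0) => _ [n _ <-]; rewrite /= seriesEnat/=.
 apply: (le_trans _ (sum_half_le n0 (n + n0))).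
 have -> : \sum_(n0 <= k < n + n0) (2^-1 : R) ^+ k = \sum_(0 <= k < n) 2^-1 ^+ (k + n0).
  by rewrite -{1}(add0n n0) big_addn addnK.
 by apply: ler_sum => i _; rewrite h// leq_addl.
have [l ul] : exists l : R, u @ \oo --> l.
 move/cvg_ex : cs => [l hl]; exists (l + u n0).
 rewrite -(cvg_shiftn n0).
 have h2 : (fun=> u n0) @ \oo --> u n0 by exact: cvg_cst.
 rewrite (_ : (fun n => u (n + n0)%N) = (series (fun k => u (k + n0).+1 - u (k + n0)%N)) \+
  (fun=> u n0)); first exact: cvgD hl h2.
 apply/esym/funext => n; rewrite seriesEnat/=.
 rewrite (eq_bigr (fun k => u (k.+1 + n0)%N - u (k + n0)%N)); last by move=> i _; rewrite addSn.
 by rewrite (@telescope_sumr _ 0 n (fun k => u (k + n0)%N))// add0n subrK.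
exists l; split => // n hn; apply/ler_addgt0Pr => e e0.
have hl : \forall m \near \oo, `|l - u m| <= e by move/cvgrPdist_le : ul => /(_ _ e0).
have hm : \forall m \near \oo, (n <= m)%N by exact: nbhs_infty_ge.
near \oo => m.
have m1 : `|l - u m| <= e by near: m.
have m2 : (n <= m)%N by near: m.
rewrite (_ : u n - l = (u n - u m) + (u m - l)); last by ring.
apply: (le_trans (ler_normD _ _)); rewrite (distrC (u m)); apply: lerD => //.
by rewrite -(subnKC m2); exact: tail.
Unshelve. all: by end_near. Qed.

Lemma within_uniform_limit (D : set R) (f : nat -> R -> R) (g : R -> R) n0 :
 (forall n, {within D, continuous (f n)}) ->
 (forall n t, (n0 <= n)%N -> D t -> `|f n t - g t| <= 2 * 2^-1 ^+ n) ->
 {within D, continuous g}.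
Proof.
move=> cf h; apply/subspace_continuousP => x Dx; apply/cvgrPdist_le => e e0.
have [m hm] : exists m, (2^-1 : R) ^+ m < e / 8 by apply: half_small; rewrite divr_gt0.
pose n := maxn n0 m.
have hn : (2^-1 : R) ^+ n < e / 8.
 by apply: le_lt_trans hm; apply: ler_wiXn2l; rewrite ?invr_ge0// ?invf_le1// ?ler1n// leq_maxr.
have nn0 : (n0 <= n)%N by rewrite leq_maxl.
have := (subspace_continuousP _ _).1 (cf n) x Dx.
move/cvgrPdist_le => /(_ (e / 2)) hf.
have e2 : 0 < e / 2 by rewrite divr_gt0.
move: (hf e2); rewrite !near_withinE => h0; apply: filterS h0 => y hy Dy.
have h1 := h n x nn0 Dx; have h2 := h n y nn0 Dy; have h3 := hy Dy.
rewrite (_ : g x - g y = (f n x - f n y) + ((f n y - g y) - (f n x - g x))); last by ring.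
apply: (le_trans (ler_normD _ _)); have := ler_normB (f n y - g y) (f n x - g x); lra.
Qed.

Lemma within_comp (D : set R) (f g : R -> R) : {within D, continuous f} ->
 continuous g -> (forall x, D x -> D (g x)) -> {within D, continuous (f \o g)}.
Proof.
move=> cf cg Dg; apply/subspace_continuousP => x Dx.
apply: (@cvg_comp _ _ _ g f _ (within D (nbhs (g x)))); last first.
 by move/subspace_continuousP : cf; apply; exact: Dg.
move=> A hA; change (nbhs x [set y | D y -> A (g y)]).
have h : nbhs x [set y | D (g y) -> A (g y)] by exact: cg x _ hA.
by apply: filterS h => y /= hy Dy; apply: hy; exact: Dg.
Qed.

Lemma within_add (D : set R) (f g : R -> R) : {within D, continuous f} ->
 {within D, continuous g} -> {within D, continuous (fun t => f t + g t)}.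
Proof.
move=> /subspace_continuousP cf /subspace_continuousP cg; apply/subspace_continuousP => x Dx.
by apply: cvgD; [exact: cf|exact: cg].
Qed.

Lemma within_sub (D : set R) (f g : R -> R) : {within D, continuous f} ->
 {within D, continuous g} -> {within D, continuous (fun t => f t - g t)}.
Proof.
move=> /subspace_continuousP cf /subspace_continuousP cg; apply/subspace_continuousP => x Dx.
by apply: cvgB; [exact: cf|exact: cg].
Qed.

Lemma within_scale (D : set R) (f : R -> R) c : {within D, continuous f} ->
 {within D, continuous (fun t => f t * c)}.
Proof.
move=> /subspace_continuousP cf; apply/subspace_continuousP => x Dx.
by apply: cvgMl; exact: cf.
Qed.

Lemma min_continuous (u : R) : continuous (fun t : R => Num.min t u).
Proof.
move=> x; apply/cvgrPdist_le => e e0.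
near=> y; apply: (@le_trans _ _ `|x - y|).
 have h3 := ler_norm (x - y); have := ler_norm (- (x - y)); rewrite normrN => h4.
 have [h1|h1] := leP x u; have [h2|h2] := leP y u; rewrite ?subrr ?normr0 ?normr_ge0//;
  by rewrite ler_norml; apply/andP; split; lra.
by near: y; move: e e0; apply/cvgrPdist_le; exact: cvg_id.
Unshelve. all: by end_near. Qed.

Lemma within_cst (D : set R) c : {within D, continuous (fun=> c : R)}.
Proof. by apply/subspace_continuousP => x Dx; exact: cvg_cst. Qed.

Variable T : R.
Hypothesis T0 : 0 < T.

Definition dyadic (m i : nat) : R := T * i%:R * 2^-1 ^+ m.

Definition dyadic_floor (m : nat) (t : R) : nat := Num.truncn (t * 2 ^+ m / T).

Lemma dyadic_floorP m t : 0 <= t -> dyadic m (dyadic_floor m t) <= t < dyadic m (dyadic_floor m t).+1.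
Proof.
move=> t0; have p : 0 < (2 : R) ^+ m by rewrite exprn_gt0.
have h : 0 <= t * 2 ^+ m / T by rewrite !mulr_ge0 ?invr_ge0// ltW.
have := truncn_itv h; rewrite -/(dyadic_floor m t) /dyadic exprVn.
rewrite ler_pdivlMr// ltr_pdivrMr// => /andP[h1 h2].
by rewrite ler_pdivrMr// ltr_pdivlMr// ![T * _]mulrC h1 h2.
Qed.

Lemma dyadic_floor_le m t : 0 <= t <= T -> (dyadic_floor m t <= 2 ^ m)%N.
Proof.
move=> /andP[t0 tT]; rewrite truncn_le_nat ltr_pdivrMr//.
have h : t * 2 ^+ m <= T * 2 ^+ m by rewrite ler_wpM2r// exprn_ge0.
by apply: (le_lt_trans h); rewrite mulrC ltr_pM2r// -natrX ltr_nat.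
Qed.

Lemma dyadic_in m i : (i <= 2 ^ m)%N -> 0 <= dyadic m i <= T.
Proof.
move=> h; have p : 0 < (2 : R) ^+ m by rewrite exprn_gt0.
apply/andP; split; first by rewrite !mulr_ge0 ?half_ge0// ltW.
rewrite /dyadic exprVn ler_pdivrMr//; apply: ler_wpM2l; first exact: ltW.
by rewrite -natrX ler_nat.
Qed.

Lemma dyadic_cvg t : 0 <= t -> (fun m => dyadic m (dyadic_floor m t)) @ \oo --> t.
Proof.
move=> t0; apply: (@squeeze_cvgr _ _ _ _ (fun m => t - T * 2^-1 ^+ m) (fun=> t)).
- near=> m; have /andP[h1 h2] := dyadic_floorP m t0; rewrite h1 andbT.
 move: h2; rewrite {1}/dyadic -addn1 natrD mulrDr mulr1 mulrDl -/(dyadic m _); lra.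
- rewrite -[X in _ --> X]subr0 -[X in _ --> _ - X](mulr0 T); apply: cvgB; first exact: cvg_cst.
 by apply: cvgMr; exact: half_cvg.
- exact: cvg_cst.
Unshelve. all: by end_near. Qed.

Lemma dyadic_le m i j : (i <= j)%N -> dyadic m i <= dyadic m j.
Proof.
move=> ij; apply: ler_wpM2r; first exact: half_ge0.
by apply: ler_wpM2l; [exact: ltW|rewrite ler_nat].
Qed.

Definition dyadics m : seq R := [seq dyadic m i | i <- iota 0 (2 ^ m).+1].

Lemma dyadicsP m t : reflect (exists2 i, (i <= 2 ^ m)%N & t = dyadic m i) (t \in dyadics m).
Proof.
apply: (iffP mapP) => -[i]; first by rewrite mem_iota add0n ltnS => /andP[_ h] ->; exists i.
by move=> h ->; exists i => //; rewrite mem_iota.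
Qed.

Lemma dyadicsS m t : t \in dyadics m -> t \in dyadics m.+1.
Proof.
move=> /dyadicsP[i h ->]; apply/dyadicsP; exists (2 * i)%N.
 by rewrite expnS leq_mul2l h orbT.
by rewrite /dyadic exprS natrM; field.
Qed.

Lemma dyadics_sorted m : sorted <=%R (dyadics m).
Proof.
by apply: homo_sorted (iota_sorted 0 (2 ^ m).+1) => i j; exact: dyadic_le.
Qed.

Lemma dyadics_path m : path <=%R 0 (dyadics m).
Proof.
rewrite path_min_sorted ?dyadics_sorted//; apply/allP => t /dyadicsP[i h ->].
by case/andP: (dyadic_in h).
Qed.

Lemma dyadics_dense (f : R -> R) c : {within `[0, T], continuous f} ->
 (forall m t, t \in dyadics m -> `|f t| <= c) -> forall t, 0 <= t <= T -> `|f t| <= c.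
Proof.
move=> cf h t tT; have [t0 _] := andP tT.
have D m : dyadic m (dyadic_floor m t) \in dyadics m.
 by apply/dyadicsP; eexists; [exact: dyadic_floor_le tT|].
have fc : (fun m => f (dyadic m (dyadic_floor m t))) @ \oo --> f t.
 apply: (within_seq cf) => /=; [by rewrite in_itv| |exact: dyadic_cvg].
 by move=> m; rewrite in_itv/=; exact: dyadic_in (dyadic_floor_le m tT).
apply/ler_addgt0Pr => e e0; move/cvgrPdist_le : fc => /(_ _ e0) fc.
near \oo => m.
have m1 : `|f t - f (dyadic m (dyadic_floor m t))| <= e by near: m.
rewrite -[f t](subrK (f (dyadic m (dyadic_floor m t)))).
apply: (le_trans (ler_normD _ _)); rewrite addrC; apply: lerD => //; exact: h (D m).
Unshelve. all: by end_near. Qed.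

End real_sequences.

Section joint_measurability.
Context {R : realType} {d} {Omega : measurableType d} (T : R) (T0 : 0 < T).
Notation TO := (measurableTypeR R * Omega)%type.

(** The step functions with values taken at the left dyadic points are jointly measurable, and they
    converge to Y because the paths are continuous. *)
Lemma joint_meas (Y : R -> Omega -> R) :
 (forall t, 0 <= t <= T -> meas_fun (Y t)) ->
 (forall w, {within `[0, T], continuous (Y ^~ w)}) ->
 meas_fun (cut T (fun z : TO => Y z.1 z.2)).
Proof.
move=> mY cY.
(* The last cell starts at T itself; without it the time t = T would be lost. *)
pose g m (z : TO) := \sum_(i < (2 ^ m).+1)
 (\1_(`[dyadic T m i, dyadic T m i.+1[%classic : set R) z.1 : R) * Y (dyadic T m i) z.2.
have mg m : meas_fun (g m).
 apply: measurable_sum => i; apply: measurable_funM.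
  apply: (measurableT_comp (f := (\1_(`[dyadic T m i, dyadic T m i.+1[%classic)
   : measurableTypeR R -> R)) (g := fst)) => //.
 apply: (measurableT_comp (g := snd)) => //; apply: mY; apply: dyadic_in => //.
 by rewrite -ltnS.
have mf := measurable_flim mg.
rewrite (_ : cut _ _ = cut T (flim g)).
 by apply: measurable_funM => //; exact: measurable_cut_indic.
apply/funext => -[t w]; rewrite /cut !indicE/=.
have [tT|_] := boolP (t \in _); last by rewrite !mul0r.
rewrite !mul1r; move: tT; rewrite inE/= in_itv/= => tT; have [t0 _] := andP tT.
apply/esym/flim_cvg.
rewrite (_ : (fun m => _) = (fun m => Y (dyadic T m (dyadic_floor T m t)) w)).
 apply: (within_seq (cY w)) => /=; [by rewrite in_itv| |exact: dyadic_cvg].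
 by move=> m; rewrite in_itv/=; exact: (dyadic_in T0 (dyadic_floor_le T0 m tT)).
apply/funext => m; have h := dyadic_floor_le T0 m tT; rewrite -ltnS in h.
rewrite /g (bigD1 (Ordinal h))//= big1 ?addr0 => [|i ni].
 by rewrite indicE mem_set ?mul1r//= in_itv/= dyadic_floorP.
rewrite indicE; case: (boolP (t \in _)); rewrite ?mul0r// inE/= in_itv/= => /andP[h1 h2].
have /andP[h3 h4] := dyadic_floorP T0 m t0.
case/eqP: ni; apply/val_inj/eqP => /=; rewrite eqn_leq; apply/andP; split.
 rewrite leqNgt; apply/negP => /(dyadic_le T0 m) h5.
 by have := lt_le_trans h4 (le_trans h5 h1); rewrite ltxx.
rewrite leqNgt; apply/negP => /(dyadic_le T0 m) h5.
by have := lt_le_trans h2 (le_trans h5 h3); rewrite ltxx.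
Qed.

End joint_measurability.

(** * Maximal inequality and continuous versions of Ito integrals *)

Section continuous_versions.
Context {R : realType} {d} {Omega : measurableType d}
 (P : probability Omega R) (T : R) (I : finType) (W : I -> R -> Omega -> R)
 (F : R -> set_system Omega) (E0 : nat -> set Omega) (BF : brownian_filtration P T W F E0).

Notation TO := (measurableTypeR R * Omega)%type.
Notation muT := (muT P T).
Notation simple := (simple T W F).
Notation L2p := (L2p P T F).
Notation ito := (ito P T W F).

Let T0 : 0 < T := bf_T BF.
Let Fs t : sigma_algebra setT (F t) := bf_sigma BF t.

Lemma F_setC t A : F t A -> F t (~` A).
Proof. by move=> FA; have [_ h _] := Fs t; rewrite -setTD; exact: h. Qed.

Lemma F_setI t A B : F t A -> F t B -> F t (A `&` B).
Proof. exact: sigma_algebraI. Qed.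

Lemma integ_indicM A (f : Omega -> R) : measurable A -> integ P f ->
 integ P (fun w => \1_A w * f w).
Proof. by move=> mA; apply: integ_le1M; [exact: measurable_indic|exact: indic_le1]. Qed.

Lemma integ_cstP c : integ P (fun=> c).
Proof. exact: finite_measure_integrable_cst. Qed.

Lemma Rint_indicP A : measurable A -> \int[P]_w (\1_A w : R) = fine (P A).
Proof. by move=> mA; rewrite /Rintegral integral_indic// setIT. Qed.

(** The increment from t to T is orthogonal to Y_t times the indicator of D, so the mean square on D
    splits into two squares. *)
Lemma ito_submart k h Y t D : ito k h Y -> 0 <= t <= T -> F t D ->
 \int[P]_w (\1_D w * Y t w ^+ 2) <= \int[P]_w (\1_D w * Y T w ^+ 2).
Proof.
move=> iY tT FD; have [t0 tT'] := andP tT; have [Lh hY _] := iY.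
have [st mt] := hY t tT.
have [sT _] := hY T ltac:(by rewrite lexx ltW).
have mD : measurable D by exact: (bf_meas BF tT').
have s1 : sq P (fun w => \1_D w * Y t w).
 by apply: sq_bddM st; [exact: measurable_indic|exact: indic_le1].
have m1 : mF (F t) (fun w => \1_D w * Y t w) by apply: mFM => //; exact: mF_indic.
have z := ito_past BF iY t0 tT' (lexx T) m1 s1.
have s2 : sq P (fun w => \1_D w * (Y T - Y t) w).
 by apply: sq_bddM; [exact: measurable_indic|exact: indic_le1|exact: sqB].
have i1 := integ_indicM mD (sq_mul st st).
have i2 := sq_mul s2 s2.
have i3 := sq_mul s1 (sqB sT st).
have -> : \int[P]_w (\1_D w * Y T w ^+ 2) = \int[P]_w (\1_D w * (Y t w * Y t w)) +
  (ip P (fun w => \1_D w * (Y T - Y t) w) (fun w => \1_D w * (Y T - Y t) w) +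
  2 * ip P (fun w => \1_D w * Y t w) (Y T - Y t)).
 rewrite /ip -RintegralZl//.
 rewrite -RintegralD//; last exact: (integZ 2 i3).
 rewrite -RintegralD//; last by apply: integD => //; exact: (integZ 2 i3).
 congr Rintegral; apply/funext => w; rewrite !fctE indicE; case: (_ \in _) => /=; ring.
rewrite z mulr0 addr0; apply: (@le_trans _ _ (\int[P]_w (\1_D w * (Y t w * Y t w)))).
 by rewrite le_eqVlt; apply/orP; left; apply/eqP; congr Rintegral.
by rewrite lerDl; exact: ip_ge0.
Qed.

Definition exceeds (Y : R -> Omega -> R) c (s : seq R) : set Omega :=
 [set w | has (fun t => c < `|Y t w|) s].

Lemma exceeds_cons Y c t s : exceeds Y c (t :: s) = [set w | c < `|Y t w|] `|` exceeds Y c s.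
Proof. by apply/seteqP; split => w; rewrite /exceeds/= => /orP. Qed.

Lemma exceed1_F (Y : R -> Omega -> R) c t : mF (F t) (Y t) -> F t [set w | c < `|Y t w|].
Proof.
move=> mY; have h : mF (F t) (fun w => `|Y t w|).
 by apply: (@mF_comp _ _ _ _ (fun x => `|x|) _ mY); exact: normr_measurable.
have := (mFP _ (Fs t)).1 h `]c, +oo[%classic (measurable_itv _).
by congr (F t); apply/seteqP; split => w /=; rewrite in_itv/= andbT.
Qed.

Lemma exceeds_meas k h Y c s : ito k h Y -> {in s, forall t, 0 <= t <= T} ->
 measurable (exceeds Y c s).
Proof.
move=> [_ hY _]; elim: s => [|t s IH] hs.
 by rewrite (_ : exceeds _ _ _ = set0)//; apply/seteqP; split => w.
have tT : 0 <= t <= T by apply: hs; rewrite inE eqxx.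
rewrite exceeds_cons; apply: measurableU; last by apply: IH => u us; apply: hs; rewrite inE us orbT.
have [_ mt] := hY t tT; have [_ tT'] := andP tT.
exact: (bf_meas BF tT' (exceed1_F c mt)).
Qed.

(** Doob's inequality on a finite list of times, by induction on the list in place of a stopping
    time. The event A is split according to whether the first time already exceeds c; the induction
    continues on the part where it does not, which is known at that time. *)
Lemma ito_maximal k h Y c a s A : ito k h Y -> 0 <= c -> 0 <= a <= T -> F a A ->
 path <=%R a s -> {in s, forall t, 0 <= t <= T} ->
 \int[P]_w (\1_(A `&` exceeds Y c s) w * c ^+ 2) <= \int[P]_w (\1_A w * Y T w ^+ 2).
Proof.
move=> iY c0; have [Lh hY _] := iY.
have [sT _] := hY T ltac:(by rewrite lexx ltW).
have iT B : measurable B -> integ P (fun w => \1_B w * Y T w ^+ 2).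
 by move=> mB; apply: integ_indicM => //; have [_] := sT.
have pos B : 0 <= \int[P]_w (\1_B w * Y T w ^+ 2).
 by apply: Rintegral_ge0 => w _; rewrite mulr_ge0 ?sqr_ge0// indicE.
have icst B : measurable B -> integ P (fun w => \1_B w * c ^+ 2).
 by move=> mB; apply: integ_indicM => //; exact: integ_cstP.
elim: s a A => [|t s IH] a A aT FA /=.
 move=> _ _; rewrite (_ : exceeds _ _ _ = set0); last by apply/seteqP; split => w.
 rewrite setI0; apply: (le_trans _ (pos A)).
 rewrite (_ : (fun w => _) = (fun=> 0)) ?Rintegral_cst ?mul0r//.
 by apply/funext => w; rewrite indic0 mul0r.
move=> /andP[at_ pts] hs.
have tT : 0 <= t <= T by apply: hs; rewrite inE eqxx.
have hs' : {in s, forall t, 0 <= t <= T} by move=> u us; apply: hs; rewrite inE us orbT.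
have [_ mt] := hY t tT; have [st _] := hY t tT; have [_ tT'] := andP tT.
have FtA : F t A by exact: (bf_mono BF at_).
pose B := [set w | c < `|Y t w|]; have FB : F t B by exact: exceed1_F.
have FAB : F t (A `&` B) by exact: F_setI.
have FAC : F t (A `&` ~` B) by apply: F_setI => //; exact: F_setC.
have mAB := bf_meas BF tT' FAB; have mAC := bf_meas BF tT' FAC.
have mE : measurable ((A `&` ~` B) `&` exceeds Y c s).
 by apply: measurableI => //; exact: (exceeds_meas c iY hs').
have h1 := IH t _ tT FAC pts hs'.
have h2 := ito_submart iY tT FAB.
have h3 : \int[P]_w (\1_(A `&` B) w * c ^+ 2) <= \int[P]_w (\1_(A `&` B) w * Y t w ^+ 2).
 apply: le_Rintegral => //.
 - exact: icst.
 - by apply: integ_indicM => //; have [_] := st.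
 move=> w _; rewrite indicE; case: (boolP (w \in _)); rewrite ?mul0r// inE => -[_ Bw].
 rewrite !mul1r -[leRHS]real_normK ?num_real// ler_sqr ?nnegrE//; exact: ltW.
have E1 : \int[P]_w (\1_A w * Y T w ^+ 2) =
  \int[P]_w (\1_(A `&` B) w * Y T w ^+ 2) + \int[P]_w (\1_(A `&` ~` B) w * Y T w ^+ 2).
 rewrite -RintegralD//; [|exact: iT|exact: iT].
 congr Rintegral; apply/funext => w; rewrite -mulrDl; congr (_ * _).
 rewrite !indicE !in_setI in_setC; case: (w \in A); case: (w \in B); rewrite /=; lra.
have E2 : \int[P]_w (\1_(A `&` exceeds Y c (t :: s)) w * c ^+ 2) =
  \int[P]_w (\1_(A `&` B) w * c ^+ 2) +
  \int[P]_w (\1_((A `&` ~` B) `&` exceeds Y c s) w * c ^+ 2).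
 rewrite -RintegralD//; [|exact: icst|exact: icst].
 congr Rintegral; apply/funext => w; rewrite -mulrDl; congr (_ * _).
 rewrite exceeds_cons !indicE !in_setI in_setU in_setC.
 by case: (w \in A); case: (w \in [set w0 | _]); case: (w \in exceeds _ _ _) => /=; rewrite ?addr0 ?add0r.
by rewrite E1 E2; apply: lerD => //; apply: (le_trans h3).
Qed.

Lemma simple_ito k H J : simple H J -> ito k H (J k).
Proof.
move=> sH; split; first exact: (simple_L2p BF sH).
 by move=> t /andP[t0 tT]; exact: (simple_J BF k sH t0 tT).
by move=> H' J' sH' t tT; apply: (simple_contr BF k (simple_sub sH' sH) tT).
Qed.

Lemma simple_cont k H J w : simple H J -> {within `[0, T], continuous (W k ^~ w)} ->
 {within `[0, T], continuous (J k ^~ w)}.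
Proof.
move=> sH cW; elim: sH => [|a b Z {}H {}J a0 ab bT mZ Zc sH IH]; first exact: within_cst.
have c1 u : 0 <= u -> u <= T -> {within `[0, T], continuous (fun t => W k (Num.min t u) w)}.
 move=> u0 uT; apply: (within_comp (g := fun t => Num.min t u) cW).
  exact: min_continuous.
 by move=> x /=; rewrite !in_itv/= => /andP[x0 xT]; rewrite le_min x0 u0 ge_min xT.
apply: within_add => //; apply: within_scale; apply: within_sub; apply: c1 => //.
- exact: le_trans ab.
- exact: le_trans bT.
Qed.

(** The exceedance events of the dyadic grids increase, so their union obeys the bound common to all
    grids; continuity of the paths carries the estimate from the grids to all times. *)
Lemma simple_sup k H J c : simple H J -> 0 < c -> exists A,
 [/\ measurable A, (P A <= ((nrm muT H / c) ^+ 2)%:E)%E &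
 forall w, ~ A w -> {within `[0, T], continuous (W k ^~ w)} ->
  forall t, 0 <= t <= T -> `|J k t w| <= c].
Proof.
move=> sH c0; have iJ := simple_ito k sH.
pose B m := exceeds (J k) c (dyadics T m).
have hin m : {in dyadics T m, forall t, 0 <= t <= T}.
 by move=> t /dyadicsP[i h ->]; exact: dyadic_in.
have mB m : measurable (B m) by exact: (exceeds_meas c iJ (hin m)).
have mU : measurable (\bigcup_m B m) by exact: bigcup_measurable.
have PB m : (P (B m) <= ((nrm muT H / c) ^+ 2)%:E)%E.
 have T00 : 0 <= (0 : R) <= T by rewrite lexx ltW.
 have FT : F 0 setT by exact: sigma_algebraT.
 have := ito_maximal iJ (ltW c0) T00 FT (dyadics_path T0 m) (hin m).
 rewrite setTI -/(B m) RintegralZr//; last exact: (integ_le (measurable_indic (mB m)) (integ_cstP 1) (indic_le1 (B m))).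
 rewrite Rint_indicP// => h.
 have sT := simple_contr BF k sH (_ : 0 <= T <= T).
 have {sT}sT : nrm P (J k T) <= nrm muT H by apply: sT; rewrite lexx ltW.
 have h2 : \int[P]_w (\1_setT w * J k T w ^+ 2) <= nrm muT H ^+ 2.
  apply: (@le_trans _ _ (nrm P (J k T) ^+ 2)); last by rewrite ler_sqr ?nnegrE ?nrm_ge0.
  rewrite sqr_nrm le_eqVlt; apply/orP; left; apply/eqP; congr Rintegral.
  by apply/funext => w; rewrite indicT mul1r.
 rewrite -[P (B m)]fineK ?fin_num_measure// lee_fin expr_div_n ler_pdivlMr ?exprn_gt0//.
 exact: le_trans h2.
exists (\bigcup_m B m); split => //.
 have hB : {homo B : n m / (n <= m)%N >-> (n <= m)%O}.
  apply: homo_leq => [A|A A' A''|m]; [exact: subset_refl| |].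
   by move=> h1 h2; apply/subsetPset; apply: subset_trans; [exact/subsetPset/h1|exact/subsetPset/h2].
  apply/subsetPset => w /hasP[t tm ht]; apply/hasP; exists t => //; exact: dyadicsS.
 have hc := nondecreasing_cvg_mu (mu := P) mB mU hB.
 rewrite -(cvg_lim _ hc)//; apply: lime_le; first by apply/cvg_ex; eexists; exact: hc.
 by apply: nearW => m /=.
move=> w nA cW; apply: (dyadics_dense T0 (simple_cont sH cW)) => m t tm.
rewrite leNgt; apply/negP => h; apply: nA; exists m => //.
by apply/hasP; exists t.
Qed.

(** By [simple_sup] and the Borel-Cantelli lemma the integrals of fast simple approximations
    converge uniformly in time for almost every path; mean square convergence identifies the limit
    as the Ito integral. *)
Lemma ito_exists k h : L2p h -> exists Y, [/\ ito k h Y,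
 forall w, {within `[0, T], continuous (Y ^~ w)} & forall w, Y 0 w = 0].
Proof.
move=> Lh; have [H [J hJ]] := simple_seq BF Lh.
have sH n : simple (H n) (J n) by case: (hJ n).
have sd n := simple_sub (sH n.+1) (sH n).
have q0 n : 0 <= (4^-1 : R) ^+ n by rewrite exprn_ge0// invr_ge0.
have nd n : nrm muT (H n.+1 - H n) <= 4^-1 ^+ n.
 have [_ h1] := hJ n; have [_ h2] := hJ n.+1.
 have := nrm_tri (simple_sq BF (sH n.+1)) (L2p_sq Lh) (simple_sq BF (sH n)).
 rewrite (nrmBC _ h (H n)); move: h2; rewrite exprS; have := q0 n; lra.
have qh n : (4^-1 : R) ^+ n = 2^-1 ^+ n * 2^-1 ^+ n.
 by rewrite -exprMn; congr (_ ^+ _); rewrite -invfM -natrM.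
have h1 n : (2^-1 : R) ^+ n <= 1 by rewrite exprn_ile1 ?invr_ge0// invf_le1// ler1n.
have nd2 n : nrm muT (H n.+1 - H n) <= 2^-1 ^+ n.
 by apply: (le_trans (nd n)); rewrite qh ler_piMl// half_ge0.
have /choice[A hA] := fun n => simple_sup k (sd n) (half_gt0 n).
have mA n : measurable (A n) by case: (hA n).
have PA n : (P (A n) <= ((2^-1 : R) ^+ n)%:E)%E.
 have [_ hP _] := hA n; apply: (le_trans hP); rewrite lee_fin.
 have h2 : nrm muT (H n.+1 - H n) / 2^-1 ^+ n <= 2^-1 ^+ n.
  by rewrite ler_pdivrMr ?half_gt0// -qh.
 apply: (@le_trans _ _ ((2^-1 ^+ n) ^+ 2)).
  by rewrite ler_sqr ?nnegrE ?half_ge0// divr_ge0 ?half_ge0 ?nrm_ge0.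
 by rewrite expr2 ler_piMl// half_ge0.
have null : P (lim_sup_set A) = 0.
 apply: lim_sup_set_cvg0 => //; apply: (@le_lt_trans _ _ 2%:E); last by rewrite ltry.
 apply: lime_le; first by apply: is_cvg_nneseries.
 apply: nearW => n; apply: (@le_trans _ _ (\sum_(0 <= k < n) ((2^-1 : R) ^+ k)%:E)%E).
  by apply: lee_sum => i _; exact: PA.
 by rewrite sumEFin lee_fin; have := @sum_half_le R 0 n; rewrite expr0 mulr1.
pose good w := {within `[0, T], continuous (W k ^~ w)} /\
 exists n0, forall n, (n0 <= n)%N -> ~ A n w.
have goodP : {ae P, forall w, good w}.
 have h2 : {ae P, forall w, ~ lim_sup_set A w}.
  exists (lim_sup_set A); split => //; last by move=> w /= /contrapT.
  apply: bigcap_measurable => // n _; apply: bigcup_measurable => j _; exact: mA.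
 apply: (ae_imp2 (bf_cont BF k) h2) => w cw nw; split => //.
 apply: contrapT => hn; apply: nw => n _; apply: contrapT => hj; apply: hn.
 by exists n => j nj Aj; apply: hj; exists j.
(* Off the good event the path is 0, so that continuity and the value 0 at time 0 hold for every w.
   Adaptedness survives because F_t contains the null sets. *)
pose Y t w := if pselect (good w) then flim (fun n => J n k t) w else 0.
have YE w : good w -> exists n0, forall t, 0 <= t <= T ->
  (fun n => J n k t w) @ \oo --> Y t w /\
  forall n, (n0 <= n)%N -> `|J n k t w - Y t w| <= 2 * 2^-1 ^+ n.
 move=> gw; have [cW [n0 hn0]] := gw; exists n0 => t tT.
 have [|l [ul hl]] := @fast_cvg _ (fun n => J n k t w) n0.
  by move=> n nn; have [_ _ hh] := hA n; exact: (hh w (hn0 n nn) cW t tT).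
 rewrite /Y; case: pselect => //= _; rewrite (flim_cvg ul); split => //.
have mJ n t : 0 <= t <= T -> sq P (J n k t) /\ mF (F t) (J n k t).
 by move=> /andP[t0 tT]; exact: (simple_J BF k (sH n) t0 tT).
have aeY t : 0 <= t <= T -> {ae P, forall w, (fun n => J n k t w) @ \oo --> Y t w}.
 by move=> tT; apply: (ae_imp goodP) => w /YE[n0 /(_ t tT)[]].
have mY t : 0 <= t <= T -> mF (F t) (Y t).
 move=> tT; apply: (mF_limit (Fs t) (fun A => @bf_null _ _ _ _ _ _ _ _ _ BF t A) _ (aeY t tT)).
 by move=> n; case: (mJ n t tT).
exists Y; split.
- apply: (ito_critS BF Lh mY sH).
  apply: (@tendstoP _ _ _ _ _ _ 1); [by move=> n; exact: (simple_sq BF (sH n))|exact: L2p_sq Lh|].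
  by move=> n; rewrite mul1r; apply: le_trans (quarter_le n); case: (hJ n).
 move=> t tT; have [t0 tT'] := andP tT.
 have fJ : fast P (fun n => J n k t).
  split; first by move=> n; case: (mJ n t tT).
  by move=> n; apply: le_trans (nd2 n); exact: (simple_contr BF k (sd n) tT).
 have [sY hY] := fast_limit fJ (mF_meas_le BF tT' (mY t tT)) (aeY t tT).
 by apply: (@tendstoP _ _ _ _ _ _ 2) => // n; case: (mJ n t tT).
- move=> w; have [gw|ngw] := pselect (good w); last first.
  rewrite (_ : Y ^~ w = fun=> 0); first exact: within_cst.
  by apply/funext => t; rewrite /Y; case: pselect.
 have [n0 hn] := YE w gw; have [cW _] := gw.
 apply: (@within_uniform_limit _ _ (fun n t => J n k t w) _ n0).
  by move=> n; exact: simple_cont (sH n) cW.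
 by move=> n t nn /=; rewrite in_itv/= => tT; have [_] := hn t tT; apply.
- move=> w; rewrite /Y; case: pselect => //= _; apply: flim_cvg.
 rewrite (_ : (fun n => _) = fun=> 0); first exact: cvg_cst.
 by apply/funext => n; rewrite (simple_J0 k (sH n)).
Qed.

Lemma ito_path_meas k h Y : ito k h Y -> (forall w, {within `[0, T], continuous (Y ^~ w)}) ->
 meas_fun (cut T (fun z : TO => Y z.1 z.2)).
Proof.
move=> [_ hY _] cY; apply: joint_meas => // t tT.
by have [sY _] := hY t tT; exact: sq_meas sY.
Qed.

End continuous_versions.

(** * Integration in time: parts, primitives and drifts *)

Lemma Rint_swap {d1 d2} {T1 : measurableType d1} {T2 : measurableType d2} {R : realType}
 (m1 : {sigma_finite_measure set T1 -> \bar R}) (m2 : {sigma_finite_measure set T2 -> \bar R})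
 (f : T1 * T2 -> R) : (m1 \x m2)%E.-integrable setT (EFin \o f) ->
 \int[m1]_x (\int[m2]_y f (x, y)) = \int[m2]_y (\int[m1]_x f (x, y)).
Proof.
move=> fi; rewrite /Rintegral; congr fine; transitivity (\int[m1 \x m2]_z (f z)%:E)%E.
 rewrite -(integral12_prod_meas1 fi); apply: ae_eq_integral => //.
 - apply/measurable_EFinP; apply: (@measurableT_comp _ _ _ _ _ _ (@fine R)) => //.
  exact: (measurable_fubini_F fi).
 - exact: (measurable_fubini_F fi).
 - by apply: filterS (ae_integrable1 fi) => x ix _; rewrite /= fineK//; exact: integrable_fin_num.
rewrite -(integral21_prod_meas1 fi); apply: ae_eq_integral => //.
- exact: (measurable_fubini_G fi).
- apply/measurable_EFinP; apply: (@measurableT_comp _ _ _ _ _ _ (@fine R)) => //.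
 exact: (measurable_fubini_G fi).
- by apply: filterS (ae_integrable2 fi) => x ix _; rewrite /= fineK//; exact: integrable_fin_num.
Qed.

Section time_integrals.
Context {R : realType} (T : R).
Notation TR := (measurableTypeR R).
Notation lamT := (lamT T).
Implicit Types f g : TR -> R.

Notation ind t := (\1_(`[0, t]%classic : set R) : TR -> R).

Lemma ind_meas t : meas_fun (ind t).
Proof. exact: measurable_indic. Qed.

Lemma integ_ind t f : integ lamT f -> integ lamT (fun s => ind t s * f s).
Proof. by apply: integ_le1M; [exact: ind_meas|exact: indic_le1]. Qed.

Lemma Rint_lamT t f : meas_fun f -> 0 <= t <= T ->
 \int[lamT]_s (ind t s * f s) = \int[lebesgue_measure]_(s in `[0, t]) f s.
Proof.
move=> mf /andP[t0 tT]; rewrite /Rintegral; congr fine.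
have mi : meas_fun (fun s : TR => (ind t s * f s)%:E).
 by apply/measurable_EFinP; apply: measurable_funM => //; exact: ind_meas.
have key (h : TR -> \bar R) : meas_fun h -> (forall s, 0 <= h s)%E ->
  (forall s, ~ (0 <= s <= t) -> h s = 0%E) ->
  (\int[lamT]_s h s = \int[lebesgue_measure]_(s in `[0%R, t]) h s)%E.
 move=> mh h0 hz; rewrite ge0_integral_lamT// integral_mkcond [RHS]integral_mkcond.
 apply: eq_integral => s _; rewrite !patchE.
 case: (boolP (s \in `[0%R, t]%classic)) => [st|st].
  suff -> : s \in `[0%R, T]%classic by [].
  by move: st; rewrite !inE/= !in_itv/= => /andP[-> st]; exact: le_trans tT.
 case: ifP => // _; apply: hz => st0; move/negP: st; apply.
 by rewrite inE/= in_itv.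
have z s : ~ (0 <= s <= t) -> ind t s * f s = 0.
 move=> h; rewrite indicE memNset ?mul0r//= in_itv/=; exact: h.
have e s : (s \in `[0%R, t]%classic) -> ind t s * f s = f s.
 by move=> h; rewrite indicE h mul1r.
rewrite integralE [RHS]integralE; congr (_ - _)%E.
 rewrite key; [|exact: measurable_funepos| |].
 - by apply: eq_integral => s st; rewrite !funeposE/= e.
 - by move=> s; exact: funepos_ge0.
 - by move=> s st; rewrite funeposE/= z// maxxx.
rewrite key; [|exact: measurable_funeneg| |].
- by apply: eq_integral => s st; rewrite !funenegE/= e.
- by move=> s; exact: funeneg_ge0.
- by move=> s st; rewrite funenegE/= z//= oppr0 maxxx.
Qed.

Hypothesis T0 : 0 < T.

Lemma Rint_cut_cont f : integ lamT f ->
 {within `[0, T], continuous (fun t => \int[lamT]_s (ind t s * f s))}.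
Proof.
move=> fi; have mf := integ_meas fi.
have li : lebesgue_measure.-integrable `[0%R, T] (EFin \o (f : R -> R)).
 apply/integrableP; split.
  by apply/measurable_EFinP; exact: measurable_funTS.
 have /integrableP[_] := fi; rewrite ge0_integral_lamT//.
 - by apply: measurableT_comp => //; exact/measurable_EFinP.
have h := parameterized_integral_continuous (ltW T0) li.
apply/subspace_continuousP => x Dx; have := (subspace_continuousP _ _).1 h x Dx.
rewrite /parameterized_integral /from_subspace -Rint_lamT//.
apply: cvg_trans; apply: near_eq_cvg; rewrite near_withinE; near=> y.
by move=> /= Dy; rewrite Rint_lamT.
Unshelve. all: by end_near. Qed.

Let A := [set z : TR * TR | (0 <= z.2) && (z.2 <= z.1)].

Let mA : measurable A.
Proof.
have m : meas_fun (fun z : TR * TR => (0 <= z.2) && (z.2 <= z.1)).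
 by apply: measurable_and; apply: measurable_fun_ler.
by have := m measurableT [set true] ltac:(by []); rewrite setTI; congr measurable;
 apply/seteqP; split => z /=.
Qed.

Let AE s r : \1_A (s, r) = ind s r :> R.
Proof.
rewrite !indicE; congr (nat_of_bool _)%:R; apply/idP/idP; rewrite !inE/= in_itv//.
Qed.

Let Kb f g (c : TR * TR -> R) : integ lamT f -> integ lamT g ->
 meas_fun c -> (forall z, `|c z| <= 1) ->
 (lamT \x lamT)%E.-integrable setT (EFin \o (fun z => c z * (f z.1 * g z.2))).
Proof.
move=> fi gi mc c1; have mf := integ_meas fi; have mg := integ_meas gi.
pose K (z : TR * TR) := f z.1 * g z.2.
have mK : meas_fun K.
 by apply: measurable_funM; [apply: (measurableT_comp mf)|apply: (measurableT_comp mg)].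
have Ki : (lamT \x lamT)%E.-integrable setT (EFin \o K).
 apply/integrable12ltyP; first exact/measurable_EFinP.
 rewrite (_ : (\int[_]_x _)%E = ((\int[lamT]_x `|(f x)%:E|) * (\int[lamT]_y `|(g y)%:E|))%E).
  have /integrableP[_ h1] := fi; have /integrableP[_ h2] := gi.
  by rewrite lte_mul_pinfty ?integral_ge0// ge0_fin_numE ?integral_ge0.
 rewrite -ge0_integralZr//; last 2 first.
 - by apply: measurableT_comp => //; exact/measurable_EFinP.
 - exact: integral_ge0.
 apply: eq_integral => s _; rewrite -ge0_integralZl//.
 - by apply: eq_integral => r _; rewrite /= normrM EFinM.
 - by apply: measurableT_comp => //; exact/measurable_EFinP.
have m : meas_fun (fun z => c z * K z) by exact: measurable_funM.
apply: (le_integrable measurableT _ _ Ki); first exact/measurable_EFinP.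
by move=> z _; rewrite /= lee_fin normrM ler_piMl.
Qed.

Let fin_int f g (c : TR * TR -> R) : integ lamT f -> integ lamT g ->
 meas_fun c -> (forall z, `|c z| <= 1) ->
 (forall s, integ lamT (fun r => c (s, r) * g r)) ->
 integ lamT (fun s => f s * \int[lamT]_r (c (s, r) * g r)).
Proof.
move=> fi gi mc c1 cr; have := integrable_fubini_F (Kb fi gi mc c1); congr integrable.
apply/funext => s; rewrite /fubini_F /comp -RintegralZl//; last exact: cr.
have -> : (fun r => f s * (c (s, r) * g r)) = (fun r => c (s, r) * (f s * g r)).
 by apply/funext => r; rewrite mulrCA.
rewrite /Rintegral fineK//; apply: integrable_fin_num => //.
by have := integZ (f s) (cr s); congr integrable; apply/funext => r /=; rewrite mulrCA.
Qed.

Let iA g s : integ lamT g -> integ lamT (fun r => \1_A (s, r) * g r).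
Proof.
by move=> gi; rewrite (_ : (fun r => _) = (fun r => ind s r * g r));
 [exact: integ_ind|apply/funext => r; rewrite AE].
Qed.

Lemma integ_parts f g : integ lamT f -> integ lamT g ->
 integ lamT (fun s => f s * \int[lamT]_r (ind s r * g r)).
Proof.
move=> fi gi; have := fin_int fi gi (measurable_indic mA) (indic_le1 A) (fun s => iA s gi).
congr integrable; apply/funext => s /=; congr (_ * _)%:E.
Qed.

(** Integration by parts for two primitives: the integral over the square is split along the
    diagonal, and Fubini's theorem is applied on one of the triangles. *)
Lemma Rint_parts f g : integ lamT f -> integ lamT g ->
 (\int[lamT]_s f s) * (\int[lamT]_r g r) =
 \int[lamT]_s (f s * \int[lamT]_r (ind s r * g r)) +
 \int[lamT]_r (g r * \int[lamT]_s (ind r s * f s)).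
Proof.
move=> fi gi; have mf := integ_meas fi; have mg := integ_meas gi.
pose K (z : TR * TR) := f z.1 * g z.2.
pose B z : R := 1 - \1_A z.
have B1 z : `|B z| <= 1.
 by rewrite /B indicE; case: (_ \in _); rewrite ?subrr ?subr0 ?normr0 ?normr1.
have mB : meas_fun B by apply: measurable_funB => //.
have KB := Kb fi gi mB B1.
have e1 s : \int[lamT]_r g r = \int[lamT]_r (ind s r * g r) + \int[lamT]_r (B (s, r) * g r).
 rewrite -RintegralD//; last 2 first.
 - exact: integ_ind.
 - have := integB gi (integ_ind s gi); congr integrable; apply/funext => r /=.
  by rewrite /B AE mulrBl mul1r.
 by congr Rintegral; apply/funext => r; rewrite /B AE -mulrDl addrC subrK mul1r.
(* [B] is the open triangle s < r; it differs from the closed one only at s = r, a null set of s. *)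
have e2 : {ae lamT, forall r, \int[lamT]_s (B (s, r) * f s) = \int[lamT]_s (ind r s * f s)}.
 apply: (ae_imp (lamT_in T)) => r /andP[r0 rT].
 apply: Rint_ae; [|by apply: measurable_funM => //; exact: ind_meas|].
  apply: measurable_funM => //; apply: (measurableT_comp mB).
  exact: measurable_pair2.
 apply: (ae_imp2 (lamT_in T) (lamT_neq T r)) => s /andP[s0 _] sr; congr (_ * _).
 rewrite /B AE !indicE !mem_setE !in_itv/= r0 s0/=.
 by have [rs|rs] := leP r s; have [sr'|sr'] := leP s r; rewrite ?subrr ?subr0//;
  [have := le_anti (introT andP (conj rs sr')) => e; rewrite e eqxx in sr|lra].
pose G s := \int[lamT]_r (ind s r * g r).
pose H s := \int[lamT]_r (B (s, r) * g r).
have iB s : integ lamT (fun r => B (s, r) * g r).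
 have := integB gi (iA s gi); congr integrable; apply/funext => r /=.
 by rewrite /B mulrBl mul1r.
have fA := fin_int fi gi (measurable_indic mA) (indic_le1 A) (fun s => iA s gi).
have fB := fin_int fi gi mB B1 iB.
rewrite -RintegralZr//.
have -> : \int[lamT]_s (f s * \int[lamT]_r g r) =
  \int[lamT]_s (f s * \int[lamT]_r (\1_A (s, r) * g r)) + \int[lamT]_s (f s * H s).
 rewrite -RintegralD//; congr Rintegral; apply/funext => s; rewrite -mulrDr (e1 s).
 by congr (_ * (_ + _)); congr Rintegral; apply/funext => r; rewrite AE.
congr (_ + _).
have -> : \int[lamT]_s (f s * H s) = \int[lamT]_s (\int[lamT]_r (B (s, r) * K (s, r))).
 congr Rintegral; apply/funext => s; rewrite /H -RintegralZl//; last exact: iB.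
 by congr Rintegral; apply/funext => r; rewrite /K/= mulrCA.
rewrite (@Rint_swap _ _ _ _ _ lamT lamT (fun z => B z * K z))//.
have fi' r : integ lamT (fun s => B (s, r) * f s).
 apply: integ_le1M fi; last by move=> t; exact: B1.
 by apply: (measurableT_comp mB); exact: measurable_pair2.
have e3 r : \int[lamT]_s (B (s, r) * K (s, r)) = g r * \int[lamT]_s (B (s, r) * f s).
 rewrite -RintegralZl//; last exact: fi'.
 by congr Rintegral; apply/funext => s; rewrite /K/=; ring.
rewrite (_ : (fun r => \int[lamT]_s _) = (fun r => g r * \int[lamT]_s (B (s, r) * f s))); last first.
 by apply/funext => r; exact: e3.
apply: Rint_ae.
- rewrite (_ : (fun r => _) = (fun r => fine (fubini_G lamT (EFin \o (fun z => B z * K z)) r))).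
  apply: (@measurableT_comp _ _ _ _ _ _ (@fine R)) => //; exact: (measurable_fubini_G KB).
 by apply/funext => r; rewrite -e3.
- exact: integ_meas (integ_parts gi fi).
- by apply: (ae_imp e2) => r ->.
Qed.

End time_integrals.

Section finite_mass.
Context {R : realType} {d} {X : measurableType d} (mu : {measure set X -> \bar R})
 (mu_fin : (mu setT < +oo)%E).

Lemma sq_cst c : sq mu (fun=> c : R).
Proof. by apply: (@sq_bdd _ _ _ _ _ `|c|) => //; exact: measurable_cst. Qed.

Lemma sq_integ1 f : sq mu f -> integ mu f.
Proof.
move=> sf; have := sq_mul sf (sq_cst 1).
by congr integ; apply/funext => s; rewrite mulr1.
Qed.

End finite_mass.

Section drift_integral.
Context {R : realType} {d} {Omega : measurableType d} (P : probability Omega R) (T : R).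
Notation TO := (measurableTypeR R * Omega)%type.
Notation muT := (muT P T).
Notation lamT := (lamT T).
Implicit Types b h g : TO -> R.

Lemma ae_integ_path b : sq muT b -> {ae P, forall w, integ lamT (fun s => b (s, w))}.
Proof.
move=> sb; apply: (ae_imp (sq_path sb)) => w s1.
exact: (sq_integ1 (lamT_fin T) s1).
Qed.

Definition tint b (t : R) (w : Omega) : R := \int[lamT]_s cut t b (s, w).

Lemma tint_meas b t : sq muT b -> meas_fun (tint b t).
Proof.
move=> sb; have s1 := sq_cut t sb.
have i1 : integ muT (cut t b) := sq_integ1 (muT_fin P T) s1.
by have [_ h _] := fubini_wt i1; exact: integ_meas h.
Qed.

Definition lift (V : Omega -> R) : TO -> R := fun z => V z.2.

Lemma sq_lift V : sq P V -> sq muT (lift V).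
Proof.
move=> sV; have := sq_tensor (sq_cst (lamT_fin T) 1) sV.
by congr sq; apply/funext => z; rewrite mul1r.
Qed.

Lemma ip_tint V b t : sq P V -> sq muT b -> ip P V (tint b t) = ip muT (lift V) (cut t b).
Proof.
move=> sV sb; have s1 := sq_cut t sb; have s2 := sq_lift sV.
have [_ h h0] := fubini_wt (sq_mul s2 s1); rewrite [RHS]h0.
apply: Rint_ae; [|exact: integ_meas h|].
 by apply: measurable_funM; [exact: sq_meas sV|exact: tint_meas].
apply: (ae_imp (ae_integ_path s1)) => w iw; rewrite /tint -RintegralZl//.
Qed.

(** For T > 0 this is the square root of T, the constant of the Cauchy-Schwarz inequality in
    time. *)
Definition time_cst : R := nrm lamT (fun=> 1).

Lemma tint_path b t w : sq lamT (fun s => b (s, w)) ->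
 tint b t w ^+ 2 <= time_cst ^+ 2 * \int[lamT]_s (b (s, w) * b (s, w)).
Proof.
move=> sw; have s0 := sq_cst (lamT_fin T) 1.
have sc : sq lamT (fun s => cut t b (s, w)).
 by apply: (sq_bddM (c := 1) (@ind_meas R t) _ sw) => s; exact: indic_le1.
have h := ip_CS s0 sc.
have e1 : ip lamT (fun=> 1) (fun s => cut t b (s, w)) = tint b t w.
 by congr Rintegral; apply/funext => s; rewrite mul1r.
rewrite e1 in h; apply: (@le_trans _ _ ((time_cst * nrm lamT (fun s => cut t b (s, w))) ^+ 2)).
 by rewrite -[leLHS]real_normK ?num_real// ler_sqr ?nnegrE// mulr_ge0 ?nrm_ge0.
rewrite exprMn; apply: ler_wpM2l; first exact: sqr_ge0.
rewrite sqr_nrm; apply: le_Rintegral => //.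
- exact: (sq_mul sc sc).
- exact: (sq_mul sw sw).
move=> s _; rewrite -!expr2 -[leLHS]real_normK ?num_real// -[leRHS]real_normK ?num_real//.
by rewrite ler_sqr ?nnegrE// cut_norm.
Qed.

Lemma tint_sq b t : sq muT b -> sq P (tint b t) /\ nrm P (tint b t) <= time_cst * nrm muT b.
Proof.
move=> sb; have [_ h2 h3] := fubini_wt (sq_mul sb sb).
have h4 : {ae P, forall w, (tint b t w) ^+ 2 <= time_cst ^+ 2 * \int[lamT]_s (b (s, w) * b (s, w))}.
 by apply: (ae_imp (sq_path sb)) => w; exact: tint_path.
have mt := tint_meas t sb.
have h5 : (\int[P]_w (tint b t w ^+ 2)%:E <= (time_cst ^+ 2 * ip muT b b)%:E)%E.
 rewrite /ip h3 -RintegralZl// /Rintegral fineK; last first.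
  by apply: integrable_fin_num => //; exact: (integZ (time_cst ^+ 2) h2).
 apply: ae_ge0_le_integral => //.
 - by move=> w _; rewrite lee_fin sqr_ge0.
 - by apply/measurable_EFinP; exact: measurable_funX.
 - move=> w _; rewrite lee_fin mulr_ge0 ?sqr_ge0//; apply: Rintegral_ge0 => s _.
  by rewrite -expr2 sqr_ge0.
 - by apply/measurable_EFinP; exact: (integ_meas (integZ (time_cst ^+ 2) h2)).
 - by apply: (ae_imp h4) => w hw _; rewrite lee_fin.
have st : sq P (tint b t) by apply: sq_fin => //; exact: le_lt_trans h5 (ltry _).
split => //.
by move: h5; rewrite integral_sqr// lee_fin -sqr_nrm -exprMn ler_sqr ?nnegrE ?mulr_ge0 ?nrm_ge0.
Qed.

Lemma tintD h g : sq muT h -> sq muT g ->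
 {ae P, forall w, forall t, tint (h + g) t w = tint h t w + tint g t w}.
Proof.
move=> sh sg; apply: (ae_imp2 (ae_integ_path sh) (ae_integ_path sg)) => w ih ig t.
rewrite /tint -RintegralD//; [|exact: integ_ind|exact: integ_ind].
by congr Rintegral; apply/funext => s; rewrite cutD.
Qed.

Lemma tintZ c h : sq muT h ->
 {ae P, forall w, forall t, tint (fun z => c * h z) t w = c * tint h t w}.
Proof.
move=> sh; apply: (ae_imp (ae_integ_path sh)) => w ih t.
rewrite /tint -RintegralZl//; last exact: integ_ind.
by congr Rintegral; apply/funext => s; rewrite /cut mulrCA.
Qed.

Lemma tintB h g : sq muT h -> sq muT g ->
 {ae P, forall w, forall t, tint (h - g) t w = tint h t w - tint g t w}.
Proof.
move=> sh sg; apply: (ae_imp2 (ae_integ_path sh) (ae_integ_path sg)) => w ih ig t.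
rewrite /tint -RintegralB//; [|exact: integ_ind|exact: integ_ind].
by congr Rintegral; apply/funext => s; rewrite cutB.
Qed.

Lemma tint_ae b b' t : sq muT b -> sq muT b' -> {ae muT, forall z, b z = b' z} ->
 {ae P, forall w, tint b t w = tint b' t w}.
Proof.
move=> sb sb' e.
have z0 : nrm muT (b - b') = 0.
 rewrite (@nrm_ae _ _ _ _ _ 0) ?nrm0//.
 - exact: sq_meas (sqB sb sb').
 - exact: measurable_cst.
 - by apply: (ae_imp e) => z ez; rewrite !fctE ez subrr.
have [s1 n1] := tint_sq t (sqB sb sb').
have n2 : nrm P (tint (b - b') t) = 0.
 by apply/eqP; rewrite eq_le nrm_ge0 andbT; rewrite z0 mulr0 in n1.
apply: (ae_imp2 (nrm0_ae s1 n2) (tintB sb sb')) => w h1 h2.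
by apply/eqP; rewrite -subr_eq0 -h2 h1.
Qed.

(** A version of [tint] that is 0 on the null set of paths whose integrand is not integrable, so
    that every path is continuous. *)
Definition drift b (t : R) (w : Omega) : R :=
 if pselect (integ lamT (fun s => b (s, w))) then tint b t w else 0.

Hypothesis T0 : 0 < T.

Lemma drift_cont b w : {within `[0, T], continuous (drift b ^~ w)}.
Proof.
have [iw|niw] := pselect (integ lamT (fun s => b (s, w))).
 rewrite (_ : drift b ^~ w = fun t => tint b t w); first exact: Rint_cut_cont.
 by apply/funext => t; rewrite /drift; case: pselect.
rewrite (_ : drift b ^~ w = fun=> 0); first exact: within_cst.
by apply/funext => t; rewrite /drift; case: pselect.
Qed.

Lemma drift_ae b : sq muT b -> {ae P, forall w, forall t, drift b t w = tint b t w}.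
Proof.
by move=> sb; apply: (ae_imp (ae_integ_path sb)) => w iw t; rewrite /drift; case: pselect.
Qed.

Lemma tint_leb b w t : meas_fun b -> 0 <= t <= T ->
 tint b t w = \int[lebesgue_measure]_(s in `[0, t]) b (s, w).
Proof. by move=> mb tT; rewrite -(@Rint_lamT _ T)//; exact: measurable_path. Qed.

End drift_integral.

Section mean_square_limits.
Context {R : realType} {d} {Omega : measurableType d} (P : probability Omega R).

(** A subsequence with a geometric rate converges almost surely, and G contains the null sets on
    which it does not. *)
Lemma mF_tendsto G (X : nat -> Omega -> R) Y : sigma_algebra setT G ->
 (forall A, P.-negligible A -> G A) -> G `<=` measurable ->
 (forall n, mF G (X n)) -> tendsto P X Y -> mF G Y.
Proof.
move=> sG nG Gm mX tX; have [sX sY _] := tX.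
have /choice[phi hphi] : forall n, exists m, nrm P (X m - Y) <= 4^-1 ^+ n / 2.
 move=> n; have q : 0 < (4^-1 : R) ^+ n / 2 by rewrite divr_gt0// exprn_gt0// invr_gt0.
 have h := tendsto_small tX q; near \oo => m; exists m; near: m; exact: h.
have q0 n : 0 <= (4^-1 : R) ^+ n by rewrite exprn_ge0// invr_ge0.
have fX : fast P (fun n => X (phi n)).
 split => // n; apply: (le_trans (nrm_tri (sX _) sY (sX _))).
 have h1 := hphi n.+1; have h2 := hphi n; rewrite (nrmBC P Y).
 have h3 : (4^-1 : R) ^+ n <= 2^-1 ^+ n.
  by apply: lerXn2r; rewrite ?nnegrE ?invr_ge0// lef_pV2 ?posrE// ler_nat.
 move: h1; rewrite exprS; have := q0 n; lra.
have [sl hl ll] := fast_flim (P_fin P) fX.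
apply: (mF_limit sG nG (fun n => mX (phi n))).
have z : nrm P (flim (fun n => X (phi n)) - Y) = 0.
 apply/eqP; rewrite eq_le nrm_ge0 andbT; apply/ler_addgt0Pr => e e0; rewrite add0r.
 have [n hn] := @half_small R (e / 4) ltac:(by rewrite divr_gt0).
 apply: (le_trans (nrm_tri sl (sX (phi n)) sY)); rewrite nrmBC.
 have h1 := hl n; have h2 := hphi n.
 have h3 : (4^-1 : R) ^+ n <= 2^-1 ^+ n.
  by apply: lerXn2r; rewrite ?nnegrE ?invr_ge0// lef_pV2 ?posrE// ler_nat.
 by have := q0 n; lra.
apply: (ae_imp2 ll (nrm0_ae_eq sl sY z)) => w h <-; exact: h.
Unshelve. all: by end_near. Qed.

End mean_square_limits.

Section null_sets.
Context {R : realType} {d} {Omega : measurableType d} (P : probability Omega R) (T : R).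

Lemma ae_muT_time (Q : R -> Prop) : {ae lamT T, forall t, Q t} -> {ae muT P T, forall z, Q z.1}.
Proof.
move=> [A [mA A0 AE]]; exists (A `*` setT); split; first exact: measurableX.
 transitivity ((lamT T \x P)%E (A `*` setT)) => //; rewrite product_measure1E//.
 by rewrite [X in (X * _)%E](_ : _ = 0%E) ?mul0e.
by move=> [t w] hz; split => //; apply: AE => /= hA; apply: hz.
Qed.

Lemma ae_muT_omega (Q : Omega -> Prop) : {ae P, forall w, Q w} -> {ae muT P T, forall z, Q z.2}.
Proof.
move=> [A [mA A0 AE]]; exists (setT `*` A); split; first exact: measurableX.
 transitivity ((lamT T \x P)%E (setT `*` A)) => //; rewrite product_measure1E//.
 by rewrite [X in (_ * X)%E](_ : _ = 0%E) ?mule0.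
by move=> [t w] hz; split => //; apply: AE => /= hA; apply: hz.
Qed.

End null_sets.

Section inner_product_sums.
Context {d} {X : measurableType d} {R : realType} (mu : {measure set X -> \bar R}).
Implicit Types a b c v : X -> R.

Lemma ip_sum3r v a b c : sq mu v -> sq mu a -> sq mu b -> sq mu c ->
 ip mu v (a + b + c) = ip mu v a + ip mu v b + ip mu v c.
Proof. by move=> sv sa sb sc; rewrite ipDr ?ipDr//; exact: sqD. Qed.

Lemma ip_sum33 a b c a' b' c' : sq mu a -> sq mu b -> sq mu c ->
 sq mu a' -> sq mu b' -> sq mu c' ->
 ip mu (a + b + c) (a' + b' + c') =
 ip mu a a' + ip mu a b' + ip mu a c' + (ip mu b a' + ip mu b b' + ip mu b c') +
 (ip mu c a' + ip mu c b' + ip mu c c').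
Proof.
move=> sa sb sc sa' sb' sc'; have s1 := sqD sa' sb'; have s2 := sqD s1 sc'.
by rewrite ipDl ?ipDl ?ip_sum3r//; exact: sqD.
Qed.

End inner_product_sums.

(** * Ito processes and the product formula *)

Section ito_processes.
Context {R : realType} {d} {Omega : measurableType d}
 (P : probability Omega R) (T : R) (I : finType) (W : I -> R -> Omega -> R)
 (F : R -> set_system Omega) (E0 : nat -> set Omega) (BF : brownian_filtration P T W F E0).

Notation TO := (measurableTypeR R * Omega)%type.
Notation muT := (muT P T).
Notation lamT := (lamT T).
Notation simple := (simple T W F).
Notation L2p := (L2p P T F).
Notation ito := (ito P T W F).
Notation tint := (tint T).
Notation drift := (drift T).

Let T0 : 0 < T := bf_T BF.
Let Fs t : sigma_algebra setT (F t) := bf_sigma BF t.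
Let Fn t (A : set Omega) : P.-negligible A -> F t A := @bf_null _ _ _ _ _ _ _ _ _ BF t A.

Lemma tint_mF_simple H J t : simple H J -> 0 <= t <= T -> mF (F t) (tint H t).
Proof.
move=> sH tT; elim: sH => [|a b Z {}H {}J a0 ab bT mZ Zc sH IH].
 rewrite (_ : tint 0 t = fun=> 0); first exact: mF_cst.
 apply/funext => w; rewrite /tint (_ : (fun s => _) = fun=> 0) ?Rintegral_cst ?mul0r//.
 by apply/funext => s; rewrite /cut mulr0.
have s1' : sq muT (elem a b Z) := elem_sq BF b (le_trans ab bT) mZ Zc.
have s2 := simple_sq BF sH.
have h : mF (F t) (fun w => tint (elem a b Z) t w + tint H t w).
 apply: mFD => //.
 have [ta|at_] := leP t a.
  rewrite (_ : tint _ t = fun=> 0); first exact: mF_cst.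
  apply/funext => w; rewrite /tint (_ : (fun s => _) = fun=> 0) ?Rintegral_cst ?mul0r//.
  apply/funext => s; rewrite /cut /elem/= mulrA -[RHS](mul0r (Z w)); congr (_ * _).
  rewrite !indicE -natrM mulnb; case: andP => //.
  rewrite !inE/= !in_itv/= => -[/andP[_ h1] /andP[h2 _]].
  by have := lt_le_trans h2 (le_trans h1 ta); rewrite ltxx.
 rewrite (_ : tint _ t = fun w => (\int[lamT]_s (\1_(`[0, t]%classic) s * \1_(`]a, b]%classic) s)) * Z w).
  by apply: mFM; [exact: mF_cst|exact: (mF_mono BF (ltW at_))].
 apply/funext => w; rewrite /tint -RintegralZr//.
  by congr Rintegral; apply/funext => s; rewrite /cut /elem mulrA.
 by apply: integ_ind; apply: (sq_integ1 (lamT_fin T)); exact: sq_indic_itv.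
apply: (mF_ae (Fs t) (@Fn t) h).
by apply: (ae_imp (tintD s1' s2)) => w ->.
Qed.

Lemma tint_tendsto b bn t : tendsto muT bn b -> tendsto P (fun n => tint (bn n) t) (tint b t).
Proof.
move=> [sn sb h]; split.
- by move=> n; have [] := tint_sq t (sn n).
- by have [] := tint_sq t sb.
apply: (@squeeze_cvgr _ _ _ _ (fun=> 0) (fun n => @time_cst R T * nrm muT (bn n - b))).
- near=> n; rewrite nrm_ge0/=.
 have [s1 n1] := tint_sq t (sqB (sn n) sb).
 have [s2 _] := tint_sq t (sn n); have [s3 _] := tint_sq t sb.
 apply: le_trans n1; rewrite le_eqVlt; apply/orP; left; apply/eqP.
 apply: nrm_ae; [exact: sq_meas (sqB s2 s3)|exact: sq_meas s1|].
 by apply: (ae_imp (tintB (sn n) sb)) => w ->.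
- exact: cvg_cst.
- by rewrite -[X in _ --> X](mulr0 (@time_cst R T)); apply: cvgMr.
Unshelve. all: by end_near. Qed.

(** Adaptedness of the integrand at each time does not by itself make the integral up to t known at
    t. For simple integrands the integral is explicit, and the property passes to mean square limits
    by density. *)
Lemma tint_mF b t : L2p b -> 0 <= t <= T -> mF (F t) (tint b t).
Proof.
move=> Lb tT; have [H [J hJ]] := simple_seq BF Lb; have [_ tT'] := andP tT.
have tH : tendsto muT H b.
 apply: (@tendstoP _ _ _ _ _ _ 1); [by move=> n; exact: (simple_sq BF (hJ n).1)|exact: L2p_sq Lb|].
 by move=> n; rewrite mul1r; apply: le_trans (quarter_le n); case: (hJ n).
apply: (mF_tendsto (Fs t) (@Fn t) (bf_meas BF tT') _ (tint_tendsto t tH)).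
by move=> n; exact: (tint_mF_simple (hJ n).1 tT).
Qed.

Lemma drift_mF b t : L2p b -> 0 <= t <= T -> mF (F t) (drift b t).
Proof.
move=> Lb tT; apply: (mF_ae (Fs t) (@Fn t) (tint_mF Lb tT)).
by apply: (ae_imp (drift_ae (L2p_sq Lb))) => w ->.
Qed.

Lemma drift_sq b t : L2p b -> 0 <= t <= T -> sq P (drift b t).
Proof.
move=> Lb tT; have [_ tT'] := andP tT; have [s1 _] := tint_sq t (L2p_sq Lb).
apply: (sq_ae s1); first exact: (mF_meas_le BF tT' (drift_mF Lb tT)).
by apply: (ae_imp (drift_ae (L2p_sq Lb))) => w ->.
Qed.

Lemma drift_path_meas b : L2p b -> meas_fun (cut T (fun z : TO => drift b z.1 z.2)).
Proof.
move=> Lb; apply: (joint_meas T0) => [t tT|w]; first exact: sq_meas (drift_sq Lb tT).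
exact: drift_cont.
Qed.

Lemma drift_bound b : L2p b -> {ae P, forall w, forall t, drift b t w ^+ 2 <=
 @time_cst R T ^+ 2 * \int[lamT]_s (b (s, w) * b (s, w))}.
Proof.
move=> Lb; have sb := L2p_sq Lb.
apply: (ae_imp2 (drift_ae sb) (sq_path sb)) => w e sw t; rewrite e.
exact: tint_path.
Qed.

Lemma drift_L2p b : L2p b -> L2p (cut T (fun z => drift b z.1 z.2)).
Proof.
move=> Lb; split; last first.
 move=> t tT; rewrite (_ : (fun w => _) = drift b t); first exact: drift_mF.
 by apply/funext => w; rewrite /cut indicE mem_set ?mul1r//= in_itv.
have m := drift_path_meas Lb; have sb := L2p_sq Lb.
pose g (z : TO) := @time_cst R T ^+ 2 * \int[lamT]_s (b (s, z.2) * b (s, z.2)).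
have [_ h2 h3] := fubini_wt (sq_mul sb sb).
split => //.
have ig : integ muT g.
 apply/muT_integrable12.
  apply: measurable_funM => //.
  exact: (measurableT_comp (integ_meas h2) (measurable_snd)).
 rewrite (_ : (\int[_]_t _)%E = (\int[lamT]_t (\int[P]_w `|g (0%R, w)|%:E))%E)//.
 rewrite integral_cst//.
 have /integrableP[_ h4] := integZ (@time_cst R T ^+ 2) h2.
 rewrite lte_mul_pinfty// ?integral_ge0//.
 - by rewrite ge0_fin_numE ?integral_ge0.
 - exact: lamT_fin.
have mi : meas_fun (fun z => cut T (fun z0 : TO => drift b z0.1 z0.2) z ^+ 2).
 exact: measurable_funX.
apply/integrableP; split; first exact/measurable_EFinP.
have /integrableP[_] := ig; apply: le_lt_trans.
apply: ae_ge0_le_integral => //.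
- by apply: measurableT_comp => //; exact/measurable_EFinP.
- by apply: measurableT_comp => //; apply/measurable_EFinP; exact: (integ_meas ig).
apply: (ae_imp (ae_muT_omega T (drift_bound Lb))) => -[t w] /= hA _.
rewrite lee_fin /g/= ger0_norm ?sqr_ge0// ger0_norm; last first.
 rewrite mulr_ge0 ?sqr_ge0//; apply: Rintegral_ge0 => s _; rewrite -expr2; exact: sqr_ge0.
apply: le_trans (hA t); by rewrite /cut exprMn ler_piMl ?sqr_ge0// indicE; case: (_ \in _); rewrite ?expr1n ?expr0n.
Qed.

(** Square integrability at time 0 is a separate clause, since [L2p] does not control single times;
    by the equation it extends to all times of [0, T]. Continuity of the paths is kept out and
    supplied where solutions are constructed. *)
Definition iproc (x b : TO -> R) (sg : I -> TO -> R) :=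
 [/\ L2p x, L2p b, forall k, L2p (sg k), sq P (fun w => x (0, w)) &
  exists Y : I -> R -> Omega -> R, (forall k, ito k (sg k) (Y k)) /\
   forall t, 0 <= t <= T -> {ae P, forall w,
    x (t, w) = x (0, w) + tint b t w + \sum_k Y k t w}].

Lemma ip_cut_cut f g t : ip muT (cut t f) (cut t g) = ip muT (cut t f) g.
Proof.
congr Rintegral; apply/funext => z; rewrite /cut indicE.
by case: (_ \in _); rewrite ?mul1r ?mul0r.
Qed.

Lemma cut_in t (h : TO -> R) s w : 0 <= s <= t -> cut t h (s, w) = h (s, w).
Proof. by move=> st; rewrite /cut indicE mem_set ?mul1r//= in_itv. Qed.

Lemma cut_out t (h : TO -> R) s w : ~~ (0 <= s <= t) -> cut t h (s, w) = 0.
Proof.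
by move=> st; rewrite /cut indicE memNset ?mul0r//= in_itv/=; apply/negP.
Qed.

Lemma ito_zero k h Y : ito k h Y -> {ae P, forall w, Y 0 w = 0}.
Proof.
move=> iY; have [_ hY _] := iY.
have T00 : 0 <= (0 : R) <= T by rewrite lexx ltW.
have [sY _] := hY 0 T00; apply: (ip0_ae sY).
rewrite (ito_iso BF iY iY T00) eqxx mul1r /ip.
rewrite (@Rint_ae _ _ _ muT _ (fun=> 0)); first by rewrite Rintegral_cst// mul0r.
- have [Lh _ _] := iY; have s1 := sq_cut 0 (L2p_sq Lh); exact: integ_meas (sq_mul s1 s1).
- exact: measurable_cst.
apply: (ae_imp (ae_muT_time P (lamT_neq T 0))) => -[t w] /= tn0.
rewrite cut_out ?mul0r//; apply/negP => /andP[h1 h2]; case/negP: tn0.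
by apply/eqP/le_anti; rewrite h1 h2.
Qed.

Lemma ito_orth0 k h Y V s t : ito k h Y -> 0 <= s -> s <= t -> t <= T -> mF (F s) V -> sq P V ->
 ip P V (Y t) = ip P V (Y s).
Proof.
move=> iY s0 st tT mV sV; have [_ hY _] := iY.
have [s1 _] := hY t ltac:(by rewrite tT (le_trans s0)).
have [s2 _] := hY s ltac:(by rewrite s0 (le_trans st)).
by apply/eqP; rewrite -subr_eq0 -ipBr// (ito_past BF iY).
Qed.

Lemma ito_orth k h Y V t : ito k h Y -> 0 <= t <= T -> mF (F 0) V -> sq P V ->
 ip P V (Y t) = 0.
Proof.
move=> iY /andP[t0 tT] mV sV; rewrite (ito_orth0 iY (lexx 0) t0 tT)//.
have [_ hY _] := iY.
have [s2 _] := hY 0 ltac:(by rewrite lexx ltW).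
rewrite ipC (@ip_ae _ _ _ _ _ 0) ?ip0l//; [exact: sq_meas s2|exact: measurable_cst|exact: sq_meas sV|].
exact: ito_zero iY.
Qed.

Section martingale_part.
Variables (sg : I -> TO -> R) (Y : I -> R -> Omega -> R) (iY : forall k, ito k (sg k) (Y k)).

Definition Msum (t : R) : Omega -> R := \sum_k Y k t.

Lemma Y_sq k t : 0 <= t <= T -> sq P (Y k t).
Proof. by move=> tT; have [_ h _] := iY k; have [] := h t tT. Qed.

Lemma Msum_sq t : 0 <= t <= T -> sq P (Msum t).
Proof. by move=> tT; apply: sq_sum => k _; exact: Y_sq. Qed.

Lemma Msum_orth0 V s t : 0 <= s -> s <= t -> t <= T -> mF (F s) V -> sq P V ->
 ip P V (Msum t) = ip P V (Msum s).
Proof.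
move=> s0 st tT mV sV.
have t1 : 0 <= t <= T by rewrite tT (le_trans s0).
have t2 : 0 <= s <= T by rewrite s0 (le_trans st).
rewrite /Msum !ip_sumr//; try by move=> k _; exact: Y_sq.
by apply: eq_bigr => k _; exact: (ito_orth0 (iY k)).
Qed.

Lemma Msum_orth V t : 0 <= t <= T -> mF (F 0) V -> sq P V -> ip P V (Msum t) = 0.
Proof.
move=> tT mV sV; rewrite /Msum ip_sumr//; last by move=> k _; exact: Y_sq.
by apply: big1 => k _; exact: (ito_orth (iY k)).
Qed.

End martingale_part.

Lemma Msum_iso sg Y sg' Y' t : (forall k, ito k (sg k) (Y k)) -> (forall k, ito k (sg' k) (Y' k)) ->
 0 <= t <= T -> ip P (Msum Y t) (Msum Y' t) = \sum_k ip muT (cut t (sg k)) (sg' k).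
Proof.
move=> iY iY' tT; rewrite /Msum ip_suml//; last first.
- by move=> k _; exact: (Y_sq iY).
- exact: (Msum_sq iY' tT).
apply: eq_bigr => k _; rewrite ip_sumr//; last first.
- by move=> l _; exact: (Y_sq iY').
- exact: (Y_sq iY).
rewrite (bigD1 k)//= big1 ?addr0 => [|l lk].
 by rewrite (ito_iso BF (iY k) (iY' k) tT) eqxx mul1r ip_cut_cut.
by rewrite (ito_iso BF (iY k) (iY' l) tT) eq_sym (negbTE lk) mul0r.
Qed.

Notation D b := (cut T (fun z : TO => drift b z.1 z.2)).

Lemma tint_parts b b' t : L2p b -> L2p b' -> 0 <= t <= T ->
 ip P (tint b t) (tint b' t) = ip muT (cut t b) (D b') + ip muT (cut t b') (D b).
Proof.
move=> Lb Lb' tT; have [t0 tT'] := andP tT.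
have sb := L2p_sq Lb; have sb' := L2p_sq Lb'.
have sD := L2p_sq (drift_L2p Lb); have sD' := L2p_sq (drift_L2p Lb').
have sc := sq_cut t sb; have sc' := sq_cut t sb'.
have [_ i1 e1] := fubini_wt (sq_mul sc sD'); have [_ i2 e2] := fubini_wt (sq_mul sc' sD).
have E1 : ip muT (cut t b) (D b') = _ := e1; have E2 : ip muT (cut t b') (D b) = _ := e2.
rewrite E1 E2 -(RintegralD measurableT i1 i2).
have [s1 _] := tint_sq t sb; have [s2 _] := tint_sq t sb'.
apply: Rint_ae; [exact: integ_meas (sq_mul s1 s2)|exact: integ_meas (integD i1 i2)|].
have key c c' w : (forall s, drift c' s w = tint c' s w) -> forall s,
  cut t c (s, w) * \int[lamT]_r (\1_(`[0, s]%classic : set R) r * cut t c' (r, w)) =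
  cut t c (s, w) * D c' (s, w).
 move=> hc s; have [st|st] := boolP (0 <= s <= t); last by rewrite cut_out// !mul0r.
 congr (_ * _); have [s0 st'] := andP st.
 rewrite cut_in; last by rewrite s0 (le_trans st').
 rewrite /= hc /tint; congr Rintegral; apply/funext => r; rewrite /cut mulrA; congr (_ * _).
 rewrite !indicE -natrM mulnb; congr (nat_of_bool _)%:R; apply/andP/idP => [[]//|rs].
 by split => //; move: rs; rewrite !inE/= !in_itv/= => /andP[-> rs]; exact: le_trans st'.
apply: (ae_imp3 (ae_integ_path sc) (ae_integ_path sc') (ae_imp2 (drift_ae sb) (drift_ae sb') (fun w h1 h2 => conj h1 h2))).
move=> w fi gi [h1 h2]; rewrite /tint Rint_parts//; congr (_ + _); congr Rintegral.
 by apply/funext => s; exact: key.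
by apply/funext => s; exact: key.
Qed.

Section product_formula.
Variables (x b x' b' : TO -> R) (sg sg' : I -> TO -> R).

Lemma iproc_sect : iproc x b sg -> exists Y, (forall k, ito k (sg k) (Y k)) /\
 forall t, 0 <= t <= T -> [/\ sq P (fun w => x (t, w)), mF (F t) (fun w => x (t, w)) &
 {ae P, forall w, x (t, w) = ((fun w => x (0, w)) + tint b t + Msum Y t) w}].
Proof.
move=> [Lx Lb Ls s0 [Y [iY hY]]]; exists Y; split => // t tT; have [_ mx] := Lx.
have [_ tT'] := andP tT.
have E : {ae P, forall w, x (t, w) = ((fun w => x (0, w)) + tint b t + Msum Y t) w}.
 by apply: (ae_imp (hY t tT)) => w ->; rewrite !fctE /Msum fct_sumE.
split => //; last exact: mx.
have [s1 _] := tint_sq t (L2p_sq Lb).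
apply: (sq_ae (sqD (sqD s0 s1) (Msum_sq iY tT))).
 exact: (mF_meas_le BF tT' (mx t tT)).
by apply: (ae_imp E) => w ->.
Qed.

End product_formula.

(** Since b(s) is known at s, the martingale part of x' at s can be replaced by its value at t. That
    value does not depend on s, and the pairing becomes one with time integrals, by [ip_tint]. *)
Lemma drift_ip t b x' b' sg' Y' : L2p b -> L2p x' -> L2p b' -> sq P (fun w => x' (0, w)) ->
 (forall k, ito k (sg' k) (Y' k)) ->
 (forall t, 0 <= t <= T ->
   {ae P, forall w, x' (t, w) = ((fun w => x' (0, w)) + tint b' t + Msum Y' t) w}) ->
 0 <= t <= T -> ip muT (cut t b) x' =
 ip muT (cut t b) (lift (fun w => x' (0, w)) + D b' + lift (Msum Y' t)).
Proof.
move=> Lb Lx' Lb' s0 iY' hx tT; have [t0 tT'] := andP tT.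
have sc := sq_cut t (L2p_sq Lb); have sD := L2p_sq (drift_L2p Lb').
have sM := Msum_sq iY' tT.
have s1 := sqD (sqD (sq_lift T s0) sD) (sq_lift T sM).
rewrite (ip_muT sc (L2p_sq Lx')) (ip_muT sc s1).
have [_ i1 _] := fubini_tw (sq_mul sc (L2p_sq Lx')).
have [_ i2 _] := fubini_tw (sq_mul sc s1).
apply: Rint_ae; [exact: integ_meas i1|exact: integ_meas i2|].
apply: (ae_imp2 (lamT_in T) (sq_section (L2p_sq Lb))) => s sT sbs; have [s0' sT'] := andP sT.
have [st|st] := boolP (0 <= s <= t); last first.
 by congr Rintegral; apply/funext => w; rewrite cut_out// !mul0r.
have [_ st'] := andP st.
have e1 (h : TO -> R) : ip P (fun w => cut t b (s, w)) (fun w => h (s, w)) = ip P (fun w => b (s, w)) (fun w => h (s, w)).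
 by congr Rintegral; apply/funext => w; rewrite cut_in.
rewrite !e1.
have mb : mF (F s) (fun w => b (s, w)) by have [_ h] := Lb; exact: h.
have [st1 _] := tint_sq s (L2p_sq Lb').
have sMs := Msum_sq iY' sT.
have sx : meas_fun (fun w => x' (s, w)) by apply: measurable_section; exact: sq_meas (L2p_sq Lx').
rewrite ipC (ip_ae sx _ _ (hx s sT)); last 2 first.
- exact: sq_meas (sqD (sqD s0 st1) sMs).
- exact: sq_meas sbs.
rewrite ipC ipDr//; last exact: sqD.
rewrite -(Msum_orth0 iY' s0' st' tT' mb sbs) -ipDr//; last exact: sqD.
have sds : sq P (drift b' s) := drift_sq Lb' sT.
rewrite ipC [RHS]ipC; apply: ip_ae.
- exact: sq_meas (sqD (sqD s0 st1) sM).
- by apply: measurable_section; exact: sq_meas s1.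
- exact: sq_meas sbs.
apply: (ae_imp (drift_ae (L2p_sq Lb'))) => w e.
by rewrite !fctE cut_in//= e.
Qed.

(** Of the nine products of initial value, drift and martingale part, those of an initial value with
    a martingale vanish, the two martingales give the isometry and the two drifts [tint_parts]. The
    remaining ones are collected by [drift_ip] into the pairings of drifts with processes. *)
Lemma iproc_ip x b sg x' b' sg' t : iproc x b sg -> iproc x' b' sg' -> 0 <= t <= T ->
 ip P (fun w => x (t, w)) (fun w => x' (t, w)) =
 ip P (fun w => x (0, w)) (fun w => x' (0, w)) + ip muT (cut t b') x + ip muT (cut t b) x' +
 \sum_k ip muT (cut t (sg k)) (sg' k).
Proof.
move=> px px' tT; have [Y [iY hY]] := iproc_sect px; have [Y' [iY' hY']] := iproc_sect px'.
have [Lx Lb _ s0 _] := px; have [Lx' Lb' _ s0' _] := px'.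
have T00 : 0 <= (0 : R) <= T by rewrite lexx ltW.
have m0 : mF (F 0) (fun w => x (0, w)) by have [_ h] := Lx; exact: h.
have m0' : mF (F 0) (fun w => x' (0, w)) by have [_ h] := Lx'; exact: h.
have [sx mx ex] := hY t tT; have [sx' mx' ex'] := hY' t tT.
have sb := L2p_sq Lb; have sb' := L2p_sq Lb'.
have [sA _] := tint_sq t sb; have [sA' _] := tint_sq t sb'.
have sM := Msum_sq iY tT; have sM' := Msum_sq iY' tT.
have sX := sqD (sqD s0 sA) sM; have sX' := sqD (sqD s0' sA') sM'.
rewrite (ip_ae (sq_meas sx) (sq_meas sX) (sq_meas sx') ex).
rewrite ipC (ip_ae (sq_meas sx') (sq_meas sX') (sq_meas sX) ex') ipC.
have hx u : 0 <= u <= T -> {ae P, forall w, x (u, w) = ((fun w => x (0, w)) + tint b u + Msum Y u) w}.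
 by move=> uT; have [] := hY u uT.
have hx' u : 0 <= u <= T -> {ae P, forall w, x' (u, w) = ((fun w => x' (0, w)) + tint b' u + Msum Y' u) w}.
 by move=> uT; have [] := hY' u uT.
rewrite (drift_ip Lb' Lx Lb s0 iY hx tT) (drift_ip Lb Lx' Lb' s0' iY' hx' tT).
have sD := L2p_sq (drift_L2p Lb); have sD' := L2p_sq (drift_L2p Lb').
have sc := sq_cut t sb; have sc' := sq_cut t sb'.
have l0 := sq_lift T s0; have l0' := sq_lift T s0'.
have lM := sq_lift T sM; have lM' := sq_lift T sM'.
have s2 := sqD s0 sA; have s2' := sqD s0' sA'.
rewrite (ip_sum33 s0 sA sM s0' sA' sM') (ip_sum3r sc l0' sD' lM') (ip_sum3r sc' l0 sD lM).
rewrite (Msum_orth iY' tT m0 s0) (ipC _ (Msum Y t) (fun w => x' (0, w))) (Msum_orth iY tT m0' s0').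
rewrite (Msum_iso iY iY' tT) (tint_parts Lb Lb' tT).
rewrite (ip_tint t s0 sb') (ipC _ (tint b t) (fun w => x' (0, w))) (ip_tint t s0' sb).
rewrite (ipC _ (tint b t) (Msum Y' t)) (ip_tint t sM' sb) (ip_tint t sM sb').
rewrite (ipC _ (lift (fun w => x' (0, w)))) (ipC _ (lift (fun w => x (0, w)))).
rewrite (ipC _ (lift (Msum Y t))) (ipC _ (lift (Msum Y' t))).
have alg (p q r u v z g s : R) :
 p + q + 0 + (r + (u + v) + z) + (0 + g + s) = p + (q + v + g) + (r + u + z) + s by ring.
exact: alg.
Qed.

End ito_processes.

(** * Test functions of class C^{1,1} *)

Section bump_functions.
Context {R : realType}.

(* C^{1,1} approximations of the indicator of the positive half-line. *)
Definition bump1 (m : nat) (y : R) : R := m.+1%:R * Num.max y 0 ^+ 2 / (1 + m.+1%:R * Num.max y 0 ^+ 2).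

Lemma pos_part_taylor (y h : R) :
 0 <= Num.max (y + h) 0 ^+ 2 - Num.max y 0 ^+ 2 - 2 * Num.max y 0 * h <= h ^+ 2.
Proof.
have [y0|y0] := leP y 0; have [yh|yh] := leP (y + h) 0; apply/andP; split; nra.
Qed.

Lemma bump1_smooth m : exists (g : R -> R) C, [/\ forall y, 0 <= bump1 m y <= 1, forall y, `|g y| <= C &
 forall y h : R, `|bump1 m (y + h) - bump1 m y - g y * h| <= C * h ^+ 2].
Proof.
pose M : R := m.+1%:R; have M1 : 1 <= M by rewrite /M ler1n.
have M0 : 0 < M by exact: lt_le_trans M1.
pose p (y : R) := Num.max y 0; have p0 y : 0 <= p y by rewrite /p le_max lexx orbT.
pose z y := M * p y ^+ 2; have z0 y : 0 <= z y by rewrite /z mulr_ge0 ?sqr_ge0// ltW.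
have bE y : bump1 m y = z y / (1 + z y) by [].
have zp y : 0 < 1 + z y by have := z0 y; lra.
(* This is the derivative of z / (1 + z) for z = M y_+^2. The constant 3 M is the sum of the bounds
   M and 2 M on the two parts of the remainder below. *)
exists (fun y => M * (2 * p y) / (1 + z y) ^+ 2), (3 * M); split.
- move=> y; rewrite bE divr_ge0//=; last exact: ltW.
 by rewrite ler_pdivrMr// mul1r lerDr.
- move=> y; rewrite ger0_norm; last first.
  by rewrite !mulr_ge0 ?invr_ge0 ?sqr_ge0// ltW.
 rewrite ler_pdivrMr ?exprn_gt0//.
 have h1 : 2 * p y <= (1 + z y).
  have : p y ^+ 2 <= z y by rewrite /z ler_peMl// sqr_ge0.
  have := sqr_ge0 (p y - 1); rewrite sqrrB; have := p0 y; lra.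
 have h2 : 1 + z y <= (1 + z y) ^+ 2 by rewrite expr2 ler_peMr//; have := z0 y; lra.
 have h3 : M * (2 * p y) <= M * (1 + z y) ^+ 2 by rewrite ler_pM2l//; lra.
 have : 0 <= M * (1 + z y) ^+ 2 by rewrite mulr_ge0 ?sqr_ge0// ltW.
 lra.
move=> y h; rewrite !bE; set z1 := z (y + h); set zz := z y.
have /andP[t1 t2] := pos_part_taylor y h; rewrite -/(p y) -/(p (y + h)) in t1 t2.
pose s := p (y + h) ^+ 2 - p y ^+ 2 - 2 * p y * h.
have a0 : 0 < 1 + zz by exact: zp. have b0 : 0 < 1 + z1 by exact: zp.
(* The first part comes from the Taylor remainder of z, the second from the curvature of z / (1 +
   z). *)
have -> : z1 / (1 + z1) - zz / (1 + zz) - M * (2 * p y) / (1 + zz) ^+ 2 * h =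
  M * s / (1 + zz) ^+ 2 - (z1 - zz) ^+ 2 / ((1 + zz) ^+ 2 * (1 + z1)).
 rewrite /s (_ : M * (p (y + h) ^+ 2 - p y ^+ 2 - 2 * p y * h) = z1 - zz - M * (2 * p y) * h).
  by field; rewrite !gt_eqF.
 by rewrite /z1 /zz /z; ring.
have a1 : 1 <= (1 + zz) ^+ 2 by rewrite expr2 -[leLHS]mulr1 ler_pM// lerDl z0.
have h1 : 0 <= M * s / (1 + zz) ^+ 2 <= M * h ^+ 2.
 rewrite divr_ge0 ?sqr_ge0 ?mulr_ge0 ?(ltW M0)//= ler_pdivrMr ?exprn_gt0//.
 apply: (@le_trans _ _ (M * h ^+ 2)); first by rewrite ler_pM2l.
 by rewrite ler_peMr// mulr_ge0 ?sqr_ge0// ltW.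
have h2 : 0 <= (z1 - zz) ^+ 2 / ((1 + zz) ^+ 2 * (1 + z1)) <= 2 * M * h ^+ 2.
 apply/andP; split; first by rewrite divr_ge0 ?sqr_ge0// mulr_ge0 ?sqr_ge0// ltW.
 rewrite ler_pdivrMr; last by rewrite mulr_gt0 ?exprn_gt0.
 have e : (z1 - zz) ^+ 2 = M ^+ 2 * ((p (y + h) - p y) ^+ 2 * (p (y + h) + p y) ^+ 2).
  by rewrite /z1 /zz /z; ring.
 have e1 : (p (y + h) - p y) ^+ 2 <= h ^+ 2.
  rewrite /p; have [y0|y0] := leP y 0; have [yh|yh] := leP (y + h) 0; nra.
 have e2 : M * (p (y + h) + p y) ^+ 2 <= 2 * ((1 + zz) * (1 + z1)).
  have : M * (p (y + h) + p y) ^+ 2 <= 2 * (z1 + zz).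
   rewrite /z1 /zz /z; have := sqr_ge0 (p (y + h) - p y) => q.
   rewrite -mulrDr [leRHS]mulrCA ler_pM2l//; lra.
  have : 0 <= zz * z1 by rewrite mulr_ge0 ?z0.
  rewrite mulrDl mulrDr; lra.
 have q0 := sqr_ge0 h.
 have e3 : (p (y + h) - p y) ^+ 2 * (M * (p (y + h) + p y) ^+ 2) <= h ^+ 2 * (2 * ((1 + zz) * (1 + z1))).
  by apply: ler_pM => //; rewrite ?sqr_ge0// mulr_ge0 ?sqr_ge0// ltW.
 have e4 : (1 + zz) * (1 + z1) <= (1 + zz) ^+ 2 * (1 + z1).
  have zz0 : 0 <= zz by exact: z0.
  by rewrite ler_pM2r// expr2 ler_peMr//; lra.
 rewrite e [leLHS](_ : _ = M * ((p (y + h) - p y) ^+ 2 * (M * (p (y + h) + p y) ^+ 2))); last by ring.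
 rewrite [leRHS](_ : _ = M * (h ^+ 2 * (2 * ((1 + zz) ^+ 2 * (1 + z1))))); last by ring.
 rewrite ler_pM2l//; apply: (le_trans e3); apply: ler_wpM2l => //.
 exact: ler_wpM2l.
have /andP[h3 h4] := h1; have /andP[h5 h6] := h2.
rewrite ler_norml; apply/andP; split; have := sqr_ge0 h; nra.
Qed.

Lemma bump1_cvg (y : R) : (fun m => bump1 m y) @ \oo --> ((0 < y)%R%:R : R).
Proof.
have [y0|y0] := leP y 0.
 rewrite (_ : (fun m => _) = fun=> 0); first exact: cvg_cst.
 by apply/funext => m; rewrite /bump1 (max_r y0) expr0n/= !mulr0 mul0r.
have E m : bump1 m y = 1 - (1 + m.+1%:R * y ^+ 2)^-1.
 rewrite /bump1 (max_l (ltW y0)).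
 have p : 0 < 1 + m.+1%:R * y ^+ 2 by rewrite ltr_pwDl// mulr_ge0 ?sqr_ge0.
 apply: (mulIf (lt0r_neq0 p)); rewrite mulrBl mulVf ?divfK ?gt_eqF// mul1r.
 by rewrite addrAC subrr add0r.
rewrite (_ : (fun m => _) = (fun m => 1 - (1 + m.+1%:R * y ^+ 2)^-1)); last by apply/funext => m; exact: E.
rewrite -[X in _ --> X]subr0; apply: cvgB; first exact: cvg_cst.
apply/cvgrPdist_le => e e0.
have y2 : 0 < y ^+ 2 by rewrite exprn_gt0.
near=> m; rewrite sub0r normrN ger0_norm; last by rewrite invr_ge0 addr_ge0// mulr_ge0// ltW.
apply: (@le_trans _ _ ((m.+1%:R)^-1 * (y ^+ 2)^-1)).
 rewrite -invfM lef_pV2 ?posrE ?mulr_gt0//; first by rewrite lerDr.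
 by rewrite ltr_pwDl// mulr_ge0// ltW.
rewrite ler_pdivrMr// ltW//; near: m.
have p : 0 < e * y ^+ 2 by rewrite mulr_gt0.
exact: (near_infty_natSinv_lt (PosNum p)).
Unshelve. all: by end_near. Qed.

End bump_functions.

Section smooth_functions.
Context {R : realType} {I : finType}.
Implicit Types (f : (I -> R) -> R) (g : I -> (I -> R) -> R) (x h : I -> R).

(* g is the gradient of f; no derivative is ever taken, only Taylor's inequality is used. *)
Definition smooth f g (C : R) : Prop :=
 [/\ forall x, `|f x| <= C, forall k x, `|g k x| <= C &
   forall x h, `|f (x + h) - f x - \sum_k g k x * h k| <= C * \sum_k h k ^+ 2].

Definition lip f (C : R) : Prop := forall x h, `|f (x + h) - f x| <= C * \sum_k `|h k|.

Lemma smooth_ge0 f g C : smooth f g C -> 0 <= C.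
Proof. by move=> [h _ _]; apply: le_trans (h 0). Qed.

Lemma sum_abs_sqr h : (\sum_k `|h k|) ^+ 2 <= #|I|%:R * \sum_k h k ^+ 2.
Proof.
have -> : (\sum_k `|h k|) ^+ 2 = \sum_k \sum_l `|h k| * `|h l|.
 by rewrite expr2 mulr_suml; apply: eq_bigr => k _; rewrite mulr_sumr.
apply: (@le_trans _ _ (\sum_k \sum_(l : I) (h k ^+ 2 + h l ^+ 2) / 2)).
 apply: ler_sum => k _; apply: ler_sum => l _.
 rewrite -(real_normK (num_real (h k))) -(real_normK (num_real (h l))).
 have := sqr_ge0 (`|h k| - `|h l|); lra.
rewrite le_eqVlt; apply/orP; left; apply/eqP.
transitivity (\sum_(k : I) \sum_(l : I) h k ^+ 2 / 2 + \sum_(k : I) \sum_(l : I) h l ^+ 2 / 2).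
 rewrite -big_split/=; apply: eq_bigr => k _; rewrite -big_split/=; apply: eq_bigr => l _.
 by rewrite mulrDl.
rewrite [X in X + _]exchange_big/= -mulr2n sumr_const -mulr_suml -mulrnAl.
by rewrite mulr2n -splitr mulr_natl.
Qed.

(** For steps of l^1 norm at least 1 the bound on f suffices; for shorter steps it is Taylor's
    inequality with the bound on g. *)
Lemma smooth_lip f g C : smooth f g C -> lip f (2 * C).
Proof.
move=> sf; have C0 := smooth_ge0 sf; have [f0 g0 fT] := sf; move=> x h.
have s0 : 0 <= \sum_k `|h k| by apply: sumr_ge0.
have [s1|s1] := leP 1 (\sum_k `|h k|).
 apply: (le_trans (ler_normB _ _)); have := f0 (x + h); have := f0 x.
 have : 2 * C <= 2 * C * \sum_k `|h k| by rewrite ler_peMr// mulr_ge0.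
 lra.
have h1 := fT x h.
have h2 : `|\sum_k g k x * h k| <= C * \sum_k `|h k|.
 apply: (le_trans (ler_norm_sum _ _ _)); rewrite mulr_sumr; apply: ler_sum => k _.
 by rewrite normrM ler_wpM2r.
have h3 : \sum_k h k ^+ 2 <= \sum_k `|h k|.
 apply: ler_sum => k _; rewrite -real_normK ?num_real// expr2 ler_piMl//.
 apply: (le_trans _ (ltW s1)); rewrite (bigD1 k)//= lerDl; exact: sumr_ge0.
have h4 : C * \sum_k h k ^+ 2 <= C * \sum_k `|h k| by rewrite ler_wpM2l.
rewrite -[f (x + h) - f x](subrK (\sum_k g k x * h k)).
apply: (le_trans (ler_normD _ _)); lra.
Qed.

Lemma smooth_cst c : smooth (fun=> c) (fun _ _ => 0) `|c|.
Proof.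
split => // [k x|x h]; first by rewrite normr0.
rewrite subrr sub0r normrN big1 ?normr0; last by move=> k _; rewrite mul0r.
by rewrite mulr_ge0// sumr_ge0// => k _; exact: sqr_ge0.
Qed.

Lemma smoothM f g C f' g' C' : smooth f g C -> smooth f' g' C' ->
 exists g'' C'', smooth (fun x => f x * f' x) g'' C''.
Proof.
move=> sf sf'; have C0 := smooth_ge0 sf; have C0' := smooth_ge0 sf'.
have lf' := smooth_lip sf'; have [f0 g0 fT] := sf; have [f0' g0' fT'] := sf'.
exists (fun k x => f x * g' k x + f' x * g k x), ((2 + 2 * #|I|%:R) * (C * C')).
have n0 : 0 <= #|I|%:R :> R by [].
have CC : 0 <= C * C' by rewrite mulr_ge0.
split.
- move=> x; rewrite normrM.
 apply: (@le_trans _ _ (C * C')); first by apply: ler_pM.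
 by rewrite ler_peMl//; lra.
- move=> k x; apply: (le_trans (ler_normD _ _)); rewrite !normrM.
 have h1 : `|f x| * `|g' k x| <= C * C' by apply: ler_pM.
 have h2 : `|f' x| * `|g k x| <= C' * C by apply: ler_pM.
 have h3 : 0 <= #|I|%:R * (C * C') by rewrite mulr_ge0.
 rewrite mulrDl; lra.
move=> x h; set S := \sum_k h k ^+ 2; have S0 : 0 <= S by apply: sumr_ge0 => k _; exact: sqr_ge0.
pose A := f (x + h) - f x - \sum_k g k x * h k.
pose B := f' (x + h) - f' x - \sum_k g' k x * h k.
pose G := \sum_k g k x * h k.
(* The first order terms cancel. The three terms left are of second order, the last as a product of
   two quantities of first order. *)
have -> : f (x + h) * f' (x + h) - f x * f' x - \sum_k (f x * g' k x + f' x * g k x) * h k =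
  A * f' (x + h) + f x * B + G * (f' (x + h) - f' x).
 have -> : \sum_k (f x * g' k x + f' x * g k x) * h k =
   f x * (\sum_k g' k x * h k) + f' x * G.
  rewrite !mulr_sumr -big_split/=; apply: eq_bigr => k _; by ring.
 rewrite /A /B /G; ring.
have hA : `|A * f' (x + h)| <= C * C' * S.
 rewrite normrM [leRHS](_ : _ = (C * S) * C'); last by ring.
 by apply: ler_pM => //; exact: fT.
have hB : `|f x * B| <= C * C' * S.
 rewrite normrM -mulrA; apply: ler_pM => //; exact: fT'.
have hG : `|G| <= C * \sum_k `|h k|.
 apply: (le_trans (ler_norm_sum _ _ _)); rewrite mulr_sumr; apply: ler_sum => k _.
 by rewrite normrM ler_wpM2r.
have hD : `|G * (f' (x + h) - f' x)| <= 2 * #|I|%:R * (C * C') * S.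
 rewrite normrM; apply: (@le_trans _ _ ((C * \sum_k `|h k|) * (2 * C' * \sum_k `|h k|))).
  by apply: ler_pM => //; exact: lf'.
 rewrite [leLHS](_ : _ = 2 * (C * C') * (\sum_k `|h k|) ^+ 2); last by rewrite expr2; ring.
 rewrite [leRHS](_ : _ = 2 * (C * C') * (#|I|%:R * S)); last by ring.
 by apply: ler_wpM2l; [rewrite mulr_ge0|exact: sum_abs_sqr].
apply: (le_trans (ler_normD _ _)); have := ler_normD (A * f' (x + h)) (f x * B); lra.
Qed.

Lemma smooth_bump m (k : I) (c : R) : exists g C, smooth (fun x => bump1 m (x k - c)) g C.
Proof.
have [g [C [b0 g0 T0]]] := @bump1_smooth R m.
have C0 : 0 <= C by apply: le_trans (g0 0).
exists (fun l x => if l == k then g (x k - c) else 0), (1 + C); split.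
- by move=> x; have /andP[h1 h2] := b0 (x k - c); rewrite ger0_norm//; lra.
- move=> l x; case: eqP => _; last by rewrite normr0; lra.
 by apply: (le_trans (g0 _)); lra.
move=> x h; rewrite (bigD1 k)//= eqxx big1 ?addr0; last first.
 by move=> l /negbTE ->; rewrite mul0r.
have := T0 (x k - c) (h k); rewrite fctE (_ : x k + h k - c = x k - c + h k); last by ring.
move=> h1; apply: (le_trans h1).
have s0 : h k ^+ 2 <= \sum_l h l ^+ 2.
 by rewrite (bigD1 k)//= lerDl; apply: sumr_ge0 => l _; exact: sqr_ge0.
have := sqr_ge0 (h k); nra.
Qed.

End smooth_functions.

(** * Discretization and freezing of the past *)

Section discretization.
Context {R : realType}.

(** Truncating to [-m, m] before rounding to multiples of 2^-m keeps the number of cells finite, so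
    that a function of the rounded vector is a finite sum of indicators. *)
Definition clip (m : nat) (x : R) : R := Num.max (- m%:R) (Num.min x m%:R).

Definition cell_count (m : nat) := (2 * m * 2 ^ m)%N.

Definition cell (m : nat) (x : R) : 'I_(cell_count m).+1 :=
 inord (Num.truncn ((clip m x + m%:R) * 2 ^+ m)).

Definition cell_val (m : nat) (j : 'I_(cell_count m).+1) : R := j%:R * 2^-1 ^+ m - m%:R.

Lemma clip_in m x : (- m%:R : R) <= clip m x <= m%:R.
Proof.
by rewrite /clip le_max lexx/= ge_max ge_min lexx orbT andbT -subr_ge0 opprK -natrD.
Qed.

Lemma clip_bound m x : 0 <= (clip m x + m%:R) * 2 ^+ m <= (cell_count m)%:R.
Proof.
have /andP[h1 h2] := clip_in m x; have p : 0 < (2 : R) ^+ m by rewrite exprn_gt0.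
rewrite mulr_ge0 ?(ltW p)//=; last by rewrite -lerBlDr sub0r.
rewrite /cell_count natrM natrX ler_pM2r// natrM mulr2n mulrDl !mul1r; lra.
Qed.

Lemma cellE m x : (cell m x : nat) = Num.truncn ((clip m x + m%:R) * 2 ^+ m).
Proof.
have /andP[h1 h2] := clip_bound m x.
rewrite inordK// ltnS truncn_le_nat; apply: (le_lt_trans h2); by rewrite ltr_nat.
Qed.

Lemma cell_near m x : `|clip m x - cell_val (cell m x)| <= 2^-1 ^+ m.
Proof.
have /andP[h1 h2] := clip_bound m x; have p : 0 < (2 : R) ^+ m by rewrite exprn_gt0.
have := truncn_itv h1; rewrite -(cellE m x) /cell_val; set j := (cell m x : nat).
move=> /andP[j1 j2]; rewrite exprVn.
have q1 : j%:R / 2 ^+ m <= clip m x + m%:R by rewrite ler_pdivrMr.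
have q2 : clip m x + m%:R <= j%:R / 2 ^+ m + (2 ^+ m)^-1.
 have -> : j%:R / 2 ^+ m + (2 ^+ m)^-1 = j.+1%:R / 2 ^+ m :> R.
  by rewrite (_ : j.+1%:R = j%:R + 1 :> R) ?mulrDl ?mul1r// -addn1 natrD.
 by rewrite ler_pdivlMr// ltW.
by rewrite ler_norml; apply/andP; split; lra.
Qed.

Lemma cell_meas m j : measurable [set x | cell m x = j].
Proof.
have mc : meas_fun (fun x : R => (clip m x + m%:R) * 2 ^+ m).
 apply: measurable_funM => //; apply: measurable_funD => //.
 by apply: measurable_maxr => //; apply: measurable_minr.
have := mc measurableT `[(j : nat)%:R, j.+1%:R[%classic (measurable_itv _).
rewrite setTI; congr measurable; apply/seteqP; split => x /=; rewrite in_itv/=.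
 by move=> h; apply/ord_inj; rewrite cellE; exact: truncn_def.
by move=> <-; rewrite cellE; apply: truncn_itv; case/andP: (clip_bound m x).
Qed.

Lemma cell_cvg x : (fun m => cell_val (cell m x)) @ \oo --> x.
Proof.
apply/cvgrPdist_le => e e0; near=> m.
have h1 : `|x| <= m%:R.
 near: m; exists (Num.truncn `|x|).+1 => // n /= hn; apply/ltW.
 by apply: lt_le_trans (truncnS_gt _) _; rewrite ler_nat.
have h2 : clip m x = x.
 move: h1; rewrite ler_norml => /andP[a b]; rewrite /clip (min_l b); exact: max_r.
have := cell_near m x; rewrite h2 => h; apply: (le_trans h).
near: m; have [n hn] := half_small e0; exists n => // k /= nk.
apply: (le_trans _ (ltW hn)); apply: ler_wiXn2l => //; rewrite ?invr_ge0// invf_le1// ler1n.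
Unshelve. all: by end_near. Qed.

End discretization.

Section freezing.
Context {R : realType} {d} {Omega : measurableType d}
 (P : probability Omega R) (T : R) (I : finType) (W : I -> R -> Omega -> R)
 (F : R -> set_system Omega) (E0 : nat -> set Omega) (BF : brownian_filtration P T W F E0).
Implicit Types (f : (I -> R) -> R) (X : I -> Omega -> R).

Notation incr k s t := (fun w => W k t w - W k s w).

Let Fs t : sigma_algebra setT (F t) := bf_sigma BF t.

Definition pick (m : nat) (v : {ffun I -> 'I_(@cell_count m).+1}) : I -> R := fun k => cell_val (v k).

Definition cells (m : nat) (X : I -> Omega -> R) (w : Omega) : {ffun I -> 'I_(cell_count m).+1} :=
 [ffun k => cell m (X k w)].

Lemma cvg_finsum (u : I -> nat -> R) (l : I -> R) : (forall k, u k @ \oo --> l k) ->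
 (fun m => \sum_k u k m) @ \oo --> \sum_k l k.
Proof.
move=> h; elim: (index_enum I) => [|k r IH].
 rewrite big_nil (_ : (fun m => _) = fun=> 0); first exact: cvg_cst.
 by apply/funext => m; rewrite big_nil.
rewrite big_cons (_ : (fun m => _) = (fun m => u k m + \sum_(j <- r) u j m)); first exact: cvgD.
by apply/funext => m; rewrite big_cons.
Qed.

Lemma lip_cvg f C (x : I -> R) (xm : nat -> I -> R) : lip f C ->
 (forall k, (fun m => xm m k) @ \oo --> x k) -> (fun m => f (xm m)) @ \oo --> f x.
Proof.
move=> lf hx; apply/subr_cvg0; apply: norm_cvg0.
apply: (@squeeze_cvgr _ _ _ _ (fun=> 0) (fun m => C * \sum_k `|xm m k - x k|)).
- near=> m; rewrite normr_ge0/=; have := lf x (xm m - x).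
 by rewrite [x + _]addrC subrK.
- exact: cvg_cst.
rewrite -[X in _ --> X](mulr0 C); apply: cvgMr.
rewrite -[X in _ --> X](_ : \sum_(k : I) (0 : R) = 0); last by rewrite big1.
apply: cvg_finsum => k; apply/norm_cvg0P.
rewrite -[X in _ --> X](subrr (x k)); apply: cvgB => //; exact: cvg_cst.
Unshelve. all: by end_near. Qed.

Lemma cells_cvg f C X w : lip f C -> (fun m => f (pick (cells m X w))) @ \oo --> f (fun k => X k w).
Proof.
move=> lf; apply: (lip_cvg lf) => k.
rewrite (_ : (fun m => _) = fun m => cell_val (cell m (X k w))); first exact: cell_cvg.
by apply/funext => m; rewrite /pick /cells ffunE.
Qed.

Lemma cells_F G X m v : sigma_algebra setT G -> (forall k, mF G (X k)) ->
 G [set w | cells m X w = v].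
Proof.
move=> sG mX.
have -> : [set w | cells m X w = v] = [set w | all (fun k => cell m (X k w) == v k) (enum I)].
 apply/seteqP; split => w /=.
  by move=> <-; apply/allP => k _; rewrite ffunE.
 by move=> /allP h; apply/ffunP => k; rewrite ffunE; apply/eqP/h; rewrite mem_enum.
elim: (enum I) => [|k r IH].
 by rewrite (_ : [set _ | _] = setT); [exact: sigma_algebraT|apply/seteqP; split].
rewrite (_ : [set _ | _] = (X k @^-1` [set x | cell m x = v k]) `&` [set w | all (fun k => cell m (X k w) == v k) r]).
 by apply: sigma_algebraI => //; apply: (mFP _ sG).1 => //; exact: cell_meas.
by apply/seteqP; split => w /=; [move=> /andP[/eqP]|move=> [/eqP -> ->]].
Qed.

Lemma cells_sum m X (f : (I -> R) -> R) w :
 f (pick (cells m X w)) = \sum_v \1_[set w | cells m X w = v] w * f (pick v).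
Proof.
rewrite (bigD1 (cells m X w))//= big1 ?addr0 => [|v vn].
 by rewrite indicE mem_set ?mul1r.
by rewrite indicE memNset ?mul0r//= => e; rewrite e eqxx in vn.
Qed.

Lemma lip_mF G f C X : sigma_algebra setT G -> lip f C -> (forall k, mF G (X k)) ->
 mF G (fun w => f (fun k => X k w)).
Proof.
move=> sG lf mX.
rewrite (_ : (fun w => _) = flim (fun m w => f (pick (cells m X w)))); last first.
 by apply/funext => w; apply/esym/flim_cvg; exact: cells_cvg lf.
apply: mF_flim => m.
rewrite (_ : (fun w => _) = fun w => \sum_v \1_[set w | cells m X w = v] w * f (pick v)).
 apply: mF_sum => v _; apply: mFM; last exact: mF_cst.
 by apply: mF_indic; exact: cells_F.
by apply/funext => w; exact: cells_sum.
Qed.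

Lemma bdd_cvg (Y phi : Omega -> R) (phin : nat -> Omega -> R) c : sq P Y ->
 (forall m, meas_fun (phin m)) -> meas_fun phi ->
 (forall m w, `|phin m w| <= c) -> (forall w, (fun m => phin m w) @ \oo --> phi w) ->
 (fun m => \int[P]_w (Y w * phin m w)) @ \oo --> \int[P]_w (Y w * phi w).
Proof.
move=> sY mn mp bn cn.
have iY := sq_integ1 (P_fin P) sY; have mY := sq_meas sY.
have iE (g : Omega -> R) : meas_fun g -> (forall w, `|g w| <= c) -> integ P (fun w => Y w * g w).
 move=> mg bg; apply: (sq_integ1 (P_fin P)); have := sq_bddM mg bg sY.
 by congr sq; apply/funext => w; rewrite mulrC.
have bp w : `|phi w| <= c.
 apply/ler_addgt0Pr => e e0; move/cvgrPdist_le : (cn w) => /(_ _ e0) h.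
 near \oo => m; have h1 : `|phi w - phin m w| <= e by near: m.
 rewrite -[phi w](subrK (phin m w)); apply: (le_trans (ler_normD _ _)).
 by rewrite addrC; apply: lerD.
have h : (\int[P]_w (Y w * phin m w)%:E)%E @[m --> \oo] --> (\int[P]_w (Y w * phi w))%:E.
 rewrite /Rintegral fineK; last by apply: integrable_fin_num => //; exact: iE.
 apply: (@dominated_cvg _ _ _ P _ measurableT _ _ (fun w => (c * `|Y w|)%:E)).
 - by move=> m; apply/measurable_EFinP; exact: measurable_funM.
 - by move=> w _; apply: cvg_EFin; [exact: nearW|apply: cvgMr; exact: cn].
 - by [].
 - exact: (integZ c (integrable_norm iY)).
 - by move=> m w _; rewrite lee_fin normrM mulrC ler_wpM2r.
exact: (fine_cvg h).
Unshelve. all: by end_near. Qed.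

Lemma mean_lip s t f C (c : R) : lip f C -> (forall x, `|f x| <= c) -> 0 <= s -> s < t -> t <= T ->
 forall x, integ P (fun w => f (fun k => x k + incr k s t w)) /\
  mF (incr_sigma W s t) (fun w => f (fun k => x k + incr k s t w)).
Proof.
move=> lf bf s0 st tT x.
have m : mF (incr_sigma W s t) (fun w => f (fun k => x k + incr k s t w)).
 apply: (lip_mF _ lf) => [|k]; first exact: smallest_sigma_algebra.
 by apply: mFD; [exact: mF_cst|exact: incr_sigma_mF].
split => //; apply: (sq_integ1 (P_fin P)); apply: (@sq_bdd _ _ _ _ _ c (P_fin P)) => //.
exact: (mF_meas (incr_sigma_meas BF s0 (ltW st) tT) m).
Qed.

(** The transition operator of W from s to t, written as a mean over the probability space instead
    of an integral against a Gaussian kernel. *)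
Definition mean_shift s t f (x : I -> R) : R := \int[P]_w f (fun k => x k + incr k s t w).

Lemma mean_shift_lip s t f C c : lip f C -> (forall x, `|f x| <= c) -> 0 <= s -> s < t -> t <= T ->
 lip (mean_shift s t f) C /\ forall x, `|mean_shift s t f x| <= c.
Proof.
move=> lf bf s0 st tT; have mi := mean_lip lf bf s0 st tT; split => [x h|x].
 rewrite /mean_shift -RintegralB//; [|exact: (mi _).1|exact: (mi _).1].
 apply: Rint_bound => [|w]; first exact: (integB (mi (x + h)).1 (mi x).1).
 have := lf (fun k => x k + incr k s t w) h.
 by congr (`|f _ - _| <= _); apply/funext => k; rewrite !fctE; ring.
by apply: Rint_bound => //; exact: (mi x).1.
Qed.

(** For discretized X the integrand is a finite sum of products of a variable known at s with a
    function of the increments, and independence applies to each term. Bounded convergence removes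
    the discretization. This replaces the computation of a conditional expectation given F_s. *)
Lemma freeze s t X f C c Y : 0 <= s -> s < t -> t <= T -> lip f C -> (forall x, `|f x| <= c) ->
 (forall k, mF (F s) (X k)) -> mF (F s) Y -> sq P Y ->
 \int[P]_w (Y w * f (fun k => X k w + incr k s t w)) =
 \int[P]_w (Y w * mean_shift s t f (fun k => X k w)).
Proof.
move=> s0 st tT lf bf mX mY sY.
have sT : s <= T := le_trans (ltW st) tT.
have [lu bu] := mean_shift_lip lf bf s0 st tT.
have mXm k := mF_meas_le BF sT (mX k).
pose A m v := [set w | cells m X w = v].
have FA m v : F s (A m v) by exact: cells_F.
pose Xm m w := pick (cells m X w).
have E m w (g : (I -> R) -> R) : g (Xm m w) = \sum_v \1_(A m v) w * g (pick v) by exact: cells_sum.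
have mi := mean_lip lf bf s0 st tT.
have mf' x : meas_fun (fun w => f (fun k => x k + incr k s t w)).
 exact: integ_meas (mi x).1.
have iYA m v : integ P (fun w => Y w * \1_(A m v) w).
 have mA := bf_meas BF sT (FA m v).
 apply: (sq_integ1 (P_fin P)).
 have := sq_bddM (measurable_indic mA) (indic_le1 (A m v)) sY.
 by congr sq; apply/funext => w; rewrite mulrC.
have key m : \int[P]_w (Y w * f (fun k => Xm m w k + incr k s t w)) =
  \int[P]_w (Y w * mean_shift s t f (Xm m w)).
 transitivity (\int[P]_w (\sum_v (Y w * \1_(A m v) w) * f (fun k => pick v k + incr k s t w))).
  congr Rintegral; apply/funext => w.
  rewrite (E m w (fun x => f (fun k => x k + incr k s t w))) mulr_sumr.
  by apply: eq_bigr => v _; rewrite mulrA.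
 transitivity (\int[P]_w (\sum_v mean_shift s t f (pick v) * (Y w * \1_(A m v) w))); last first.
  congr Rintegral; apply/funext => w; rewrite (E m w (mean_shift s t f)) mulr_sumr.
  by apply: eq_bigr => v _; rewrite mulrC mulrA.
 have ind v := incr_indep BF s0 st tT (mFM mY (mF_indic (FA m v))) (mi (pick v)).2 (iYA m v) (mi (pick v)).1.
 rewrite Rint_sum; last by move=> v; have [] := ind v.
 rewrite Rint_sum; last by move=> v; exact: integZ.
 apply: eq_bigr => v _; have [_ ->] := ind v.
 by rewrite RintegralZl//; [rewrite mulrC|exact: iYA].
have c1 : (fun m => \int[P]_w (Y w * f (fun k => Xm m w k + incr k s t w))) @ \oo -->
  \int[P]_w (Y w * f (fun k => X k w + incr k s t w)).
 apply: (@bdd_cvg _ _ _ c sY).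
 - move=> m; rewrite (_ : (fun w => _) = fun w => \sum_v \1_(A m v) w * f (fun k => pick v k + incr k s t w)).
   apply: measurable_sum => v; apply: measurable_funM; last exact: mf'.
   by apply: measurable_indic; exact: (bf_meas BF sT (FA m v)).
  by apply/funext => w; exact: (E m w (fun x => f (fun k => x k + incr k s t w))).
 - apply: (mF_meas_le BF tT (lip_mF (Fs t) lf _)) => k; apply: mFD.
   exact: (mF_mono BF (ltW st)).
  apply: mFB; first by apply: (bf_W BF); rewrite tT (le_trans s0)// ltW.
  by apply: (mF_mono BF (ltW st)); apply: (bf_W BF); rewrite s0.
 - by [].
 - move=> w; apply: (lip_cvg lf) => k; apply: cvgD; last exact: cvg_cst.
  rewrite (_ : (fun m => _) = fun m => cell_val (cell m (X k w))); first exact: cell_cvg.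
  by apply/funext => m; rewrite /Xm /pick /cells ffunE.
have c2 : (fun m => \int[P]_w (Y w * mean_shift s t f (Xm m w))) @ \oo -->
  \int[P]_w (Y w * mean_shift s t f (fun k => X k w)).
 apply: (@bdd_cvg _ _ _ c sY).
 - move=> m; rewrite (_ : (fun w => _) = fun w => \sum_v \1_(A m v) w * mean_shift s t f (pick v)).
   apply: measurable_sum => v; apply: measurable_funM => //.
   by apply: measurable_indic; exact: (bf_meas BF sT (FA m v)).
  by apply/funext => w; exact: (E m w).
 - exact: (mF_meas_le BF sT (lip_mF (Fs s) lu mX)).
 - by [].
 - by move=> w; exact: cells_cvg lu.
rewrite (_ : (fun m => _) = fun m => \int[P]_w (Y w * mean_shift s t f (Xm m w))) in c1; last first.
 by apply/funext => m; exact: key.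
exact: (cvg_unique _ c1 c2).
Qed.

End freezing.

(** * Variables orthogonal to all stochastic integrals *)

Section martingale_orthogonality.
Context {R : realType} {d} {Omega : measurableType d}
 (P : probability Omega R) (T : R) (I : finType) (W : I -> R -> Omega -> R)
 (F : R -> set_system Omega) (E0 : nat -> set Omega) (BF : brownian_filtration P T W F E0).
Implicit Types (f : (I -> R) -> R) (g : I -> (I -> R) -> R) (X : I -> Omega -> R).

Notation incr k s t := (fun w => W k t w - W k s w).
Notation mean_shift := (mean_shift P W).
Notation simple := (simple T W F).
Notation Wv t w := (fun k => W k t w).

Let T0 : 0 < T := bf_T BF.
Let Fs t : sigma_algebra setT (F t) := bf_sigma BF t.

Definition unit_step (k : I) (e : R) : I -> R := fun l => if l == k then e else 0.

Lemma sum_unit_step (a : I -> R) k e : \sum_l a l * unit_step k e l = a k * e.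
Proof.
rewrite (bigD1 k)//= big1 ?addr0; first by rewrite /unit_step eqxx.
by move=> l /negbTE lk; rewrite /unit_step lk mulr0.
Qed.

Lemma sum_unit_step2 k e : \sum_l unit_step k e l ^+ 2 = e ^+ 2.
Proof.
rewrite (bigD1 k)//= big1 ?addr0; first by rewrite /unit_step eqxx.
by move=> l /negbTE lk; rewrite /unit_step lk expr0n.
Qed.

Lemma Rint_cstP (c : R) : \int[P]_w c = c.
Proof. by rewrite Rintegral_cst// (_ : fine (P setT) = 1) ?mulr1// probability_setT. Qed.

(** [smooth] assumes no measurability of the gradient; as a limit of difference quotients of f it
    inherits that of f. *)
Lemma smooth_grad_cvg f g C k x : smooth f g C ->
 (fun n => n.+1%:R * (f (x + unit_step k n.+1%:R^-1) - f x)) @ \oo --> g k x.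
Proof.
move=> sf; have C0 := smooth_ge0 sf; have [_ _ fT] := sf.
apply/subr_cvg0; apply: norm_cvg0.
apply: (@squeeze_cvgr _ _ _ _ (fun=> 0) (fun n => C * n.+1%:R^-1)).
- near=> n; rewrite normr_ge0/=.
 have n0 : 0 < n.+1%:R :> R by rewrite ltr0n.
 have := fT x (unit_step k n.+1%:R^-1).
 rewrite sum_unit_step sum_unit_step2.
 move=> h; rewrite -(ler_pM2l n0) in h.
 rewrite -[X in X * `|_|](gtr0_norm n0) -normrM in h.
 rewrite (_ : _ - _ = n.+1%:R * (f (x + unit_step k n.+1%:R^-1) - f x - g k x / n.+1%:R)).
  by apply: (le_trans h); rewrite expr2 mulrCA mulVKf ?gt_eqF//.
 by rewrite [RHS]mulrBr mulrCA divff ?gt_eqF// mulr1.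
- exact: cvg_cst.
rewrite -[X in _ --> X](mulr0 C); apply: cvgMr.
apply/cvgrPdist_le => e e0; near=> n.
rewrite sub0r normrN ger0_norm ?invr_ge0// ltW//; near: n.
exact: (near_infty_natSinv_lt (PosNum e0)).
Unshelve. all: by end_near. Qed.

Lemma lip_shift f C h : lip f C -> lip (fun x => f (x + h)) C.
Proof.
by move=> lf x h'; rewrite (_ : x + h' + h = x + h + h')//; apply/funext => k; rewrite !fctE; ring.
Qed.

Lemma smooth_grad_mF G f g C X k : sigma_algebra setT G -> smooth f g C ->
 (forall k, mF G (X k)) -> mF G (fun w => g k (fun k => X k w)).
Proof.
move=> sG sf mX; have lf := smooth_lip sf.
rewrite (_ : (fun w => _) = flim (fun n w => n.+1%:R *
  (f ((fun k => X k w) + unit_step k n.+1%:R^-1) - f (fun k => X k w)))); last first.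
 by apply/funext => w; apply/esym/flim_cvg; exact: smooth_grad_cvg sf.
apply: mF_flim => n; apply: mFM; first exact: mF_cst.
by apply: mFB; [exact: (lip_mF sG (lip_shift _ lf) mX)|exact: (lip_mF sG lf mX)].
Qed.

Lemma mean_shift_id s f : mean_shift s s f = f.
Proof.
apply/funext => x; rewrite /mean_shift/=.
rewrite (_ : (fun w => _) = fun=> f x); last first.
 by apply/funext => w; congr f; apply/funext => k; rewrite subrr addr0.
by rewrite Rint_cstP.
Qed.

(** Averaging keeps the constant C, so one error bound serves all steps of a subdivision. *)
Lemma mean_shift_smooth s t f g C : smooth f g C -> 0 <= s -> s <= t -> t <= T ->
 smooth (mean_shift s t f) (fun k => mean_shift s t (g k)) C.
Proof.
move=> sf s0; rewrite le_eqVlt => /orP[/eqP <- _|st tT].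
 by rewrite (_ : (fun k => _) = g) ?mean_shift_id//; apply/funext => k; rewrite mean_shift_id.
have lf := smooth_lip sf; have [f0 g0 fT] := sf.
have mi := mean_lip BF lf f0 s0 st tT.
have mgi x k : integ P (fun w => g k (fun k => x k + incr k s t w)).
 apply: (sq_integ1 (P_fin P)); apply: (@sq_bdd _ _ _ _ _ C (P_fin P)) => //.
 apply: (mF_meas (incr_sigma_meas BF s0 (ltW st) tT)).
 apply: (smooth_grad_mF k _ sf) => [|l]; first exact: smallest_sigma_algebra.
 by apply: mFD; [exact: mF_cst|exact: incr_sigma_mF].
split => [x|k x|x h].
- exact: (Rint_bound (mi x).1).
- exact: (Rint_bound (mgi x k)).
have i1 := (mi (x + h)).1; have i2 := (mi x).1.
have i3 k : integ P (fun w => h k * g k (fun k => x k + incr k s t w)) := integZ (h k) (mgi x k).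
have i4 : integ P (fun w => \sum_k h k * g k (fun k => x k + incr k s t w)) := integ_sum _ _ i3.
have e : \sum_k mean_shift s t (g k) x * h k =
  \int[P]_w (\sum_k h k * g k (fun k => x k + incr k s t w)).
 rewrite Rint_sum//; apply: eq_bigr => k _.
 by rewrite RintegralZl//; [rewrite mulrC|exact: mgi].
rewrite e /mean_shift -(RintegralB measurableT i1 i2) -(RintegralB measurableT (integB i1 i2) i4).
apply: Rint_bound; first exact: (integB (integB i1 i2) i4).
move=> w; have := fT (fun k => x k + incr k s t w) h.
rewrite (_ : (fun k => x k + incr k s t w) + h = (fun k => (x + h) k + incr k s t w)); last first.
 by apply/funext => k; rewrite !fctE; ring.
by congr (`| _ - _| <= _); apply: eq_bigr => k _; rewrite mulrC.
Qed.

Lemma mean_shift_comp r s t f g C : smooth f g C -> 0 <= r -> r < s -> s <= t -> t <= T ->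
 mean_shift r s (mean_shift s t f) = mean_shift r t f.
Proof.
move=> sf r0 rs; rewrite le_eqVlt => /orP[/eqP <- _|st tT]; first by rewrite mean_shift_id.
have lf := smooth_lip sf; have [f0 g0 fT] := sf.
have s0 : 0 <= s := le_trans r0 (ltW rs). have sT : s <= T := le_trans (ltW st) tT.
apply/funext => x.
have mX k : mF (F s) (fun w => x k + incr k r s w).
 apply: mFD; first exact: mF_cst.
 apply: mFB; first by apply: (bf_W BF); rewrite s0.
 by apply: (mF_mono BF (ltW rs)); apply: (bf_W BF); rewrite r0 (le_trans (ltW rs)).
have := freeze BF s0 st tT lf f0 mX (@mF_cst R Omega (F s) 1) (sq_cst (P_fin P) 1).
rewrite (_ : (fun w => 1 * mean_shift s t f _) = (fun w => mean_shift s t f (fun k => x k + incr k r s w))); last first.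
 by apply/funext => w; rewrite mul1r.
move=> e; apply: (etrans (esym e)); congr Rintegral; apply/funext => w; rewrite mul1r; congr f.
by apply/funext => k; ring.
Qed.

Lemma sum_sqr_le (h : I -> R) : (\sum_k h k) ^+ 2 <= #|I|%:R * \sum_k h k ^+ 2.
Proof.
apply: le_trans (sum_abs_sqr h); rewrite -[leLHS]real_normK ?num_real//.
by rewrite ler_sqr ?nnegrE ?sumr_ge0// ler_norm_sum.
Qed.

Lemma integ_le_ae (f1 f2 : Omega -> R) : integ P f1 -> integ P f2 -> (forall w, f1 w <= f2 w) ->
 \int[P]_w f1 w <= \int[P]_w f2 w.
Proof. by move=> i1 i2 h; apply: le_Rintegral. Qed.

Lemma incr_sqsum s t : 0 <= s -> s < t -> t <= T ->
 [/\ sq P (fun w => \sum_k incr k s t w ^+ 2),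
   \int[P]_w (\sum_k incr k s t w ^+ 2) = #|I|%:R * (t - s) &
   ip P (fun w => \sum_k incr k s t w ^+ 2) (fun w => \sum_k incr k s t w ^+ 2) <=
    #|I|%:R ^+ 2 * 128 * (t - s) ^+ 2].
Proof.
move=> s0 st tT; have i4 k := incr_X4 BF k s0 st tT.
have m k := incr_meas BF k s0 (ltW st) tT.
have mS : meas_fun (fun w => \sum_k incr k s t w ^+ 2).
 by apply: measurable_sum => k; apply: measurable_funX; exact: m.
have iS : integ P (fun w => \sum_k incr k s t w ^+ 4) by apply: integ_sum => k; case: (i4 k).
have iS' := integZ #|I|%:R iS.
have le w : (\sum_k incr k s t w ^+ 2) ^+ 2 <= #|I|%:R * \sum_k incr k s t w ^+ 4.
 apply: (le_trans (sum_sqr_le _)); rewrite ler_wpM2l//; apply: ler_sum => k _.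
 by rewrite -exprM.
have sS : sq P (fun w => \sum_k incr k s t w ^+ 2).
 split => //; apply: (integ_le _ iS').
  exact: measurable_funX.
 by move=> w; rewrite ger0_norm ?sqr_ge0.
split => //.
 rewrite Rint_sum; last by move=> k; have [] := incr_sq BF k s0 (ltW st) tT.
 rewrite (eq_bigr (fun=> t - s)); first by rewrite sumr_const mulr_natl.
 by move=> k _; exact: (incr_var BF k s0 (ltW st) tT).
apply: (@le_trans _ _ (\int[P]_w (#|I|%:R * \sum_k incr k s t w ^+ 4))).
 by apply: integ_le_ae => //; exact: sq_mul.
rewrite RintegralZl// Rint_sum; last by move=> k; case: (i4 k).
rewrite expr2 -!mulrA ler_wpM2l//.
apply: (@le_trans _ _ (\sum_(k : I) 128 * (t - s) ^+ 2)).
 by apply: ler_sum => k _; case: (i4 k).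
by rewrite sumr_const -[leLHS]mulr_natl.
Qed.

(* 258 = 2 (128 + 1), where 128 comes from the fourth moments of the increments. *)
Definition err_cst : R := locked 258%:R.

Lemma err_cst_ge0 : 0 <= err_cst.
Proof. by rewrite /err_cst -lock. Qed.

Definition step_error s t (U : (I -> R) -> R) g : Omega -> R := fun w =>
 U (Wv t w) - mean_shift s t U (Wv s w) - \sum_k g k (Wv s w) * incr k s t w.

Lemma W_mF k s t : 0 <= s -> s <= t -> s <= T -> mF (F t) (W k s).
Proof. by move=> s0 st sT; apply: (mF_mono BF st); apply: (bf_W BF); rewrite s0. Qed.

(** The linear term has mean 0, so averaging moves U by at most a multiple of t - s. The error is
    therefore bounded by the squared increments plus a multiple of t - s, and its mean square is of
    order (t - s)^2 by the fourth moments. Freezing gives the orthogonality to the past. *)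
Lemma step_errorP s t U g C : smooth U g C -> 0 <= s -> s < t -> t <= T ->
 [/\ sq P (step_error s t U g), mF (F t) (step_error s t U g),
   ip P (step_error s t U g) (step_error s t U g) <= err_cst * (C * #|I|%:R) ^+ 2 * (t - s) ^+ 2 &
   forall Y, mF (F s) Y -> sq P Y -> ip P Y (step_error s t U g) = 0].
Proof.
move=> sU s0 st tT; have C0 := smooth_ge0 sU; have lU := smooth_lip sU; have [U0 g0 UT] := sU.
have sT : s <= T := le_trans (ltW st) tT. have t0 := le_trans s0 (ltW st).
have [S1 S2 S3] := incr_sqsum s0 st tT.
pose u := mean_shift s t U.
have [lu bu] := mean_shift_lip BF lU U0 s0 st tT.
have mWs k : mF (F s) (W k s) by exact: W_mF.
have mWt k : mF (F t) (W k t) by exact: W_mF.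
have mg k : mF (F s) (fun w => g k (Wv s w)) by exact: (smooth_grad_mF k (Fs s) sU).
have mu : mF (F s) (fun w => u (Wv s w)) by exact: (lip_mF (Fs s) lu).
have mUt : mF (F t) (fun w => U (Wv t w)) by exact: (lip_mF (Fs t) lU).
have sg k := past_incr BF k s0 (ltW st) tT (mg k) (sq_bdd (P_fin P) (mF_meas_le BF sT (mg k)) (fun w => g0 k _)).
have mD : mF (F t) (step_error s t U g).
 apply: mFB.
  by apply: mFB => //; exact: (mF_mono BF (ltW st)).
 apply: mF_sum => k _; apply: mFM; first exact: (mF_mono BF (ltW st)).
 by apply: mFB => //; exact: (mF_mono BF (ltW st)).
have dist x : `|u x - U x| <= C * #|I|%:R * (t - s).
 have mi := mean_lip BF lU U0 s0 st tT x.
 have ig k : integ P (fun w => g k x * incr k s t w).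
  by apply: integZ; apply: (sq_integ1 (P_fin P)); exact: (incr_sq BF k s0 (ltW st) tT).
 have igs : integ P (fun w => \sum_k g k x * incr k s t w) := integ_sum _ _ ig.
 have z : \int[P]_w (\sum_k g k x * incr k s t w) = 0.
  rewrite Rint_sum//; apply: big1 => k _; rewrite RintegralZl//.
   by rewrite (incr_mean BF k s0 (ltW st) tT) mulr0.
  by apply: (sq_integ1 (P_fin P)); exact: (incr_sq BF k s0 (ltW st) tT).
 have ic : integ P (fun=> U x) := integ_cstP P _.
 have -> : u x - U x = \int[P]_w (U (fun k => x k + incr k s t w) - U x - \sum_k g k x * incr k s t w).
  rewrite (RintegralB measurableT (integB mi.1 ic) igs) (RintegralB measurableT mi.1 ic) z subr0.
  by rewrite Rint_cstP.
 have i5 := integB (integB mi.1 ic) igs.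
 apply: (le_trans (le_normr_Rintegral measurableT i5)).
 rewrite -mulrA -S2 -RintegralZl//; last exact: (sq_integ1 (P_fin P) S1).
 apply: integ_le_ae; [exact: (integrable_norm i5)|exact: (integZ C (sq_integ1 (P_fin P) S1))|].
 by move=> w; exact: UT.
have bD w : `|step_error s t U g w| <= C * (\sum_k incr k s t w ^+ 2 + #|I|%:R * (t - s)).
 rewrite /step_error (_ : _ - _ = (U (Wv t w) - U (Wv s w) - \sum_k g k (Wv s w) * incr k s t w) - (u (Wv s w) - U (Wv s w))); last by rewrite /u; ring.
 apply: (le_trans (ler_normB _ _)); rewrite mulrDr; apply: lerD; last by rewrite mulrA.
 have := UT (Wv s w) (fun k => incr k s t w).
 by rewrite (_ : Wv s w + _ = Wv t w)//; apply/funext => k; rewrite !fctE addrC subrK.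
have dts : 0 <= t - s by rewrite subr_ge0 ltW.
have cd : 0 <= #|I|%:R * (t - s) by rewrite mulr_ge0.
have sb : sq P (fun w => C * (\sum_k incr k s t w ^+ 2 + #|I|%:R * (t - s))).
 by apply: sqZ; apply: (sqD S1); exact: (sq_cst (P_fin P)).
have sD : sq P (step_error s t U g).
 apply: (sq_le (mF_meas_le BF tT mD) sb) => w; apply: (le_trans (bD w)); exact: ler_norm.
split => //.
 pose S w := \sum_k incr k s t w ^+ 2.
 have i1 := sq_mul S1 S1.
 have ic : integ P (fun=> (#|I|%:R * (t - s)) ^+ 2) := integ_cstP P _.
 apply: (@le_trans _ _ (\int[P]_w (2 * C ^+ 2 * (S w * S w) + 2 * C ^+ 2 * (#|I|%:R * (t - s)) ^+ 2))).
  apply: integ_le_ae.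
  - exact: sq_mul.
  - exact: (integD (integZ (2 * C ^+ 2) i1) (integZ (2 * C ^+ 2) ic)).
  move=> w; rewrite -expr2 -[leLHS]real_normK ?num_real//.
  apply: (@le_trans _ _ ((C * (S w + #|I|%:R * (t - s))) ^+ 2)).
   have h0 := bD w; have h1 := le_trans (normr_ge0 _) h0.
   by rewrite ler_sqr ?nnegrE.
  rewrite exprMn.
  apply: (@le_trans _ _ (C ^+ 2 * (2 * (S w * S w) + 2 * (#|I|%:R * (t - s)) ^+ 2))).
   apply: ler_wpM2l; first exact: sqr_ge0.
   have := sqr_ge0 (S w - #|I|%:R * (t - s)); set q := _ * (t - s); set p := S w.
   rewrite sqrrB sqrrD; lra.
  by rewrite le_eqVlt; apply/orP; left; apply/eqP; ring.
 rewrite (RintegralD measurableT (integZ (2 * C ^+ 2) i1) (integZ (2 * C ^+ 2) ic)).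
 rewrite RintegralZl// Rint_cstP.
 have h : 2 * C ^+ 2 * (\int[P]_w (S w * S w)) <= 2 * C ^+ 2 * (#|I|%:R ^+ 2 * 128 * (t - s) ^+ 2).
  by rewrite ler_wpM2l// mulr_ge0// sqr_ge0.
 apply: (le_trans (lerD h (lexx _))); rewrite /err_cst -lock le_eqVlt; apply/orP; left; apply/eqP; ring.
move=> Y mY sY.
have sUt : sq P (fun w => U (Wv t w)) by apply: (sq_bdd (P_fin P) (mF_meas_le BF tT mUt)).
have su : sq P (fun w => u (Wv s w)) by apply: (sq_bdd (P_fin P) (mF_meas_le BF sT mu)).
have sgk k : sq P (fun w => g k (Wv s w) * incr k s t w) by have [] := sg k.
have e : step_error s t U g = (fun w => U (Wv t w)) - (fun w => u (Wv s w)) -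
  \sum_k (fun w => g k (Wv s w) * incr k s t w).
 by apply/funext => w; rewrite /step_error !fctE fct_sumE.
rewrite e ipBr//; last 2 first.
- exact: sqB.
- by apply: sq_sum => k _.
rewrite ipBr// ip_sumr//.
have fr := freeze BF s0 st tT lU U0 mWs mY sY.
have -> : ip P Y (fun w => U (Wv t w)) = ip P Y (fun w => u (Wv s w)).
 rewrite -[RHS]fr /ip; congr Rintegral; apply/funext => w; congr (_ * U _).
 by apply/funext => k; rewrite addrC subrK.
rewrite subrr sub0r big1 ?oppr0// => k _.
have sYg : sq P (fun w => g k (Wv s w) * Y w).
 by apply: (sq_bddM (mF_meas_le BF sT (mg k)) _ sY) => w; exact: g0.
have [_ z] := past_incr BF k s0 (ltW st) tT (mFM (mg k) mY) sYg.
by rewrite -[RHS]z /ip; congr Rintegral; apply/funext => w; rewrite mulrA; congr (_ * _); rewrite mulrC.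
Qed.

Lemma ip_bddM (V S : Omega -> R) c : meas_fun V -> (forall w, `|V w| <= c) -> sq P S ->
 nrm P (fun w => V w * S w) <= c * nrm P S.
Proof.
move=> mV Vc sS; have c0 : 0 <= c by apply: le_trans (Vc point).
have sVS := sq_bddM mV Vc sS.
rewrite -[leRHS]ger0_norm ?mulr_ge0 ?nrm_ge0// -[leLHS]ger0_norm ?nrm_ge0//.
rewrite -ler_sqr ?nnegrE// !real_normK ?num_real// exprMn !sqr_nrm /ip -RintegralZl//; last exact: sq_mul.
apply: integ_le_ae; [exact: sq_mul|exact: (integZ (c ^+ 2) (sq_mul sS sS))|].
move=> w; rewrite -!expr2 exprMn ler_wpM2r ?sqr_ge0// -[leLHS]real_normK ?num_real//.
by rewrite ler_sqr ?nnegrE.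
Qed.

Section orthogonal.
Variable Z : Omega -> R.
Hypotheses (sZ : sq P Z) (Z0 : forall V : Omega -> R, mF (F 0) V -> sq P V -> ip P Z V = 0).
Hypothesis Zs : forall k H J, simple H J -> ip P Z (J k T) = 0.

Lemma sqVf t f C (V : Omega -> R) c : lip f C -> (forall x, `|f x| <= c) -> 0 <= t -> t <= T ->
 meas_fun V -> (exists c', forall w, `|V w| <= c') ->
 sq P (fun w => V w * f (Wv t w)).
Proof.
move=> lf f0 t0 tT mV [c' Vc]; apply: (sq_bddM mV Vc).
apply: (sq_bdd (P_fin P)); last by move=> w; exact: f0.
apply: (mF_meas_le BF tT (lip_mF (Fs t) lf _)) => k; exact: W_mF.
Qed.

Lemma step_orth s t U g C V : smooth U g C -> 0 <= s -> s < t -> t <= T ->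
 mF (F s) V -> (exists c, forall w, `|V w| <= c) ->
 ip P Z (fun w => V w * U (Wv t w)) =
 ip P Z (fun w => V w * mean_shift s t U (Wv s w)) + ip P Z (fun w => V w * step_error s t U g w).
Proof.
move=> sU s0 st tT mV Vc; have [c hc] := Vc; have [U0 g0 UT] := sU; have lU := smooth_lip sU.
have sT : s <= T := le_trans (ltW st) tT.
have mVm := mF_meas_le BF sT mV.
have [lu bu] := mean_shift_lip BF lU U0 s0 st tT.
have [sD _ _ _] := step_errorP sU s0 st tT.
have mg k : mF (F s) (fun w => V w * g k (Wv s w)).
 apply: mFM => //; apply: (smooth_grad_mF k (Fs s) sU) => l; exact: W_mF.
have bg k : exists c, forall w, `|V w * g k (Wv s w)| <= c.
 by exists (c * C) => w; rewrite normrM ler_pM.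
pose Hk k : I -> R -> Omega -> R := elemJ W s t (fun w => V w * g k (Wv s w)).
have se k := simple_elem W s0 (ltW st) tT (mg k) (bg k).
have hk k : ip P Z (Hk k k T) = 0 := Zs k (se k).
have sk k : sq P (Hk k k T).
 have [] := elemJ_sq BF k s0 (ltW st) tT (mg k) (bg k) (ltW T0) (lexx T); by [].
have s1 := sqVf lu bu s0 sT mVm Vc.
have s2 := sq_bddM mVm hc sD.
rewrite (_ : (fun w => V w * U _) = (fun w => V w * mean_shift s t U (Wv s w)) +
  (fun w => V w * step_error s t U g w) + \sum_k Hk k k T).
 rewrite ipDr//; last 2 first.
 - exact: sqD.
 - by apply: sq_sum => k _.
 rewrite ipDr// ip_sumr// [X in _ + X]big1 ?addr0// => k _; exact: hk.
apply/funext => w; rewrite !fctE fct_sumE -mulrDr /step_error.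
rewrite (_ : \sum_k Hk k k T w = V w * \sum_k g k (Wv s w) * incr k s t w); first by ring.
rewrite mulr_sumr; apply: eq_bigr => k _; rewrite /Hk /elemJ (min_r tT) (min_r sT); ring.
Qed.

(** Going back from b in j steps, the step errors are accumulated in one variable S that does not
    depend on V. Each new error is known at the time from which the previous sum is orthogonal to
    the past, so mean squares add instead of norms: n steps of size 1/n contribute a total of order
    1/n. *)
Lemma telescope f g C a b n : smooth f g C -> 0 <= a -> a < b -> b <= T ->
 forall j, (j <= n.+1)%N -> exists S, let s := b - j%:R * ((b - a) / n.+1%:R) in
 [/\ sq P S, forall Y, mF (F s) Y -> sq P Y -> ip P Y S = 0,
   ip P S S <= j%:R * (err_cst * (C * #|I|%:R) ^+ 2 * ((b - a) / n.+1%:R) ^+ 2) &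
   forall V, mF (F s) V -> (exists c, forall w, `|V w| <= c) ->
   ip P Z (fun w => V w * f (Wv b w)) =
   ip P Z (fun w => V w * mean_shift s b f (Wv s w)) + ip P Z (fun w => V w * S w)].
Proof.
move=> sf a0 ab bT; set dl := (b - a) / n.+1%:R.
have n0 : 0 < n.+1%:R :> R by rewrite ltr0n.
have dl0 : 0 < dl by rewrite divr_gt0// subr_gt0.
have ndl : n.+1%:R * dl = b - a by rewrite mulrC divfK// gt_eqF.
elim => [_|j IH jn].
 exists 0; rewrite mul0r subr0; split; first exact: sq0.
 - by move=> Y _ _; rewrite ip0r.
 - by rewrite ip0l mul0r.
 move=> V mV _; rewrite mean_shift_id (_ : (fun w => V w * 0 w) = 0) ?ip0r ?addr0//.
 by apply/funext => w; rewrite mulr0.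
have [S] := IH (ltnW jn); set t := b - j%:R * dl; cbv zeta => -[sS oS nS eS].
set s := b - j.+1%:R * dl.
have ts : t - s = dl by rewrite /t /s -natr1; ring.
have st : s < t by rewrite -subr_gt0 ts.
have as_ : a <= s.
 have : j.+1%:R * dl <= n.+1%:R * dl by rewrite ler_pM2r// ler_nat.
 rewrite ndl /s; lra.
have s0 := le_trans a0 as_.
have tb : t <= b by rewrite /t lerBlDr lerDl mulr_ge0// ltW.
have tT := le_trans tb bT; have t0 := le_trans s0 (ltW st).
have sU := mean_shift_smooth sf t0 tb bT.
have [sD mD nD oD] := step_errorP sU s0 st tT.
set D := step_error _ _ _ _ in sD mD nD oD.
exists (S + D); split.
- exact: sqD.
- move=> Y mY sY; rewrite ipDr// oD// oS ?addr0//; exact: (mF_mono BF (ltW st)).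
(* The cross terms vanish: D is known at t and S is orthogonal to what is known at t. *)
- clearbody D; rewrite ipDl; [|exact: sS|exact: sD|exact: sqD]; rewrite !ipDr//.
 rewrite (oS D mD sD) (ipC P S D) (oS D mD sD) add0r addr0.
 by rewrite ts in nD; apply: (le_trans (lerD nS nD)); rewrite (_ : j.+1%:R = j%:R + 1 :> R) ?mulrDl ?mul1r// -addn1 natrD.
move=> V mV Vc.
have mVt := mF_mono BF (ltW st) mV.
have sT : s <= T := le_trans (ltW st) tT.
have mVm := mF_meas_le BF sT mV.
rewrite (eS V mVt Vc) (step_orth sU s0 st tT mV Vc) (mean_shift_comp sf s0 st tb bT) -addrA.
have [c hc] := Vc.
have sVD := sq_bddM mVm hc sD; have sVS := sq_bddM mVm hc sS.
congr (_ + _); apply: (etrans (esym (ipDr sVD sVS sZ))); congr ip; clearbody D.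
by apply/funext => w; rewrite !fctE mulrDr addrC.
Qed.

Lemma telescope_lim f g C a b V : smooth f g C -> 0 <= a -> a <= b -> b <= T ->
 mF (F a) V -> (exists c, forall w, `|V w| <= c) ->
 ip P Z (fun w => V w * f (Wv b w)) = ip P Z (fun w => V w * mean_shift a b f (Wv a w)).
Proof.
move=> sf a0; rewrite le_eqVlt => /orP[/eqP <- _ _ _|ab bT mV Vc]; first by rewrite mean_shift_id.
have [c hc] := Vc; have c0 : 0 <= c by apply: le_trans (hc point).
have mVm := mF_meas_le BF (le_trans (ltW ab) bT) mV.
apply/eqP; rewrite -subr_eq0 -normr_eq0; set x := `|_|.
pose M := (nrm P Z * c) ^+ 2 * (err_cst * (C * #|I|%:R) ^+ 2 * (b - a) ^+ 2).
(* n + 1 errors, each of mean square of order (b - a)^2 / (n + 1)^2. *)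
have key n : x ^+ 2 <= M * n.+1%:R^-1.
 have n0 : 0 < n.+1%:R :> R by rewrite ltr0n.
 have [S] := telescope sf a0 ab bT (leqnn n.+1); cbv zeta.
 have -> : b - n.+1%:R * ((b - a) / n.+1%:R) = a.
  by rewrite mulrC divfK ?gt_eqF// opprB addrC subrK.
 move=> [sS oS nS eS].
 have sVS := sq_bddM mVm hc sS.
 have h1 : x <= nrm P Z * c * nrm P S.
  rewrite /x (eS V mV Vc) addrC addKr.
  apply: (le_trans (ip_CS sZ sVS)); rewrite -mulrA ler_wpM2l ?nrm_ge0//.
  exact: ip_bddM.
 apply: (@le_trans _ _ ((nrm P Z * c * nrm P S) ^+ 2)).
  by rewrite ler_sqr ?nnegrE ?mulr_ge0 ?nrm_ge0// /x.
 rewrite exprMn sqr_nrm /M -[leRHS]mulrA; apply: ler_wpM2l; first exact: sqr_ge0.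
 apply: (le_trans nS); rewrite le_eqVlt; apply/orP; left; apply/eqP.
 by rewrite expr_div_n; field; rewrite gt_eqF.
rewrite -sqrf_eq0; apply/eqP/le_anti; rewrite sqr_ge0 andbT; apply/ler_addgt0Pr => e e0; rewrite add0r.
have M0 : 0 <= M by rewrite /M mulr_ge0 ?sqr_ge0// mulr_ge0 ?sqr_ge0// mulr_ge0 ?sqr_ge0 ?err_cst_ge0.
have p : 0 < e / (M + 1) by rewrite divr_gt0// ltr_wpDl.
near \oo => n.
apply: (le_trans (key n)).
have h : n.+1%:R^-1 < e / (M + 1).
 by near: n; exact: (near_infty_natSinv_lt (PosNum p)).
apply: (@le_trans _ _ (M * (e / (M + 1)))); first by rewrite ler_wpM2l// ltW.
have M1 : 0 < M + 1 by rewrite ltr_wpDl.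
by rewrite mulrA ler_pdivrMr// mulrDr mulr1 mulrC lerDl ltW.
Unshelve. all: by end_near. Qed.

Definition smoothable f := exists g C, smooth f g C.

Definition path_prod (l : seq (R * ((I -> R) -> R))) (w : Omega) : R :=
 \prod_(p <- l) p.2 (Wv p.1 w).

Lemma path_prod_mF l t : 0 <= t <= T -> {in map fst l, forall s, 0 <= s <= t} ->
 (forall p, List.In p l -> smoothable p.2) ->
 mF (F t) (path_prod l) /\ exists c, forall w, `|path_prod l w| <= c.
Proof.
move=> /andP[t0 tT]; elim: l => [|[s f] l IH] hl sl.
 rewrite (_ : path_prod [::] = fun=> 1); last by apply/funext => w; rewrite /path_prod big_nil.
 by split; [exact: mF_cst|exists `|1|].
have [||m [c hc]] := IH.
- by move=> u ul; apply: hl; rewrite inE ul orbT.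
- by move=> p pl; apply: sl; right.
have [g [C sf]] := sl (s, f) (or_introl erefl); have [f0 _ _] := sf.
have /andP[s0 st] := hl s ltac:(by rewrite inE eqxx).
rewrite (_ : path_prod _ = fun w => f (Wv s w) * path_prod l w); last first.
 by apply/funext => w; rewrite /path_prod big_cons.
split.
 apply: mFM => //; apply: (lip_mF (Fs t) (smooth_lip sf)) => k.
 exact: (W_mF k s0 st (le_trans st tT)).
by exists (C * c) => w; rewrite normrM ler_pM.
Qed.

(** The times decrease along the list. The factor at the latest time t is averaged back to the next
    time s, where it merges with the factor already there; this shortens the list by one. The last
    factor is averaged back to time 0, where Z is orthogonal by assumption. *)
Lemma orth_path_prod n : forall l V, size l = n -> sorted (fun p q => q.1 <= p.1) l ->
 {in map fst l, forall s, 0 <= s <= T} -> (forall p, List.In p l -> smoothable p.2) ->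
 mF (F 0) V -> (exists c, forall w, `|V w| <= c) ->
 ip P Z (fun w => V w * path_prod l w) = 0.
Proof.
have T00 : 0 <= (0 : R) <= T by rewrite lexx ltW.
elim: n => [|n IH] [|[t f] l] V //=.
 move=> _ _ _ _ mV [c Vc]; apply: Z0.
  by apply: mFM => //; rewrite (_ : path_prod [::] = fun=> 1); [exact: mF_cst|apply/funext => w; rewrite /path_prod big_nil].
 rewrite (_ : (fun w => _) = V); first by apply: (sq_bdd (P_fin P) _ Vc); exact: (mF_meas_le BF (ltW T0) mV).
 by apply/funext => w; rewrite /path_prod big_nil mulr1.
move=> [sl] srt hl sml mV Vc; have [c hc] := Vc.
have [g [C sf]] := sml (t, f) (or_introl erefl).
have /andP[t0 tT] := hl t ltac:(by rewrite inE eqxx).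
have mV' : meas_fun V := mF_meas_le BF (ltW T0) mV.
case: l sl srt hl sml => [|[s f'] l] sl srt hl sml.
 rewrite (_ : (fun w => _) = fun w => V w * f (Wv t w)); last first.
  by apply/funext => w; rewrite /path_prod big_cons big_nil mulr1.
 rewrite (telescope_lim sf (lexx 0) t0 tT mV Vc).
 have su := mean_shift_smooth sf (lexx 0) t0 tT; have [u0 _ _] := su.
 apply: Z0; last exact: (sqVf (smooth_lip su) u0 (lexx 0) (ltW T0) mV' Vc).
 by apply: mFM => //; apply: (lip_mF (Fs 0) (smooth_lip su)) => k; exact: (W_mF k _ _ (ltW T0)).
have /andP[st srt'] : (s <= t) && path (fun p q => q.1 <= p.1) (s, f') l by exact: srt.
have /andP[s0 sT] := hl s ltac:(by rewrite !inE eqxx orbT).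
have sT0 : 0 <= s <= T by rewrite s0.
have srt2 : path (fun x y : R => y <= x) (s, f').1 (map fst l) by rewrite path_map.
have hl' : {in map fst ((s, f') :: l), forall u, 0 <= u <= s}.
 have trn : transitive (fun x y : R => y <= x) by move=> x y z h1 h2; exact: le_trans h2 h1.
 have /allP srt3 := order_path_min trn srt2.
 move=> u /= ul; have /andP[-> _] : 0 <= u <= T by apply: hl; rewrite inE ul orbT.
 by move: ul; rewrite inE => /orP[/eqP ->|/srt3] /=.
have sml' p : List.In p ((s, f') :: l) -> smoothable p.2 by move=> pl; apply: sml; right.
have [mp [c' hc']] := path_prod_mF sT0 hl' sml'.
pose V' w := V w * path_prod ((s, f') :: l) w.
have mV1 : mF (F s) V' by apply: mFM => //; exact: (mF_mono BF s0).
have Vc1 : exists c, forall w, `|V' w| <= c by exists (c * c') => w; rewrite normrM ler_pM.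
rewrite (_ : (fun w => _) = fun w => V' w * f (Wv t w)); last first.
 by apply/funext => w; rewrite /V' /path_prod big_cons/=; ring.
rewrite (telescope_lim sf s0 st tT mV1 Vc1).
have su := mean_shift_smooth sf s0 st tT.
have [g' [C' sf']] := sml (s, f') (or_intror (or_introl erefl)).
(* The average of f from s to t, times the factor at s; this product is smooth again. *)
pose U x := mean_shift s t f x * f' x.
have [gU [CU sU]] := smoothM su sf'.
rewrite -[RHS](IH ((s, U) :: l) V)//.
- congr ip; apply/funext => w; rewrite /V' /path_prod !big_cons/= /U; ring.
- by have : path (fun x y : R => y <= x) (s, U).1 (map fst l) by []; rewrite path_map.
- move=> u; rewrite inE => /orP[/eqP ->//|ul]; apply: hl; by rewrite !inE ul !orbT.
- by move=> p [<-|pl]; [exists gU, CU|apply: sml'; right].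
Qed.

(** A Brownian event is approximated by a bump. An initial event is not a function of W: it gets the
    trivial factor here and its indicator goes into [init_prod]. *)
Definition atom_pair (m : nat) (a : atom I) : R * ((I -> R) -> R) :=
 match a with
 | inl _ => (0, fun=> 1)
 | inr (k, r, c) => (ratr r, fun x => bump1 m (x k - ratr c))
 end.

Definition atom_init (a : atom I) : Omega -> R :=
 match a with inl n => \1_(E0 n) | inr _ => fun=> 1 end.

Definition init_prod (s : seq (atom I)) (w : Omega) : R := \prod_(a <- s) atom_init a w.

Lemma init_prodP s : mF (F 0) (init_prod s) /\ forall w, `|init_prod s w| <= 1.
Proof.
elim: s => [|a s [m b]].
 rewrite (_ : init_prod [::] = fun=> 1); last by apply/funext => w; rewrite /init_prod big_nil.
 by split; [exact: mF_cst|move=> w; rewrite normr1].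
rewrite (_ : init_prod _ = fun w => atom_init a w * init_prod s w); last first.
 by apply/funext => w; rewrite /init_prod big_cons.
have [ma ba] : mF (F 0) (atom_init a) /\ forall w, `|atom_init a w| <= 1.
 case: a => [n|p] /=; last by split; [exact: mF_cst|move=> w; rewrite normr1].
 by split; [apply: mF_indic; exact: (bf_E0 BF)|exact: indic_le1].
by split; [exact: mFM|move=> w; rewrite normrM -[leRHS]mulr1 ler_pM].
Qed.

Lemma atom_pair_smooth m a : smoothable (atom_pair m a).2.
Proof.
case: a => [n|[[k r] c]] /=; last exact: smooth_bump.
by exists (fun _ _ => 0), `|1|; exact: smooth_cst.
Qed.

Lemma bump1_in m (y : R) : 0 <= bump1 m y <= 1.
Proof. by have [g [C [h _ _]]] := @bump1_smooth R m; exact: h. Qed.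

Lemma atom_prod_bound m s w : `|path_prod (map (atom_pair m) s) w| <= 1.
Proof.
rewrite /path_prod big_map normr_prod; elim: s => [|a s IH]; first by rewrite big_nil.
rewrite big_cons -[leRHS]mulr1; apply: ler_pM => //; first by apply: prodr_ge0.
case: a => [n|[[k r] c]] /=; first by rewrite normr1.
by have /andP[h1 h2] := bump1_in m (W k (ratr r) w - ratr c); rewrite ger0_norm.
Qed.

Lemma atom_prod_cvg s w : (fun m => init_prod s w * path_prod (map (atom_pair m) s) w) @ \oo -->
 (\1_(cylinder W E0 s) w : R).
Proof.
elim: s => [|a s IH].
 rewrite /= indicT (_ : (fun m => _) = fun=> 1); first exact: cvg_cst.
 by apply/funext => m; rewrite /init_prod /path_prod !big_nil mulr1.
have -> : (\1_(cylinder W E0 (a :: s)) w : R) = \1_(atom_set W E0 a) w * \1_(cylinder W E0 s) w.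
 by rewrite /= indicI.
rewrite (_ : (fun m => _) = (fun m => (atom_init a w * (atom_pair m a).2 (Wv (atom_pair m a).1 w)) *
  (init_prod s w * path_prod (map (atom_pair m) s) w))); last first.
 by apply/funext => m; rewrite /init_prod /path_prod /= !big_cons; ring.
apply: cvgM => //; case: a => [n|[[k r] c]] /=.
 rewrite (_ : (fun m => _) = fun=> \1_(E0 n) w); first exact: cvg_cst.
 by apply/funext => m; rewrite mulr1.
rewrite (_ : (fun m => _) = fun m => bump1 m (W k (ratr r) w - ratr c)); last first.
 by apply/funext => m; rewrite mul1r.
have := @bump1_cvg R (W k (ratr r) w - ratr c); congr (_ @ _ --> _).
rewrite indicE subr_gt0; congr (nat_of_bool _)%:R.
by apply/idP/idP; rewrite inE.
Qed.

Lemma atoms_times m s : all (atom_before T) s ->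
 {in map fst (map (atom_pair m) s), forall t, 0 <= t <= T}.
Proof.
elim: s => [//|a s IH] /= /andP[ha hs] t; rewrite inE => /orP[/eqP ->|]; last exact: IH.
case: a ha => [n _|[[k q] c]] /=; first by rewrite lexx ltW.
by move=> /andP[-> /ltW].
Qed.

Lemma orth_atoms m s : all (atom_before T) s ->
 ip P Z (fun w => init_prod s w * path_prod (map (atom_pair m) s) w) = 0.
Proof.
move=> hs.
pose a0 : atom I := inl 0%N.
(* The factors are put in order of decreasing time. The sort acts on indices, so that the
   permutation of the product is one of natural numbers. *)
pose r := [seq nth a0 s i | i <- sort (fun i j => (atom_pair m (nth a0 s j)).1 <= (atom_pair m (nth a0 s i)).1) (iota 0 (size s))].
have e w : path_prod (map (atom_pair m) s) w = path_prod (map (atom_pair m) r) w.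
 rewrite /path_prod !big_map -[in LHS](mkseq_nth a0 s) /mkseq big_map.
 by apply: perm_big; rewrite perm_sym perm_sort.
rewrite (_ : (fun w => _) = fun w => init_prod s w * path_prod (map (atom_pair m) r) w); last first.
 by apply/funext => w; rewrite e.
have [mi bi] := init_prodP s.
apply: (@orth_path_prod _ _ _ erefl) => //.
- rewrite sorted_map /r sorted_map; apply: sort_sorted => i j; exact: le_total.
- move=> t; rewrite /r -!map_comp => /mapP[i]; rewrite mem_sort mem_iota add0n => /= hi ->.
 apply: (@atoms_times m s hs); rewrite -map_comp.
 rewrite -[X in X \in _](nth_map a0 (0 : R) (fun a => (atom_pair m a).1))//.
 by rewrite mem_nth// size_map.
- by move=> p /List.in_map_iff[a [<- _]]; exact: atom_pair_smooth.
- by exists 1.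
Qed.

Lemma orth_cylinder s : all (atom_before T) s -> \int[P]_(w in cylinder W E0 s) Z w = 0.
Proof.
move=> hs; have mc : measurable (cylinder W E0 s).
 by apply: (bf_meas BF (lexx T)); exact: (cylinder_F BF (ltW T0) (lexx T) hs).
rewrite (Rint_indic P Z mc).
have c1 : (fun m => \int[P]_w (Z w * (init_prod s w * path_prod (map (atom_pair m) s) w))) @ \oo -->
  \int[P]_w (Z w * \1_(cylinder W E0 s) w).
 have [mi bi] := init_prodP s.
 have TT : 0 <= T <= T by rewrite lexx ltW.
 have smp m p : List.In p (map (atom_pair m) s) -> smoothable p.2.
  by move=> /List.in_map_iff[a [<- _]]; exact: atom_pair_smooth.
 apply: (@bdd_cvg _ _ _ _ _ _ _ 1 sZ).
 - move=> m; apply: measurable_funM; first exact: (mF_meas_le BF (ltW T0) mi).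
  by apply: (mF_meas_le BF (lexx T)); have [] := path_prod_mF TT (@atoms_times m s hs) (fun p hp => smp m p hp).
 - exact: measurable_indic.
 - by move=> m w; rewrite normrM -[leRHS]mulr1 ler_pM// atom_prod_bound.
 - by move=> w; exact: atom_prod_cvg.
have c2 : (fun m => \int[P]_w (Z w * (init_prod s w * path_prod (map (atom_pair m) s) w))) @ \oo --> (0 : R).
 rewrite (_ : (fun m => _) = fun=> 0); first exact: cvg_cst.
 by apply/funext => m; exact: orth_atoms.
rewrite -[RHS](cvg_unique _ c1 c2)//; congr Rintegral; apply/funext => w; exact: mulrC.
Qed.

Lemma orth_all_zero : mF (F T) Z -> {ae P, forall w, Z w = 0}.
Proof.
move=> mZ; apply: (cylinders_orth BF T0 (lexx T) mZ (sq_integ1 (P_fin P) sZ)) => s hs.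
exact: orth_cylinder.
Qed.

End orthogonal.

End martingale_orthogonality.

Section mean_square_uniqueness.
Context {d} {X : measurableType d} {R : realType} (mu : {measure set X -> \bar R}).

Lemma tendsto_sum (I : finType) (fn : I -> nat -> X -> R) (f : I -> X -> R) :
 (forall k, tendsto mu (fn k) (f k)) ->
 tendsto mu (fun n => \sum_k fn k n) (\sum_k f k).
Proof.
move=> h; elim: (index_enum I) => [|k r IH].
 rewrite big_nil (_ : (fun n => _) = fun=> 0); first by apply: tendsto_cst; exact: sq0.
 by apply/funext => n; rewrite big_nil.
rewrite big_cons (_ : (fun n => _) = (fun n => fn k n + \sum_(j <- r) fn j n)).
 exact: tendstoD.
by apply/funext => n; rewrite big_cons.
Qed.

Lemma tendsto_unique (fn : nat -> X -> R) f g : tendsto mu fn f -> tendsto mu fn g ->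
 {ae mu, forall x, f x = g x}.
Proof.
move=> tf tg; have [sn sf _] := tf; have [_ sg _] := tg.
apply: nrm0_ae_eq => //; apply/eqP; rewrite eq_le nrm_ge0 andbT.
apply/ler_addgt0Pr => e e0; rewrite add0r.
have e2 : 0 < e / 2 by rewrite divr_gt0.
have h1 := tendsto_small tf e2; have h2 := tendsto_small tg e2.
near \oo => n.
have n1 : nrm mu (fn n - f) <= e / 2 by near: n.
have n2 : nrm mu (fn n - g) <= e / 2 by near: n.
apply: (le_trans (nrm_tri sf (sn n) sg)); rewrite (nrmBC mu f (fn n)); lra.
Unshelve. all: by end_near. Qed.

End mean_square_uniqueness.

(** * Martingale representation *)

Section representation.
Context {R : realType} {d} {Omega : measurableType d}
 (P : probability Omega R) (T : R) (I : finType) (W : I -> R -> Omega -> R)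
 (F : R -> set_system Omega) (E0 : nat -> set Omega) (BF : brownian_filtration P T W F E0).

Notation TO := (measurableTypeR R * Omega)%type.
Notation muT := (muT P T).
Notation simple := (simple T W F).
Notation L2p := (L2p P T F).
Notation ito := (ito P T W F).

Let T0 : 0 < T := bf_T BF.
Let Fs t : sigma_algebra setT (F t) := bf_sigma BF t.
Let TT : 0 <= T <= T.
Proof. by rewrite lexx ltW. Qed.

Let diag (J : I -> I -> R -> Omega -> R) : I -> R -> Omega -> R := fun k => J k k.

Lemma simple_energy (A : Omega -> R) (H : I -> TO -> R) J : mF (F 0) A -> sq P A ->
 (forall k, simple (H k) (J k)) ->
 ip P (A + \sum_k J k k T) (A + \sum_k J k k T) = ip P A A + \sum_k ip muT (H k) (H k).
Proof.
move=> mA sA sH.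
have iJ k : ito k (H k) (diag J k) := simple_ito BF k (sH k).
have sM := Msum_sq iJ TT.
have h1 := Msum_orth BF iJ TT mA sA.
have h2 := Msum_iso BF iJ iJ TT.
rewrite -[\sum_k J k k T]/(Msum (diag J) T) ipDl//; last exact: sqD.
rewrite !ipDr// (ipC P (Msum _ _) A) h1 h2 addr0 add0r; congr (_ + _).
apply: eq_bigr => k _; have sk := simple_sq BF (sH k).
apply: ip_ae; [exact: sq_meas (sq_cut T sk)|exact: sq_meas sk|exact: sq_meas sk|].
exact: cutT_ae.
Qed.

Lemma martingale_representation X : sq P X -> mF (F T) X -> exists X0 sg,
 [/\ mF (F 0) X0, sq P X0, forall k, L2p (sg k) & forall Y, (forall k, ito k (sg k) (Y k)) ->
   {ae P, forall w, X w = X0 w + \sum_k Y k T w}].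
Proof.
move=> sX mX.
pose S (g : Omega -> R) := exists A H J, [/\ mF (F 0) A, sq P A,
 forall k : I, simple (H k) (J k) & g = A + \sum_(k : I) J k k T].
have sS A (H : I -> TO -> R) J : sq P A -> (forall k, simple (H k) (J k)) -> sq P (A + \sum_k J k k T).
 move=> sA sH; apply: sqD => //; apply: sq_sum => k _.
 by have [] := simple_J BF k (sH k) (ltW T0) (lexx T).
have [||||s [Ss fs orth]] := @projection _ _ _ P (P_fin P) S X _ _ _ _ sX.
- exists 0, (fun=> 0), (fun _ _ _ => 0); split.
 + exact: mF_cst.
 + exact: sq0.
 + by move=> k; exact: simple_nil.
 + by rewrite big1 ?addr0.
- move=> g h [A [H [J [mA sA sH ->]]]] [A' [H' [J' [mA' sA' sH' ->]]]].
 exists (A + A'), (fun k => H k + H' k), (fun k l t => J k l t + J' k l t); split.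
 + exact: mFD.
 + exact: sqD.
 + by move=> k; exact: simple_add.
 + by rewrite big_split/= addrACA.
- move=> c g [A [H [J [mA sA sH ->]]]].
 exists (fun w => c * A w), (fun k z => c * H k z), (fun k l t w => c * J k l t w); split.
 + by apply: mFM => //; exact: mF_cst.
 + exact: sqZ.
 + by move=> k; exact: simple_scale.
 + by apply/funext => w; rewrite !fctE !fct_sumE mulrDr mulr_sumr.
- by move=> g [A [H [J [mA sA sH ->]]]]; exact: (sS _ H).
have [sl ll _] := fast_flim (P_fin P) fs.
have /choice[A /choice[H /choice[J hJ]]] := Ss.
have mA n : mF (F 0) (A n) by case: (hJ n).
have sA n : sq P (A n) by case: (hJ n).
have sH n k : simple (H n k) (J n k) by have [_ _ h _] := hJ n; exact: h.
have sE n : s n = A n + \sum_k J n k k T by case: (hJ n).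
have dE n : ip P (s n.+1 - s n) (s n.+1 - s n) =
  ip P (A n.+1 - A n) (A n.+1 - A n) + \sum_k ip muT (H n.+1 k - H n k) (H n.+1 k - H n k).
 have sub k := simple_sub (sH n.+1 k) (sH n k).
 have mAA : mF (F 0) (A n.+1 - A n) by exact: mFB.
 rewrite -(simple_energy mAA (sqB (sA _) (sA _)) sub); congr ip.
  rewrite !sE sumrB; apply/funext => w; rewrite !fctE; ring.
 rewrite !sE sumrB; apply/funext => w; rewrite !fctE; ring.
have [_ fds] := fs.
have le_nrm (a b : R) : 0 <= a -> 0 <= b -> a ^+ 2 <= b ^+ 2 -> a <= b.
 by move=> a0 b0; rewrite ler_sqr ?nnegrE.
have fA : fast P A.
 split => // n; apply: le_trans (fds n); apply: le_nrm; rewrite ?nrm_ge0//.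
 by rewrite !sqr_nrm dE lerDl; apply: sumr_ge0 => k _; exact: ip_ge0.
have fH k : fast muT (fun n => H n k).
 split; first by move=> n; exact: (simple_sq BF (sH n k)).
 move=> n; apply: le_trans (fds n); apply: le_nrm; rewrite ?nrm_ge0//.
 rewrite !sqr_nrm dE (bigD1 k)//= addrCA lerDl addr_ge0 ?ip_ge0//.
 by apply: sumr_ge0 => l _; exact: ip_ge0.
have [sA0 lA _] := fast_flim (P_fin P) fA.
pose sg k := flim (fun n => H n k).
exists (flim A), sg; split => //.
- exact: mF_flim.
- by move=> k; exact: (L2p_flim (fun n => simple_L2p BF (sH n k)) (fH k)).
move=> Y iY.
have tA : tendsto P A (flim A) by apply: (tendstoP (c := 2)).
have tJ k : tendsto P (fun n => J n k k T) (Y k T).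
 have [_ hY hl] := iY k; have [sY _] := hY T TT.
 have [sHl lH _] := fast_flim (muT_fin P T) (fH k).
 apply: (tendstoP (c := 2)) => //.
  by move=> n; have [] := simple_J BF k (sH n k) (ltW T0) (lexx T).
 by move=> n; apply: le_trans (lH n); exact: (hl _ _ (sH n k) T TT).
have t1 := tendstoD tA (tendsto_sum tJ).
have t2 : tendsto P s (flim s) by have [ss _] := fs; apply: (tendstoP (c := 2)).
rewrite (_ : (fun n => _) = s) in t1; last by apply/funext => n; rewrite sE.
have E := tendsto_unique t1 t2.
have FsT : mF (F T) (flim s).
 apply: mF_flim => n; rewrite sE; apply: mFD; first exact: (mF_mono BF (ltW T0) (mA n)).
 rewrite (_ : \sum_k _ = fun w => \sum_k J n k k T w); last by apply/funext => w; rewrite fct_sumE.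
 by apply: mF_sum => k _; have [] := simple_J BF k (sH n k) (ltW T0) (lexx T).
have sZ : sq P (X - flim s) by exact: sqB.
have z : {ae P, forall w, (X - flim s) w = 0}.
 apply: (orth_all_zero BF sZ).
 - move=> V mV sV; apply: orth; exists V, (fun=> 0), (fun _ _ _ => 0); split => //.
   by move=> k; exact: simple_nil.
  by rewrite big1 ?addr0.
 - move=> k H' J' sH'; apply: orth.
  exists 0, (fun l => if l == k then H' else 0), (fun l => if l == k then J' else fun _ _ => 0); split.
  + exact: mF_cst.
  + exact: sq0.
  + by move=> l; case: eqP => _ //; exact: simple_nil.
  + by rewrite add0r (bigD1 k)//= eqxx big1 ?addr0// => l /negbTE ->.
 - exact: mFB.
apply: (ae_imp2 E z) => w e1 e2.
move: e1; rewrite !fctE fct_sumE => ->.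
by apply/eqP; rewrite -subr_eq0; apply/eqP; exact: e2.
Qed.

End representation.

(** * Energy estimates with an exponential weight, and Picard iteration *)

Section exponential_weight.
Context {R : realType} (T : R) (T0 : 0 < T).
Notation TR := (measurableTypeR R).
Notation lamT := (lamT T).
Notation ind t := (\1_(`[0, t]%classic : set R) : TR -> R).

(* Clamping the time to [0, T] makes the weight bounded on the whole line. *)
Definition ew (mu t : R) : R := expR (mu * Num.max 0 (Num.min t T)).

Lemma ew_in mu t : 0 <= t <= T -> ew mu t = expR (mu * t).
Proof. by move=> /andP[t0 tT]; rewrite /ew (min_l tT) (max_r t0). Qed.

Lemma ew_gt0 mu t : 0 < ew mu t.
Proof. exact: expR_gt0. Qed.

Lemma ew_bounds mu t : expR (- (`|mu| * T)) <= ew mu t <= expR (`|mu| * T).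
Proof.
set c := Num.max 0 (Num.min t T).
have c0 : 0 <= c by rewrite le_max lexx.
have cT : c <= T by rewrite ge_max (ltW T0)/= ge_min lexx orbT.
have h : `|mu * c| <= `|mu| * T by rewrite normrM (ger0_norm c0) ler_wpM2l.
by move: h; rewrite ler_norml !ler_expR.
Qed.

Lemma ew_meas mu : meas_fun (ew mu : TR -> R).
Proof.
apply: (measurableT_comp (f := expR)) => //; apply: measurable_funM => //.
by apply: measurable_maxr => //; apply: measurable_minr.
Qed.

Lemma ew_norm mu t : `|ew mu t| <= expR (`|mu| * T).
Proof. by rewrite gtr0_norm ?ew_gt0//; case/andP: (ew_bounds mu t). Qed.

Lemma ew_sq mu : sq lamT (ew mu).
Proof. apply: (sq_bdd (lamT_fin T) (ew_meas mu)) => t; exact: ew_norm. Qed.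

Lemma Rint_ew mu t : 0 <= t <= T -> \int[lamT]_r (ind t r * (mu * ew mu r)) = expR (mu * t) - 1.
Proof.
move=> tT; have [t0 tT'] := andP tT.
rewrite (@Rint_lamT _ T)//; last by apply: measurable_funM => //; exact: ew_meas.
transitivity (\int[lebesgue_measure]_(r in `[0, t]) (mu * expR (mu * r))).
 apply: eq_Rintegral => r; rewrite inE/= in_itv/= => /andP[r0 rt]; rewrite ew_in// r0; exact: le_trans tT'.
have [z|tn0] := eqVneq t 0.
 by rewrite z set_itv1 Rintegral_set1 mulr0 expR0 subrr.
have tp : 0 < t by rewrite lt_def tn0.
have D (x : R) : is_derive x 1 (fun r : R => expR (mu * r)) (mu * expR (mu * x)).
 have h : is_derive x 1 (fun r : R => mu * r) mu.
  have := is_deriveM (is_derive_cst mu x 1) (is_derive_id x 1).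
  move=> h; apply: is_derive_eq h _; by rewrite scaler0 addr0 /cst /GRing.scale/= mulr1.
 have := is_derive1_comp (f := expR) (is_derive_expR (mu * x)) h.
 by rewrite mulrC.
have cE : continuous (fun r : R => expR (mu * r)).
 by move=> x; apply: differentiable_continuous; apply/derivable1_diffP; case: (D x).
rewrite /Rintegral (continuous_FTC2 tp (F := fun r => expR (mu * r)))/=.
- by rewrite mulr0 expR0.
- apply: continuous_subspaceT => x; apply: cvgMr; exact: cE.
- split => [x _||]; first by case: (D x).
 + by apply: cvg_at_right_filter; exact: cE.
 + by apply: cvg_at_left_filter; exact: cE.
- by move=> x _; rewrite derive1E; case: (D x).
Qed.

Lemma ew_integ mu (f : TR -> R) : integ lamT f -> integ lamT (fun s => ew mu s * f s).
Proof.
move=> fi; have h := integZ (expR (`|mu| * T)) (integrable_norm fi).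
apply: (integ_le _ h); first by apply: measurable_funM; [exact: ew_meas|exact: integ_meas fi].
by move=> s; rewrite normrM ler_wpM2r// ew_norm.
Qed.

(** [Rint_parts] for the primitive [phi] and the primitive exp(mu t) - 1 of the weight. Only the
    values of [phi] on [0, T] enter. *)
Lemma exp_ibp mu (theta : TR -> R) (phi : R -> R) phi0 : integ lamT theta ->
 meas_fun (phi : TR -> R) ->
 (forall t, 0 <= t <= T -> phi t = phi0 + \int[lamT]_s (ind t s * theta s)) ->
 integ lamT (fun r => mu * ew mu r * phi r) /\
 \int[lamT]_r (mu * ew mu r * phi r) =
  phi T * expR (mu * T) - phi0 - \int[lamT]_s (ew mu s * theta s).
Proof.
move=> it mphi hphi.
have TT : 0 <= T <= T by rewrite lexx ltW.
have ig : integ lamT (fun r => mu * ew mu r).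
 by apply: integZ; apply: (sq_integ1 (lamT_fin T)); exact: ew_sq.
have ip1 := integ_parts ig it.
have ip2 := integD ip1 (integZ phi0 ig).
have e : {ae lamT, forall r, mu * ew mu r * \int[lamT]_s (ind r s * theta s) + phi0 * (mu * ew mu r) =
  mu * ew mu r * phi r}.
 by apply: (ae_imp (lamT_in T)) => r rT; rewrite (hphi r rT); ring.
have iew := ew_integ mu it.
have parts := Rint_parts it ig.
have full (f : TR -> R) : integ lamT f -> \int[lamT]_s f s = \int[lamT]_s (ind T s * f s).
 move=> fi; apply: Rint_ae; [exact: integ_meas fi|exact: integ_meas (integ_ind T fi)|].
 by apply: (ae_imp (lamT_in T)) => s sT; rewrite indicE mem_set ?mul1r//= in_itv.
have gT : \int[lamT]_r (mu * ew mu r) = expR (mu * T) - 1 by rewrite (full _ ig) Rint_ew.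
have p1 : \int[lamT]_s (theta s * \int[lamT]_r (ind s r * (mu * ew mu r))) =
  \int[lamT]_s (ew mu s * theta s) - \int[lamT]_s theta s.
 rewrite -RintegralB//; apply: Rint_ae.
 - exact: integ_meas (integ_parts it ig).
 - exact: integ_meas (integB iew it).
 - by apply: (ae_imp (lamT_in T)) => s sT; rewrite Rint_ew// ew_in//; ring.
have thT : phi T = phi0 + \int[lamT]_s theta s by rewrite (hphi T TT) -full.
have m3 : meas_fun (fun r : TR => mu * ew mu r * phi r).
 by apply: measurable_funM => //; apply: measurable_funM => //; exact: ew_meas.
split; first exact: (integ_ae ip2 m3 e).
rewrite -(Rint_ae (integ_meas ip2) m3 e) (RintegralD measurableT ip1 (integZ phi0 ig)).
rewrite RintegralZl// gT.
move: parts; rewrite p1 gT => parts.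
have -> : \int[lamT]_r (mu * ew mu r * \int[lamT]_s (ind r s * theta s)) =
  (\int[lamT]_s theta s) * (expR (mu * T) - 1) -
  (\int[lamT]_s (ew mu s * theta s) - \int[lamT]_s theta s) by rewrite parts; ring.
by rewrite thT; ring.
Qed.

End exponential_weight.

Section weighted_energy.
Context {R : realType} {d} {Omega : measurableType d}
 (P : probability Omega R) (T : R) (I : finType) (W : I -> R -> Omega -> R)
 (F : R -> set_system Omega) (E0 : nat -> set Omega) (BF : brownian_filtration P T W F E0).

Notation TO := (measurableTypeR R * Omega)%type.
Notation muT := (muT P T).
Notation lamT := (lamT T).
Notation L2p := (L2p P T F).
Notation iproc := (iproc P T W F).
Implicit Types f g h : TO -> R.

Let T0 : 0 < T := bf_T BF.

Definition wip (mu : R) f g := ip muT (fun z => ew T mu z.1 * f z) g.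

Lemma ew_meas2 mu : meas_fun (fun z : TO => ew T mu z.1).
Proof. by apply: (measurableT_comp (f := (ew T mu : measurableTypeR R -> R)) (g := fst)) => //; exact: ew_meas. Qed.

Lemma wip_integ mu f g : sq muT f -> sq muT g -> integ muT (fun z => ew T mu z.1 * f z * g z).
Proof.
move=> sf sg; apply: sq_mul => //.
by apply: (sq_bddM (ew_meas2 mu) _ sf) => z; exact: ew_norm.
Qed.

Lemma wip_sections mu f g : sq muT f -> sq muT g ->
 wip mu f g = \int[lamT]_s (ew T mu s * ip P (fun w => f (s, w)) (fun w => g (s, w))).
Proof.
move=> sf sg; have [_ i1 e1] := fubini_tw (wip_integ mu sf sg); have [_ i2 _] := fubini_tw (sq_mul sf sg).
rewrite [LHS]e1; apply: Rint_ae; [exact: integ_meas i1| |].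
 by apply: measurable_funM; [exact: ew_meas|exact: integ_meas i2].
apply: (ae_imp2 (sq_section sf) (sq_section sg)) => s s1 s2.
by rewrite /ip -RintegralZl//; [congr Rintegral; apply/funext => w; rewrite mulrA|exact: sq_mul].
Qed.

Lemma ip_cut_sections t f g : sq muT f -> sq muT g ->
 ip muT (cut t f) g = \int[lamT]_s (\1_(`[0, t]%classic : set R) s * ip P (fun w => f (s, w)) (fun w => g (s, w))).
Proof.
move=> sf sg; have [_ i2 _] := fubini_tw (sq_mul sf sg).
rewrite (ip_muT (sq_cut t sf) sg); congr Rintegral; apply/funext => s.
rewrite /cut indicE /=; case: (_ \in _).
 by rewrite mul1r /ip; congr Rintegral; apply/funext => w; rewrite mul1r.
by rewrite mul0r /ip (_ : (fun w => _) = fun=> 0) ?Rintegral_cst ?mul0r//; apply/funext => w; rewrite !mul0r.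
Qed.

(** The product formula of x with itself writes E[x(t)^2] as the primitive of an integrable
    function, and [exp_ibp] integrates it against the weight. A negative mu is used for forward
    equations, a positive one for backward equations. *)
Lemma weighted_energy mu x b sg : iproc x b sg ->
 mu * wip mu x x = expR (mu * T) * ip P (fun w => x (T, w)) (fun w => x (T, w)) -
  ip P (fun w => x (0, w)) (fun w => x (0, w)) -
  (2 * wip mu b x + \sum_k wip mu (sg k) (sg k)).
Proof.
move=> px; have [Lx Lb Ls s0 _] := px.
have sx := L2p_sq Lx; have sb := L2p_sq Lb; have ss k := L2p_sq (Ls k).
pose th1 s := ip P (fun w => b (s, w)) (fun w => x (s, w)).
pose th2 k s := ip P (fun w => sg k (s, w)) (fun w => sg k (s, w)).
have [_ i1 _] := fubini_tw (sq_mul sb sx).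
have i2 k : integ lamT (th2 k) by have [_ h _] := fubini_tw (sq_mul (ss k) (ss k)).
have [_ i3 _] := fubini_tw (sq_mul sx sx).
pose theta s := 2 * th1 s + \sum_k th2 k s.
have ith : integ lamT theta.
 apply: integD; first exact: (integZ 2 i1).
 exact: integ_sum.
pose phi s := ip P (fun w => x (s, w)) (fun w => x (s, w)).
have hphi t : 0 <= t <= T -> phi t = phi 0 + \int[lamT]_s (\1_(`[0, t]%classic : set R) s * theta s).
 move=> tT; rewrite /phi (iproc_ip BF px px tT) -!addrA; congr (_ + _).
 rewrite (ip_cut_sections t sb sx).
 rewrite (eq_bigr (fun k => \int[lamT]_s (\1_(`[0, t]%classic : set R) s * th2 k s))); last first.
  by move=> k _; exact: ip_cut_sections.
 have j1 := integ_ind t i1; have j2 k := integ_ind t (i2 k).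
 rewrite -Rint_sum// addrA -mulr2n -[X in X + _]mulr_natl -RintegralZl//.
 rewrite -(RintegralD measurableT (integZ 2 j1) (integ_sum _ _ j2)).
 congr Rintegral; apply/funext => s; rewrite /theta mulrDr mulr_sumr; congr (_ + _).
 by rewrite mulrCA.
have [_ e] := exp_ibp T0 mu ith (integ_meas i3) hphi.
rewrite (wip_sections mu sx sx) -RintegralZl//; last exact: (ew_integ T0 mu i3).
rewrite (_ : (fun s => _) = (fun r => mu * ew T mu r * phi r)); last first.
 by apply/funext => s; rewrite mulrA.
rewrite e [expR _ * _]mulrC; congr (_ - _).
have k1 : integ lamT (fun s => ew T mu s * th1 s) := ew_integ T0 mu i1.
have k2 k : integ lamT (fun s => ew T mu s * th2 k s) := ew_integ T0 mu (i2 k).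
rewrite (wip_sections mu sb sx) -RintegralZl//.
rewrite (eq_bigr (fun k => \int[lamT]_s (ew T mu s * th2 k s))); last by move=> k _; exact: wip_sections.
rewrite -Rint_sum// -(RintegralD measurableT (integZ 2 k1) (integ_sum _ _ k2)).
congr Rintegral; apply/funext => s; rewrite /theta mulrDr mulr_sumr; congr (_ + _).
by rewrite mulrCA.
Qed.

Lemma wipNl mu f g : sq muT f -> sq muT g -> wip mu (- f) g = - wip mu f g.
Proof.
move=> sf sg; rewrite /wip (_ : (fun z => _) = - (fun z => ew T mu z.1 * f z)); last first.
 by apply/funext => z; rewrite !fctE mulrN.
by apply: ipNl => //; apply: (sq_bddM (ew_meas2 mu) _ sf) => z; exact: ew_norm.
Qed.

Lemma wip_ge0 mu f : 0 <= wip mu f f.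
Proof.
by apply: Rintegral_ge0 => z _; rewrite -mulrA -expr2 mulr_ge0 ?sqr_ge0// ltW// ew_gt0.
Qed.

Lemma wip_young mu c f g : 0 < c -> sq muT f -> sq muT g ->
 2 * wip mu f g <= c * wip mu g g + c^-1 * wip mu f f.
Proof.
move=> c0 sf sg; have i1 := wip_integ mu sf sg; have i2 := wip_integ mu sg sg; have i3 := wip_integ mu sf sf.
rewrite /wip /ip -!RintegralZl// -(RintegralD measurableT (integZ c i2) (integZ c^-1 i3)).
apply: le_Rintegral => //; [exact: (integZ 2 i1)|exact: (integD (integZ c i2) (integZ c^-1 i3))|].
move=> z _; set e := ew T mu z.1; have e0 : 0 < e by exact: ew_gt0.
have -> : 2 * (e * f z * g z) = e * (2 * (f z * g z)) by ring.
have -> : c * (e * g z * g z) + c^-1 * (e * f z * f z) = e * (c * g z ^+ 2 + c^-1 * f z ^+ 2) by ring.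
rewrite ler_pM2l//.
have : 0 <= c^-1 * (c * g z - f z) ^+ 2 by rewrite mulr_ge0 ?sqr_ge0// invr_ge0 ltW.
have -> : c^-1 * (c * g z - f z) ^+ 2 = c * g z ^+ 2 - 2 * (f z * g z) + c^-1 * f z ^+ 2.
 by field; rewrite gt_eqF.
lra.
Qed.

Lemma wip_sum_le (A B : finType) mu K (f : A -> TO -> R) (g : B -> TO -> R) :
 (forall a, sq muT (f a)) -> (forall b, sq muT (g b)) ->
 {ae muT, forall z, \sum_a f a z ^+ 2 <= K * \sum_b g b z ^+ 2} ->
 \sum_a wip mu (f a) (f a) <= K * \sum_b wip mu (g b) (g b).
Proof.
move=> sf sg h.
have i1 a := wip_integ mu (sf a) (sf a); have i2 b := wip_integ mu (sg b) (sg b).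
rewrite /wip /ip -!Rint_sum// -RintegralZl//; last exact: integ_sum.
have i3 := integ_sum (index_enum A) predT i1; have i4 := integZ K (integ_sum (index_enum B) predT i2).
rewrite -subr_ge0 -(RintegralB measurableT i4 i3).
have m : meas_fun (fun z : TO => Num.max 0 (K * \sum_b ew T mu z.1 * g b z * g b z - \sum_a ew T mu z.1 * f a z * f a z)).
 by apply: measurable_maxr => //; exact: (integ_meas (integB i4 i3)).
rewrite (Rint_ae (integ_meas (integB i4 i3)) m).
 by apply: Rintegral_ge0 => z _; rewrite le_max lexx.
apply: (ae_imp h) => z hz; rewrite max_r//.
have e1 (C : finType) (u : C -> R) : \sum_c ew T mu z.1 * u c * u c = ew T mu z.1 * \sum_c u c ^+ 2.
 by rewrite mulr_sumr; apply: eq_bigr => c _; rewrite expr2 mulrA.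
rewrite !e1 mulrCA -mulrBr mulr_ge0 ?subr_ge0//; exact/ltW/ew_gt0.
Qed.

Definition wcst (mu : R) : R := expR (`|mu| * T).

Lemma ip_le_wip mu f : sq muT f -> ip muT f f <= wcst mu * wip mu f f.
Proof.
move=> sf; have i1 := wip_integ mu sf sf.
rewrite /wip /ip -RintegralZl//; apply: le_Rintegral => //; [exact: sq_mul|exact: (integZ (wcst mu) i1)|].
move=> z _; have /andP[h1 _] := ew_bounds T0 mu z.1.
have p : 0 < wcst mu by exact: expR_gt0.
have h2 : 1 <= wcst mu * ew T mu z.1.
 by rewrite -(ler_pM2l p) in h1; apply: le_trans h1; rewrite /wcst -expRD subrr expR0.
rewrite (_ : wcst mu * _ = wcst mu * ew T mu z.1 * (f z * f z)); last by ring.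
by rewrite ler_peMl// -expr2 sqr_ge0.
Qed.

Section picard.
Variables (K : finType) (mu : R) (Phi : (K -> TO -> R) -> K -> TO -> R)
 (Phi_L2p : forall s, (forall k, L2p (s k)) -> forall k, L2p (Phi s k)).
Hypothesis Phi_contr : forall s s', (forall k, L2p (s k)) -> (forall k, L2p (s' k)) ->
 \sum_k wip mu (Phi s k - Phi s' k) (Phi s k - Phi s' k) <=
 4^-1 * \sum_k wip mu (s k - s' k) (s k - s' k).

Let it n : K -> TO -> R := iter n Phi (fun=> 0).

Let it_L2p n k : L2p (it n k).
Proof. by elim: n k => [|n IH] k; [exact: L2p0|exact: Phi_L2p]. Qed.

Let dist (s s' : K -> TO -> R) := \sum_k wip mu (s k - s' k) (s k - s' k).

Let it_dist n : dist (it n.+1) (it n) <= 4^-1 ^+ n * dist (it 1%N) (it 0%N).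
Proof.
elim: n => [|n IH]; first by rewrite expr0 mul1r.
apply: (le_trans (Phi_contr (it_L2p n.+1) (it_L2p n))).
by rewrite exprS -mulrA ler_wpM2l// invr_ge0.
Qed.

Let nrm_dist s s' k : (forall k, L2p (s k)) -> (forall k, L2p (s' k)) ->
 nrm muT (s k - s' k) ^+ 2 <= wcst mu * dist s s'.
Proof.
move=> Ls Ls'; rewrite sqr_nrm.
apply: (le_trans (ip_le_wip mu (L2p_sq (L2pB (Ls k) (Ls' k))))).
rewrite ler_wpM2l ?expR_ge0// /dist (bigD1 k)//= lerDl.
by apply: sumr_ge0 => l _; exact: wip_ge0.
Qed.

(** Squared weighted distances shrink by 1/4, so distances shrink by 1/2 and the iterates are
    [fast], after a shift. The limit is a fixed point up to null sets only. *)
Lemma picard : exists s, (forall k, L2p (s k)) /\ forall k, {ae muT, forall z, Phi s k z = s k z}.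
Proof.
pose D := wcst mu * dist (it 1%N) (it 0%N).
have D0 : 0 <= D by rewrite mulr_ge0 ?expR_ge0// sumr_ge0// => k _; exact: wip_ge0.
(* Starting at the m-th iterate absorbs the first distance and the comparison constant between the
   weighted and the plain norm. *)
have [m hm] : exists m, D <= (2 ^+ m) ^+ 2.
 exists (Num.truncn D).+1; apply: (@le_trans _ _ ((Num.truncn D).+1%:R)); first exact/ltW/truncnS_gt.
 rewrite -exprM -natrX ler_nat; apply: (leq_trans (ltnW (ltn_expl _ (ltnSn 1)))).
 by rewrite leq_exp2l// leq_pmulr.
have step n k : nrm muT (it (n + m).+1 k - it (n + m)%N k) <= 2^-1 ^+ n.
 rewrite -(@ler_pXn2r _ 2)// ?nnegrE ?nrm_ge0 ?half_ge0//.
 apply: (le_trans (nrm_dist k (it_L2p _) (it_L2p _))).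
 apply: (@le_trans _ _ (4^-1 ^+ (n + m) * D)).
  by rewrite /D mulrCA ler_wpM2l ?expR_ge0.
 rewrite exprD -mulrA -[leRHS]mulr1 (_ : (2^-1 ^+ n) ^+ 2 = 4^-1 ^+ n); last first.
  by rewrite exprAC; congr (_ ^+ _); rewrite exprVn; congr (_^-1); rewrite expr2 -natrM.
 rewrite ler_wpM2l ?exprn_ge0 ?invr_ge0// -(ler_pM2l (x := 4 ^+ m)) ?exprn_gt0//.
 rewrite mulrA -exprMn divff// expr1n mul1r mulr1; apply: (le_trans hm).
 by rewrite exprAC (_ : 2 ^+ 2 = 4 :> R)// expr2 -natrM.
pose u n k := it (n + m)%N k.
have fu k : fast muT (fun n => u n k).
 by split => [n|n]; [exact: L2p_sq (it_L2p _ _)|rewrite /u addSn; exact: step].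
pose s k := flim (fun n => u n k).
have Ls k : L2p (s k) by apply: (L2p_flim (fun n => it_L2p _ _) (fu k)).
have ll k n : nrm muT (u n k - s k) <= 2 * 2^-1 ^+ n.
 by have [_ h _] := fast_flim (muT_fin P T) (fu k); exact: h.
have t1 k : tendsto muT (fun n => u n k) (s k).
 by apply: (tendstoP (c := 2)) => [n||n]; [exact: L2p_sq (it_L2p _ _)|exact: L2p_sq|exact: ll].
exists s; split => // k.
have dn n : dist (u n) s <= expR (`|mu| * T) * (#|K|%:R * (2 * 2^-1 ^+ n) ^+ 2).
 apply: (@le_trans _ _ (expR (`|mu| * T) * \sum_k nrm muT (u n k - s k) ^+ 2)).
  rewrite mulr_sumr; apply: ler_sum => l _; rewrite sqr_nrm.
  have sl := L2p_sq (L2pB (it_L2p (n + m) l) (Ls l)).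
  rewrite /wip /ip -RintegralZl//; last exact: sq_mul.
  apply: le_Rintegral => //; [exact: wip_integ|exact: (integZ _ (sq_mul sl sl))|].
  by move=> z _; rewrite -mulrA ler_wpM2r -?expr2 ?sqr_ge0//; have /andP[] := ew_bounds T0 mu z.1.
 rewrite ler_wpM2l ?expR_ge0//.
 apply: (@le_trans _ _ (\sum_(l : K) (2 * 2^-1 ^+ n) ^+ 2)).
  by apply: ler_sum => l _; rewrite ler_sqr ?nnegrE ?nrm_ge0 ?mulr_ge0 ?half_ge0.
 by rewrite sumr_const -[leLHS]mulr_natl.
pose M := wcst mu * expR (`|mu| * T) * #|K|%:R.
have M0 : 0 <= M by rewrite !mulr_ge0 ?expR_ge0.
have t2 : tendsto muT (fun n => u n.+1 k) (Phi s k).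
 have [c hc] : exists c, 0 <= c /\ M <= c ^+ 2.
  by exists (M + 1); split; [lra|rewrite sqrrD; have := sqr_ge0 M; lra].
 have [c0 hc2] := hc.
 apply: (@tendstoP _ _ _ _ _ _ c) => [n||n]; [exact: L2p_sq (it_L2p _ _)|exact: L2p_sq (Phi_L2p Ls k)|].
 rewrite -(@ler_pXn2r _ 2)// ?nnegrE ?nrm_ge0 ?mulr_ge0 ?half_ge0//.
 have -> : u n.+1 = Phi (u n) by [].
 have Lu l : L2p (u n l) by exact: it_L2p.
 apply: (le_trans (nrm_dist k (Phi_L2p Lu) (Phi_L2p Ls))).
 apply: (@le_trans _ _ (wcst mu * (4^-1 * (expR (`|mu| * T) * (#|K|%:R * (2 * 2^-1 ^+ n) ^+ 2))))).
  rewrite ler_wpM2l ?expR_ge0//; apply: (le_trans (Phi_contr Lu Ls)).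
  by rewrite ler_pM2l ?invr_gt0//; exact: dn.
 rewrite [leLHS](_ : _ = M * (2^-1 ^+ n) ^+ 2); last by rewrite /M exprMn; field.
 by rewrite exprMn ler_wpM2r ?sqr_ge0.
have t1' : tendsto muT (fun n => u n.+1 k) (s k).
 have [a b c] := t1 k; split => //.
 by rewrite (cvg_shiftS (fun n => nrm muT (u n k - s k))).
exact: (tendsto_unique t2 t1').
Qed.

End picard.

End weighted_energy.

(** * Ito processes with prescribed initial or final value *)

Section ito_process_existence.
Context {R : realType} {d} {Omega : measurableType d}
 (P : probability Omega R) (T : R) (I : finType) (W : I -> R -> Omega -> R)
 (F : R -> set_system Omega) (E0 : nat -> set Omega) (BF : brownian_filtration P T W F E0).

Notation TO := (measurableTypeR R * Omega)%type.
Notation muT := (muT P T).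
Notation lamT := (lamT T).
Notation L2p := (L2p P T F).
Notation ito := (ito P T W F).
Notation iproc := (iproc P T W F).
Notation drift := (drift T).
Notation tint := (tint T).
Implicit Types f g h : TO -> R.

Let T0 : 0 < T := bf_T BF.
Let TT : 0 <= T <= T. Proof. by rewrite lexx ltW. Qed.
Let T00 : 0 <= (0 : R) <= T. Proof. by rewrite lexx ltW. Qed.

Lemma ito_L2p k h Y : ito k h Y -> (forall w, {within `[0, T], continuous (Y ^~ w)}) ->
 L2p (cut T (fun z => Y z.1 z.2)).
Proof.
move=> iY cY; have [Lh sY _] := iY; have m := ito_path_meas BF iY cY.
split; last first.
 move=> t tT; rewrite (_ : (fun w => _) = Y t); first by have [_] := sY t tT.
 by apply/funext => w; rewrite cut_in.
have m2 : meas_fun (fun z => cut T (fun z : TO => Y z.1 z.2) z ^+ 2) by exact: measurable_funX.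
split => //; apply/muT_integrable12 => //.
apply: (@le_lt_trans _ _ (\int[lamT]_t (nrm muT h ^+ 2)%:E)%E); last first.
 by rewrite integral_cst// lte_mul_pinfty// ?lee_fin ?sqr_ge0//; exact: lamT_fin.
apply: ae_ge0_le_integral => //.
- by move=> t _; apply: integral_ge0 => w _; rewrite lee_fin.
- apply: (@measurable_fun_fubini_tonelli_F _ _ _ _ _ P (fun z => (`|cut T (fun z : TO => Y z.1 z.2) z ^+ 2|)%:E)).
  by apply/measurable_EFinP; exact: measurableT_comp.
 by move=> z; rewrite lee_fin.
- by move=> t _; rewrite lee_fin sqr_ge0.
apply: (ae_imp (lamT_in T)) => t tT _; have [t0 tT'] := andP tT.
have [st _] := sY t tT.
rewrite (_ : (\int[P]_w _)%E = (\int[P]_w (Y t w ^+ 2)%:E)%E); last first.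
 by apply: eq_integral => w _; rewrite cut_in//= ger0_norm ?sqr_ge0.
rewrite integral_sqr// lee_fin sqr_nrm (ito_iso BF iY iY tT) eqxx mul1r -sqr_nrm.
by rewrite ler_sqr ?nnegrE ?nrm_ge0// nrm_cut//; exact: L2p_sq Lh.
Qed.

Lemma drift0 (b : TO -> R) w : meas_fun b -> drift b 0 w = 0.
Proof.
move=> mb; rewrite /drift; case: pselect => [h|h]; last by [].
by rewrite tint_leb// set_itv1 Rintegral_set1.
Qed.

Lemma lift_L2p X : sq P X -> mF (F 0) X -> L2p (lift X).
Proof.
move=> sX mX; split; first exact: sq_lift.
by move=> t /andP[t0 _]; apply: mF_sub mX; [exact: (bf_sigma BF t)|exact: (bf_mono BF t0)].
Qed.

Lemma iproc_build X0 b sg : sq P X0 -> mF (F 0) X0 -> L2p b -> (forall k, L2p (sg k)) ->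
 exists x Y, [/\ forall k, ito k (sg k) (Y k), iproc x b sg,
  forall w, x (0, w) = X0 w,
  forall t, 0 <= t <= T -> {ae P, forall w, x (t, w) = X0 w + tint b t w + \sum_k Y k t w} &
  forall w, {within `[0, T], continuous (fun t => x (t, w))}].
Proof.
move=> sX mX Lb Ls.
have /choice[Y hY] : forall k, exists Y, [/\ ito k (sg k) Y,
 forall w, {within `[0, T], continuous (Y ^~ w)} & forall w, Y 0 w = 0].
 by move=> k; exact: ito_exists BF _ _ (Ls k).
have iY k : ito k (sg k) (Y k) by case: (hY k).
pose x : TO -> R := lift X0 + cut T (fun z => drift b z.1 z.2) +
 \sum_k cut T (fun z => Y k z.1 z.2).
have xE t w : 0 <= t <= T -> x (t, w) = X0 w + drift b t w + \sum_k Y k t w.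
 move=> tT; rewrite /x !fctE fct_sumE cut_in//; congr (_ + _ + _).
 by apply: eq_bigr => k _; rewrite cut_in.
have x0 w : x (0, w) = X0 w.
 rewrite xE// (drift0 w (sq_meas (L2p_sq Lb))) addr0 big1 ?addr0// => k _.
 by have [_ _] := hY k.
have hx t : 0 <= t <= T -> {ae P, forall w, x (t, w) = X0 w + tint b t w + \sum_k Y k t w}.
 by move=> tT; apply: (ae_imp (drift_ae (L2p_sq Lb))) => w h; rewrite xE// h.
exists x, Y; split => //.
- split => //.
 + apply: L2pD; first by apply: L2pD; [exact: lift_L2p|exact: drift_L2p BF _ Lb].
  by apply: L2p_sum => k _; apply: (ito_L2p (iY k)); case: (hY k).
 + by rewrite (_ : (fun w => _) = X0)//; exact/funext.
 + exists Y; split => // t tT; apply: (ae_imp (hx t tT)) => w ->; by rewrite x0.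
- move=> w; apply: (@subspace_eq_continuous _ _ _ (fun t => X0 w + drift b t w + \sum_k Y k t w)).
  by move=> t /set_mem; rewrite /= in_itv/= => tT; exact/esym/xE.
 apply: within_add; first by apply: within_add; [exact: within_cst|exact: drift_cont].
 elim: (index_enum I) => [|k s IH].
  by rewrite (_ : (fun t => _) = fun=> 0); [exact: within_cst|apply/funext => t; rewrite big_nil].
 rewrite (_ : (fun t => _) = fun t => Y k t w + \sum_(k <- s) Y k t w).
  by apply: within_add => //; case: (hY k).
 by apply/funext => t; rewrite big_cons.
Qed.

Lemma iproc_sub x b sg x' b' sg' : iproc x b sg -> iproc x' b' sg' ->
 iproc (x - x') (b - b') (fun k => sg k - sg' k).
Proof.
move=> [Lx Lb Ls s0 [Y [iY hY]]] [Lx' Lb' Ls' s0' [Y' [iY' hY']]]; split.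
- exact: L2pB.
- exact: L2pB.
- by move=> k; exact: L2pB.
- exact: (sqB s0 s0').
- exists (fun k t => Y k t + fun w => -1 * Y' k t w); split.
  move=> k; rewrite (_ : sg k - sg' k = sg k + fun z => -1 * sg' k z).
   by apply: (itoD BF); [exact: iY|exact: (itoZ BF)].
  by apply/funext => z; rewrite !fctE mulN1r.
 move=> t tT; apply: (ae_imp3 (hY t tT) (hY' t tT) (tintB (L2p_sq Lb) (L2p_sq Lb'))) => w h h' hb.
 rewrite !fctE h h' hb; under [in RHS]eq_bigr do rewrite !fctE mulN1r.
 by rewrite big_split/= sumrN; ring.
Qed.

Lemma iproc_ae x b sg b' sg' : iproc x b sg -> L2p b' -> (forall k, L2p (sg' k)) ->
 {ae muT, forall z, b z = b' z} -> (forall k, {ae muT, forall z, sg k z = sg' k z}) ->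
 iproc x b' sg'.
Proof.
move=> [Lx Lb Ls s0 [Y [iY hY]]] Lb' Ls' eb es; split => //.
exists Y; split; first by move=> k; exact: (ito_ae BF (iY k)).
move=> t tT; apply: (ae_imp2 (hY t tT) (tint_ae t (L2p_sq Lb) (L2p_sq Lb') eb)) => w -> ->.
by [].
Qed.

Lemma iproc_terminal Z b : sq P Z -> mF (F T) Z -> L2p b -> exists x sg,
 [/\ iproc x b sg, {ae P, forall w, x (T, w) = Z w} &
  forall w, {within `[0, T], continuous (fun t => x (t, w))}].
Proof.
move=> sZ mZ Lb.
have [X0 [sg [m0 s0 Ls rep]]] : exists X0 sg,
  [/\ mF (F 0) X0, sq P X0, forall k, L2p (sg k) & forall Y, (forall k, ito k (sg k) (Y k)) ->
   {ae P, forall w, (Z - drift b T) w = X0 w + \sum_k Y k T w}].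
 apply: (martingale_representation BF); first by apply: sqB => //; exact: (drift_sq BF).
 by apply: mFB => //; exact: (drift_mF BF).
have [x [Y [iY px _ hx cx]]] := iproc_build s0 m0 Lb Ls.
exists x, sg; split => //.
apply: (ae_imp3 (hx T TT) (rep Y iY) (drift_ae (L2p_sq Lb))) => w -> h hb.
by move: h; rewrite !fctE hb => h; rewrite addrAC -h; ring.
Qed.

End ito_process_existence.

Section linear_combinations.
Context {R : realType} {d} {Omega : measurableType d}
 (P : probability Omega R) (T : R) (F : R -> set_system Omega).
Notation TO := (measurableTypeR R * Omega)%type.
Notation muT := (muT P T).
Notation L2p := (L2p P T F).

(** The bound holds at every time of the line; essentially bounded coefficients are brought to this
    form by [Linfty_bounded]. *)
Definition bounded_coef (A K : finType) (M : A -> K -> R -> R) :=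
 (forall a k, meas_fun (M a k : measurableTypeR R -> R)) /\
 exists c, forall a k t, `|M a k t| <= c.

Definition lincomb (A K : finType) (M : A -> K -> R -> R) (y : K -> TO -> R) (a : A) : TO -> R :=
 fun z => \sum_k M a k z.1 * y k z.

Lemma bounded_coef_tr (A K : finType) (M : A -> K -> R -> R) :
 bounded_coef M -> bounded_coef (fun k a => M a k).
Proof. by move=> [h [c hc]]; split => [k a|]; [exact: h|exists c]. Qed.

Variables (A K : finType) (M : A -> K -> R -> R) (MB : bounded_coef M).
Implicit Types y : K -> TO -> R.

Lemma coef_meas a k : meas_fun (fun z : TO => M a k z.1).
Proof.
have [h _] := MB.
exact: (measurableT_comp (f := (M a k : measurableTypeR R -> R)) (g := fst)).
Qed.

Lemma lincomb_sq y a : (forall k, sq muT (y k)) -> sq muT (lincomb M y a).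
Proof.
move=> sy; rewrite (_ : lincomb M y a = \sum_k (fun z => M a k z.1 * y k z)).
 apply: sq_sum => k _; have [_ [c hc]] := MB.
 by apply: (sq_bddM (coef_meas a k) _ (sy k)) => z; exact: hc.
by apply/funext => z; rewrite fct_sumE.
Qed.

Lemma lincomb_L2p y a : (forall k, L2p (y k)) -> L2p (lincomb M y a).
Proof.
move=> Ly; split; first by apply: lincomb_sq => k; exact: L2p_sq (Ly k).
move=> t tT; apply: (@mF_sum _ _ _ _ _ _ (fun k w => M a k t * y k (t, w))) => k _; apply: mFM; first exact: mF_cst.
by have [_] := Ly k; exact.
Qed.

Lemma lincombB y y' a : lincomb M y a - lincomb M y' a = lincomb M (fun k => y k - y' k) a.
Proof.
apply/funext => z; rewrite !fctE /lincomb -sumrB; apply: eq_bigr => k _.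
by rewrite !fctE mulrBr.
Qed.

Lemma lincomb_lipschitz : exists2 L, 0 <= L & forall y z,
 \sum_a lincomb M y a z ^+ 2 <= L * \sum_k y k z ^+ 2.
Proof.
have [_ [c hc]] := MB.
exists (#|A|%:R * (#|K|%:R * c ^+ 2)) => [|y z]; first by rewrite mulr_ge0// mulr_ge0 ?sqr_ge0.
apply: (@le_trans _ _ (\sum_(a : A) #|K|%:R * c ^+ 2 * \sum_k y k z ^+ 2)); last first.
 by rewrite sumr_const -[leLHS]mulr_natl mulrA.
apply: ler_sum => a _; apply: (le_trans (sum_sqr_le _)).
rewrite -[leRHS]mulrA ler_wpM2l// mulr_sumr; apply: ler_sum => k _.
by rewrite exprMn ler_wpM2r ?sqr_ge0// -[M a k z.1 ^+ 2]real_normK ?num_real// ler_sqr ?nnegrE// (le_trans _ (hc a k z.1)).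
Qed.

End linear_combinations.

(** * Linear forward and backward equations *)

Section linear_equations.
Context {R : realType} {d} {Omega : measurableType d}
 (P : probability Omega R) (T : R) (I : finType) (W : I -> R -> Omega -> R)
 (F : R -> set_system Omega) (E0 : nat -> set Omega) (BF : brownian_filtration P T W F E0).

Notation TO := (measurableTypeR R * Omega)%type.
Notation muT := (muT P T).
Notation L2p := (L2p P T F).
Notation iproc := (iproc P T W F).
Notation wip := (wip P T).
Implicit Types f g h : TO -> R.

Let T0 : 0 < T := bf_T BF.

Variable A : finType.
Notation E := (A + A * I)%type.

Lemma sum_sum_type (f : E -> R) :
 \sum_e f e = \sum_a f (inl a) + \sum_a \sum_k f (inr (a, k)).
Proof.
rewrite big_sumType/=; congr (_ + _); rewrite pair_bigA/=.
by apply: eq_bigr => -[].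
Qed.

Section forward.
Variable M : E -> A -> R -> R.
Hypothesis MB : bounded_coef M.

(** The coefficients are evaluated at y while the process is x. The map from y to x is iterated, and
    the equation itself is the case y = x. *)
Definition forward_iproc (phi : E -> TO -> R) (y x : A -> TO -> R) := forall a,
 iproc (x a) (lincomb M y (inl a) + phi (inl a)) (fun k => lincomb M y (inr (a, k)) + phi (inr (a, k))).

Lemma forward_iproc_sub phi y x y' x' : forward_iproc phi y x -> forward_iproc phi y' x' ->
 forward_iproc 0 (fun a => y a - y' a) (fun a => x a - x' a).
Proof.
move=> p p' a; have := iproc_sub BF (p a) (p' a).
have h e : lincomb M y e + phi e - (lincomb M y' e + phi e) = lincomb M (fun a => y a - y' a) e + 0.
 by rewrite opprD addrACA subrr lincombB.
by congr iproc; [exact: h|apply/funext => k; exact: h].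
Qed.

(* For lam large compared with K this makes the map y |-> x a contraction. *)
Lemma forward_energy (y x : A -> TO -> R) K lam : (forall a, L2p (y a)) ->
 (forall (y : A -> TO -> R) z, \sum_e lincomb M y e z ^+ 2 <= K * \sum_a y a z ^+ 2) ->
 (forall a, {ae P, forall w, x a (0, w) = 0}) -> forward_iproc 0 y x ->
 \sum_a expR (- lam * T) * ip P (fun w => x a (T, w)) (fun w => x a (T, w)) +
 (lam - 1) * \sum_a wip (- lam) (x a) (x a) <= K * \sum_a wip (- lam) (y a) (y a).
Proof.
move=> Ly hK x0 px.
have sy a := L2p_sq (Ly a).
have sl e : sq muT (lincomb M y e) by exact: lincomb_sq.
apply: le_trans (wip_sum_le BF (- lam) sl sy _); last by apply: aeW => z; exact: hK.
rewrite sum_sum_type -big_split/= mulr_sumr -big_split/=; apply: ler_sum => a _.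
have := weighted_energy BF (- lam) (px a).
have [Lx _ _ s0 _] := px a.
rewrite (_ : ip P (fun w => x a (0, w)) (fun w => x a (0, w)) = 0); last first.
 rewrite (ip_ae (sq_meas s0) (f' := 0) _ (sq_meas s0) (x0 a)) ?ip0l//.
 exact: measurable_cst.
(* Young's inequality with constant 1 costs one unit of [lam]. *)
have := wip_young BF (- lam) ltr01 (sl (inl a)) (L2p_sq Lx).
rewrite invr1 !mul1r !addr0 subr0.
under [in X in _ -> X -> _]eq_bigr do rewrite addr0.
set u := wip _ _ _; set v := wip _ _ _; set b := wip _ _ _; set s := \sum_k _.
set e := expR _ * _; lra.
Qed.

Lemma forward_exists (phi : E -> TO -> R) (xi : A -> Omega -> R) :
 (forall e, L2p (phi e)) -> (forall a, sq P (xi a) /\ mF (F 0) (xi a)) ->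
 exists x, [/\ forall a w, x a (0, w) = xi a w, forward_iproc phi x x &
  forall a w, {within `[0, T], continuous (fun t => x a (t, w))}].
Proof.
move=> Lphi hxi.
have Lc y e : (forall a, L2p (y a)) -> L2p (lincomb M y e + phi e).
 by move=> Ly; apply: L2pD => //; exact: lincomb_L2p.
have /choice[Phi hPhi] : forall y : A -> TO -> R, exists x : A -> TO -> R, (forall a, L2p (y a)) ->
  [/\ forall a w, x a (0, w) = xi a w, forward_iproc phi y x &
  forall a w, {within `[0, T], continuous (fun t => x a (t, w))}].
 move=> y; have [Ly|nLy] := pselect (forall a, L2p (y a)); last by exists y => /nLy.
 have /choice[x hx] : forall a, exists x : TO -> R, [/\ forall w, x (0, w) = xi a w,
   iproc x (lincomb M y (inl a) + phi (inl a)) (fun k => lincomb M y (inr (a, k)) + phi (inr (a, k))) &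
   forall w, {within `[0, T], continuous (fun t => x (t, w))}].
  move=> a; have [s0 m0] := hxi a.
  have [x [Y [_ px x0 _ cx]]] := iproc_build BF s0 m0 (Lc y (inl a) Ly) (fun k => Lc y (inr (a, k)) Ly).
  by exists x.
 by exists x => _; split => [a|a|a]; case: (hx a).
have [K K0 hK] := lincomb_lipschitz (Omega := Omega) MB.
have LPhi y : (forall a, L2p (y a)) -> forall a, L2p (Phi y a).
 by move=> Ly a; have [_ h _] := hPhi y Ly; have [] := h a.
(* The energy estimate then bounds 4 (K + 1) times the new distance by K times the old one, hence
   the factor 1/4. *)
pose lam := 4 * (K + 1) + 1.
have [|x [Lx ex]] := picard BF (mu := - lam) (Phi := Phi) LPhi.
 move=> y y' Ly Ly'.
 have [i1 p1 _] := hPhi y Ly; have [i2 p2 _] := hPhi y' Ly'.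
 have pd : forward_iproc 0 (fun a => y a - y' a) (fun a => Phi y a - Phi y' a).
  exact: forward_iproc_sub p1 p2.
 have z0 a : {ae P, forall w, (Phi y a - Phi y' a) (0, w) = 0}.
  by apply: aeW => w; rewrite !fctE i1 i2 subrr.
 have := forward_energy lam (fun a => L2pB (Ly a) (Ly' a)) hK z0 pd.
 set t := \sum_a _ * _; set u := \sum_a _; set v := \sum_a _ => h.
 have t0 : 0 <= t by apply: sumr_ge0 => a _; rewrite mulr_ge0 ?expR_ge0 ?ip_ge0.
 have v0 : 0 <= v by apply: sumr_ge0 => a _; exact: wip_ge0.
 have l1 : lam - 1 = 4 * (K + 1) by rewrite /lam; ring.
 have : 4 * (K + 1) * u <= K * v by rewrite -l1; lra.
 move=> h2; have k1 : 0 < K + 1 by lra.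
 rewrite -(ler_pM2l (x := 4 * (K + 1))) ?mulr_gt0//; apply: (le_trans h2).
 rewrite (_ : _ * (4^-1 * v) = K * v + v); last by field.
 by rewrite lerDl.
(* The fixed point x is determined up to null sets only. Its image under the map has the exact
   initial value and continuous paths, and solves the same equation. *)
have [i p c] := hPhi x Lx; exists (Phi x); split => // a.
have e e0 : {ae muT, forall z, (lincomb M x e0 + phi e0) z = (lincomb M (Phi x) e0 + phi e0) z}.
 have /ae_fin : forall a, {ae muT, forall z, Phi x a z = x a z} by [].
 by move=> H; apply: (ae_imp H) => z hz; rewrite !fctE /lincomb; congr (_ + _); apply: eq_bigr => k _; rewrite hz.
by apply: (iproc_ae BF (p a)) => // [|k]; apply: Lc; exact: LPhi.
Qed.

Lemma forward_unique (phi : E -> TO -> R) (x x' : A -> TO -> R) :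
 (forall a, {ae P, forall w, x a (0, w) = x' a (0, w)}) ->
 forward_iproc phi x x -> forward_iproc phi x' x' ->
 forall a, {ae muT, forall z, x a z = x' a z} /\ {ae P, forall w, x a (T, w) = x' a (T, w)}.
Proof.
move=> x0 p p'.
have Lx a : L2p (x a) by case: (p a).
have Lx' a : L2p (x' a) by case: (p' a).
have Ld a := L2pB (Lx a) (Lx' a).
have [K K0 hK] := lincomb_lipschitz (Omega := Omega) MB.
have pd : forward_iproc 0 (fun a => x a - x' a) (fun a => x a - x' a).
 exact: forward_iproc_sub p p'.
have z0 a : {ae P, forall w, (x a - x' a) (0, w) = 0}.
 by apply: (ae_imp (x0 a)) => w; rewrite !fctE => ->; rewrite subrr.
(* The left side now exceeds the right by the weighted norm itself, so both nonnegative sums vanish;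
   the first one gives equality at T. *)
pose lam := K + 2.
have := forward_energy lam Ld hK z0 pd.
set t := \sum_a _ * _; set u := \sum_a _ => h.
have t0 a : 0 <= expR (- lam * T) * ip P (fun w => (x a - x' a) (T, w)) (fun w => (x a - x' a) (T, w)).
 by rewrite mulr_ge0 ?expR_ge0 ?ip_ge0.
have u0 a : 0 <= wip (- lam) (x a - x' a) (x a - x' a) by exact: wip_ge0.
have tp : 0 <= t by exact: sumr_ge0.
have up : 0 <= u by exact: sumr_ge0.
have l1 : (lam - 1) * u = K * u + u by rewrite /lam; ring.
have [tz uz] : t = 0 /\ u = 0 by split; lra.
move=> a; have [_ _ _ _ _] := pd a.
have ta : ip P (fun w => (x a - x' a) (T, w)) (fun w => (x a - x' a) (T, w)) = 0.
 have := psumr_eq0P (fun a _ => t0 a) tz (i := a) isT.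
 by move/eqP; rewrite mulf_eq0 gt_eqF ?expR_gt0//= => /eqP.
have ua := psumr_eq0P (fun a _ => u0 a) uz (i := a) isT.
split.
 apply: (ae_imp (ip0_ae (L2p_sq (Ld a)) _)) => [|z].
  apply/eqP; rewrite eq_le ip_ge0 andbT; apply: (le_trans (ip_le_wip BF (- lam) (L2p_sq (Ld a)))).
  by rewrite ua mulr0.
 by rewrite !fctE => /subr0_eq.
have [Y [iY hY]] := iproc_sect BF (pd a).
have [sT _ _] := hY T (introT andP (conj (ltW T0) (lexx T))).
by apply: (ae_imp (ip0_ae sT ta)) => w; rewrite !fctE => /subr0_eq.
Qed.

End forward.

Section backward.
Variable M : A -> E -> R -> R.
Hypothesis MB : bounded_coef M.

(** The unknowns of a backward equation are packed in one family over the index that labels drift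
    and diffusion coefficients, so that the adjoint coefficients are plain transposes. *)
Definition pairing (p : A -> TO -> R) (q : A -> I -> TO -> R) (e : E) : TO -> R :=
 match e with inl a => p a | inr (a, k) => q a k end.

(** The difference of two images vanishes at T, and its value at 0 enters with a favourable sign
    when the weight increases in time. The energy identity then controls the process and its
    diffusion together. *)
Lemma backward_exists (h : A -> TO -> R) (Z : A -> Omega -> R) :
 (forall a, L2p (h a)) -> (forall a, sq P (Z a) /\ mF (F T) (Z a)) ->
 exists p q, [/\ forall a, iproc (p a) (- lincomb M (pairing p q) a - h a) (q a),
  forall a, {ae P, forall w, p a (T, w) = Z a w} &
  forall a w, {within `[0, T], continuous (fun t => p a (t, w))}].
Proof.
move=> Lh hZ.
have Lc y a : (forall e, L2p (y e)) -> L2p (- lincomb M y a - h a).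
 by move=> Ly; apply: L2pB => //; apply: L2pN; exact: lincomb_L2p.
have /choice[Psi hPsi] : forall y : E -> TO -> R,
  exists pq : (A -> TO -> R) * (A -> I -> TO -> R), (forall e, L2p (y e)) ->
  [/\ forall a, iproc (pq.1 a) (- lincomb M y a - h a) (pq.2 a),
  forall a, {ae P, forall w, pq.1 a (T, w) = Z a w} &
  forall a w, {within `[0, T], continuous (fun t => pq.1 a (t, w))}].
 move=> y; have [Ly|nLy] := pselect (forall e, L2p (y e)); last by exists (0, 0) => /nLy.
 have /choice[pq hpq] : forall a, exists pq : (TO -> R) * (I -> TO -> R),
   [/\ iproc pq.1 (- lincomb M y a - h a) pq.2, {ae P, forall w, pq.1 (T, w) = Z a w} &
   forall w, {within `[0, T], continuous (fun t => pq.1 (t, w))}].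
  move=> a; have [s0 m0] := hZ a.
  have [x [sg [h1 h2 h3]]] := iproc_terminal BF s0 m0 (Lc y a Ly).
  by exists (x, sg).
 by exists (fun a => (pq a).1, fun a => (pq a).2) => _; split => [a|a|a]; case: (hpq a).
pose Phi y := pairing (Psi y).1 (Psi y).2.
have LPhi y : (forall e, L2p (y e)) -> forall e, L2p (Phi y e).
 move=> Ly; have [g _ _] := hPsi y Ly.
 by move=> [a|[a k]]; have [Lp _ Lq _ _] := g a; [exact: Lp|exact: Lq].
have [K K0 hK] := lincomb_lipschitz (Omega := Omega) MB.
(* c is the constant in Young's inequality. The extra unit in [lam] leaves the norm of the process
   on the left, and K / c is below 1/4. *)
pose c := 4 * (K + 1); pose lam := c + 1.
have c0 : 0 < c by rewrite /c; lra.
have [|y [Ly ey]] := picard BF (mu := lam) (Phi := Phi) LPhi.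
 move=> y y' Ly Ly'.
 have [p1 t1 _] := hPsi y Ly; have [p2 t2 _] := hPsi y' Ly'.
 pose g e := y e - y' e; pose D a := (Psi y).1 a - (Psi y').1 a.
 pose S a k := (Psi y).2 a k - (Psi y').2 a k.
 have sl a : sq muT (lincomb M g a).
  by apply: lincomb_sq => // e; exact: L2p_sq (L2pB (Ly e) (Ly' e)).
 have pd a : iproc (D a) (- lincomb M g a) (S a).
  have := iproc_sub BF (p1 a) (p2 a); congr iproc; rewrite -lincombB.
  by apply/funext => z; rewrite !fctE; ring.
 have e1 a : lam * wip lam (D a) (D a) + \sum_k wip lam (S a k) (S a k) <=
   c * wip lam (D a) (D a) + c^-1 * wip lam (lincomb M g a) (lincomb M g a).
  have [LD _ _ s0 _] := pd a; have sD := L2p_sq LD.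
  have [Y [_ hY]] := iproc_sect BF (pd a).
  have [sT _ _] := hY T (introT andP (conj (ltW T0) (lexx T))).
  have := weighted_energy BF lam (pd a).
  have -> : ip P (fun w => D a (T, w)) (fun w => D a (T, w)) = 0.
   have z : {ae P, forall w, D a (T, w) = (0 : Omega -> R) w}.
    by apply: (ae_imp2 (t1 a) (t2 a)) => w; rewrite /D !fctE => -> ->; rewrite subrr.
   by rewrite (ip_ae (sq_meas sT) (sq_meas (sq0 P)) (sq_meas sT) z) ip0l.
  have := ip_ge0 P (fun w => D a (0, w)).
  have := wip_young BF lam c0 (sl a) sD.
  have -> : wip lam (- lincomb M g a) (D a) = - wip lam (lincomb M g a) (D a).
   exact: (wipNl BF).
  set i0 := ip _ _ _; set wD := wip _ (D a) _; set wl := wip _ _ (lincomb _ _ _).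
  set wb := wip _ _ _; set sS := \sum_k _; set em := expR _; lra.
 have e2 : \sum_a wip lam (D a) (D a) + \sum_a \sum_k wip lam (S a k) (S a k) <=
   c^-1 * \sum_a wip lam (lincomb M g a) (lincomb M g a).
  rewrite -big_split/= mulr_sumr; apply: ler_sum => a _; have := e1 a.
  rewrite /lam mulrDl mul1r; set u := _ * _; lra.
 rewrite sum_sum_type; apply: (le_trans e2).
 rewrite ler_pdivrMl//; apply: (le_trans (wip_sum_le BF lam sl (g := g) (K := K) _ _)).
 + by move=> e; exact: L2p_sq (L2pB (Ly e) (Ly' e)).
 + by apply: aeW => z; exact: hK.
 rewrite -/g; have : 0 <= \sum_e wip lam (g e) (g e) by apply: sumr_ge0 => e _; exact: wip_ge0.
 set v := \sum_e _ => v0; rewrite (_ : c * (4^-1 * v) = K * v + v); last by rewrite /c; field.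
 by rewrite lerDl.
have [p t c'] := hPsi y Ly; exists (Psi y).1, (Psi y).2; split => // a.
apply: (iproc_ae BF (p a)) => [|k||k].
- by apply: Lc; exact: LPhi.
- by have [] := p a.
- have /ae_fin : forall e, {ae muT, forall z, Phi y e z = y e z} by [].
 by move=> H; apply: (ae_imp H) => z hz; rewrite !fctE /lincomb; congr (- _ - _); apply: eq_bigr => k _; rewrite -hz.
- exact: ae_eq_refl.
Qed.

End backward.

End linear_equations.

(** * Quadratic forms with variable coefficients *)

Section coefficient_forms.
Context {d} {X : measurableType d} {R : realType} (mu : {measure set X -> \bar R}).

Lemma ip_lin a f f' g g' : sq mu f -> sq mu f' -> sq mu g -> sq mu g' ->
 ip mu (f + fun z => a * f' z) (g + fun z => a * g' z) =
 ip mu f g + a * (ip mu f g' + ip mu f' g) + a ^+ 2 * ip mu f' g'.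
Proof.
move=> sf sf' sg sg'; have saf := sqZ a sf'; have sag := sqZ a sg'.
rewrite (ipDl sf saf (sqD sg sag)) !(ipDr sg sag)// (ipZr _ sg' sf) (ipZr _ sg' saf).
by rewrite (ipZl _ sf' sg) (ipZl _ sf' sg'); ring.
Qed.

(** With coefficients that are functions on the space, the running weights on the product and the
    constant final weight on Omega are treated alike. *)
Definition lincom (A K : finType) (S : A -> K -> X -> R) (y : K -> X -> R) (a : A) : X -> R :=
 fun z => \sum_k S a k z * y k z.

Definition good_coef (A K : finType) (S : A -> K -> X -> R) :=
 (forall a k, meas_fun (S a k)) /\ exists c, forall a k z, `|S a k z| <= c.

Definition qf (V : finType) (S : V -> V -> X -> R) (e f : V -> X -> R) :=
 \sum_i ip mu (lincom S e i) (f i).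

Section lincom.
Variables (A K : finType) (S : A -> K -> X -> R) (SG : good_coef S).

Lemma good_sq a k f : sq mu f -> sq mu (fun z => S a k z * f z).
Proof.
by move=> sf; have [m [c hc]] := SG; apply: (sq_bddM (m a k) _ sf) => z; exact: hc.
Qed.

Lemma lincom_sq y a : (forall k, sq mu (y k)) -> sq mu (lincom S y a).
Proof.
move=> sy; rewrite (_ : lincom S y a = \sum_k (fun z => S a k z * y k z)).
 by apply: sq_sum => k _; exact: good_sq.
by apply/funext => z; rewrite fct_sumE.
Qed.

Lemma lincom_lin c y y' a :
 lincom S (fun k => y k + fun z => c * y' k z) a = lincom S y a + fun z => c * lincom S y' a z.
Proof.
apply/funext => z; rewrite !fctE /lincom mulr_sumr -big_split/=; apply: eq_bigr => k _.
by rewrite !fctE mulrDr mulrCA.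
Qed.

Lemma lincom_adj y f : (forall k, sq mu (y k)) -> (forall a, sq mu (f a)) ->
 \sum_a ip mu (lincom S y a) (f a) = \sum_k ip mu (lincom (fun k a => S a k) f k) (y k).
Proof.
move=> sy sf.
have e1 a : ip mu (lincom S y a) (f a) = \sum_k ip mu (fun z => S a k z * f a z) (y k).
 rewrite /ip -Rint_sum; last by move=> k; apply: sq_mul => //; exact: good_sq.
 congr Rintegral; apply/funext => z; rewrite mulr_suml; apply: eq_bigr => k _.
 by rewrite mulrAC.
rewrite (eq_bigr _ (fun a _ => e1 a)) exchange_big/=; apply: eq_bigr => k _.
rewrite -ip_suml//; last by move=> a _; exact: good_sq.
by congr (ip mu); apply/funext => z; rewrite fct_sumE.
Qed.

End lincom.

Lemma good_coef_tr (A K : finType) (S : A -> K -> X -> R) :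
 good_coef S -> good_coef (fun k a => S a k).
Proof. by move=> [m [c hc]]; split => [k a|]; [exact: m|exists c]. Qed.

Section symmetric_forms.
Variables (V : finType) (S : V -> V -> X -> R) (SG : good_coef S)
 (Ssym : {ae mu, forall z, forall i j, S i j z = S j i z}).

Lemma qf_sym e f : (forall i, sq mu (e i)) -> (forall i, sq mu (f i)) -> qf S e f = qf S f e.
Proof.
move=> se sf; rewrite /qf lincom_adj//; apply: eq_bigr => i _.
apply: ip_ae; [|exact: sq_meas (lincom_sq SG i sf)|exact: sq_meas (se i)|].
 exact: sq_meas (lincom_sq (good_coef_tr SG) i sf).
by apply: (ae_imp Ssym) => z h; apply: eq_bigr => j _; rewrite h.
Qed.

Lemma qf_lin a e g : (forall i, sq mu (e i)) -> (forall i, sq mu (g i)) ->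
 qf S (fun i => e i + fun z => a * g i z) (fun i => e i + fun z => a * g i z) =
 qf S e e + 2 * a * qf S e g + a ^+ 2 * qf S g g.
Proof.
move=> se sg; have sl y i : (forall i, sq mu (y i)) -> sq mu (lincom S y i) by exact: lincom_sq.
transitivity (qf S e e + a * (qf S e g + qf S g e) + a ^+ 2 * qf S g g); last first.
 by rewrite (qf_sym sg se); ring.
rewrite /qf -[X in a * X]big_split/= !mulr_sumr -!big_split/=; apply: eq_bigr => i _.
by rewrite (lincom_lin S) ip_lin//; exact: sl.
Qed.

Lemma qf_ae0 e f : (forall i, sq mu (e i)) -> (forall i, sq mu (f i)) ->
 (forall i, {ae mu, forall z, f i z = 0}) -> qf S e f = 0.
Proof.
move=> se sf f0; rewrite /qf big1// => i _; rewrite ipC.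
rewrite (ip_ae (sq_meas (sf i)) (sq_meas (sq0 mu)) (sq_meas (lincom_sq SG i se)) (f0 i)).
exact: ip0l.
Qed.

End symmetric_forms.

End coefficient_forms.

Lemma quadratic_ge0 {R : realType} (l q : R) :
 (forall a, 0 <= a * l + 2^-1 * a ^+ 2 * q) <-> l = 0 /\ 0 <= q.
Proof.
split; last by move=> [-> q0] a; rewrite mulr0 add0r mulr_ge0// mulr_ge0 ?invr_ge0 ?sqr_ge0.
move=> h; have q0 : 0 <= q by have := h 1; have := h (-1); rewrite sqrrN expr1n; lra.
split => //; apply/eqP; rewrite -sqrf_eq0 eq_le sqr_ge0 andbT.
have q1 : 0 < q + 1 by lra.
(* The minimizer would be -l / q; adding 1 covers q = 0 and still gives a negative value unless l =
   0. *)
have := h (- l / (q + 1)).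
rewrite (_ : _ + _ = - (l ^+ 2 * ((q + 1)^-2 * (1 + 2^-1 * q)))); last by field; rewrite gt_eqF.
rewrite oppr_ge0 pmulr_lle0// mulr_gt0// ?invr_gt0 ?exprn_gt0//; lra.
Qed.

(* dx = (M x + N v + phi), with running cost |K x - eta|_Q^2 + |v - ref|_S^2 and  *)
(* final cost |K0 x(T) - eta0|_G^2; the summands of the index A + A * I are the   *)
(* drift and the diffusion coefficients of the state.                             *)
Record lq_problem {R : realType} {d : measure_display} (Omega : measurableType d)
  (I A C V : finType) := LQProblem {
 lp_M : A + A * I -> A -> R -> R;
 lp_N : A + A * I -> C -> R -> R;
 lp_phi : A + A * I -> measurableTypeR R * Omega -> R;
 lp_xi : A -> Omega -> R;
 lp_Q : V -> V -> R -> R;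
 lp_K : V -> A -> R -> R;
 lp_eta : V -> measurableTypeR R * Omega -> R;
 lp_S : C -> C -> R -> R;
 lp_ref : C -> measurableTypeR R * Omega -> R;
 lp_G : V -> V -> R;
 lp_K0 : V -> A -> R;
 lp_eta0 : V -> Omega -> R }.

(** * The scalar form of a linear-quadratic control problem *)

Section linear_quadratic.
Context {R : realType} {d} {Omega : measurableType d}
 (P : probability Omega R) (T : R) (I : finType) (W : I -> R -> Omega -> R)
 (F : R -> set_system Omega) (E0 : nat -> set Omega) (BF : brownian_filtration P T W F E0).

Notation TO := (measurableTypeR R * Omega)%type.
Notation muT := (muT P T).
Notation L2p := (L2p P T F).
Notation iproc := (iproc P T W F).

Let T0 : 0 < T := bf_T BF.

Variables (A C V : finType) (D : @lq_problem R d Omega I A C V).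

Record lq_regular : Prop := LQRegular {
 lr_M : bounded_coef (lp_M D);
 lr_N : bounded_coef (lp_N D);
 lr_phi : forall e, L2p (lp_phi D e);
 lr_xi : forall a, sq P (lp_xi D a) /\ mF (F 0) (lp_xi D a);
 lr_Q : bounded_coef (lp_Q D);
 lr_Qsym : {ae lamT T, forall t, forall i j, lp_Q D i j t = lp_Q D j i t};
 lr_K : bounded_coef (lp_K D);
 lr_eta : forall v, L2p (lp_eta D v);
 lr_S : bounded_coef (lp_S D);
 lr_Ssym : {ae lamT T, forall t, forall i j, lp_S D i j t = lp_S D j i t};
 lr_ref : forall c, L2p (lp_ref D c);
 lr_G : forall i j, lp_G D i j = lp_G D j i;
 lr_eta0 : forall v, sq P (lp_eta0 D v) /\ mF (F T) (lp_eta0 D v) }.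

Hypothesis D_reg : lq_regular.

Notation space M := (fun a b (z : TO) => M a b z.1).

Definition lq_state (v : C -> TO -> R) (x : A -> TO -> R) := (forall a, {ae P, forall w, x a (0, w) = lp_xi D a w}) /\
 forward_iproc P T W F (lp_M D) (fun e => lp_phi D e + lincomb (lp_N D) v e) x x.

Definition lq_var (v : C -> TO -> R) (y : A -> TO -> R) := (forall a, {ae P, forall w, y a (0, w) = 0}) /\
 forward_iproc P T W F (lp_M D) (lincomb (lp_N D) v) y y.

Definition lq_err (x : A -> TO -> R) (i : V) : TO -> R := lincomb (lp_K D) x i - lp_eta D i.

Definition lq_end (x : A -> TO -> R) (i : V) : Omega -> R := fun w => \sum_a lp_K0 D i a * x a (T, w).

Definition lq_cost (v : C -> TO -> R) (x : A -> TO -> R) : R := 2^-1 * (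
 qf muT (space (lp_Q D)) (lq_err x) (lq_err x) +
 qf muT (space (lp_S D)) (fun c => v c - lp_ref D c) (fun c => v c - lp_ref D c) +
 qf P (fun i j => fun=> lp_G D i j) (fun i => lq_end x i - lp_eta0 D i) (fun i => lq_end x i - lp_eta0 D i)).

(** The derivative of [lq_cost] at (v, x) in the direction (w, y), where y is the variation of the
    state caused by w; [lq_curv] is the second derivative. *)
Definition lq_slope (v : C -> TO -> R) (x : A -> TO -> R) (w : C -> TO -> R) (y : A -> TO -> R) : R :=
 qf muT (space (lp_Q D)) (lq_err x) (lincomb (lp_K D) y) +
 qf muT (space (lp_S D)) (fun c => v c - lp_ref D c) w +
 qf P (fun i j => fun=> lp_G D i j) (fun i => lq_end x i - lp_eta0 D i) (lq_end y).

Definition lq_curv (w : C -> TO -> R) (y : A -> TO -> R) : R :=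
 qf muT (space (lp_Q D)) (lincomb (lp_K D) y) (lincomb (lp_K D) y) +
 qf muT (space (lp_S D)) w w + qf P (fun i j => fun=> lp_G D i j) (lq_end y) (lq_end y).

Definition lq_adjoint (x : A -> TO -> R) (p : A -> TO -> R) (q : A -> I -> TO -> R) :=
 (forall a, iproc (p a) (- lincomb (fun a e => lp_M D e a) (pairing p q) a -
   lincomb (fun a i => lp_K D i a) (lincomb (lp_Q D) (lq_err x)) a) (q a)) /\
 forall a, {ae P, forall w, p a (T, w) =
  \sum_i lp_K0 D i a * \sum_j lp_G D i j * (lq_end x j w - lp_eta0 D j w)}.

Definition lq_stat (v : C -> TO -> R) (p : A -> TO -> R) (q : A -> I -> TO -> R) (c : C) : TO -> R :=
 lincomb (fun c e => lp_N D e c) (pairing p q) c + lincomb (lp_S D) (fun c => v c - lp_ref D c) c.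

Lemma space_good (A' K : finType) (M : A' -> K -> R -> R) : bounded_coef M ->
 good_coef (X := TO) (space M).
Proof.
by move=> MB; split => [a k|]; [exact: coef_meas|have [_ [c hc]] := MB; exists c => a k z; exact: hc].
Qed.

Lemma cst_good (A' K : finType) (M : A' -> K -> R) : good_coef (X := Omega) (fun a k => fun=> M a k).
Proof.
split => [a k|]; first exact: measurable_cst.
exists (\sum_a \sum_k `|M a k|) => a k _.
rewrite (bigD1 a)//= (bigD1 k)//= -addrA lerDl addr_ge0// sumr_ge0// => b _.
exact: sumr_ge0.
Qed.

Lemma forward_L2p y phi x : forward_iproc P T W F (lp_M D) phi y x -> forall a, L2p (x a).
Proof. by move=> h a; case: (h a). Qed.

Lemma forward_end y phi x : forward_iproc P T W F (lp_M D) phi y x ->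
 forall a, sq P (fun w => x a (T, w)) /\ mF (F T) (fun w => x a (T, w)).
Proof.
move=> h a; have [Y [_ hY]] := iproc_sect BF (h a).
by have [] := hY T (introT andP (conj (ltW T0) (lexx T))).
Qed.

Lemma iprocZ c x b sg : iproc x b sg ->
 iproc (fun z => c * x z) (fun z => c * b z) (fun k z => c * sg k z).
Proof.
move=> [Lx Lb Ls s0 [Y [iY hY]]]; split.
- exact: L2pZ.
- exact: L2pZ.
- by move=> k; exact: L2pZ.
- exact: (sqZ c s0).
exists (fun k t w => c * Y k t w); split; first by move=> k; exact: (itoZ BF).
move=> t tT; apply: (ae_imp2 (hY t tT) (tintZ c (L2p_sq Lb))) => w h hb.
by rewrite h hb -mulr_sumr; ring.
Qed.

Lemma lincombZ (A' K : finType) (M : A' -> K -> R -> R) a (x y : K -> TO -> R) e :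
 lincomb M (fun b => x b + fun z => a * y b z) e = lincomb M x e + fun z => a * lincomb M y e z.
Proof. exact: (lincom_lin (space M)). Qed.

Let lqv (v w : C -> TO -> R) a (c : C) : TO -> R := v c + fun z => a * w c z.
Let lqx (x y : A -> TO -> R) a (b : A) : TO -> R := x b + fun z => a * y b z.

Lemma lq_state_lin v x w y a : lq_state v x -> lq_var w y ->
 lq_state (fun c => v c + fun z => a * w c z) (fun b => x b + fun z => a * y b z).
Proof.
move=> [x0 px] [y0 py]; split=> b.
 by apply: (ae_imp2 (x0 b) (y0 b)) => u h h'; rewrite !fctE h h' mulr0 addr0.
have opp (f : TO -> R) : (fun z => - a * f z) = - (fun z => a * f z).
 by apply/funext => z; rewrite fctE mulNr.
have sub (f g : TO -> R) : f - (fun z => - a * g z) = f + fun z => a * g z by rewrite opp opprK.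
have := iproc_sub BF (px b) (iprocZ (- a) (py b)); rewrite sub.
have h e : lincomb (lp_M D) x e + (lp_phi D e + lincomb (lp_N D) v e) -
   (fun z => - a * (lincomb (lp_M D) y e + lincomb (lp_N D) w e) z) =
  lincomb (lp_M D) (lqx x y a) e + (lp_phi D e + lincomb (lp_N D) (lqv v w a) e).
 by rewrite sub !lincombZ; apply/funext => z; rewrite !fctE; ring.
by congr iproc; [exact: h|apply/funext => k; exact: h].
Qed.

Lemma lq_state_sub v x v' x' : lq_state v x -> lq_state v' x' ->
 lq_var (fun c => v' c - v c) (fun b => x' b - x b).
Proof.
move=> [x0 px] [x0' px']; split=> b.
 by apply: (ae_imp2 (x0 b) (x0' b)) => u h h'; rewrite !fctE h h' subrr.
have := iproc_sub BF (px' b) (px b).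
have h e : lincomb (lp_M D) x' e + (lp_phi D e + lincomb (lp_N D) v' e) -
   (lincomb (lp_M D) x e + (lp_phi D e + lincomb (lp_N D) v e)) =
  lincomb (lp_M D) (fun b => x' b - x b) e + lincomb (lp_N D) (fun c => v' c - v c) e.
 by rewrite -!lincombB; apply/funext => z; rewrite !fctE; ring.
by congr iproc; [exact: h|apply/funext => k; exact: h].
Qed.

Lemma lq_state_exists v : (forall c, L2p (v c)) -> exists x, lq_state v x /\
 (forall a w, x a (0, w) = lp_xi D a w) /\
 forall a w, {within `[0, T], continuous (fun t => x a (t, w))}.
Proof.
move=> Lv.
have [x [x0 px cx]] := forward_exists BF (lr_M D_reg)
 (fun e => L2pD (lr_phi D_reg e) (lincomb_L2p (lr_N D_reg) e Lv)) (lr_xi D_reg).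
by exists x; do !split => //; move=> a; apply: aeW => w; exact: x0.
Qed.

Lemma lq_var_exists w : (forall c, L2p (w c)) -> exists y, lq_var w y.
Proof.
move=> Lw.
have [y [y0 py _]] := forward_exists BF (lr_M D_reg) (xi := fun=> 0)
 (fun e => lincomb_L2p (lr_N D_reg) e Lw) (fun _ => conj (sq0 P) (@mF_cst R Omega (F 0) 0)).
by exists y; split => // a; apply: aeW => u; exact: y0.
Qed.

Lemma lq_err_sq x i : (forall a, L2p (x a)) -> L2p (lq_err x i).
Proof. by move=> Lx; apply: L2pB; [exact: (lincomb_L2p (lr_K D_reg))|exact: lr_eta D_reg i]. Qed.

Lemma lq_end_sq x i : (forall a, sq P (fun w => x a (T, w)) /\ mF (F T) (fun w => x a (T, w))) ->
 sq P (lq_end x i) /\ mF (F T) (lq_end x i).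
Proof.
move=> hx; split.
 by apply: (lincom_sq (cst_good (lp_K0 D)) i (y := fun a w => x a (T, w))) => a; case: (hx a).
apply: (@mF_sum _ _ _ _ _ _ (fun a w => lp_K0 D i a * x a (T, w))) => a _.
by apply: mFM; [exact: mF_cst|case: (hx a)].
Qed.

Let Qsym : {ae muT, forall z, forall i j, space (lp_Q D) i j z = space (lp_Q D) j i z}.
Proof. exact: ae_muT_time (lr_Qsym D_reg). Qed.

Let Ssym : {ae muT, forall z, forall i j, space (lp_S D) i j z = space (lp_S D) j i z}.
Proof. exact: ae_muT_time (lr_Ssym D_reg). Qed.

Let Gsym : {ae P, forall z, forall i j, lp_G D i j = lp_G D j i}.
Proof. by apply: aeW => _; exact: lr_G. Qed.

Lemma lq_cost_lin v x w y a : (forall c, L2p (v c)) -> (forall c, L2p (w c)) ->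
 lq_state v x -> lq_var w y ->
 lq_cost (lqv v w a) (lqx x y a) =
 lq_cost v x + (a * lq_slope v x w y + 2^-1 * a ^+ 2 * lq_curv w y).
Proof.
move=> Lv Lw [_ px] [_ py].
have Lx := forward_L2p px; have Ly := forward_L2p py.
have ex i := lq_end_sq i (forward_end px); have ey i := lq_end_sq i (forward_end py).
rewrite /lq_cost.
have -> : lq_err (lqx x y a) = fun i => lq_err x i + fun z => a * lincomb (lp_K D) y i z.
 by apply/funext => i; rewrite /lq_err lincombZ addrAC.
have -> : (fun c => lqv v w a c - lp_ref D c) = fun c => (v c - lp_ref D c) + fun z => a * w c z.
 by apply/funext => c; rewrite /lqv addrAC.
have -> : (fun i => lq_end (lqx x y a) i - lp_eta0 D i) =
  fun i => (lq_end x i - lp_eta0 D i) + fun u => a * lq_end y i u.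
 have e i : lq_end (lqx x y a) i = lq_end x i + fun u => a * lq_end y i u.
  exact: (lincom_lin (fun i a => fun=> lp_K0 D i a) a (fun b u => x b (T, u)) (fun b u => y b (T, u))).
 by apply/funext => i; rewrite e addrAC.
rewrite (qf_lin (space_good (lr_Q D_reg)) Qsym); last first.
- by move=> i; apply: (lincomb_sq (lr_K D_reg)) => b; exact: L2p_sq (Ly b).
- by move=> i; exact: L2p_sq (lq_err_sq i Lx).
rewrite (qf_lin (space_good (lr_S D_reg)) Ssym); last first.
- by move=> c; exact: L2p_sq (Lw c).
- by move=> c; exact: L2p_sq (L2pB (Lv c) (lr_ref D_reg c)).
rewrite (qf_lin (cst_good (lp_G D)) Gsym); last first.
- by move=> i; case: (ey i).
- by move=> i; apply: sqB; [case: (ex i)|case: (lr_eta0 D_reg i)].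
by rewrite /lq_slope /lq_curv; field.
Qed.

Lemma lq_cost_sub v x v' x' : (forall c, L2p (v c)) -> (forall c, L2p (v' c)) ->
 lq_state v x -> lq_state v' x' ->
 lq_cost v' x' = lq_cost v x + (lq_slope v x (fun c => v' c - v c) (fun b => x' b - x b) +
  2^-1 * lq_curv (fun c => v' c - v c) (fun b => x' b - x b)).
Proof.
move=> Lv Lv' h h'.
have := lq_cost_lin 1 Lv (fun c => L2pB (Lv' c) (Lv c)) h (lq_state_sub h h').
have -> : lqv v (fun c => v' c - v c) 1 = v'.
 by apply/eq2_fun => c z; rewrite /lqv !fctE mul1r addrC subrK.
have -> : lqx x (fun b => x' b - x b) 1 = x'.
 by apply/eq2_fun => c z; rewrite /lqx !fctE mul1r addrC subrK.
by rewrite expr1n mulr1 mul1r.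
Qed.

(** The two states agree almost everywhere on the product and almost surely at T, so the slope and
    curvature along their difference vanish. The choice made by [state_of] is therefore harmless. *)
Lemma lq_cost_unique v x x' : (forall c, L2p (v c)) -> lq_state v x -> lq_state v x' ->
 lq_cost v x = lq_cost v x'.
Proof.
move=> Lv h h'; rewrite (lq_cost_sub Lv Lv h h').
have [x0 px] := h; have [x0' px'] := h'; have [_ py] := lq_state_sub h h'.
have Ly := forward_L2p py; have Lx := forward_L2p px.
have ex i := lq_end_sq i (forward_end px); have ey i := lq_end_sq i (forward_end py).
have u a := forward_unique BF (lr_M D_reg)
 (fun a => ae_imp2 (x0 a) (x0' a) (fun w e e' => etrans e (esym e'))) px px' a.
have /ae_fin h1 : forall a, {ae muT, forall z, x a z = x' a z} by move=> a; case: (u a).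
have /ae_fin h2 : forall a, {ae P, forall w, x a (T, w) = x' a (T, w)} by move=> a; case: (u a).
have s1 i : sq muT (lincomb (lp_K D) (fun b => x' b - x b) i).
 by apply: (lincomb_sq (lr_K D_reg)) => b; exact: L2p_sq (Ly b).
have z1 i : {ae muT, forall z, lincomb (lp_K D) (fun b => x' b - x b) i z = 0}.
 by apply: (ae_imp h1) => z e; rewrite /lincomb big1// => b _; rewrite !fctE e subrr mulr0.
have z2 i : {ae P, forall w, lq_end (fun b => x' b - x b) i w = 0}.
 by apply: (ae_imp h2) => z e; rewrite /lq_end big1// => b _; rewrite !fctE e subrr mulr0.
have s0 c : sq muT (v c - v c) by apply: sqB; exact: L2p_sq (Lv c).
have z0 c : {ae muT, forall z, (v c - v c) z = 0} by apply: aeW => z; rewrite !fctE subrr.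
have gQ := space_good (lr_Q D_reg); have gS := space_good (lr_S D_reg); have gG := cst_good (lp_G D).
have s3 i : sq muT (lq_err x i) := L2p_sq (lq_err_sq i Lx).
have s4 c : sq muT (v c - lp_ref D c) := L2p_sq (L2pB (Lv c) (lr_ref D_reg c)).
have s5 i : sq P (lq_end x i - lp_eta0 D i) by apply: sqB; [case: (ex i)|case: (lr_eta0 D_reg i)].
have s6 i : sq P (lq_end (fun b => x' b - x b) i) by case: (ey i).
by rewrite /lq_slope /lq_curv (qf_ae0 gQ s3 s1 z1) (qf_ae0 gQ s1 s1 z1) (qf_ae0 gS s4 s0 z0)
 (qf_ae0 gS s0 s0 z0) (qf_ae0 gG s5 s6 z2) (qf_ae0 gG s6 s6 z2) !(addr0, mulr0).
Qed.

(* Controls vanish outside [0, T], as do the coordinates of vector controls. *)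
Definition lq_ctrl (v : C -> TO -> R) := forall c, L2p (v c) /\ cut T (v c) = v c.

Lemma lq_ctrl_lin v w a : lq_ctrl v -> lq_ctrl w -> lq_ctrl (lqv v w a).
Proof.
move=> Lv Lw c; have [l1 e1] := Lv c; have [l2 e2] := Lw c; split.
 by apply: L2pD => //; exact: L2pZ.
rewrite /lqv cutD e1; congr (_ + _); apply/funext => z.
by move: (congr1 (fun f => f z) e2); rewrite /cut/= => {2}<-; rewrite mulrCA.
Qed.

Lemma lq_ctrl_sub v w : lq_ctrl v -> lq_ctrl w -> lq_ctrl (fun c => v c - w c).
Proof.
move=> Lv Lw c; have [l1 e1] := Lv c; have [l2 e2] := Lw c.
by rewrite cutB e1 e2; split => //; exact: L2pB.
Qed.

Definition lq_convex := forall w y, lq_ctrl w -> lq_var w y -> 0 <= lq_curv w y.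

Lemma lq_optimal v x : lq_ctrl v -> lq_state v x ->
 (forall v' x', lq_ctrl v' -> lq_state v' x' -> lq_cost v x <= lq_cost v' x') <->
 (forall w y, lq_ctrl w -> lq_var w y -> lq_slope v x w y = 0) /\ lq_convex.
Proof.
move=> Cv h; have Lv c : L2p (v c) by case: (Cv c).
split.
 move=> H; have key w y : lq_ctrl w -> lq_var w y -> lq_slope v x w y = 0 /\ 0 <= lq_curv w y.
  move=> Cw hy; have Lw c : L2p (w c) by case: (Cw c).
  apply/quadratic_ge0 => a.
  rewrite -(lerD2l (lq_cost v x)) addr0 -(lq_cost_lin a Lv Lw h hy); apply: H.
   exact: lq_ctrl_lin.
  exact: lq_state_lin.
 by split => w y Lw hy; have [] := key w y Lw hy.
move=> [H1 H2] v' x' Cv' h'; have Lv' c : L2p (v' c) by case: (Cv' c).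
rewrite (lq_cost_sub Lv Lv' h h').
have Cw := lq_ctrl_sub Cv' Cv; have hy := lq_state_sub h h'.
by rewrite (H1 _ _ Cw hy) add0r lerDl mulr_ge0 ?invr_ge0//; exact: H2.
Qed.

(* Duality: the adjoint equation has the transposed coefficients. *)
Lemma lq_slope_adjoint v x p q w y : (forall c, L2p (v c)) -> lq_state v x -> lq_adjoint x p q ->
 (forall c, L2p (w c)) -> lq_var w y ->
 lq_slope v x w y = \sum_c ip muT (lq_stat v p q c) (w c).
Proof.
move=> Lv [_ px] [pp pT] Lw [y0 py].
have Lx := forward_L2p px; have Ly := forward_L2p py.
have ex i := lq_end_sq i (forward_end px); have ey i := lq_end_sq i (forward_end py).
have Lp a : L2p (p a) by case: (pp a).
have Lq a k : L2p (q a k) by case: (pp a).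
have Lpq e : L2p (pairing p q e) by case: e => [a|[a k]]; [exact: Lp|exact: Lq].
have spq e := L2p_sq (Lpq e); have sy a := L2p_sq (Ly a); have sw c := L2p_sq (Lw c).
have gM := space_good (lr_M D_reg); have gN := space_good (lr_N D_reg).
have gQ := space_good (lr_Q D_reg); have gS := space_good (lr_S D_reg).
have gK := space_good (lr_K D_reg); have gG := cst_good (lp_G D); have gK0 := cst_good (lp_K0 D).
pose h a := lincomb (fun a i => lp_K D i a) (lincomb (lp_Q D) (lq_err x)) a.
have s1 i : sq muT (lincomb (lp_Q D) (lq_err x) i).
 by apply: (lincom_sq gQ) => j; exact: L2p_sq (lq_err_sq j Lx).
have sh a : sq muT (h a) by apply: (lincom_sq (good_coef_tr gK)).
have sm a : sq muT (lincomb (fun a e => lp_M D e a) (pairing p q) a).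
 exact: (lincom_sq (good_coef_tr gM)).
have sn c : sq muT (lincomb (fun c e => lp_N D e c) (pairing p q) c).
 exact: (lincom_sq (good_coef_tr gN)).
have sb e : sq muT (lincomb (lp_M D) y e) by exact: (lincom_sq gM).
have sc e : sq muT (lincomb (lp_N D) w e) by exact: (lincom_sq gN).
have TT : 0 <= T <= T by rewrite lexx ltW.
have cutT (f g : TO -> R) : sq muT f -> sq muT g -> ip muT (cut T f) g = ip muT f g.
 move=> sf sg; apply: ip_ae; [exact: sq_meas (sq_cut T sf)|exact: sq_meas sf|exact: sq_meas sg|].
 exact: cutT_ae.
(* Product formula for p and y at time T; the initial term vanishes because y starts at 0. *)
have st a : ip P (fun w => p a (T, w)) (fun w => y a (T, w)) =
  ip muT (lincomb (lp_M D) y (inl a) + lincomb (lp_N D) w (inl a)) (p a) +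
  \sum_k ip muT (lincomb (lp_M D) y (inr (a, k)) + lincomb (lp_N D) w (inr (a, k))) (q a k) -
  (ip muT (lincomb (fun a e => lp_M D e a) (pairing p q) a) (y a) + ip muT (h a) (y a)).
 rewrite (iproc_ip BF (pp a) (py a) TT).
 have [_ _ _ p0 _] := pp a; have [_ _ _ y0' _] := py a.
 rewrite ipC (ip_ae (sq_meas y0') (sq_meas (sq0 P)) (sq_meas p0) (y0 a)) ip0l add0r.
 rewrite -/(h a) (cutT _ _ (sqD (sb _) (sc _)) (spq (inl a))) (cutT _ _ (sqB (sqN (sm a)) (sh a)) (sy a)).
 rewrite (ipBl (sqN (sm a)) (sh a) (sy a)) (ipNl (sm a) (sy a)).
 rewrite (eq_bigr (fun k => ip muT (lincomb (lp_M D) y (inr (a, k)) + lincomb (lp_N D) w (inr (a, k))) (q a k))).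
  by ring.
 move=> k _; rewrite cutT ?(ipC _ (q a k))//; [exact: (spq (inr (a, k)))|exact: sqD].
have LHS : qf P (fun i j => fun=> lp_G D i j) (fun i => lq_end x i - lp_eta0 D i) (lq_end y) =
  \sum_a ip P (fun w => p a (T, w)) (fun w => y a (T, w)).
 have sg i : sq P (lincom (fun i j => fun=> lp_G D i j) (fun i => lq_end x i - lp_eta0 D i) i).
  by apply: (lincom_sq gG) => j; apply: sqB; [case: (ex j)|case: (lr_eta0 D_reg j)].
 have sye a : sq P (fun w => y a (T, w)) by case: (forward_end py a).
 rewrite /qf; transitivity (\sum_i ip P (lincom (fun i a => fun=> lp_K0 D i a) (fun a w => y a (T, w)) i)
  (lincom (fun i j => fun=> lp_G D i j) (fun i => lq_end x i - lp_eta0 D i) i)).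
  by apply: eq_bigr => i _; rewrite ipC.
 rewrite (lincom_adj gK0)//; apply: eq_bigr => a _; apply/esym.
 have [sp _] : sq P (fun w => p a (T, w)) /\ mF (F T) (fun w => p a (T, w)).
  have [Y [_ hY]] := iproc_sect BF (pp a); by have [] := hY T TT.
 apply: ip_ae; [exact: sq_meas sp| |exact: sq_meas (sye a)|].
  by apply: sq_meas; apply: (lincom_sq (good_coef_tr gK0)) => i; exact: sg.
 exact: pT.
have E1 : qf muT (space (lp_Q D)) (lq_err x) (lincomb (lp_K D) y) = \sum_a ip muT (h a) (y a).
 rewrite -(lincom_adj gK)//; apply: eq_bigr => i _; exact: ipC.
rewrite /lq_slope LHS E1 (eq_bigr _ (fun a _ => st a)) sumrB !big_split/=.
have b1 : \sum_a ip muT (lincomb (lp_M D) y (inl a) + lincomb (lp_N D) w (inl a)) (p a) =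
  \sum_a ip muT (lincomb (lp_M D) y (inl a)) (p a) + \sum_a ip muT (lincomb (lp_N D) w (inl a)) (p a).
 rewrite -big_split/=; apply: eq_bigr => a _.
 exact: (ipDl (sb (inl a)) (sc (inl a)) (spq (inl a))).
have b2 : \sum_a \sum_k ip muT (lincomb (lp_M D) y (inr (a, k)) + lincomb (lp_N D) w (inr (a, k))) (q a k) =
  \sum_a \sum_k ip muT (lincomb (lp_M D) y (inr (a, k))) (q a k) +
  \sum_a \sum_k ip muT (lincomb (lp_N D) w (inr (a, k))) (q a k).
 rewrite -big_split/=; apply: eq_bigr => a _; rewrite -big_split/=; apply: eq_bigr => k _.
 exact: (ipDl (sb (inr (a, k))) (sc (inr (a, k))) (spq (inr (a, k)))).
rewrite b1 b2.
(* Transposition turns the terms in [lp_M] into those of the adjoint drift, which cancel; the terms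
   in [lp_N] remain. *)
have e1 : \sum_a ip muT (lincomb (lp_M D) y (inl a)) (p a) +
  \sum_a \sum_k ip muT (lincomb (lp_M D) y (inr (a, k))) (q a k) =
  \sum_a ip muT (lincomb (fun a e => lp_M D e a) (pairing p q) a) (y a).
 by apply: etrans (lincom_adj gM sy spq); rewrite sum_sum_type.
have e2 : \sum_a ip muT (lincomb (lp_N D) w (inl a)) (p a) +
  \sum_a \sum_k ip muT (lincomb (lp_N D) w (inr (a, k))) (q a k) =
  \sum_c ip muT (lincomb (fun c e => lp_N D e c) (pairing p q) c) (w c).
 by apply: etrans (lincom_adj gN sw spq); rewrite sum_sum_type.
have -> : \sum_c ip muT (lq_stat v p q c) (w c) =
  \sum_c ip muT (lincomb (fun c e => lp_N D e c) (pairing p q) c) (w c) +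
  qf muT (space (lp_S D)) (fun c => v c - lp_ref D c) w.
 rewrite -big_split/=; apply: eq_bigr => c _; apply: ipDl => //.
 by apply: (lincom_sq gS) => c'; exact: L2p_sq (L2pB (Lv c') (lr_ref D_reg c')).
rewrite -e1 -e2; ring.
Qed.

Lemma lq_adjoint_exists v x : (forall c, L2p (v c)) -> lq_state v x -> exists p q,
 lq_adjoint x p q /\ forall a w, {within `[0, T], continuous (fun t => p a (t, w))}.
Proof.
move=> Lv [_ px]; have Lx := forward_L2p px; have ex i := lq_end_sq i (forward_end px).
have Lh a : L2p (lincomb (fun a i => lp_K D i a) (lincomb (lp_Q D) (lq_err x)) a).
 apply: (lincomb_L2p (bounded_coef_tr (lr_K D_reg))) => i.
 by apply: (lincomb_L2p (lr_Q D_reg)) => j; exact: lq_err_sq.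
have hZ a : sq P (fun w => \sum_i lp_K0 D i a * \sum_j lp_G D i j * (lq_end x j w - lp_eta0 D j w)) /\
  mF (F T) (fun w => \sum_i lp_K0 D i a * \sum_j lp_G D i j * (lq_end x j w - lp_eta0 D j w)).
 split.
  apply: (lincom_sq (good_coef_tr (cst_good (lp_K0 D))) a) => i.
  apply: (lincom_sq (cst_good (lp_G D)) i (y := fun j => lq_end x j - lp_eta0 D j)) => j.
  by apply: sqB; [case: (ex j)|case: (lr_eta0 D_reg j)].
 apply: (@mF_sum _ _ _ _ _ _ (fun i w => lp_K0 D i a * \sum_j lp_G D i j * (lq_end x j w - lp_eta0 D j w))) => i _.
 apply: mFM; first exact: mF_cst.
 apply: (@mF_sum _ _ _ _ _ _ (fun j w => lp_G D i j * (lq_end x j w - lp_eta0 D j w))) => j _.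
 by apply: mFM; [exact: mF_cst|apply: mFB; [case: (ex j)|case: (lr_eta0 D_reg j)]].
have [p [q [h1 h2 h3]]] := backward_exists BF (bounded_coef_tr (lr_M D_reg)) Lh hZ.
by exists p, q.
Qed.

Lemma lq_stationary v x p q : lq_ctrl v -> lq_state v x -> lq_adjoint x p q ->
 (forall w y, lq_ctrl w -> lq_var w y -> lq_slope v x w y = 0) <->
 (forall c, {ae muT, forall z, lq_stat v p q c z = 0}).
Proof.
move=> Cv sx hp; have [pp _] := hp; have Lv c : L2p (v c) by case: (Cv c).
have Lpq e : L2p (pairing p q e).
 by case: e => [a|[a k]]; have [Lp _ Lq _ _] := pp a; [exact: Lp|exact: Lq].
have Ls c : L2p (lq_stat v p q c).
 apply: L2pD; first exact: (lincomb_L2p (bounded_coef_tr (lr_N D_reg))).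
 by apply: (lincomb_L2p (lr_S D_reg)) => c'; apply: L2pB => //; exact: lr_ref.
split=> [H c|H w y Cw hy].
 have Lc c0 := L2p_cut T (Ls c0).
 (* The test direction is the stationarity expression itself, cut to [0, T] to be a control; the
    slope becomes a sum of squared norms. *)
 have Cc : lq_ctrl (fun c => cut T (lq_stat v p q c)).
  by move=> c0; split => //; apply/funext => z; rewrite /cut mulrA indicE -natrM mulnb andbb.
 have [y hy] := lq_var_exists Lc; have := H _ _ Cc hy; rewrite (lq_slope_adjoint Lv sx hp Lc hy).
 rewrite (eq_bigr (fun c => ip muT (lq_stat v p q c) (lq_stat v p q c))) => [s0|c0 _].
  apply: (ip0_ae (L2p_sq (Ls c))).
  exact: (psumr_eq0P (fun c _ => ip_ge0 muT (lq_stat v p q c)) s0 (i := c) isT).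
 rewrite ipC; apply: ip_ae; [exact: sq_meas (L2p_sq (Lc c0))| | |exact: cutT_ae];
  exact: sq_meas (L2p_sq (Ls c0)).
have Lw c : L2p (w c) by case: (Cw c).
rewrite (lq_slope_adjoint Lv sx hp Lw hy) big1// => c _.
by rewrite (ip_ae (sq_meas (L2p_sq (Ls c))) (sq_meas (sq0 muT)) (sq_meas (L2p_sq (Lw c))) (H c)) ip0l.
Qed.

Lemma lq_convexP : lq_convex <-> forall v1 v2 a x1 x2 x,
 lq_ctrl v1 -> lq_ctrl v2 -> 0 <= a <= 1 ->
 lq_state v1 x1 -> lq_state v2 x2 -> lq_state (fun c z => a * v1 c z + (1 - a) * v2 c z) x ->
 lq_cost (fun c z => a * v1 c z + (1 - a) * v2 c z) x <= a * lq_cost v1 x1 + (1 - a) * lq_cost v2 x2.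
Proof.
split=> [H v1 v2 a x1 x2 x C1 C2 /andP[a0 a1] s1 s2 s|H w y Cw hy].
 have L1 c : L2p (v1 c) by case: (C1 c).
 have L2 c : L2p (v2 c) by case: (C2 c).
 have hy := lq_state_sub s2 s1; have Lw c := L2pB (L1 c) (L2 c).
 have e : (fun c z => a * v1 c z + (1 - a) * v2 c z) = lqv v2 (fun c => v1 c - v2 c) a.
  by apply/eq2_fun => c z; rewrite /lqv !fctE; ring.
 rewrite e in s *; have sl := lq_state_lin a s2 hy.
 rewrite (lq_cost_unique _ s sl); last by move=> c; apply: L2pD => //; exact: L2pZ.
 rewrite (lq_cost_lin a L2 Lw s2 hy) (lq_cost_sub L2 L1 s2 s1).
 have := H _ _ (lq_ctrl_sub C1 C2) hy; set q := lq_curv _ _; set l := lq_slope _ _ _ _; set J := lq_cost _ _ => q0.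
 rewrite -subr_ge0 (_ : _ - _ = 2^-1 * (a * (1 - a) * q)); last by field.
 by rewrite mulr_ge0 ?invr_ge0// mulr_ge0// mulr_ge0// subr_ge0.
(* Convexity is used at the midpoint 0 of w and -w: the slopes cancel and the curvature is what
   remains. *)
pose v0 : C -> TO -> R := fun=> 0.
have L0 c : L2p (v0 c) by exact: L2p0.
have C0 : lq_ctrl v0 by move=> c; split => //; apply/funext => z; rewrite /cut mulr0.
have Lw c : L2p (w c) by case: (Cw c).
have [x [sx _]] := lq_state_exists L0.
have Cl a := lq_ctrl_lin a C0 Cw.
have e : (fun c z => 2^-1 * lqv v0 w 1 c z + (1 - 2^-1) * lqv v0 w (-1) c z) = v0.
 by apply/funext => c; apply/funext => z; rewrite /lqv /v0 !fctE; field.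
have := H (lqv v0 w 1) (lqv v0 w (-1)) 2^-1 (lqx x y 1) (lqx x y (-1)) x (Cl 1) (Cl (-1)).
rewrite e => /(_ _ (lq_state_lin 1 sx hy) (lq_state_lin (-1) sx hy) sx).
rewrite !(lq_cost_lin _ L0 Lw sx hy).
have hh : 0 <= (2^-1 : R) <= 1 by apply/andP; split; lra.
move=> /(_ hh); rewrite sqrrN expr1n; set J := lq_cost _ _; set l := lq_slope _ _ _ _; lra.
Qed.

Lemma lq_necessary v x : lq_ctrl v -> lq_state v x ->
 (forall v' x', lq_ctrl v' -> lq_state v' x' -> lq_cost v x <= lq_cost v' x') ->
 lq_convex /\ exists p q, [/\ lq_adjoint x p q,
  forall a w, {within `[0, T], continuous (fun t => p a (t, w))} &
  forall c, {ae muT, forall z, lq_stat v p q c z = 0}].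
Proof.
move=> Cv sx /(lq_optimal Cv sx)[H1 H2]; split => //; have Lv c : L2p (v c) by case: (Cv c).
have [p [q [hp cp]]] := lq_adjoint_exists Lv sx; exists p, q; split => //.
exact/(lq_stationary Cv sx hp).
Qed.

Lemma lq_sufficient v x p q : lq_ctrl v -> lq_state v x -> lq_adjoint x p q ->
 lq_convex -> (forall c, {ae muT, forall z, lq_stat v p q c z = 0}) ->
 forall v' x', lq_ctrl v' -> lq_state v' x' -> lq_cost v x <= lq_cost v' x'.
Proof.
by move=> Cv sx hp cv hs; apply/(lq_optimal Cv sx); split=> //; exact/(lq_stationary Cv sx hp).
Qed.

End linear_quadratic.

(** * Vector processes and their coordinates *)

Section random_vectors.
Context {R : realType} {d} {Omega : measurableType d}.

Lemma rvec_mF (G : set_system Omega) m (X : Omega -> 'cV[R]_m) : sigma_algebra setT G ->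
 (forall S, sigma_rvec X S -> G S) <-> (forall j, mF G (fun w => X w j 0)).
Proof.
move=> sG; split=> [h j|h S [C bC ->]].
 apply/(mFP _ sG) => B mB; apply: h; exists [set v | B (v j 0)] => //.
 by apply: sub_sigma_algebra; exists j, B.
have [G0 GC GU] := sG.
suff : <<s [set C | exists (j : 'I_m) (B : set R), measurable B /\ C = [set v : 'cV[R]_m | B (v j 0)]] >>
  `<=` [set C | G (X @^-1` C)] by exact.
apply: smallest_sub => [|_ [j [B [mB ->]]]]; last exact: (mFP _ sG).1 (h j) B mB.
split.
- by rewrite /= preimage_set0.
- by move=> A GA; have := GC _ GA; rewrite /= !setTD preimage_setC.
- by move=> A GA; rewrite /= preimage_bigcup; exact: GU.
Qed.

End random_vectors.

Section convergence_to_zero.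
Context {R : realType}.

Lemma cvg_sqr_sum (m : nat) (u : nat -> 'I_m -> R) : (forall l j, 0 <= u l j) ->
 ((fun l => (\sum_j u l j ^+ 2)%:E) @ \oo --> 0%E) <-> (forall j, u ^~ j @ \oo --> 0).
Proof.
move=> u0; split=> [h j|h].
 have /fine_cvgP[_ h1] := h.
 have h2 : (fun l => u l j ^+ 2) @ \oo --> 0.
  apply: (squeeze_cvgr (f := fun=> 0) (h := fun l => \sum_j u l j ^+ 2)) => //; last exact: cvg_cst.
  apply: nearW => l; rewrite sqr_ge0/= (bigD1 j)//= lerDl sumr_ge0// => i _; exact: sqr_ge0.
 have h3 : (fun l => Num.sqrt (u l j ^+ 2)) @ \oo --> Num.sqrt (0 : R).
  by apply: continuous_cvg => //; exact: sqrt_continuous.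
 rewrite sqrtr0 in h3; rewrite (_ : u ^~ j = fun l => Num.sqrt (u l j ^+ 2))//.
 by apply/funext => l; rewrite sqrtr_sqr ger0_norm.
apply: cvg_EFin; first exact: nearW.
rewrite (_ : fine \o _ = fun l => \sum_j u l j ^+ 2)//.
elim: (index_enum _) => [|j s IH]; first by under eq_fun do rewrite big_nil; exact: cvg_cst.
under eq_fun do rewrite big_cons expr2.
have := cvgD (cvgM (h j) (h j)) IH; rewrite mulr0 addr0; exact.
Qed.

End convergence_to_zero.

Section vector_processes.
Context {R : realType} {d} {Omega : measurableType d}
 (P : probability Omega R) (T : R) (I : finType) (W : I -> R -> Omega -> R)
 (F : R -> set_system Omega) (E0 : nat -> set Omega) (BF : brownian_filtration P T W F E0).

Notation TO := (measurableTypeR R * Omega)%type.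
Notation muT := (muT P T).
Notation lamT := (lamT T).
Notation L2p := (L2p P T F).
Notation ito := (ito P T W F).
Notation iproc := (iproc P T W F).
Notation sproc m := (@simple_process R d Omega m).

Let T0 : 0 < T := bf_T BF.
Let Fs t : sigma_algebra setT (F t) := bf_sigma BF t.

(** Vector processes are arbitrary outside [0, T]; the cut gives coordinates that are measurable on
    the whole product. *)
Definition comp m (h : process R Omega m) (j : 'I_m) : TO -> R := cut T (fun z => h z.1 z.2 j 0).

Lemma compE m (h : process R Omega m) j z :
 comp h j z = (\1_(`[0, T]%classic : set R) z.1 : R) * h z.1 z.2 j 0.
Proof. by []. Qed.

Lemma comp_in m (h : process R Omega m) j t w : 0 <= t <= T -> comp h j (t, w) = h t w j 0.
Proof. exact: cut_in. Qed.

Lemma comp_meas m (h : process R Omega m) : time_space_measurable T h <->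
 forall j, meas_fun (comp h j).
Proof.
pose Dom : set TO := `[0, T]%classic `*` [set: Omega].
have mD : measurable Dom by apply: measurableX => //; exact: measurable_itv.
have e j : comp h j = (fun z : TO => h z.1 z.2 j 0) \_ Dom.
 apply/funext => z; rewrite /comp /cut patchE indicE /Dom in_setX in_setT andbT.
 by case: ifP; rewrite ?mul1r ?mul0r.
by split=> H j; have := H j; rewrite e; [move/(measurable_restrictT _ mD)|move=> /(measurable_restrictT _ mD)].
Qed.

Lemma normsqE m (x : 'cV[R]_m) : normsq x = \sum_j x j 0 ^+ 2.
Proof. by rewrite /normsq /dot mxE; apply: eq_bigr => j _; rewrite mxE expr2. Qed.

Lemma integral_normsq m (X : Omega -> 'cV[R]_m) : (forall j, meas_fun (fun w => X w j 0)) ->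
 (\int[P]_w (normsq (X w))%:E = \sum_j \int[P]_w (X w j 0 ^+ 2)%:E)%E.
Proof.
move=> mX; rewrite -ge0_integral_sum//.
- by apply: eq_integral => w _; rewrite normsqE sumEFin.
- by move=> j; apply/measurable_EFinP; exact: measurable_funX.
- by move=> j w _; rewrite lee_fin sqr_ge0.
Qed.

Lemma normsq_nrm m (X : Omega -> 'cV[R]_m) : (forall j, sq P (fun w => X w j 0)) ->
 (\int[P]_w (normsq (X w))%:E = (\sum_j nrm P (fun w => X w j 0) ^+ 2)%:E)%E.
Proof.
move=> sX; rewrite integral_normsq; last by move=> j; exact: sq_meas (sX j).
by rewrite -sumEFin; apply: eq_bigr => j _; rewrite integral_sqr.
Qed.

Lemma normsq_fin m (X : Omega -> 'cV[R]_m) : (forall j, meas_fun (fun w => X w j 0)) ->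
 (\int[P]_w (normsq (X w))%:E < +oo)%E -> forall j, sq P (fun w => X w j 0).
Proof.
move=> mX fX j; apply: sq_fin => //; apply: le_lt_trans fX; rewrite integral_normsq//.
rewrite (bigD1 j)//= leeDl// sume_ge0// => i _.
by apply: integral_ge0 => w _; rewrite lee_fin sqr_ge0.
Qed.

Lemma mean_time_normsqE m (h : process R Omega m) : time_space_measurable T h ->
 (mean_time_normsq P T h = \sum_j \int[muT]_z (comp h j z ^+ 2)%:E)%E.
Proof.
move=> /comp_meas mh; rewrite /mean_time_normsq.
have m2 j : meas_fun (fun z => (comp h j z ^+ 2)%:E).
 by apply/measurable_EFinP; exact: measurable_funX.
have n2 j z : (0 <= (comp h j z ^+ 2)%:E)%E by rewrite lee_fin sqr_ge0.
transitivity (\sum_j \int[P]_w \int[lamT]_t (comp h j (t, w) ^+ 2)%:E)%E; last first.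
 by apply: eq_bigr => j _; exact/esym/(@fubini_tonelli2 _ _ _ _ _ lamT P).
have mj j w : meas_fun (fun t : measurableTypeR R => (comp h j (t, w) ^+ 2)%:E).
 by apply/measurable_EFinP; apply: measurable_funX; exact: measurable_path.
rewrite -ge0_integral_sum//; last first.
- by move=> j w _; exact: integral_ge0.
- move=> j; exact: (@measurable_fun_fubini_tonelli_G _ _ _ _ _ lamT (fun z => (comp h j z ^+ 2)%:E)).
apply: eq_integral => w _; rewrite -ge0_integral_sum// ge0_integral_lamT; last 2 first.
- by apply: emeasurable_sum => j; exact: mj.
- by move=> t; apply: sume_ge0 => j _.
apply: eq_integral => t; rewrite inE/= in_itv/= => tT; rewrite normsqE -sumEFin.
by apply: eq_bigr => j _; rewrite comp_in.
Qed.

Lemma mean_time_nrm m (h : process R Omega m) : (forall j, sq muT (comp h j)) ->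
 mean_time_normsq P T h = (\sum_j nrm muT (comp h j) ^+ 2)%:E.
Proof.
move=> sh; rewrite mean_time_normsqE; last by apply/comp_meas => j; exact: sq_meas (sh j).
by rewrite -sumEFin; apply: eq_bigr => j _; rewrite integral_sqr.
Qed.

Lemma L2_comp m (h : process R Omega m) : L2 P T F h <-> forall j, L2p (comp h j).
Proof.
have ad : adapted T F h <-> forall j t, 0 <= t <= T -> mF (F t) (fun w => comp h j (t, w)).
 have e j t : 0 <= t <= T -> (fun w => comp h j (t, w)) = fun w => h t w j 0.
  by move=> tT; apply/funext => w; rewrite comp_in.
 split=> [H j t tT|H t tT]; first by rewrite e//; exact: ((rvec_mF _ (Fs t)).1 (H t tT)).
 by apply/(rvec_mF _ (Fs t)) => j; rewrite -e//; exact: H.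
split=> [[mh /ad ah fh] j|H].
 split; last exact: ah.
 apply: sq_fin; first by move/comp_meas : mh.
 apply: le_lt_trans fh; rewrite mean_time_normsqE// (bigD1 j)//= leeDl// sume_ge0// => i _.
 by apply: integral_ge0 => z _; rewrite lee_fin sqr_ge0.
have sh j := L2p_sq (H j); split.
- by apply/comp_meas => j; exact: sq_meas (sh j).
- by apply/ad => j t tT; have [_] := H j; exact.
- by rewrite mean_time_nrm// ltry.
Qed.

Lemma component_simple m (S : sproc m) j : simple_adapted T F S ->
 simple T W F (fun z => simple_eval S z.1 z.2 j 0) (fun k t w => simple_integral (W k) S t w j 0).
Proof.
move=> aS.
have h (i : 'I_(sp_size S)) : simple T W F (elem (sp_lo i) (sp_hi i) (fun w => sp_val i w j 0))
  (elemJ W (sp_lo i) (sp_hi i) (fun w => sp_val i w j 0)).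
 have [a0 ab bT mv [c hc]] := aS i; apply: simple_elem => //.
  exact: ((rvec_mF _ (Fs (sp_lo i))).1 mv).
 exists (1 + c) => w; apply: le_trans (_ : 1 + normsq (sp_val i w) <= _); last by rewrite lerD2l.
 apply: (@le_trans _ _ (1 + sp_val i w j 0 ^+ 2)).
  by have := norm_mul_le 1 (sp_val i w j 0); rewrite mul1r expr1n.
 by rewrite lerD2l normsqE (bigD1 j)//= lerDl sumr_ge0// => l _; exact: sqr_ge0.
have := simple_sum (index_enum _) (p := xpredT) (fun i _ => h i); congr simple.
 by apply/funext => z; rewrite fct_sumE /simple_eval summxE; apply: eq_bigr => i _; rewrite !mxE.
apply/eq2_fun => k t; apply/funext => w.
by rewrite fct_sumE /simple_integral summxE; apply: eq_bigr => i _; rewrite !mxE.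
Qed.

(** Scalar simple integrands, one for each coordinate, are reassembled into one vector simple
    process by appending pieces supported on a single coordinate. *)
Definition vsimple m (H : process R Omega m) (J : I -> process R Omega m) :=
 exists S : sproc m, [/\ simple_adapted T F S,
  forall t w, simple_eval S t w = H t w & forall k t w, simple_integral (W k) S t w = J k t w].

Lemma vsimple_cons m a b (Z : Omega -> R) (j : 'I_m) H J : 0 <= a -> a <= b -> b <= T ->
 mF (F a) Z -> (exists c, forall w, `|Z w| <= c) -> vsimple H J ->
 vsimple (fun t w => ((\1_(`]a, b]%classic : set R) t : R) * Z w) *: delta_mx j 0 + H t w)
  (fun k t w => ((W k (Num.min t b) w - W k (Num.min t a) w) * Z w) *: delta_mx j 0 + J k t w).
Proof.
move=> a0 ab bT mZ [c hc] [S [aS eS iS]].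
pose ex X (x : X) (f : 'I_(sp_size S) -> X) (i : 'I_(sp_size S).+1) :=
 if unlift ord0 i is Some i' then f i' else x.
exists (SimpleProcess (ex R a (fun i => sp_lo i)) (ex R b (fun i => sp_hi i))
 (ex _ (fun w => Z w *: delta_mx j 0) (fun i => sp_val i))).
split=> [i|t w|k t w]; last 2 first.
- rewrite -eS /simple_eval /= big_ord_recl; congr (_ + _).
  by rewrite /ex unlift_none scalerA.
 by apply: eq_bigr => i _; rewrite /ex liftK.
- rewrite -iS /simple_integral /= big_ord_recl; congr (_ + _).
  by rewrite /ex unlift_none scalerA.
 by apply: eq_bigr => i _; rewrite /ex liftK.
rewrite /= /ex; case: unliftP => [i' _|_]; first exact: aS.
split => //.
 apply/(rvec_mF _ (Fs a)) => l; under eq_fun do rewrite !mxE.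
 by apply: mFM => //; exact: mF_cst.
exists (\sum_(l < m) c ^+ 2) => w; rewrite normsqE; apply: ler_sum => l _.
rewrite !mxE eqxx andbT exprMn.
have z2 : Z w ^+ 2 <= c ^+ 2.
 by rewrite -[Z w ^+ 2]real_normK ?num_real// ler_sqr ?nnegrE// (le_trans _ (hc w)).
by case: eqP => _; rewrite ?expr1n ?mulr1// expr0n mulr0 sqr_ge0.
Qed.

Lemma vsimple_add m (j : 'I_m) h g H J : simple T W F h g -> vsimple H J ->
 vsimple (fun t w => h (t, w) *: delta_mx j 0 + H t w)
  (fun k t w => g k t w *: delta_mx j 0 + J k t w).
Proof.
move=> s vH; elim: s => [|a b Z {}h {}g a0 ab bT mZ Zc _ IH].
 move: vH; congr vsimple.
  by apply/eq2_fun => t w; rewrite scale0r add0r.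
 by apply/eq2_fun => k t; apply/funext => w; rewrite scale0r add0r.
have := vsimple_cons j a0 ab bT mZ Zc IH; congr vsimple.
 by apply/eq2_fun => t w; rewrite addrA -scalerDl.
by apply/eq2_fun => k t; apply/funext => w; rewrite addrA -scalerDl.
Qed.

Lemma vsimple_col m (h : 'I_m -> TO -> R) (g : 'I_m -> I -> R -> Omega -> R) :
 (forall j, simple T W F (h j) (g j)) ->
 vsimple (fun t w => \col_j h j (t, w)) (fun k t w => \col_j g j k t w).
Proof.
move=> s.
have key (r : seq 'I_m) : vsimple (fun t w => \sum_(j <- r) h j (t, w) *: delta_mx j 0)
  (fun k t w => \sum_(j <- r) g j k t w *: delta_mx j 0).
 elim: r => [|j r IH].
  exists (@SimpleProcess R _ _ m 0 (fun=> 0) (fun=> 0) (fun _ _ => 0)); split=> [[]//|t w|k t w].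
   by rewrite /simple_eval big_ord0 big_nil.
  by rewrite /simple_integral big_ord0 big_nil.
 have := vsimple_add j (s j) IH; congr vsimple.
  by apply/eq2_fun => t w; rewrite big_cons.
 by apply/eq2_fun => k t; apply/funext => w; rewrite big_cons.
have e (f : 'I_m -> R) : \sum_j f j *: delta_mx j 0 = \col_j f j :> 'cV[R]_m.
 apply/colP => i; rewrite summxE mxE (bigD1 i)//= !mxE !eqxx mulr1 big1 ?addr0// => l li.
 by rewrite !mxE eq_sym (negPf li) mulr0.
have := key (index_enum _); congr vsimple.
 by apply/eq2_fun => t w; rewrite e.
by apply/eq2_fun => k t; apply/funext => w; rewrite e.
Qed.

Lemma comp_sub m (h g : process R Omega m) j : comp (fun t w => h t w - g t w) j = comp h j - comp g j.
Proof. by apply/funext => z; rewrite !fctE /comp /cut !mxE mulrBr. Qed.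

Lemma nrm_comp m (H h : process R Omega m) j : sq muT (fun z => H z.1 z.2 j 0) -> sq muT (comp h j) ->
 sq muT (comp (fun t w => H t w - h t w) j) /\
 nrm muT (comp (fun t w => H t w - h t w) j) = nrm muT ((fun z => H z.1 z.2 j 0) - comp h j).
Proof.
move=> sH sh; have sc := sq_cut T sH; rewrite comp_sub; split; first exact: sqB.
apply: nrm_ae; [exact: sq_meas (sqB sc sh)|exact: sq_meas (sqB sH sh)|].
by apply: (ae_imp (cutT_ae P T (fun z : TO => H z.1 z.2 j 0))) => z e; rewrite !fctE; congr (_ - _).
Qed.

(** [is_ito_integral] asks only measurability of Y_t; its square integrability and adaptedness are
    recovered from the mean square convergence of simple integrals. *)
Lemma ito_of_vector m k (h Y : process R Omega m) j : is_ito_integral P T F (W k) h Y ->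
 ito k (comp h j) (fun t w => Y t w j 0).
Proof.
move=> [Lh mY [H [aH cH cY]]].
have Lc := (L2_comp h).1 Lh.
have sH l i := component_simple i (aH l).
have mYj t i : 0 <= t <= T -> meas_fun (fun w => Y t w i 0).
 move=> tT; apply: (mF_meas (@subset_refl _ _)).
 exact: ((rvec_mF _ (@sigma_measurable _ Omega)).1 (mY t tT)).
have sJ l t i : 0 <= t <= T -> sq P (fun w => simple_integral (W k) (H l) t w i 0).
 by move=> /andP[t0 tT]; have [] := simple_J BF k (sH l i) t0 tT.
have sY t i : 0 <= t <= T -> sq P (fun w => Y t w i 0).
 (* Convergence to 0 in the extended reals makes some term finite, and one term suffices. *)
 move=> tT; have := cY t tT => /fine_cvgP[[l _ /(_ l (leqnn l)) fin] _].
 have sD : sq P (fun w => (simple_integral (W k) (H l) t w - Y t w) i 0).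
  apply: (normsq_fin (X := fun w => simple_integral (W k) (H l) t w - Y t w)).
   move=> q; under eq_fun do rewrite !mxE.
   by apply: measurable_funB; [exact: sq_meas (sJ l t q tT)|exact: mYj].
  by move: fin; rewrite ge0_fin_numE//; apply: integral_ge0 => w _; rewrite lee_fin normsqE sumr_ge0// => q _; exact: sqr_ge0.
 have := sqB (sJ l t i tT) sD; congr sq; apply/funext => w; rewrite !fctE !mxE; ring.
have tY t : 0 <= t <= T -> tendsto P (fun l w => simple_integral (W k) (H l) t w j 0) (fun w => Y t w j 0).
 move=> tT; split; [by move=> l; exact: sJ|exact: sY|].
 have := cY t tT.
 rewrite (_ : (fun l => _) = fun l => (\sum_i nrm P (fun w => (simple_integral (W k) (H l) t w - Y t w) i 0) ^+ 2)%:E); last first.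
  apply/funext => l; apply: normsq_nrm => i; have := sqB (sJ l t i tT) (sY t i tT).
  by congr sq; apply/funext => w; rewrite !fctE !mxE.
 move=> /cvg_sqr_sum h0; have := h0 (fun _ _ => nrm_ge0 _ _) j.
 by under eq_fun do under [X in nrm P X]eq_fun do rewrite !mxE.
apply: (ito_critS BF (H := fun l z => simple_eval (H l) z.1 z.2 j 0)
 (J := fun l k t w => simple_integral (W k) (H l) t w j 0)) => //.
- move=> t tT; have [t0 tT'] := andP tT.
 apply: (mF_tendsto (Fs t) _ _ _ (tY t tT)); [exact: bf_null BF t|exact: bf_meas BF _ tT'|].
 by move=> l; have [] := simple_J BF k (sH l j) t0 tT'.
split; [by move=> l; exact: (simple_sq BF (sH l j))|exact: L2p_sq|].
have e l i := nrm_comp (simple_sq BF (sH l i)) (L2p_sq (Lc i)).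
move: cH; rewrite (_ : (fun l => _) = fun l => (\sum_i nrm muT ((fun z => simple_eval (H l) z.1 z.2 i 0) - comp h i) ^+ 2)%:E); last first.
 apply/funext => l; rewrite mean_time_nrm; last by move=> i; case: (e l i).
 by congr EFin; apply: eq_bigr => i _; case: (e l i) => _ ->.
by move=> /cvg_sqr_sum h0; exact: (h0 (fun _ _ => nrm_ge0 _ _) j).
Qed.

Lemma vector_of_ito m k (h : process R Omega m) (Y : 'I_m -> R -> Omega -> R) :
 L2 P T F h -> (forall j, ito k (comp h j) (Y j)) ->
 is_ito_integral P T F (W k) h (fun t w => \col_j Y j t w).
Proof.
move=> Lh iY.
have Lc := (L2_comp h).1 Lh.
have /choice[H /choice[J hHJ]] j : exists H J, [/\ forall n, simple T W F (H n) (J n),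
  tendsto muT H (comp h j) & forall t, 0 <= t <= T -> tendsto P (fun n => J n k t) (Y j t)].
 exact: (ito_seq BF (iY j)).
have /choice[S hS] : forall n, exists S : sproc m, [/\ simple_adapted T F S,
  forall t w, simple_eval S t w = \col_j H j n (t, w) &
  forall k t w, simple_integral (W k) S t w = \col_j J j n k t w].
 by move=> n; apply: (vsimple_col (h := fun j => H j n) (g := fun j => J j n)) => j; case: (hHJ j).
split => //.
 move=> t tT; apply/(rvec_mF _ (@sigma_measurable _ Omega)) => j.
 under eq_fun do rewrite mxE; have [_ sY _] := iY j; have [_ mY] := sY t tT.
 by apply: mF_sub mY; [exact: sigma_measurable|apply: (bf_meas BF); case/andP: tT].
exists S; split => [n||t tT]; first by case: (hS n).
 have e n i : sq muT (comp (fun t w => simple_eval (S n) t w - h t w) i) /\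
   nrm muT (comp (fun t w => simple_eval (S n) t w - h t w) i) = nrm muT (H i n - comp h i).
  have [hs tH _] := hHJ i; have [sHn sh _] := tH; have [_ eS _] := hS n.
  have q : (fun z : TO => simple_eval (S n) z.1 z.2 i 0) = H i n.
   by apply/funext => -[t w]; rewrite eS mxE.
  have := nrm_comp (H := simple_eval (S n)) (h := h) (j := i); rewrite q; apply => //.
 under eq_fun => n do rewrite (mean_time_nrm (fun i => proj1 (e n i))).
 apply/cvg_sqr_sum => [n i|i]; first exact: nrm_ge0.
 by under eq_fun => n do rewrite (proj2 (e n i)); have [_ [_ _]] := hHJ i.
have q n i : (fun w => (simple_integral (W k) (S n) t w - \col_j Y j t w) i 0) = J i n k t - Y i t.
 by have [_ _ iS] := hS n; apply/funext => w; rewrite iS !mxE.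
have tJ i : tendsto P (fun n => J i n k t) (Y i t) by have [_ _ h0] := hHJ i; exact: h0.
have sJ n i : sq P (fun w => (simple_integral (W k) (S n) t w - \col_j Y j t w) i 0).
 by rewrite q; have [a b _] := tJ i; exact: sqB.
under eq_fun => n do rewrite (normsq_nrm (sJ n)).
apply/cvg_sqr_sum => [n i|i]; first exact: nrm_ge0.
by under eq_fun => n do rewrite q; have [] := tJ i.
Qed.

Lemma tint_comp m (b : process R Omega m) j t w : meas_fun (comp b j) -> 0 <= t <= T ->
 tint T (comp b j) t w = \int[lebesgue_measure]_(r in `[0, t]) b r w j 0.
Proof.
move=> mb tT; have [t0 tT'] := andP tT; rewrite tint_leb//; apply: eq_Rintegral => r.
by rewrite inE/= in_itv/= => /andP[r0 rt]; rewrite comp_in// r0 (le_trans rt).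
Qed.

(** The clause of [iproc] that is not among the hypotheses is square integrability at time 0. *)
Lemma iproc_of_vector m (X b : process R Omega m) (s : I -> process R Omega m) j :
 L2 P T F X -> ito_equation P T F W X b s ->
 iproc (comp X j) (comp b j) (fun k => comp (s k) j).
Proof.
move=> /L2_comp LX [Lb _ [Y [iY hY]]].
have Lbj : L2p (comp b j) by move/L2_comp : Lb.
have iYj k := ito_of_vector j (iY k).
have Lsj k : L2p (comp (s k) j) by case: (iYj k).
have T00 : 0 <= (0 : R) <= T by rewrite lexx ltW.
have eq t : 0 <= t <= T -> {ae P, forall w, comp X j (t, w) =
  comp X j (0, w) + tint T (comp b j) t w + \sum_k Y k t w j 0}.
 move=> tT; apply: (ae_imp (hY t tT)) => w e.
 rewrite !comp_in// e (tint_comp _ (sq_meas (L2p_sq Lbj)) tT).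
 by rewrite !mxE summxE.
split => //; last by exists (fun k t w => Y k t w j 0).
have [LXs LXa] := LX j.
(* Almost every section of X is square integrable, and [0, T] is not a null set. From such a time t
   the initial value is recovered by subtracting the drift and the martingale part. *)
have [t [tT st]] : exists t, 0 <= t <= T /\ sq P (fun w => comp X j (t, w)).
 have := ae_imp2 (lamT_in T) (sq_section LXs) (fun t h1 h2 => conj h1 h2).
 move=> [N [mN N0 hN]]; apply: contrapT => nex.
 have : N = setT.
  by rewrite -subTset => t _; apply: hN => /= h; apply: nex; exists t.
 move=> NT; have : lamT setT = 0%E by rewrite -NT; exact: N0.
 rewrite lamTE setTI => l0.
 have : (@lebesgue_measure R `[0%R, T]%classic = T%:E)%E.
  by rewrite lebesgue_measure_itv/= lte_fin T0 sube0.
 rewrite l0 => -[] /eqP; by rewrite eq_sym gt_eqF.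
have sM : sq P (Msum (fun k t w => Y k t w j 0) t) by exact: (Msum_sq iYj tT).
have [sb _] := tint_sq t (L2p_sq Lbj).
apply: (sq_ae (sqB (sqB st sb) sM)); first exact: measurable_section (sq_meas LXs).
by apply: (ae_imp (eq t tT)) => w e; rewrite !fctE e /Msum fct_sumE; ring.
Qed.

Lemma vector_of_iproc m (x : 'I_m -> TO -> R) b' s' (b : process R Omega m) (s : I -> process R Omega m) :
 L2 P T F b -> (forall k, L2 P T F (s k)) -> (forall j, iproc (x j) (b' j) (s' j)) ->
 (forall j, {ae muT, forall z, b' j z = comp b j z}) ->
 (forall j k, {ae muT, forall z, s' j k z = comp (s k) j z}) ->
 (forall j w, {within `[0, T], continuous (fun t => x j (t, w))}) ->
 ito_equation P T F W (fun t w => \col_j x j (t, w)) b s.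
Proof.
move=> Lb Ls px eb es cx; split => //.
 by apply: aeW => w j; rewrite (_ : (fun t => _) = fun t => x j (t, w)) //; apply/funext => t; rewrite mxE.
have Lbj j : L2p (comp b j) by move/L2_comp : Lb.
have Lsj k j : L2p (comp (s k) j) by move/L2_comp : (Ls k).
have p j := iproc_ae BF (px j) (Lbj j) (fun k => Lsj k j) (eb j) (es j).
have /choice[Y hY] j : exists Y : I -> R -> Omega -> R, (forall k, ito k (comp (s k) j) (Y k)) /\
  forall t, 0 <= t <= T -> {ae P, forall w,
   x j (t, w) = x j (0, w) + tint T (comp b j) t w + \sum_k Y k t w} by case: (p j).
exists (fun k t w => \col_j Y j k t w); split.
 by move=> k; apply: (vector_of_ito (Ls k)) => j; have [h _] := hY j; exact: h.
move=> t tT; have /ae_fin : forall j, {ae P, forall w,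
  x j (t, w) = x j (0, w) + tint T (comp b j) t w + \sum_k Y j k t w}.
 by move=> j; have [_ h] := hY j; exact: h.
move=> H; apply: (ae_imp H) => w e; apply/colP => j.
rewrite !mxE e summxE (tint_comp _ (sq_meas (L2p_sq (Lbj j))) tT).
by congr (_ + _); apply: eq_bigr => k _; rewrite mxE.
Qed.

End vector_processes.

(** * Bounded versions of the coefficients, and null sets of the strip *)

Section bounded_coefficients.
Context {R : realType}.
Notation TR := (measurableTypeR R).

Definition bfun (f : R -> R) := meas_fun (f : TR -> R) /\ exists c, forall t, `|f t| <= c.

Lemma bfun_cst c : bfun (fun=> c).
Proof. by split; [exact: measurable_cst|exists `|c|]. Qed.

Lemma bfunD f g : bfun f -> bfun g -> bfun (fun t => f t + g t).
Proof.
move=> [mf [c hc]] [mg [b hb]]; split; first exact: measurable_funD.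
by exists (c + b) => t; apply: (le_trans (ler_normD _ _)); exact: lerD.
Qed.

Lemma bfunZ a f : bfun f -> bfun (fun t => a * f t).
Proof.
move=> [mf [c hc]]; split; first exact: measurable_funM.
by exists (`|a| * c) => t; rewrite normrM ler_wpM2l.
Qed.

Lemma bounded_coefP (A K : finType) (M : A -> K -> R -> R) :
 (forall a k, bfun (M a k)) -> bounded_coef M.
Proof.
move=> h; split => [a k|]; first by case: (h a k).
have /choice[c hc] : forall ak : A * K, exists c, forall t, `|M ak.1 ak.2 t| <= c.
 by move=> [a k]; case: (h a k).
exists (\sum_ak `|c ak|) => a k t; apply: (le_trans (hc (a, k) t)); apply: (le_trans (ler_norm _)).
by rewrite (bigD1 (a, k))//= lerDl sumr_ge0.
Qed.

Variable T : R.

(** Truncating the entries at the essential bound changes them only on a null set of times of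
    [0, T]. *)
Lemma Linfty_bounded m1 m2 (M : R -> 'M[R]_(m1, m2)) : Linfty T M -> exists M' : R -> 'M[R]_(m1, m2),
 (forall i j, bfun (fun t => M' t i j)) /\ {ae lamT T, forall t, M' t = M t}.
Proof.
move=> [mM [c hc]].
pose f i j t := (fun t => M t i j) \_ `[0, T] t.
have mf i j : meas_fun (f i j : TR -> R).
 by apply/(measurable_restrictT _ (measurable_itv `[0, T])); exact: mM.
exists (fun t => \matrix_(i, j) Num.max (- `|c|) (Num.min `|c| (f i j t))); split=> [i j|].
 under eq_fun do rewrite mxE; split.
  by apply: measurable_maxr => //; apply: measurable_minr.
 exists `|c| => t; rewrite ler_norml le_max lexx/= ge_max ge_min lexx/= andbT.
 by rewrite (le_trans _ (normr_ge0 c))// oppr_le0.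
move/ae_lamT : hc => hc; apply: (ae_imp2 (lamT_in T) hc) => t tT h.
apply/matrixP => i j; rewrite mxE /f patchE mem_set ?in_itv//=.
have := le_trans (h i j) (ler_norm c); rewrite ler_norml => /andP[h1 h2].
by rewrite (min_r h2) (max_r h1).
Qed.

End bounded_coefficients.

Section null_sets_of_the_strip.
Context {R : realType} {d} {Omega : measurableType d} (P : probability Omega R) (T : R).
Notation TO := (measurableTypeR R * Omega)%type.
Notation muT := (muT P T).

Let strip : set TO := `[0, T]%classic `*` [set: Omega].

Let mstrip : measurable strip.
Proof. by apply: measurableX => //; exact: measurable_itv. Qed.

Lemma muTE (A : set TO) : measurable A ->
 muT A = ((@lebesgue_measure R) \x P)%E (A `&` strip).
Proof.
move=> mA.
rewrite [LHS](_ : _ = (\int[lamT T]_t P (xsection A t))%E)//.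
rewrite [RHS](_ : _ = (\int[@lebesgue_measure R]_t P (xsection (A `&` strip) t))%E)//.
rewrite ge0_integral_lamT; [|exact: measurable_fun_xsection|by move=> t; exact: measure_ge0].
rewrite integral_mkcond; apply: eq_integral => t _; rewrite patchE.
case: ifPn => tT; congr (P _) || (rewrite (_ : xsection _ _ = set0) ?measure0//).
 apply/seteqP; split=> w; rewrite /xsection/= !inE => h; last by case: h.
 by split => //; split => //; move: tT; rewrite inE.
rewrite -subset0 => w; rewrite /xsection/= inE => -[_ [tI _]].
by move: tT; rewrite notin_setE.
Qed.

(** [stationary] is stated for Lebesgue measure on the whole line times P, restricted to the strip
    by an implication; the two null sets differ by points off the strip. *)
Lemma ae_muT_leb (Q : TO -> Prop) : {ae muT, forall z, Q z} <->
 {ae ((@lebesgue_measure R) \x P)%E, forall z, z.1 \in `[0, T] -> Q z}.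
Proof.
split=> -[N [mN N0 hN]].
 have mNs : measurable (N `&` strip) by exact: measurableI.
 exists (N `&` strip); split => //; first by rewrite -muTE.
 move=> z /= nQ; split; first by apply: hN => /= q; apply: nQ.
 by split => //=; apply: contrapT => h; apply: nQ => zT; exfalso; exact: h.
have mM : measurable (N `|` ~` strip) by apply: measurableU => //; exact: measurableC.
exists (N `|` ~` strip); split => //.
 rewrite muTE//.
 apply/eqP; rewrite eq_le measure_ge0 andbT -N0; apply: le_measure; rewrite ?inE//; first exact: measurableI.
 by move=> z [[//|ns] s].
move=> z /= nQ; have [zT|zT] := boolP (z.1 \in `[0, T]); first by left; apply: hN => /= h; exact: nQ (h zT).
by right => -[/= z1 _]; move/negP: zT; apply.
Qed.

End null_sets_of_the_strip.

Section process_operations.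
Context {R : realType} {d} {Omega : measurableType d}
 (P : probability Omega R) (T : R) (I : finType) (W : I -> R -> Omega -> R)
 (F : R -> set_system Omega) (E0 : nat -> set Omega) (BF : brownian_filtration P T W F E0).

Notation TO := (measurableTypeR R * Omega)%type.
Notation muT := (muT P T).
Notation L2p := (L2p P T F).
Notation L2 := (L2 P T F).
Notation process := (process R Omega).

Lemma L2_add m (h g : process m) : L2 h -> L2 g -> L2 (fun t w => h t w + g t w).
Proof.
move=> /(L2_comp BF) Lh /(L2_comp BF) Lg; apply/(L2_comp BF) => j; have := L2pD (Lh j) (Lg j).
by congr (L2p _); apply/funext => z; rewrite !fctE /comp /cut !mxE mulrDr.
Qed.

Lemma L2_scale m c (h : process m) : L2 h -> L2 (fun t w => c *: h t w).
Proof.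
move=> /(L2_comp BF) Lh; apply/(L2_comp BF) => j; have := L2pZ c (Lh j).
by congr (L2p _); apply/funext => z; rewrite /comp /cut !mxE mulrCA.
Qed.

Lemma L2_opp m (h : process m) : L2 h -> L2 (fun t w => - h t w).
Proof.
move=> Lh; have := L2_scale (-1) Lh; congr Defs.L2.
by apply/eq2_fun => t w; rewrite scaleN1r.
Qed.

Lemma L2_zero m : L2 (fun _ _ => 0 : 'cV[R]_m).
Proof.
apply/(L2_comp BF) => j; have := L2p0 P T F; congr (L2p _).
by apply/funext => z; rewrite /comp /cut mxE mulr0.
Qed.

Lemma L2_avg N m (y : 'I_N -> process m) : (forall i, L2 (y i)) -> L2 (avg y).
Proof.
move=> Ly; apply: L2_scale.
elim: (index_enum _) => [|i s IH].
 by have := @L2_zero m; congr (L2 _); apply/eq2_fun => t w; rewrite big_nil.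
have := L2_add (Ly i) IH; congr Defs.L2.
by apply/eq2_fun => t w; rewrite big_cons.
Qed.

Lemma L2_mul m1 m2 (M : R -> 'M[R]_(m1, m2)) (h : process m2) : Linfty T M -> L2 h ->
 L2 (fun t w => M t *m h t w).
Proof.
move=> LM Lh; have /(L2_comp BF) Lc := Lh; apply/(L2_comp BF) => j.
have [M' [bM' eM]] := Linfty_bounded LM.
have bc : bounded_coef (fun j c t => M' t j c) by exact: bounded_coefP.
have [sl _] := lincomb_L2p (P := P) bc j Lc.
have e : {ae muT, forall z, lincomb (fun j c t => M' t j c) (comp T h) j z =
  comp T (fun t w => M t *m h t w) j z}.
 apply: (ae_imp (ae_muT_time P (ae_imp2 eM (lamT_in T) (fun t h1 h2 => conj h1 h2)))).
 move=> [t w] /= [eMt tT]; rewrite comp_in// mxE; apply: eq_bigr => c _.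
 by rewrite comp_in//= eMt.
have [mM _] := LM.
split.
 apply: (sq_ae sl _ e).
 rewrite (_ : comp T _ j = fun z => \sum_c (fun t => M t j c) \_ `[0, T] z.1 * comp T h c z).
  apply: measurable_sum => c; apply: measurable_funM; last exact: sq_meas (L2p_sq (Lc c)).
  apply: (measurableT_comp (f := ((fun t => M t j c) \_ `[0, T] : measurableTypeR R -> R)) (g := fst)) => //.
  by apply/(measurable_restrictT _ (measurable_itv `[0, T])); exact: mM.
 apply/funext => z; rewrite /comp /cut mxE mulr_sumr; apply: eq_bigr => c _.
 by rewrite patchE indicE; case: (_ \in _); rewrite ?mul1r// !mul0r.
move=> t tT; rewrite (_ : (fun w => _) = fun w => \sum_c M t j c * comp T h c (t, w)).
 apply: (@mF_sum _ _ _ _ _ _ (fun c w => M t j c * comp T h c (t, w))) => c _.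
 by apply: mFM; [exact: mF_cst|have [_] := Lc c; exact].
by apply/funext => w; rewrite comp_in// mxE; apply: eq_bigr => c _; rewrite comp_in.
Qed.

Lemma lincomb_ae (A K : finType) (M : A -> K -> R -> R) (y y' : K -> TO -> R) a :
 (forall k, {ae muT, forall z, y k z = y' k z}) ->
 {ae muT, forall z, lincomb M y a z = lincomb M y' a z}.
Proof.
move=> /ae_fin h; apply: (ae_imp h) => z e; rewrite /lincomb; apply: eq_bigr => k _.
by rewrite e.
Qed.

End process_operations.

Section finite_sums.
Context {R : realType} (N n : nat).
Implicit Types (f y : 'I_N * 'I_n -> R).

Lemma sum_pair f : \sum_p f p = \sum_i \sum_j f (i, j).
Proof. by rewrite (pair_bigA _ (fun i j => f (i, j))); apply: eq_bigr => -[]. Qed.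

Lemma sum_block i a e y : \sum_p ((p.1 == i)%:R * a p + e p) * y p =
 \sum_j a (i, j) * y (i, j) + \sum_p e p * y p.
Proof.
under eq_bigr do rewrite mulrDl; rewrite big_split/= sum_pair (bigD1 i)//=.
rewrite [X in _ + X + _]big1 ?addr0 => [|i' /negPf i'i]; last first.
 by rewrite big1// => j _; rewrite i'i !mul0r.
by congr (_ + _); apply: eq_bigr => j _; rewrite eqxx mul1r.
Qed.

Lemma sum_avg (e : 'I_n -> R) s (y : 'I_N -> 'I_n -> R) :
 \sum_j e j * (s * \sum_i y i j) = \sum_p s * e p.2 * y p.1 p.2.
Proof.
rewrite sum_pair exchange_big; apply: eq_bigr => j _ /=.
by rewrite mulrCA !mulr_sumr; apply: eq_bigr => i _; rewrite mulrA.
Qed.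

Lemma sum_own i f : \sum_p (p.1 == i)%:R * f p = \sum_j f (i, j).
Proof.
rewrite sum_pair (bigD1 i)//= [X in _ + X]big1 ?addr0 => [|i' /negPf i'i]; last first.
 by rewrite big1// => j _; rewrite i'i mul0r.
by apply: eq_bigr => j _; rewrite eqxx mul1r.
Qed.

Lemma sum_noise i m1 m2 (X Y : 'M[R]_(m1, m2)) r c (q : 'I_N.+1 -> R) :
 \sum_l (if l == ord0 then X else if l == agent i then Y else 0) r c * q l =
 X r c * q ord0 + Y r c * q (agent i).
Proof.
rewrite big_ord_recl eqxx; congr (_ + _).
rewrite (bigD1 i)//= eqxx big1 ?addr0// => l li.
by rewrite (inj_eq lift_inj) (negPf li) mxE mul0r.
Qed.

End finite_sums.

Lemma wnormsqE {R : realType} m (Q : 'M[R]_m) (x : 'cV[R]_m) :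
 wnormsq Q x = \sum_i (\sum_j Q i j * x j 0) * x i 0.
Proof. by rewrite /wnormsq /dot mxE; apply: eq_bigr => i _; rewrite !mxE. Qed.

Lemma mulmx_trE {R : realType} m1 m2 (M : 'M[R]_(m1, m2)) (v : 'cV[R]_m1) c :
 (M^T *m v) c 0 = \sum_r M r c * v r 0.
Proof. by rewrite mxE; apply: eq_bigr => r _; rewrite mxE. Qed.

Lemma addmxE {R : realType} m1 m2 (X Y : 'M[R]_(m1, m2)) i j : (X + Y) i j = X i j + Y i j.
Proof. by rewrite mxE. Qed.

Lemma error_weight_entry {R : realType} N n (Gamma : 'M[R]_n) (i j : 'I_N) a b :
 error_weight Gamma i j a b = (j == i)%:R * (b == a)%:R + - N%:R^-1 * Gamma b a.
Proof. by rewrite /error_weight; case: eqP => _; rewrite !mxE mulNr ?mul1r ?mul0r ?add0r. Qed.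

Lemma error_weightE {R : realType} N n (Gamma : 'M[R]_n) (i j : 'I_N) (v : 'cV[R]_n) c :
 (error_weight Gamma i j *m v) c 0 =
 \sum_r ((j == i)%:R * (r == c)%:R + - N%:R^-1 * Gamma r c) * v r 0.
Proof. by rewrite mxE; apply: eq_bigr => r _; rewrite error_weight_entry. Qed.

(** * The game as one linear-quadratic problem per agent *)

Section game_problem.
Context {R : realType} {d} {Omega : measurableType d}
 (P : probability Omega R) (T : R) (N n k : nat)
 (W : 'I_N.+1 -> R -> Omega -> R) (xi : 'I_N -> Omega -> 'cV[R]_n) (L : lq_data R Omega n k)
 (T0 : 0 < T) (P_complete : measure_is_complete P) (BW : brownian_motion P T W)
 (A1 : assumption_A1 P T W xi L).

Notation TO := (measurableTypeR R * Omega)%type.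
Notation muT := (muT P T).
Notation F := (filtration P W xi).
Notation L2p := (L2p P T F).
Notation L2 := (L2 P T F).
Notation comp := (comp T).
Notation I := 'I_N.+1.
Notation A := ('I_N * 'I_n)%type.
Notation E := (A + A * I)%type.
Notation cprofile := ('I_N -> process R Omega k).
Notation profile := ('I_N -> process R Omega n).

Lemma game_BF : brownian_filtration P T W F (init_event xi).
Proof.
have [_ _ [h1 _ _ h4]] := A1.
by apply: game_brownian_filtration => // i; case: (h1 i).
Qed.

Let BF := game_BF.

Lemma filtration0_sub t : filtration0 P W t `<=` F t.
Proof.
apply: smallest_sub; first exact: (bf_sigma BF).
move=> S [[s [st hS]]|nS]; apply: sub_sigma_algebra; right; [left|by right].
by exists ord0, s.
Qed.

Lemma L2_filtration0 m (h : process R Omega m) : Defs.L2 P T (filtration0 P W) h -> L2 h.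
Proof.
by move=> [mh ah fh]; split => // t tT S hS; apply: filtration0_sub; exact: ah hS.
Qed.

(* None selects the drift and Some l the coefficient of W_l. *)
Definition noise_coef (X : Type) (x0 x1 x2 x3 : X) (i : 'I_N) (o : option I) : X :=
 match o with
 | None => x1
 | Some l => if l == ord0 then x3 else if l == agent i then x2 else x0
 end.

Definition coefA := noise_coef (fun=> 0) (lq_A L) (lq_C L) (lq_Cw L).
Definition coefE := noise_coef (fun=> 0) (lq_E L) (lq_F L) (lq_Fw L).
Definition coefB := noise_coef (fun=> 0) (lq_B L) (lq_D L) (lq_Dw L).
Definition coefF := noise_coef (fun _ _ => 0) (lq_f L) (lq_g L) (lq_gw L).

Definition game_coef (u : cprofile) (x : profile) (i : 'I_N) (o : option I) : process R Omega n :=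
 fun t w => coefA i o t *m x i t w + coefB i o t *m u i t w + coefE i o t *m avg x t w + coefF i o t w.

Lemma diffusionE u x i l : state_diffusion L u x i l = game_coef u x i (Some l).
Proof.
apply/eq2_fun => t w; rewrite /state_diffusion /game_coef /coefA /coefB /coefE /coefF /=.
by case: ifP => // _; case: ifP => // _; rewrite !mul0mx !addr0.
Qed.

Lemma noise_coefP (X : Type) (Q : X -> Prop) x0 x1 x2 x3 i o : Q x0 -> Q x1 -> Q x2 -> Q x3 ->
 Q (noise_coef x0 x1 x2 x3 i o).
Proof. by rewrite /noise_coef => *; case: o => // l; case: ifP => // _; case: ifP. Qed.

Lemma Linfty_tr m1 m2 (M : R -> 'M[R]_(m1, m2)) : Linfty T M -> Linfty T (fun t => (M t)^T).
Proof.
move=> [mM [c hc]]; split=> [i j|].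
 by rewrite (_ : (fun t => _) = fun t => M t j i)//; apply/funext => t; rewrite mxE.
by exists c; apply: (ae_imp hc) => t h tT i j; rewrite mxE; exact: h.
Qed.

Lemma Linfty_cst m1 m2 (M : 'M[R]_(m1, m2)) : Linfty T (fun=> M).
Proof.
split=> [i j|]; first exact: measurable_cst.
exists (\sum_i \sum_j `|M i j|); apply: aeW => t _ i j.
by rewrite (bigD1 i)//= (bigD1 j)//= -addrA lerDl addr_ge0// sumr_ge0// => i' _; exact: sumr_ge0.
Qed.

Lemma coefA_Linfty i o : Linfty T (coefA i o).
Proof. by have [[[? ? ?] _ _ _] _ _] := A1; apply: noise_coefP => //; exact: (Linfty_cst 0). Qed.

Lemma coefE_Linfty i o : Linfty T (coefE i o).
Proof. by have [[_ [? ? ?] _ _] _ _] := A1; apply: noise_coefP => //; exact: (Linfty_cst 0). Qed.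

Lemma coefB_Linfty i o : Linfty T (coefB i o).
Proof. by have [[_ _ [? ? ?] _] _ _] := A1; apply: noise_coefP => //; exact: (Linfty_cst 0). Qed.

Lemma coefF_L2 i o : L2 (coefF i o).
Proof.
have [[_ _ _ [h1 h2 h3]] _ _] := A1.
apply: noise_coefP; [exact: (L2_zero BF)| | |]; exact: L2_filtration0.
Qed.

Lemma Q_Linfty : Linfty T (lq_Q L). Proof. by have [_ [[]]] := A1. Qed.
Lemma R_Linfty : Linfty T (lq_Rr L). Proof. by have [_ [[]]] := A1. Qed.
Lemma Gamma1_Linfty : Linfty T (lq_Gamma1 L). Proof. by have [_ [[]]] := A1. Qed.
Lemma eta1_L2 : L2 (lq_eta1 L). Proof. by have [_ [_ _ _ [h _] _] _] := A1; exact: L2_filtration0. Qed.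
Lemma eta2_L2 : L2 (lq_eta2 L). Proof. by have [_ [_ _ _ [_ h] _] _] := A1; exact: L2_filtration0. Qed.

Lemma L2_game_coef u x i o : (forall i, L2 (u i)) -> (forall i, L2 (x i)) -> L2 (game_coef u x i o).
Proof.
move=> Lu Lx.
exact: (L2_add BF (L2_add BF (L2_add BF (L2_mul BF (coefA_Linfty i o) (Lx i)) (L2_mul BF (coefB_Linfty i o) (Lu i)))
 (L2_mul BF (coefE_Linfty i o) (L2_avg BF Lx))) (coefF_L2 i o)).
Qed.

Lemma error_weight_Linfty (i j : 'I_N) : Linfty T (fun t => error_weight (lq_Gamma1 L t) i j).
Proof.
have [mM [c hc]] := Gamma1_Linfty; split=> [a b|].
 rewrite (_ : (fun t => _) = fun t => (j == i)%:R * (b == a)%:R + - N%:R^-1 * lq_Gamma1 L t b a).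
  by apply: measurable_funD; [exact: measurable_cst|apply: measurable_funM; [exact: measurable_cst|exact: mM]].
 by apply/funext => t; rewrite error_weight_entry.
exists (1 + N%:R^-1 * c); apply: (ae_imp hc) => t h tT a b; rewrite error_weight_entry.
apply: (le_trans (ler_normD _ _)); apply: lerD.
 by rewrite -natrM normr_nat -[leRHS]/(1%:R) ler_nat mulnb leq_b1.
have n0 : 0 <= (N%:R^-1 : R) by rewrite invr_ge0 ler0n.
by rewrite mulNr normrN normrM (ger0_norm n0); apply: ler_wpM2l => //; exact: h.
Qed.

Lemma L2_tracking (x : profile) i : (forall i, L2 (x i)) -> L2 (tracking_error L x i).
Proof.
move=> Lx.
exact: (L2_add BF (L2_add BF (Lx i) (L2_opp BF (L2_mul BF Gamma1_Linfty (L2_avg BF Lx)))) (L2_opp BF eta1_L2)).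
Qed.

Variables (pA pE : 'I_N -> option I -> R -> 'M[R]_n) (pB : 'I_N -> option I -> R -> 'M[R]_(n, k))
 (pQ pK : R -> 'M[R]_n) (pS : R -> 'M[R]_k).

Definition represents m1 m2 (M' M : R -> 'M[R]_(m1, m2)) :=
 (forall i j, bfun (fun t => M' t i j)) /\ {ae lamT T, forall t, M' t = M t}.

Hypotheses (hA : forall i o, represents (pA i o) (coefA i o))
 (hE : forall i o, represents (pE i o) (coefE i o))
 (hB : forall i o, represents (pB i o) (coefB i o))
 (hQ : represents pQ (lq_Q L)) (hK : represents pK (lq_Gamma1 L)) (hS : represents pS (lq_Rr L)).

(** All matrix identities are proved pointwise at these times, where the bounded versions agree with
    the given coefficients; almost every time is of this kind. *)
Definition good_time (t : R) := [/\ 0 <= t <= T, forall io, pA io.1 io.2 t = coefA io.1 io.2 t,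
 forall io, pE io.1 io.2 t = coefE io.1 io.2 t, forall io, pB io.1 io.2 t = coefB io.1 io.2 t &
 [/\ pQ t = lq_Q L t, pK t = lq_Gamma1 L t & pS t = lq_Rr L t]].

Lemma ae_good_time : {ae lamT T, forall t, good_time t}.
Proof.
have [[_ h1] [_ h2] [_ h3]] := And3 hQ hK hS.
have /ae_fin hA' : forall io : 'I_N * option I, {ae lamT T, forall t, pA io.1 io.2 t = coefA io.1 io.2 t}.
 by move=> io; case: (hA io.1 io.2).
have /ae_fin hE' : forall io : 'I_N * option I, {ae lamT T, forall t, pE io.1 io.2 t = coefE io.1 io.2 t}.
 by move=> io; case: (hE io.1 io.2).
have /ae_fin hB' : forall io : 'I_N * option I, {ae lamT T, forall t, pB io.1 io.2 t = coefB io.1 io.2 t}.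
 by move=> io; case: (hB io.1 io.2).
have h4 := ae_imp3 h1 h2 h3 (fun t a b c => And3 a b c).
by apply: (ae_imp3 (lamT_in T) (ae_imp3 hA' hE' hB' (fun t a b c => And3 a b c)) h4) => t tT [].
Qed.

Definition own (e : E) : 'I_N := (match e with inl a => a | inr al => al.1 end).1.
Definition row (e : E) : 'I_n := (match e with inl a => a | inr al => al.1 end).2.
Definition src (e : E) : option I := match e with inl _ => None | inr al => Some al.2 end.

(* The problem of agent i: its state has one coordinate (j, c) for each coordinate c *)
(* of each agent j, and the controls of the other agents belong to the forcing.      *)
Definition game_lq (u : cprofile) (i : 'I_N) : @lq_problem R d Omega I A 'I_k 'I_n :=
 LQProblem
  (fun e a t => (own e == a.1)%:R * pA (own e) (src e) t (row e) a.2
    + N%:R^-1 * pE (own e) (src e) t (row e) a.2)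
  (fun e c t => (own e == i)%:R * pB (own e) (src e) t (row e) c)
  (fun e => (fun z => (own e != i)%:R *
    lincomb (fun j c t => pB (own e) (src e) t j c) (comp (u (own e))) (row e) z)
   + comp (coefF (own e) (src e)) (row e))
  (fun a w => xi a.1 w a.2 0)
  (fun r s t => pQ t r s)
  (fun r a t => (a.1 == i)%:R * (r == a.2)%:R + - N%:R^-1 * pK t r a.2)
  (comp (lq_eta1 L))
  (fun c c' t => pS t c c')
  (comp (lq_eta2 L))
  (fun r s => lq_G L r s)
  (fun r a => (a.1 == i)%:R * (r == a.2)%:R + - N%:R^-1 * lq_Gamma0 L r a.2)
  (fun r w => lq_eta0 L w r 0).

Definition vec (x : profile) (a : A) : TO -> R := comp (x a.1) a.2.

(** The control of agent i enters the forcing only through the factor that vanishes for i, so a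
    deviation changes the control of the problem but not the problem. *)
Lemma game_deviate u i v : game_lq (deviate u i v) i = game_lq u i.
Proof.
rewrite /game_lq; congr LQProblem; apply/funext => e; congr (_ + _); apply/funext => z.
by rewrite /deviate; case: eqP => // _; rewrite !mul0r.
Qed.

Lemma game_regular u i : (forall i, L2 (u i)) -> lq_regular P T F (game_lq u i).
Proof.
move=> Lu.
have rep m1 m2 (M' M : R -> 'M[R]_(m1, m2)) a b : represents M' M -> bfun (fun t => M' t a b) by case.
have c1 m (h : process R Omega m) j : L2 h -> L2p (comp h j) by move=> /(L2_comp BF).
have [_ [_ hsym [Gs _] _ [me0 fe0]] [hxi _ _ _]] := A1.
have sm0 (f : Omega -> R) : mF (F 0) f -> meas_fun f.
 by apply: mF_meas; apply: (bf_meas BF); exact: ltW.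
have hh := ae_imp2 ae_good_time ((ae_lamT _ _).2 hsym) (fun t h1 h2 => conj h1 h2).
split => /=.
- by apply: bounded_coefP => e a; exact: (bfunD (bfunZ _ (rep _ _ _ _ _ _ (hA _ _))) (bfunZ _ (rep _ _ _ _ _ _ (hE _ _)))).
- by apply: bounded_coefP => e c; exact: (bfunZ _ (rep _ _ _ _ _ _ (hB _ _))).
- move=> e; have bB : bounded_coef (fun j c t => pB (own e) (src e) t j c).
  by apply: bounded_coefP => j c; exact: (rep _ _ _ _ _ _ (hB _ _)).
 exact: (L2pD (L2pZ _ (lincomb_L2p bB _ (fun c => c1 _ _ c (Lu (own e))))) (c1 _ _ _ (coefF_L2 _ _))).
- move=> [i' j] /=.
 have mx : mF (F 0) (fun w => xi i' w j 0).
  apply: (rvec_mF (xi i') (bf_sigma BF 0)).1 => S hS0.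
  by apply: sub_sigma_algebra; left; exists i'.
 split => //; have [_ fx] := hxi i'.
 apply: (normsq_fin _ fx j) => j'.
 apply: sm0; apply: (rvec_mF (xi i') (bf_sigma BF 0)).1 => S hS0.
 by apply: sub_sigma_algebra; left; exists i'.
- by apply: bounded_coefP => r s; exact: (rep _ _ _ _ _ _ hQ).
- apply: (ae_imp hh) => t [[tT _ _ _ [eQ _ _]] [sQ _ _]] r s.
 by rewrite eQ -{1}sQ mxE.
- by apply: bounded_coefP => r a; exact: (bfunD (bfun_cst _) (bfunZ _ (rep _ _ _ _ _ _ hK))).
- by move=> r; apply: c1; exact: eta1_L2.
- by apply: bounded_coefP => r s; exact: (rep _ _ _ _ _ _ hS).
- apply: (ae_imp hh) => t [[tT _ _ _ [_ _ eS]] [_ _ sS]] r s.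
 by rewrite eS -{1}sS mxE.
- by move=> c; apply: c1; exact: eta2_L2.
- by move=> r s; rewrite -{1}Gs mxE.
- move=> r; have m0 j : mF (F T) (fun w => lq_eta0 L w j 0).
  by apply: (rvec_mF (lq_eta0 L) (bf_sigma BF T)).1 => S hS0; apply: filtration0_sub; exact: me0 hS0.
 split => //; apply: (normsq_fin _ fe0 r) => j.
 by apply: mF_meas (m0 j); exact: (bf_meas BF).
Qed.

Lemma game_coefP u x i e t w : good_time t ->
 lincomb (lp_M (game_lq u i)) (vec x) e (t, w) + (lp_phi (game_lq u i) e (t, w) +
  lincomb (lp_N (game_lq u i)) (comp (u i)) e (t, w)) =
 game_coef u x (own e) (src e) t w (row e) 0.
Proof.
move=> [tT eA eE eB _]; rewrite /lincomb /= !fctE /game_coef !mxE comp_in// /lincomb.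
set i' := own e; set j := row e; set o := src e.
have -> : \sum_a ((i' == a.1)%:R * pA i' o t j a.2 + N%:R^-1 * pE i' o t j a.2) * vec x a (t, w) =
  \sum_c coefA i' o t j c * x i' t w c 0 + \sum_c coefE i' o t j c * avg x t w c 0.
 under eq_bigr do rewrite [i' == _]eq_sym.
 rewrite (sum_block i' (fun a => pA i' o t j a.2) (fun a => N%:R^-1 * pE i' o t j a.2) (fun a => vec x a (t, w))).
 congr (_ + _); first by apply: eq_bigr => c _; rewrite /vec comp_in//= (eA (i', o)).
 transitivity (\sum_c coefE i' o t j c * (N%:R^-1 * \sum_i0 x i0 t w c 0)); last first.
  by apply: eq_bigr => c _; rewrite /avg mxE summxE.
 rewrite sum_avg; apply: eq_bigr => a _; rewrite /vec comp_in//.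
 by rewrite -(eE (i', o)).
have -> : (i' != i)%:R * (\sum_c pB i' o t j c * comp (u i') c (t, w)) + coefF i' o t w j 0 +
  \sum_c (i' == i)%:R * pB i' o t j c * comp (u i) c (t, w) =
  \sum_c coefB i' o t j c * u i' t w c 0 + coefF i' o t w j 0.
 rewrite addrAC; congr (_ + _); rewrite mulr_sumr -big_split/=; apply: eq_bigr => c _.
 rewrite !comp_in// -(eB (i', o))/=; case: eqP => [->|_] /=; ring.
ring.
Qed.

Lemma ae_good (Q : TO -> Prop) : (forall t w, good_time t -> Q (t, w)) -> {ae muT, forall z, Q z}.
Proof. by move=> h; apply: (ae_imp (ae_muT_time P ae_good_time)) => -[t w]; exact: h. Qed.

Lemma game_coef_ae u x i e : {ae muT, forall z,
 (lincomb (lp_M (game_lq u i)) (vec x) e + (lp_phi (game_lq u i) e +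
  lincomb (lp_N (game_lq u i)) (comp (u i)) e)) z = comp (game_coef u x (own e) (src e)) (row e) z}.
Proof.
by apply: ae_good => t w gt; have [tT _ _ _ _] := gt; rewrite comp_in// -(game_coefP u x i e w gt) !fctE.
Qed.

Lemma ctrl_comp (v : process R Omega k) : L2 v -> lq_ctrl P T F (comp v).
Proof.
move=> /(L2_comp BF) Lv c; split; first exact: Lv.
by apply/funext => z; rewrite /cut !compE mulrA indicE -natrM mulnb andbb.
Qed.

Lemma state_lq u x i : (forall i, L2 (u i)) -> is_state P T W xi L u x ->
 lq_state P T W F (game_lq u i) (comp (u i)) (vec x).
Proof.
move=> Lu sx; have reg := game_regular i Lu.
have Lx i' : L2 (x i') by case: (sx i').
have Lc e : L2p (lincomb (lp_M (game_lq u i)) (vec x) e + (lp_phi (game_lq u i) e +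
  lincomb (lp_N (game_lq u i)) (comp (u i)) e)).
 apply: L2pD; first by apply: (lincomb_L2p (lr_M reg)) => a; have /(L2_comp BF) := Lx a.1; exact.
 apply: L2pD; first exact: lr_phi reg e.
 by apply: (lincomb_L2p (lr_N reg)) => c; have /(L2_comp BF) := Lu i; exact.
have sym (f g : TO -> R) : {ae muT, forall z, f z = g z} -> {ae muT, forall z, g z = f z}.
 by apply: filterS => z ->.
split=> [[i' j]|[i' j]] /=; have [_ x0 eqx] := sx i'.
 by apply: (ae_imp x0) => w e; rewrite /vec comp_in ?e// lexx ltW.
apply: (iproc_ae BF (iproc_of_vector BF j (Lx i') eqx) (Lc _) (fun l => Lc _)) => [|l]; apply: sym.
 exact: (game_coef_ae u x i (inl (i', j))).
by rewrite diffusionE; exact: (game_coef_ae u x i (inr ((i', j), l))).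
Qed.

Lemma col_comp m (x : 'I_m -> TO -> R) j : comp (fun t w => \col_j x j (t, w)) j = cut T (x j).
Proof. by apply/funext => -[t w]; rewrite !compE mxE. Qed.

(** The problems of all agents describe the same joint state; the index i only selects one of
    them. *)
Lemma state_exists (i : 'I_N) u : (forall i, L2 (u i)) -> exists x, is_state P T W xi L u x.
Proof.
move=> Lu; have reg := game_regular i Lu.
have Lui c : L2p (comp (u i) c) by have /(L2_comp BF) := Lu i; exact.
have [y [[_ py] [y0 cy]]] := lq_state_exists BF reg Lui.
pose x : profile := fun i t w => \col_j y (i, j) (t, w).
have vx a : vec x a = cut T (y a) by rewrite /vec (col_comp (fun j => y (a.1, j))); case: a.
have Ly a : L2p (y a) by case: (py a).
have Lx i' : L2 (x i').
 by apply/(L2_comp BF) => j; have := L2p_cut T (Ly (i', j)); rewrite -vx.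
have ae e : {ae muT, forall z, (lincomb (lp_M (game_lq u i)) y e + (lp_phi (game_lq u i) e +
  lincomb (lp_N (game_lq u i)) (comp (u i)) e)) z = comp (game_coef u x (own e) (src e)) (row e) z}.
 have h : {ae muT, forall z, lincomb (lp_M (game_lq u i)) (vec x) e z = lincomb (lp_M (game_lq u i)) y e z}.
  by apply: lincomb_ae => a; rewrite vx; exact: cutT_ae.
 by apply: (ae_imp2 h (game_coef_ae u x i e)) => z; rewrite !fctE => ->.
exists x => i'; split => //.
 by apply: aeW => w; apply/colP => j; rewrite mxE y0.
apply: (vector_of_iproc BF _ _ (fun j => py (i', j)) _ _ (fun j w => cy (i', j) w)).
- exact: (L2_game_coef i' None Lu Lx).
- by move=> l; rewrite diffusionE; exact: L2_game_coef.
- by move=> j; exact: (ae (inl (i', j))).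
- by move=> j l; rewrite diffusionE; exact: (ae (inr ((i', j), l))).
Qed.

Lemma errP u x i r t w : good_time t ->
 lq_err (game_lq u i) (vec x) r (t, w) = tracking_error L x i t w r 0.
Proof.
move=> [tT _ _ _ [_ eK _]]; rewrite /lq_err !fctE /lincomb/= comp_in// /tracking_error !mxE; congr (_ - _).
rewrite (sum_block i (fun a => (r == a.2)%:R) (fun a => - N%:R^-1 * pK t r a.2) (fun a => vec x a (t, w)))/=.
rewrite (bigD1 r)//= eqxx mul1r big1 ?addr0 => [|j jr]; last by rewrite eq_sym (negPf jr) mul0r.
rewrite /vec comp_in//; congr (_ + _).
transitivity (\sum_j lq_Gamma1 L t r j * (- N%:R^-1 * \sum_i0 x i0 t w j 0)).
 by rewrite sum_avg; apply: eq_bigr => a _; rewrite comp_in// eK.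
by rewrite -sumrN; apply: eq_bigr => j _; rewrite /avg mxE summxE; ring.
Qed.

Lemma endP u x i r w :
 lq_end T (game_lq u i) (vec x) r w - lp_eta0 (game_lq u i) r w = terminal_error T L x i w r 0.
Proof.
have TT : 0 <= T <= T by rewrite lexx ltW.
rewrite /lq_end/= /terminal_error !mxE; congr (_ - _).
rewrite (sum_block i (fun a => (r == a.2)%:R) (fun a => - N%:R^-1 * lq_Gamma0 L r a.2) (fun a => vec x a (T, w)))/=.
rewrite (bigD1 r)//= eqxx mul1r big1 ?addr0 => [|j jr]; last by rewrite eq_sym (negPf jr) mul0r.
rewrite /vec comp_in//; congr (_ + _).
transitivity (\sum_j lq_Gamma0 L r j * (- N%:R^-1 * \sum_i0 x i0 T w j 0)).
 by rewrite sum_avg; apply: eq_bigr => a _; rewrite comp_in.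
by rewrite -sumrN; apply: eq_bigr => j _; rewrite /avg mxE summxE; ring.
Qed.

Lemma wnormsq_path m (M : R -> 'M[R]_m) (h : process R Omega m) w : Linfty T M -> L2 h ->
 exists f : measurableTypeR R -> R, meas_fun f /\
  forall t, 0 <= t <= T -> f t = wnormsq (M t) (h t w).
Proof.
move=> [mM _] /(L2_comp BF) Lh.
exists (fun t => \sum_i (\sum_j (fun t => M t i j) \_ `[0, T] t * comp h j (t, w)) * comp h i (t, w)); split.
 have mh j : meas_fun (fun t : measurableTypeR R => comp h j (t, w)).
  by apply: measurable_path; exact: sq_meas (L2p_sq (Lh j)).
 apply: measurable_sum => i; apply: measurable_funM => //.
 apply: measurable_sum => j; apply: measurable_funM => //.
 by apply/(measurable_restrictT _ (measurable_itv `[0, T])); exact: mM.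
move=> t tT; rewrite wnormsqE; apply: eq_bigr => i _; rewrite comp_in//; congr (_ * _).
by apply: eq_bigr => j _; rewrite comp_in// patchE mem_set// /= in_itv.
Qed.

Lemma qf_integral d' (X : measurableType d') (mu : {measure set X -> \bar R}) (V : finType)
  (S : V -> V -> X -> R) (e : V -> X -> R) : good_coef S -> (forall i, sq mu (e i)) ->
 integ mu (fun z => \sum_i lincom S e i z * e i z) /\
 qf mu S e e = \int[mu]_z \sum_i lincom S e i z * e i z.
Proof.
move=> gS se; have h i : integ mu (fun z => lincom S e i z * e i z).
 by apply: sq_mul => //; exact: lincom_sq.
by split; [exact: integ_sum|rewrite Rint_sum].
Qed.

Lemma cost_lq u i x : (forall i, L2 (u i)) -> is_state P T W xi L u x ->
 2^-1 * \int[P]_w ((\int[lebesgue_measure]_(t in `[0, T])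
    (wnormsq (lq_Q L t) (tracking_error L x i t w)
     + wnormsq (lq_Rr L t) (u i t w - lq_eta2 L t w)))
   + wnormsq (lq_G L) (terminal_error T L x i w)) =
 lq_cost P T (game_lq u i) (comp (u i)) (vec x).
Proof.
move=> Lu sx; have reg := game_regular i Lu; have sl := state_lq i Lu sx.
have [_ px] := sl; set D := game_lq u i in reg sl px *.
have Lx i' : L2 (x i') by case: (sx i').
have s1 r : sq muT (lq_err D (vec x) r) := L2p_sq (lq_err_sq reg r (forward_L2p px)).
have s2 c : sq muT (comp (u i) c - lp_ref D c).
 by apply: L2p_sq; apply: L2pB; [have /(L2_comp BF) := Lu i; exact|exact: lr_ref].
have s3 r : sq P (lq_end T D (vec x) r - lp_eta0 D r).
 have [se _] := lq_end_sq D r (forward_end BF px).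
 by apply: sqB => //; have [] := lr_eta0 reg r.
have [i1 e1] := qf_integral (space_good (lr_Q reg)) s1.
have [i2 e2] := qf_integral (space_good (lr_S reg)) s2.
have [i3 e3] := qf_integral (cst_good (lp_G D)) s3.
have i12 := integD i1 i2; have [_ j12 f12] := fubini_wt i12.
rewrite /lq_cost e1 e2 e3 -(RintegralD measurableT i1 i2) f12 -(RintegralD measurableT j12 i3).
congr (_ * _); congr Rintegral; apply/funext => w; congr (_ + _); last first.
 rewrite wnormsqE; apply: eq_bigr => r _; rewrite -(endP u x i r w); congr (_ * _).
 by apply: eq_bigr => s _; rewrite -(endP u x i s w).
have Lerr : L2 (fun t w => u i t w - lq_eta2 L t w) by exact: (L2_add BF (Lu i) (L2_opp BF eta2_L2)).
(* The cost integrates the given coefficients over [0, T]. Measurable functions that agree with the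
   integrand there allow the passage to [lamT], where the bounded versions take over. *)
have [f1 [m1 h1]] := wnormsq_path w Q_Linfty (L2_tracking i Lx).
have [f2 [m2 h2]] := wnormsq_path w R_Linfty Lerr.
have TT : 0 <= T <= T by rewrite lexx ltW.
have m12 : meas_fun (fun t : measurableTypeR R => f1 t + f2 t) by exact: measurable_funD.
transitivity (\int[lebesgue_measure]_(t in `[0, T]) (f1 t + f2 t)).
 by apply: eq_Rintegral => t; rewrite inE/= in_itv/= => tT; rewrite h1// h2.
rewrite -(Rint_lamT m12 TT); apply: Rint_ae.
- exact: (measurable_funM (ind_meas T)).
- exact: (measurable_path w (integ_meas i12)).
apply: (ae_imp ae_good_time) => t gt; have [tT _ _ _ [eQ _ eS]] := gt.
rewrite indicE mem_set ?mul1r/= ?in_itv// h1// h2// !wnormsqE; congr (_ + _).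
 apply: eq_bigr => r _; rewrite -(errP u x i r w gt); congr (_ * _).
 by apply: eq_bigr => s _; rewrite -(errP u x i s w gt) /= eQ.
apply: eq_bigr => r _; rewrite !mxE !fctE !comp_in//; congr (_ * _).
by apply: eq_bigr => s _; rewrite !mxE !fctE !comp_in//= eS.
Qed.

Lemma noise_coefE m1 m2 (X0 X1 X2 X3 : R -> 'M[R]_(m1, m2)) i l t :
 noise_coef X0 X1 X2 X3 i (Some l) t = if l == ord0 then X3 t else if l == agent i then X2 t else X0 t.
Proof. by rewrite /=; case: ifP => // _; case: ifP. Qed.

Lemma mul_tr_avg (M : 'M[R]_n) (y : profile) t w c :
 (M^T *m avg y t w) c 0 = \sum_a N%:R^-1 * M a.2 c * y a.1 t w a.2 0.
Proof.
rewrite mulmx_trE -(sum_avg (fun r => M r c) _ (fun i r => y i t w r 0)).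
by apply: eq_bigr => r _; rewrite /avg mxE summxE.
Qed.

Section adjoint_equation.
Variables (x : profile) (p : 'I_N -> profile) (q : 'I_N -> 'I_N -> 'I_N.+1 -> process R Omega n).

Definition pvec (i : 'I_N) (a : A) : TO -> R := comp (p i a.1) a.2.
Definition qvec (i : 'I_N) (a : A) (l : I) : TO -> R := comp (q i a.1 l) a.2.

Lemma adjointP u i j c t w : good_time t ->
 (- lincomb (fun a e => lp_M (game_lq u i) e a) (pairing (pvec i) (qvec i)) (j, c) -
  lincomb (fun a r => lp_K (game_lq u i) r a) (lincomb (lp_Q (game_lq u i))
   (lq_err (game_lq u i) (vec x))) (j, c)) (t, w) =
 adjoint_drift L x p q i j t w c 0.
Proof.
move=> gt; have [tT eA eE _ [eQ eK _]] := gt.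
rewrite !fctE /adjoint_drift mxE addmxE opprD; congr (- _ - _); last first.
 rewrite error_weightE /lincomb /=; apply: eq_bigr => r _; rewrite eK; congr (_ * _).
 by rewrite mxE; apply: eq_bigr => s _; rewrite eQ (errP u x i s w gt).
have T1 : \sum_a ((a.1 == j)%:R * pA a.1 None t a.2 c + N%:R^-1 * pE a.1 None t a.2 c) * pvec i a (t, w) =
  \sum_r lq_A L t r c * p i j t w r 0 + \sum_a N%:R^-1 * lq_E L t a.2 c * p i a.1 t w a.2 0.
 rewrite (sum_block j (fun a => pA a.1 None t a.2 c) (fun a => N%:R^-1 * pE a.1 None t a.2 c)
  (fun a => pvec i a (t, w))).
 congr (_ + _); apply: eq_bigr => r _; rewrite /pvec comp_in//=.
  by rewrite (eA (j, None)).
 by rewrite (eE (r.1, None)).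
have T2 : \sum_a \sum_l ((a.1 == j)%:R * pA a.1 (Some l) t a.2 c +
   N%:R^-1 * pE a.1 (Some l) t a.2 c) * qvec i a l (t, w) =
  \sum_r (lq_Cw L t r c * q i j ord0 t w r 0 + lq_C L t r c * q i j (agent j) t w r 0) +
  \sum_a (N%:R^-1 * lq_Fw L t a.2 c * q i a.1 ord0 t w a.2 0 +
   N%:R^-1 * lq_F L t a.2 c * q i a.1 (agent a.1) t w a.2 0).
 rewrite -(sum_own j (fun a => lq_Cw L t a.2 c * q i a.1 ord0 t w a.2 0 +
  lq_C L t a.2 c * q i a.1 (agent a.1) t w a.2 0)) -big_split/=; apply: eq_bigr => a _.
 have nA : \sum_l coefA a.1 (Some l) t a.2 c * q i a.1 l t w a.2 0 =
   lq_Cw L t a.2 c * q i a.1 ord0 t w a.2 0 + lq_C L t a.2 c * q i a.1 (agent a.1) t w a.2 0.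
  rewrite -(sum_noise a.1 _ _ _ _ (fun l => q i a.1 l t w a.2 0)).
  by apply: eq_bigr => l _; rewrite /coefA noise_coefE.
 have nE : \sum_l coefE a.1 (Some l) t a.2 c * q i a.1 l t w a.2 0 =
   lq_Fw L t a.2 c * q i a.1 ord0 t w a.2 0 + lq_F L t a.2 c * q i a.1 (agent a.1) t w a.2 0.
  rewrite -(sum_noise a.1 _ _ _ _ (fun l => q i a.1 l t w a.2 0)).
  by apply: eq_bigr => l _; rewrite /coefE noise_coefE.
 transitivity ((a.1 == j)%:R * (\sum_l coefA a.1 (Some l) t a.2 c * q i a.1 l t w a.2 0) +
  N%:R^-1 * \sum_l coefE a.1 (Some l) t a.2 c * q i a.1 l t w a.2 0); last by rewrite nA nE; ring.
 rewrite !mulr_sumr -big_split/=; apply: eq_bigr => l _.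
 by rewrite /qvec comp_in// (eA (a.1, Some l)) (eE (a.1, Some l))/=; ring.
rewrite /lincomb sum_sum_type/= T1 T2 !addmxE !mul_tr_avg !mulmx_trE !big_split/=; ring.
Qed.

Lemma statP u i c t w : good_time t ->
 lq_stat (game_lq u i) (comp (u i)) (pvec i) (qvec i) c (t, w) =
 ((lq_B L t)^T *m p i i t w + (lq_D L t)^T *m q i i (agent i) t w +
  (lq_Dw L t)^T *m q i i ord0 t w + lq_Rr L t *m u i t w - lq_Rr L t *m lq_eta2 L t w) c 0.
Proof.
move=> [tT _ _ eB [_ _ eS]].
rewrite /lq_stat fctE /lincomb sum_sum_type/= !addmxE !mulmx_trE.
have -> : \sum_a (a.1 == i)%:R * pB a.1 None t a.2 c * pvec i a (t, w) = \sum_r lq_B L t r c * p i i t w r 0.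
 under eq_bigr do rewrite -mulrA.
 rewrite (sum_own i (fun a => pB a.1 None t a.2 c * pvec i a (t, w))).
 by apply: eq_bigr => r _; rewrite /pvec comp_in// (eB (i, None)).
have -> : \sum_a \sum_l (a.1 == i)%:R * pB a.1 (Some l) t a.2 c * qvec i a l (t, w) =
  \sum_r lq_D L t r c * q i i (agent i) t w r 0 + \sum_r lq_Dw L t r c * q i i ord0 t w r 0.
 under eq_bigr => a _ do (under eq_bigr => l _ do rewrite -mulrA; rewrite -mulr_sumr).
 rewrite (sum_own i (fun a => \sum_l pB a.1 (Some l) t a.2 c * qvec i a l (t, w))) -big_split/=.
 apply: eq_bigr => r _; rewrite addrC -(sum_noise i _ _ _ _ (fun l => q i i l t w r 0)); apply: eq_bigr => l _.
 by rewrite -[if _ then _ else _](noise_coefE (fun=> 0) (lq_B L) (lq_D L) (lq_Dw L) i l t) -/coefB -(eB (i, Some l)) /qvec comp_in.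
rewrite -!addrA; do 3 congr (_ + _); rewrite [in RHS]mxE [X in _ = _ + X]mxE [X in _ = _ - X]mxE -sumrB.
by apply: eq_bigr => c' _; rewrite eS !fctE !comp_in// mulrBr.
Qed.

Hypothesis Lx : forall i, L2 (x i).

Lemma L2_adjoint_drift i j : (forall j, L2 (p i j)) -> (forall j l, L2 (q i j l)) ->
 L2 (adjoint_drift L x p q i j).
Proof.
move=> Lp Lq; have [[[hA0 hC hCw] [hE0 hF hFw] _ _] _ _] := A1.
apply: (L2_opp BF).
exact: (L2_add BF (L2_add BF (L2_add BF (L2_add BF (L2_add BF (L2_add BF
 (L2_mul BF (Linfty_tr hA0) (Lp j)) (L2_mul BF (Linfty_tr hC) (Lq j (agent j)))) (L2_mul BF (Linfty_tr hCw) (Lq j ord0)))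
 (L2_mul BF (Linfty_tr hE0) (L2_avg BF Lp))) (L2_mul BF (Linfty_tr hF) (L2_avg BF (fun l => Lq l (agent l)))))
 (L2_mul BF (Linfty_tr hFw) (L2_avg BF (fun l => Lq l ord0))))
 (L2_mul BF (error_weight_Linfty i j) (L2_mul BF Q_Linfty (L2_tracking i Lx)))).
Qed.

Lemma adjoint_lq u i : (forall i, L2 (u i)) -> is_adjoint P T W xi L x p q ->
 lq_adjoint P T W F (game_lq u i) (vec x) (pvec i) (qvec i).
Proof.
move=> Lu ap; have reg := game_regular i Lu.
have TT : 0 <= T <= T by rewrite lexx ltW.
have Lp j : L2 (p i j) by case: (ap i j).
have Lq j l : L2 (q i j l) by have [_ Lq0 _ _] := ap i j; exact: Lq0.
have Lpq e : L2p (pairing (pvec i) (qvec i) e).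
 by case: e => [a|[a l]]; [have /(L2_comp BF) := Lp a.1|have /(L2_comp BF) := Lq a.1 l]; exact.
split=> -[j c].
 have [_ _ eqp _] := ap i j.
 have p1 := iproc_of_vector BF c (Lp j) eqp.
 apply: (iproc_ae BF p1) => [|l||l].
 - apply: L2pB; first by apply: L2pN; exact: (lincomb_L2p (bounded_coef_tr (lr_M reg))).
  apply: (lincomb_L2p (bounded_coef_tr (lr_K reg))) => r.
  apply: (lincomb_L2p (lr_Q reg)) => s; apply: lq_err_sq => // a.
  by have /(L2_comp BF) := Lx a.1; exact.
 - exact: (Lpq (inr ((j, c), l))).
 - apply: ae_good => t w gt; have [tT _ _ _ _] := gt.
  by rewrite comp_in// -(adjointP u i j c w gt).
 - exact: ae_eq_refl.
have [_ _ _ eT] := ap i j; apply: (ae_imp eT) => w e.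
rewrite /pvec comp_in//= e error_weightE; apply: eq_bigr => r _; congr (_ * _).
by rewrite mxE; apply: eq_bigr => s _; rewrite -(endP u x i s w).
Qed.

End adjoint_equation.

Definition pcol (p : 'I_N -> A -> TO -> R) (i : 'I_N) : profile := fun j t w => \col_c p i (j, c) (t, w).
Definition qcol (q : 'I_N -> A -> I -> TO -> R) (i j : 'I_N) (l : I) : process R Omega n :=
 fun t w => \col_c q i (j, c) l (t, w).

Lemma pvec_col p i a : pvec (pcol p) i a = cut T (p i a).
Proof. by rewrite /pvec (col_comp (fun c => p i (a.1, c))); case: a. Qed.

Lemma qvec_col q i a l : qvec (qcol q) i a l = cut T (q i a l).
Proof. by rewrite /qvec (col_comp (fun c => q i (a.1, c) l)); case: a. Qed.

Lemma pairing_col_ae (K : finType) (M : K -> E -> R -> R) p q i c : {ae muT, forall z,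
 lincomb M (pairing (pvec (pcol p) i) (qvec (qcol q) i)) c z = lincomb M (pairing (p i) (q i)) c z}.
Proof. by apply: lincomb_ae => -[a|[a l]] /=; rewrite ?pvec_col ?qvec_col; exact: cutT_ae. Qed.

Lemma adjoint_of_lq (u : cprofile) (x : profile) (p : 'I_N -> A -> TO -> R) (q : 'I_N -> A -> I -> TO -> R) :
 (forall i, L2 (x i)) ->
 (forall i, lq_adjoint P T W F (game_lq u i) (vec x) (p i) (q i)) ->
 (forall i a w, {within `[0, T], continuous (fun t => p i a (t, w))}) ->
 is_adjoint P T W xi L x (pcol p) (qcol q).
Proof.
move=> Lx ap cp i j; have [pp pT] := ap i.
have Lp' j' : L2 (pcol p i j').
 apply/(L2_comp BF) => c; have [Lp _ _ _ _] := pp (j', c).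
 by have := L2p_cut T Lp; rewrite -pvec_col.
have Lq' j' l : L2 (qcol q i j' l).
 apply/(L2_comp BF) => c; have [_ _ Lq _ _] := pp (j', c).
 by have := L2p_cut T (Lq l); rewrite -qvec_col.
split => //.
 apply: (vector_of_iproc BF (L2_adjoint_drift Lx _ Lp' Lq') (Lq' j) (fun c => pp (j, c)) _ _ (fun c w => cp i (j, c) w)).
  move=> c; have h := pairing_col_ae (fun a e => lp_M (game_lq u i) e a) p q i (j, c).
  apply: (ae_imp2 h (ae_muT_time P ae_good_time)) => -[t w] e gt; have [tT _ _ _ _] := gt.
  by rewrite comp_in// -(adjointP x (pcol p) (qcol q) u i j c w gt) !fctE e.
 move=> c l; have := cutT_ae P T (q i (j, c) l); rewrite -qvec_col => h.
 by apply: (ae_imp h) => z e; exact: esym e.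
have /ae_fin := fun c => pT (j, c).
move=> hT; apply: (ae_imp hT) => w e; apply/colP => c.
rewrite mxE e error_weightE; apply: eq_bigr => r _; congr (_ * _).
by rewrite [RHS]mxE; apply: eq_bigr => s _; rewrite -(endP u x i s w).
Qed.

Lemma ctrl_process v : lq_ctrl P T F v -> exists2 V : process R Omega k, L2 V & comp V = v.
Proof.
move=> Cv; have e : comp (fun t w => \col_c v c (t, w)) = v.
 by apply/funext => c; rewrite col_comp; case: (Cv c).
exists (fun t w => \col_c v c (t, w)); last exact: e.
by apply/(L2_comp BF) => c; rewrite e; case: (Cv c).
Qed.

Lemma L2_deviate (u : cprofile) (i : 'I_N) (v : process R Omega k) : (forall i, L2 (u i)) -> L2 v -> forall j, L2 (deviate u i v j).
Proof. by move=> Lu Lv j; rewrite /deviate; case: eqP => _; [exact: Lv|exact: Lu]. Qed.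

Lemma state_ofP (i : 'I_N) u : (forall i, L2 (u i)) -> is_state P T W xi L u (state_of P T W xi L u).
Proof. by move=> Lu; have [x sx] := state_exists i Lu; exact: (xgetPex _ (ex_intro _ x sx)). Qed.

Lemma cost_deviate u i v x : (forall i, L2 (u i)) -> L2 v ->
 lq_state P T W F (game_lq u i) (comp v) x ->
 cost P T W xi L i (deviate u i v) = lq_cost P T (game_lq u i) (comp v) x.
Proof.
move=> Lu Lv sx; have Ld := L2_deviate i Lu Lv.
have dv : deviate u i v i = v by rewrite /deviate eqxx.
have sd := state_ofP i Ld; have := state_lq i Ld sd; rewrite game_deviate dv => sl.
rewrite /cost (cost_lq i Ld sd) game_deviate dv.
apply: (lq_cost_unique BF (game_regular i Lu)) sl sx.
by have /(L2_comp BF) := Lv; exact.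
Qed.

Lemma deviate_self (u : cprofile) i : deviate u i (u i) = u.
Proof. by apply/funext => j; rewrite /deviate; case: eqP => [->|]. Qed.

Lemma nash_lq u i x : (forall i, L2 (u i)) -> lq_state P T W F (game_lq u i) (comp (u i)) x ->
 (cost P T W xi L i u)%:E = ereal_inf [set (cost P T W xi L i (deviate u i v))%:E |
  v in admissible P T W xi] <->
 (forall v' x', lq_ctrl P T F v' -> lq_state P T W F (game_lq u i) v' x' ->
  lq_cost P T (game_lq u i) (comp (u i)) x <= lq_cost P T (game_lq u i) v' x').
Proof.
move=> Lu sx; have c0 := cost_deviate Lu (Lu i) sx; rewrite deviate_self in c0.
split=> [H v' x' Cv sx'|H].
 have [V LV eV] := ctrl_process Cv; rewrite -{v' Cv}eV in sx' *.
 have le2 (a b a' b' : R) : a = b -> a' = b' -> a <= a' -> b <= b' by move=> -> ->.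
 apply: (le2 _ _ _ _ c0 (cost_deviate Lu LV sx')); rewrite -lee_fin.
 have h2 : (ereal_inf [set (cost P T W xi L i (deviate u i v))%:E | v in admissible P T W xi] <=
   (cost P T W xi L i (deviate u i V))%:E)%E by apply: ereal_inf_lbound; exists V.
 apply: le_trans h2.
 exact: (eq_ind _ (fun y => ((cost P T W xi L i u)%:E <= y)%E) (lexx _) _ H).
apply/eqP; rewrite eq_le; apply/andP; split; last first.
 by apply: ereal_inf_lbound; exists (u i); [exact: Lu|rewrite deviate_self].
apply/ereal_infP => _ [v Lv <-]; rewrite lee_fin c0.
have Cv := ctrl_comp Lv.
have [x' [sx' _]] := lq_state_exists BF (game_regular i Lu) (fun c => proj1 (Cv c)).
by rewrite (cost_deviate Lu Lv sx'); exact: H.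
Qed.

(** Convexity for the single profile u already implies it for all profiles, as [convex_cost]
    demands, because the curvature does not see the controls of the others. *)
Lemma convex_lq u i : (forall i, L2 (u i)) ->
 convex_cost P T W xi L i <-> lq_convex P T W F (game_lq u i).
Proof.
move=> Lu.
have mixE (v1 v2 : process R Omega k) a : comp (fun t w => a *: v1 t w + (1 - a) *: v2 t w) =
  fun c z => a * comp v1 c z + (1 - a) * comp v2 c z.
 by apply/eq2_fun => c z; rewrite !compE !mxE; ring.
have Lmix (v1 v2 : process R Omega k) a : L2 v1 -> L2 v2 -> L2 (fun t w => a *: v1 t w + (1 - a) *: v2 t w).
 by move=> L1 L2'; exact: (L2_add BF (L2_scale BF a L1) (L2_scale BF (1 - a) L2')).
have le3 (a J J1 J2 K K1 K2 : R) : J = K -> J1 = K1 -> J2 = K2 ->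
 (J <= a * J1 + (1 - a) * J2) = (K <= a * K1 + (1 - a) * K2) by move=> -> -> ->.
split=> [H|H u' Lu' v1 v2 L1 L2' a a01].
 apply/(lq_convexP BF (game_regular i Lu)) => v1 v2 a x1 x2 x C1 C2 a01 s1 s2 s.
 have [V1 L1 e1] := ctrl_process C1; have [V2 L2' e2] := ctrl_process C2.
 rewrite -{v1 C1}e1 -{v2 C2}e2 -?mixE in s1 s2 s *.
 have e := le3 a _ _ _ _ _ _ (cost_deviate Lu (Lmix _ _ a L1 L2') s)
  (cost_deviate Lu L1 s1) (cost_deviate Lu L2' s2).
 by apply: (etrans (esym e)); exact: (H u Lu V1 V2 L1 L2' a a01).
(* [game_lq] depends on the profile through its forcing only, and the forcing does not occur in
   [lq_convex]. *)
have H' : lq_convex P T W F (game_lq u' i) by exact: H.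
have reg := game_regular i Lu'.
have ex v : L2 v -> exists x, lq_state P T W F (game_lq u' i) (comp v) x.
 move=> Lv; have [x [sx _]] := lq_state_exists BF reg (fun c => proj1 (ctrl_comp Lv c)).
 by exists x.
have [x1 s1] := ex v1 L1; have [x2 s2] := ex v2 L2'; have [x s] := ex _ (Lmix v1 v2 a L1 L2').
apply: (etrans (le3 a _ _ _ _ _ _ (cost_deviate Lu' (Lmix _ _ a L1 L2') s)
 (cost_deviate Lu' L1 s1) (cost_deviate Lu' L2' s2))).
rewrite mixE in s *.
exact: ((lq_convexP BF reg).1 H' _ _ _ _ _ _ (ctrl_comp L1) (ctrl_comp L2') a01 s1 s2 s).
Qed.

Definition stat_vec (u : cprofile) (p : 'I_N -> profile)
  (q : 'I_N -> 'I_N -> 'I_N.+1 -> process R Omega n) (i : 'I_N) (z : TO) : 'cV[R]_k :=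
 (lq_B L z.1)^T *m p i i z.1 z.2 + (lq_D L z.1)^T *m q i i (agent i) z.1 z.2
 + (lq_Dw L z.1)^T *m q i i ord0 z.1 z.2 + lq_Rr L z.1 *m u i z.1 z.2
 - lq_Rr L z.1 *m lq_eta2 L z.1 z.2.

Lemma stationary_lq u p q : stationary P T L p q u <->
 (forall i c, {ae muT, forall z, lq_stat (game_lq u i) (comp (u i)) (pvec p i) (qvec q i) c z = 0}).
Proof.
have gt := ae_muT_time P ae_good_time.
split=> [H i c|H i].
 have h := (ae_muT_leb P T (fun z => stat_vec u p q i z = 0)).2 (H i).
 apply: (ae_imp2 gt h) => -[t w] g e.
 apply: (etrans (statP p q u i c w g)); apply: (etrans (congr1 (fun M : 'cV[R]_k => M c 0) e)).
 by rewrite mxE.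
apply: (ae_muT_leb P T (fun z => stat_vec u p q i z = 0)).1.
have /ae_fin h := H i; apply: (ae_imp2 gt h) => -[t w] g e.
by apply/colP => c; rewrite -[LHS](statP p q u i c w g) e mxE.
Qed.

(** Each agent is treated separately by [lq_necessary] and [lq_sufficient], since the adjoint
    processes with superscript i concern agent i alone; the state is common to all agents. *)
Lemma nash_maximum_principle u : (forall i, L2 (u i)) ->
 nash_equilibrium P T W xi L u <->
 (forall i, convex_cost P T W xi L i) /\
 exists (x : profile) (p : 'I_N -> profile) (q : 'I_N -> 'I_N -> 'I_N.+1 -> process R Omega n),
  [/\ is_state P T W xi L u x, is_adjoint P T W xi L x p q & stationary P T L p q u].
Proof.
move=> Lu; split=> [[_ H]|[H [x [p [q [sx ap st]]]]]]; last first.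
 split=> // i; have sl := state_lq i Lu sx; apply/(nash_lq Lu sl) => v' x' Cv sx'.
 have Lx i' : L2 (x i') by case: (sx i').
 apply: (lq_sufficient BF (game_regular i Lu) (ctrl_comp (Lu i)) sl (adjoint_lq Lx i Lu ap) _ _ Cv sx').
  exact/(convex_lq i Lu).
 by move=> c; exact: (stationary_lq u p q).1.
have key i := lq_necessary BF (game_regular i Lu) (ctrl_comp (Lu i))
 (state_lq i Lu (state_ofP i Lu)) ((nash_lq Lu (state_lq i Lu (state_ofP i Lu))).1 (H i)).
split=> [i|]; first by apply/(convex_lq i Lu); case: (key i).
have /choice[p /choice[q hpq]] := fun i => proj2 (key i).
have sx : is_state P T W xi L u (state_of P T W xi L u).
 by move=> i; have h := state_ofP i Lu; exact: h.
have Lx i' : L2 (state_of P T W xi L u i') by case: (sx i').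
(* The scalar adjoints of each agent are put together into vectors. Their coordinates are the cut
   versions, equal to the scalar adjoints almost everywhere. *)
exists (state_of P T W xi L u), (pcol p), (qcol q); split => //.
 by apply: (adjoint_of_lq (u := u) Lx) => [i|i a w]; case: (hpq i).
apply/stationary_lq => i c; have [_ _ /(_ c) h] := hpq i.
apply: (ae_imp2 (pairing_col_ae (fun c e => lp_N (game_lq u i) e c) p q i c) h) => z.
by rewrite /lq_stat !fctE => ->.
Qed.

End game_problem.

Theorem theorem3p1 (R : realType) (d : measure_display) (Omega : measurableType d)
  (P : probability Omega R) (T : R) (N n k : nat)
  (W : 'I_N.+1 -> R -> Omega -> R) (xi : 'I_N -> Omega -> 'cV[R]_n)
  (L : lq_data R Omega n k)
  (T_gt0 : 0 < T) (N_gt0 : (0 < N)%N)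
  (P_complete : measure_is_complete P)
  (W_brownian : brownian_motion P T W)
  (A1 : assumption_A1 P T W xi L)
  (u : 'I_N -> process R Omega k)
  (u_admissible : forall i, admissible P T W xi (u i)) :
 nash_equilibrium P T W xi L u
 <->
 (forall i, convex_cost P T W xi L i) /\
 exists (x : 'I_N -> process R Omega n)
     (p : 'I_N -> 'I_N -> process R Omega n)
     (q : 'I_N -> 'I_N -> 'I_N.+1 -> process R Omega n),
  [/\ is_state P T W xi L u x,
    is_adjoint P T W xi L x p q &
    stationary P T L p q u].
Proof.
(* Bounded versions are chosen simultaneously for all agents and all noises. *)
have cp m1 m2 (M : 'I_N * option 'I_N.+1 -> R -> 'M[R]_(m1, m2)) : (forall io, Linfty T (M io)) ->
  exists pM : 'I_N * option 'I_N.+1 -> R -> 'M[R]_(m1, m2), forall io, represents T (pM io) (M io).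
 by move=> LM; have /choice[pM h] := fun io => Linfty_bounded (LM io); exists pM.
have [pA hA] := cp _ _ _ (fun io => coefA_Linfty A1 io.1 io.2).
have [pE hE] := cp _ _ _ (fun io => coefE_Linfty A1 io.1 io.2).
have [pB hB] := cp _ _ _ (fun io => coefB_Linfty A1 io.1 io.2).
have [pQ hQ] := Linfty_bounded (Q_Linfty A1).
have [pK hK] := Linfty_bounded (Gamma1_Linfty A1).
have [pS hS] := Linfty_bounded (R_Linfty A1).
exact: (nash_maximum_principle T_gt0 P_complete W_brownian A1 (fun i o => hA (i, o))
 (fun i o => hE (i, o)) (fun i o => hB (i, o)) hQ hK hS u_admissible).
Qed.
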